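(* Let $\mathfrak{g}$ be a quadratic Lie algebra, $G$ a Lie group integrating $\mathfrak{g}$ such that the quadratic structure is $\mathrm{Ad}_G$-invariant, with canonical 2-shifted symplectic structure $\Omega_G+\Theta_G$, and let $D=G\times\overline{G}$. Let $\mathcal{H}=P(G)\times G^2\rightrightarrows G$ be the direct product of the pair groupoid $P(G)=G\times G\rightrightarrows G$ and the Lie group $G^2$, let $\Phi:\mathcal{H}\to D^2$ be $$\Phi(a_1,a_2,g_1,g_2)=\big((a_1g_2a_2^{-1},g_1),(a_1^{-1}g_1a_2,g_2)\big),\qquad(a_1,a_2)\in P(G),\ (g_1,g_2)\in G^2,$$ and let $\sigma\in\Omega^2(\mathcal{H})$ be $$\sigma|_{(a_1,a_2,g_1,g_2)}=(a_1,a_1^{-1}g_1a_2)^*\Omega_G-(g_1,a_2)^*\Omega_G-(a_1,g_2)^*\Omega_G+(a_1g_2a_2^{-1},a_2)^*\Omega_G.$$ Then $\Phi:(\mathcal{H},\sigma)\to D^2$ is a global multiplicative $D^2$-valued moment map that integrates the quasi-Poisson $\mathfrak{g}_\Delta^2$-manifold $(G,0)$.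
   Context: Everything is real and $C^\infty$. Lie brackets on Lie algebras of Lie groups (and Lie algebroids $A_{\mathcal{H}}=\ker(T\mathtt{s})|_N$, anchor $\mathtt{a}_{\mathcal{H}}=T\mathtt{t}$) are defined by right-invariant vector fields; $u^r,u^l$ are right/left-invariant vector fields; $\theta^l,\theta^r$ are the left/right Maurer–Cartan forms. Pullbacks are denoted by the expression of the map: e.g. $(g_1,a_2)^*\Omega_G$ is the pullback of $\Omega_G\in\Omega^2(G\times G)$ along $\mathcal{H}\to G\times G$, $(a_1,a_2,g_1,g_2)\mapsto(g_1,a_2)$. In $P(G)$, $(a_1,a_2)$ has target $a_1$ and source $a_2$. $\Omega_G=-\frac12\langle\mathrm{pr}_1^*\theta^l,\mathrm{pr}_2^*\theta^r\rangle\in\Omega^2(G\times G)$, $\Theta_G=-\frac1{12}\langle\theta^l,[\theta^l,\theta^l]\rangle\in\Omega^3(G)$. $\overline{G}$ is $G$ with $-(\Omega_G+\Theta_G)$; products carry the sum of the structures. $\overline{\mathfrak{g}}$ is $\mathfrak{g}$ with opposite pairing; $\mathfrak{d}=\mathfrak{g}\oplus\overline{\mathfrak{g}}=\mathrm{Lie}(D)$, $\mathfrak{g}_\Delta\subset\mathfrak{d}$ is the diagonal (lagrangian) subalgebra, and we use the Manin pair $(\mathfrak{d}^2,\mathfrak{g}_\Delta^2)$. 2-shifted symplectic group $(D',\Omega+\Theta)$: $\Omega\in\Omega^2(D'\times D')$ normalized (vanishing pullbacks along $k\mapsto(1,k),(k,1)$), $\Theta\in\Omega^3(D')$, $\delta\Omega=0$,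 $\mathrm{pr}_1^*\Theta+\mathrm{pr}_2^*\Theta-\mathtt{m}^*\Theta=-d\Omega$, $d\Theta=0$, with $\langle u,v\rangle=-\Omega_{(1,1)}((u,0),(0,v))+\Omega_{(1,1)}((0,u),(v,0))$ nondegenerate on $\mathfrak{d}'$. Given a Manin pair $(\mathfrak{d}',\mathfrak{g}')$ (quadratic Lie algebra, lagrangian subalgebra), put $\mathbf{A}_{\mathfrak{g}'}|_d=\{((u^r-v^l)|_d,\Omega|_{(1,d)}((0,\cdot),(u,0))-\Omega|_{(d,1)}((\cdot,0),(0,v))):u,v\in\mathfrak{g}'\}$. A multiplicative $D'$-valued moment map is a Lie groupoid morphism $\Phi:(\mathcal{H}\rightrightarrows N)\to D'$ with $\sigma\in\Omega^2(\mathcal{H})$ such that $\epsilon^*\sigma=0$ ($\epsilon$ the unit map), $\mathrm{pr}_1^*\sigma+\mathrm{pr}_2^*\sigma-\mathtt{m}^*\sigma=\Phi^*\Omega$, $d\sigma+\Phi^*\Theta=0$, $\dim\mathcal{H}-2\dim N=\frac12\dim D'$, $\ker(\sigma)\cap\ker(T\Phi)=0$, and $\mathbf{A}_{\mathfrak{g}'}|_{\Phi(h)}=\{(T\Phi(Z),\beta):Z\in T_h\mathcal{H},\ i_Z\sigma=\Phi^*\beta\}$ for all $h$. It integrates the Dirac structure $\mathbf{L}=(\mathtt{a}_{\mathcal{H}},\lambda_\sigma,\mathrm{Lie}(\Phi))(A_{\mathcal{H}})\subset\mathbb{T}N\times\mathfrak{d}'$, $\lambda_\sigma(u)=(i_u\sigma)|_{TN}$.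 Global: let $\phi_{G'}:G'\to D'$, $g\mapsto\bar g$, be a Lie group morphism integrating $\mathfrak{g}'\hookrightarrow\mathfrak{d}'$ such that $\mathrm{Ad}_{\bar g}$ preserves the pairing of $\mathfrak{d}'$ and extends the adjoint action of $G'$ on $\mathfrak{g}'$ (here $G'=G^2$, $D'=D^2$, $\phi_{G'}(g_1,g_2)=((g_1,g_1),(g_2,g_2))$). $\mathrm{Lie}(\Phi)$ restricts to an isomorphism $\ker(\lambda_\sigma)\to N\times\mathfrak{g}'$; let $\psi$ be its inverse. Then $\mathtt{a}_{\mathcal{H}}\circ\psi$ is a $\mathfrak{g}'$-action on $N$ and $\psi:\mathfrak{g}'\ltimes N\to A_{\mathcal{H}}$ a Lie algebroid morphism. $\Phi$ is global if: (e1) the $\mathfrak{g}'$-action on $N$ integrates to a $G'$-action; (e2) $\psi$ integrates to a groupoid morphism $\Psi:G'\ltimes N\to\mathcal{H}$ with $\Phi\circ\Psi$ the projection to $G'$ followed by $\phi_{G'}$; (e3) $\Phi$ is $G'\times G'$-equivariant for $(g_1,g_2)h=\Psi(g_1,\mathtt{t}(h))h\Psi(g_2,\mathtt{s}(h))^{-1}$ and $(g_1,g_2)d=\bar g_1d\bar g_2^{-1}$; (e4) $\Psi(g,\cdot)^*\sigma=0$ for each $g\in G'$. The quasi-Poisson $\mathfrak{g}_\Delta^2$-manifold $(G,0)$ is $G$ with the zero bivector field and the $\mathfrak{g}\times\mathfrak{g}$-action $\rho(u_1,u_2)=u_1^r-u_2^l$. Its Dirac structure in $\mathbb{T}G\times\mathfrak{d}^2$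 is $\{((\rho(u),\alpha),(u,-\rho^*\alpha))\}$, where $\mathfrak{g}\oplus\mathfrak{g}^*$ is identified with $\mathfrak{d}=\mathfrak{g}\oplus\overline{\mathfrak{g}}$ by $(u,v^\vee)\mapsto(u+\frac v2,u-\frac v2)$, $v^\vee=\langle v,\cdot\rangle$. Explicitly, at $a\in G$ it is the set of $\big((u_1^r-u_2^l)|_a,\ \alpha,\ (u_1+\frac{v_1}2,u_1-\frac{v_1}2),\ (u_2+\frac{v_2}2,u_2-\frac{v_2}2)\big)$ with $u_1,u_2\in\mathfrak{g}$, $\alpha\in T_a^*G$, and $v_1,v_2$ defined by $\langle v_1,w\rangle=-\alpha(w^r)$, $\langle v_2,w\rangle=\alpha(w^l)$ for all $w\in\mathfrak{g}$. *)

(* Defs.v *)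
From HB Require Import structures.
From mathcomp Require Import all_boot all_order all_algebra.
From mathcomp Require Import all_classical all_reals all_analysis.

Set Implicit Arguments.
Unset Strict Implicit.
Unset Printing Implicit Defensive.
Import Order.TTheory GRing.Theory Num.Theory.
Import numFieldNormedType.Exports.

Local Open Scope classical_set_scope.
Local Open Scope ring_scope.

(* The records ending in [_data] carry no axioms: the axioms are the           *)
(* predicates [is_manifold], [is_lie_group], [is_lie_groupoid], etc.           *)

Fixpoint Ck_on (R : realType) (m : nat) (W : normedModType R) (k : nat)
    (U : set 'rV[R]_m) (f : 'rV[R]_m -> W) : Prop :=
  if k is k'.+1 then
    (forall x, U x -> differentiable f x) /\
    (forall v, Ck_on k' U (fun x => 'D_v f x))
  else forall x, U x -> {for x, continuous f}.

Definition smooth_on (R : realType) (m : nat) (W : normedModType R)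
    (U : set 'rV[R]_m) (f : 'rV[R]_m -> W) : Prop :=
  forall k, Ck_on k U f.

(* An atlas is indexed by the points of the manifold: [chart p] is a chart     *)
(* around [p], defined on [chart_dom p], with inverse [chart_inv p].           *)
(* The tangent space at [p] is 'rV_(mdim M), read in the chart at [p].         *)
Record manifold_data (R : realType) := ManifoldData {
  mpoint :> topologicalType;
  mdim : nat;
  chart_dom : mpoint -> set mpoint;
  chart : mpoint -> mpoint -> 'rV[R]_mdim;
  chart_inv : mpoint -> 'rV[R]_mdim -> mpoint
}.

Section Manifold.
Context {R : realType}.
Local Notation tangent M := 'rV[R]_(mdim M).
Implicit Types M N : manifold_data R.

Definition chart_cod M (p : M) : set (tangent M) := chart p @` chart_dom p.

Record is_manifold M : Prop := IsManifold {
  manifold_hausdorff : hausdorff_space M;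
  manifold_second_countable : @second_countable M;
  chart_dom_open : forall p : M, open (chart_dom p);
  chart_dom_center : forall p : M, chart_dom p p;
  chart_cod_open : forall p : M, open (chart_cod p);
  chartK : forall p q : M, chart_dom p q -> chart_inv p (chart p q) = q;
  chart_continuous : forall p : M, {within chart_dom p, continuous (chart p)};
  chart_inv_continuous :
    forall p : M, {within chart_cod p, continuous (chart_inv p)};
  chart_transition_smooth : forall p q : M,
    smooth_on (chart_cod p `&` chart_inv p @^-1` chart_dom q)
      (chart q \o chart_inv p)
}.

Definition prod_manifold M N : manifold_data R := {|
  mpoint := (M * N)%type;
  mdim := mdim M + mdim N;
  chart_dom := fun p => chart_dom p.1 `*` chart_dom p.2;
  chart := fun p q => row_mx (chart p.1 q.1) (chart p.2 q.2);
  chart_inv := fun p x =>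
    (chart_inv p.1 (lsubmx x), chart_inv p.2 (rsubmx x)) |}.

Definition is_smooth M N (f : M -> N) : Prop :=
  continuous f /\
  forall p q, smooth_on
    (chart_cod p `&` chart_inv p @^-1` (f @^-1` chart_dom q))
    (chart q \o f \o chart_inv p).

Definition tmap M N (f : M -> N) (p : M) (v : tangent M) : tangent N :=
  'D_v (chart (f p) \o f \o chart_inv p) (chart p p).

Definition is_submersion M N (f : M -> N) : Prop :=
  is_smooth f /\ forall p w, exists v, tmap f p v = w.

Definition is_embedding M N (f : M -> N) : Prop :=
  [/\ is_smooth f, injective f,
      forall p, injective (tmap f p) &
      forall U, open U -> exists2 V, open V & U = f @^-1` V].

(* Change of coordinates between the chart at [p] and the chart at [q], which  *)
(* are the coordinates used for the tangent space at [q].                      *)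
Definition to_chart M (p q : M) (v : tangent M) : tangent M :=
  'D_v (chart p \o chart_inv q) (chart q q).
Definition from_chart M (p q : M) (v : tangent M) : tangent M :=
  'D_v (chart q \o chart_inv p) (chart p q).

Definition field_in_chart M (X : M -> tangent M) (p : M) :
    tangent M -> tangent M :=
  fun x => to_chart p (chart_inv p x) (X (chart_inv p x)).

Definition vf_bracket M (X Y : M -> tangent M) (p : M) : tangent M :=
  'D_(X p) (field_in_chart Y p) (chart p p) -
  'D_(Y p) (field_in_chart X p) (chart p p).

End Manifold.

Definition form2 (R : realType) (M : manifold_data R) :=
  let V := 'rV[R]_(mdim M) in M -> V -> V -> R.
Definition form3 (R : realType) (M : manifold_data R) :=
  let V := 'rV[R]_(mdim M) in M -> V -> V -> V -> R.
Definition form4 (R : realType) (M : manifold_data R) :=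
  let V := 'rV[R]_(mdim M) in M -> V -> V -> V -> V -> R.

Section Forms.
Context {R : realType}.
Local Notation tangent M := 'rV[R]_(mdim M).
Implicit Types M N : manifold_data R.

Definition form2_in_chart M (w : form2 M) (p : M) (u1 u2 : tangent M) :
    tangent M -> R^o :=
  fun x => let q := chart_inv p x in
    w q (from_chart p q u1) (from_chart p q u2).

Definition form3_in_chart M (w : form3 M) (p : M) (u1 u2 u3 : tangent M) :
    tangent M -> R^o :=
  fun x => let q := chart_inv p x in
    w q (from_chart p q u1) (from_chart p q u2) (from_chart p q u3).

Record is_form2 M (w : form2 M) : Prop := IsForm2 {
  form2_linear1 : forall p u2, scalar (fun u => w p u u2);
  form2_linear2 : forall p u1, scalar (fun u => w p u1 u);
  form2_alternating : forall p u, w p u u = 0;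
  form2_smooth : forall p u1 u2,
    smooth_on (chart_cod p) (form2_in_chart w p u1 u2)
}.

Record is_form3 M (w : form3 M) : Prop := IsForm3 {
  form3_linear1 : forall p u2 u3, scalar (fun u => w p u u2 u3);
  form3_linear2 : forall p u1 u3, scalar (fun u => w p u1 u u3);
  form3_linear3 : forall p u1 u2, scalar (fun u => w p u1 u2 u);
  form3_alternating12 : forall p u v, w p u u v = 0;
  form3_alternating23 : forall p u v, w p u v v = 0;
  form3_smooth : forall p u1 u2 u3,
    smooth_on (chart_cod p) (form3_in_chart w p u1 u2 u3)
}.

Definition pullback2 M N (f : M -> N) (w : form2 N) : form2 M :=
  fun p u1 u2 => w (f p) (tmap f p u1) (tmap f p u2).

Definition pullback3 M N (f : M -> N) (w : form3 N) : form3 M :=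
  fun p u1 u2 u3 => w (f p) (tmap f p u1) (tmap f p u2) (tmap f p u3).

(* Exterior derivatives, by the coordinate formula in the chart at [p]. *)
Definition ext_d2 M (w : form2 M) : form3 M := fun p u1 u2 u3 =>
  'D_u1 (form2_in_chart w p u2 u3) (chart p p)
  - 'D_u2 (form2_in_chart w p u1 u3) (chart p p)
  + 'D_u3 (form2_in_chart w p u1 u2) (chart p p).

Definition ext_d3 M (w : form3 M) : form4 M := fun p u1 u2 u3 u4 =>
  'D_u1 (form3_in_chart w p u2 u3 u4) (chart p p)
  - 'D_u2 (form3_in_chart w p u1 u3 u4) (chart p p)
  + 'D_u3 (form3_in_chart w p u1 u2 u4) (chart p p)
  - 'D_u4 (form3_in_chart w p u1 u2 u3) (chart p p).

End Forms.

Record lie_group_data (R : realType) := LieGroupData {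
  lg_manifold :> manifold_data R;
  gone : lg_manifold;
  gmul : lg_manifold -> lg_manifold -> lg_manifold;
  ginv : lg_manifold -> lg_manifold
}.
Arguments gone {R _}.
Arguments ginv {R _}.

Section LieGroup.
Context {R : realType}.
Local Notation tangent M := 'rV[R]_(mdim M).
Local Notation lie_algebra K := 'rV[R]_(mdim K).
Implicit Types K L : lie_group_data R.

Record is_lie_group K : Prop := IsLieGroup {
  lie_group_manifold : is_manifold K;
  gmulA : associative (@gmul R K);
  gmul1g : left_id gone (@gmul R K);
  gmulVg : left_inverse gone ginv (@gmul R K);
  gmul_smooth :
    @is_smooth R (prod_manifold K K) K (fun x => gmul x.1 x.2);
  ginv_smooth : @is_smooth R K K ginv
}.

Definition prod_lie_group K L : lie_group_data R := {|
  lg_manifold := prod_manifold K L;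
  gone := (gone, gone);
  gmul := fun x y => (gmul x.1 y.1, gmul x.2 y.2);
  ginv := fun x => (ginv x.1, ginv x.2) |}.

Definition is_lie_group_morphism K L (f : K -> L) : Prop :=
  is_smooth f /\ forall x y, f (gmul x y) = gmul (f x) (f y).

Definition right_field K (u : lie_algebra K) (g : K) : tangent K :=
  tmap (fun x => gmul x g) gone u.
Definition left_field K (u : lie_algebra K) (g : K) : tangent K :=
  tmap (gmul g) gone u.

Definition theta_l K (g : K) (v : tangent K) : lie_algebra K :=
  tmap (gmul (ginv g)) g v.
Definition theta_r K (g : K) (v : tangent K) : lie_algebra K :=
  tmap (fun x => gmul x (ginv g)) g v.

Definition Ad K (g : K) (u : lie_algebra K) : lie_algebra K :=
  tmap (fun x => gmul (gmul g x) (ginv g)) gone u.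

Definition lie_bracket K (u v : lie_algebra K) : lie_algebra K :=
  vf_bracket (right_field u) (right_field v) gone.

Record is_quadratic K (B : lie_algebra K -> lie_algebra K -> R) : Prop :=
  IsQuadratic {
  quadratic_linear : forall u, scalar (B u);
  quadratic_sym : forall u v, B u v = B v u;
  quadratic_nondeg : forall u, (forall v, B u v = 0) -> u = 0;
  quadratic_inv : forall u v w,
    B (lie_bracket u v) w + B v (lie_bracket u w) = 0
}.

Definition is_Ad_invariant K (B : lie_algebra K -> lie_algebra K -> R) : Prop :=
  forall (g : K) u v, B (Ad g u) (Ad g v) = B u v.

Record is_lie_group_action K (N : manifold_data R) (act : K -> N -> N) : Prop :=
  IsLieGroupAction {
  act1 : forall x, act gone x = x;
  actM : forall g h x, act (gmul g h) x = act g (act h x);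
  act_smooth : @is_smooth R (prod_manifold K N) N (fun p => act p.1 p.2)
}.

End LieGroup.

Record shifted_data (R : realType) := ShiftedData {
  sh_group :> lie_group_data R;
  sh_Omega : form2 (prod_manifold sh_group sh_group);
  sh_Theta : form3 sh_group
}.
Arguments sh_Omega {R} s.
Arguments sh_Theta {R} s.

Section Shifted.
Context {R : realType}.
Local Notation tangent M := 'rV[R]_(mdim M).
Local Notation lie_algebra K := 'rV[R]_(mdim K).
Implicit Types (K : lie_group_data R) (S T : shifted_data R).

Local Notation "M ** N" := (prod_manifold M N) (at level 40).

Definition pairing S (u v : lie_algebra S) : R :=
  - sh_Omega S (gone, gone) (row_mx u 0) (row_mx 0 v)
  + sh_Omega S (gone, gone) (row_mx 0 u) (row_mx v 0).

Record is_shifted_symplectic S : Prop := IsShiftedSymplectic {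
  shifted_lie_group : is_lie_group S;
  Omega_form : is_form2 (sh_Omega S);
  Theta_form : is_form3 (sh_Theta S);
  Omega_normalized_l :
    @pullback2 R S (S ** S) (fun k => (gone, k)) (sh_Omega S) = 0;
  Omega_normalized_r :
    @pullback2 R S (S ** S) (fun k => (k, gone)) (sh_Omega S) = 0;
  Omega_closed :
    let pull (f : S * S * S -> S * S) :=
      @pullback2 R (S ** S ** S) (S ** S) f (sh_Omega S) in
    pull (fun k => (k.1.2, k.2)) - pull (fun k => (gmul k.1.1 k.1.2, k.2))
    + pull (fun k => (k.1.1, gmul k.1.2 k.2)) - pull (fun k => k.1) = 0;
  Theta_Omega :
    let pull (f : S * S -> S) := @pullback3 R (S ** S) S f (sh_Theta S) in
    pull fst + pull snd - pull (fun k => gmul k.1 k.2)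
    = - ext_d2 (sh_Omega S);
  Theta_closed : ext_d3 (sh_Theta S) = 0;
  pairing_nondeg :
    forall u : lie_algebra S, (forall v, pairing u v = 0) -> u = 0
}.

Definition canonical_shifted K (B : lie_algebra K -> lie_algebra K -> R) :
    shifted_data R := {|
  sh_group := K;
  sh_Omega := fun p X Y =>
    let pr1 := @tmap R (K ** K) K fst p in
    let pr2 := @tmap R (K ** K) K snd p in
    - 2^-1 * (B (theta_l p.1 (pr1 X)) (theta_r p.2 (pr2 Y))
              - B (theta_l p.1 (pr1 Y)) (theta_r p.2 (pr2 X)));
  (* [theta, theta](Y, Z) = 2 [theta Y, theta Z]; the wedge product with the   *)
  (* 1-form theta is the sum over cyclic permutations                          *)
  sh_Theta := fun g X Y Z =>
    let th := @theta_l R K g in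
    let c x y z := B (th x) (2 *: lie_bracket (th y) (th z)) in
    - 12^-1 * (c X Y Z + c Y Z X + c Z X Y) |}.

Definition opp_shifted S : shifted_data R := {|
  sh_group := S;
  sh_Omega := - sh_Omega S;
  sh_Theta := - sh_Theta S |}.

Definition prod_shifted S T : shifted_data R := {|
  sh_group := prod_lie_group S T;
  sh_Omega :=
    @pullback2 R ((S ** T) ** (S ** T)) (S ** S)
      (fun p => (p.1.1, p.2.1)) (sh_Omega S) +
    @pullback2 R ((S ** T) ** (S ** T)) (T ** T)
      (fun p => (p.1.2, p.2.2)) (sh_Omega T);
  sh_Theta := @pullback3 R (S ** T) S fst (sh_Theta S) +
              @pullback3 R (S ** T) T snd (sh_Theta T) |}.

Record is_manin_pair S (g' : set (lie_algebra S)) : Prop := IsManinPair {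
  manin_quadratic : is_quadratic (@pairing S);
  manin_0 : g' 0;
  manin_linear : forall (c : R) u v, g' u -> g' v -> g' (c *: u + v);
  manin_bracket : forall u v, g' u -> g' v -> g' (lie_bracket u v);
  manin_lagrangian : forall u, g' u <-> forall v, g' v -> pairing u v = 0
}.

Definition A_dirac S (g' : set (lie_algebra S)) (d : S) :
    set (tangent S * (tangent S -> R)) :=
  [set e | exists u v, [/\ g' u, g' v &
    e = (right_field u d - left_field v d,
         fun w => sh_Omega S (gone, d) (row_mx 0 w) (row_mx u 0)
                  - sh_Omega S (d, gone) (row_mx w 0) (row_mx 0 v))]].

End Shifted.

(* [gpd_comp] is the manifold of composable pairs, embedded by                 *)
(* [(comp_fst, comp_snd)] in the square of the manifold of arrows; the         *)
(* multiplication is only meaningful on composable pairs.                      *)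
Record lie_groupoid_data (R : realType) := LieGroupoidData {
  arr : manifold_data R;
  obj : manifold_data R;
  gpd_src : arr -> obj;
  gpd_tgt : arr -> obj;
  gpd_unit : obj -> arr;
  gpd_inv : arr -> arr;
  gpd_mul : arr -> arr -> arr;
  gpd_comp : manifold_data R;
  comp_fst : gpd_comp -> arr;
  comp_snd : gpd_comp -> arr
}.
Arguments gpd_src {R H} : rename.
Arguments gpd_tgt {R H} : rename.
Arguments gpd_unit {R H} : rename.
Arguments gpd_inv {R H} : rename.
Arguments gpd_mul {R H} : rename.
Arguments comp_fst {R H} : rename.
Arguments comp_snd {R H} : rename.

Section LieGroupoid.
Context {R : realType}.
Implicit Types (M N : manifold_data R) (K : lie_group_data R).
Implicit Types H : lie_groupoid_data R.

Local Notation "M ** N" := (prod_manifold M N) (at level 40).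

Definition composable H (h k : arr H) : Prop := gpd_src h = gpd_tgt k.

Definition comp_mul H (c : gpd_comp H) : arr H :=
  gpd_mul (comp_fst c) (comp_snd c).

Record is_lie_groupoid H : Prop := IsLieGroupoid {
  arr_manifold : is_manifold (arr H);
  obj_manifold : is_manifold (obj H);
  comp_manifold : is_manifold (gpd_comp H);
  src_submersion : is_submersion (@gpd_src R H);
  tgt_submersion : is_submersion (@gpd_tgt R H);
  unit_smooth : is_smooth (@gpd_unit R H);
  inv_smooth : is_smooth (@gpd_inv R H);
  comp_embedding : @is_embedding R (gpd_comp H) (arr H ** arr H)
    (fun c => (comp_fst c, comp_snd c));
  comp_image : forall h k : arr H,
    composable h k <-> exists c, h = comp_fst c /\ k = comp_snd c;
  mul_smooth : is_smooth (@comp_mul H);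
  src_unit : forall x : obj H, gpd_src (gpd_unit x) = x;
  tgt_unit : forall x : obj H, gpd_tgt (gpd_unit x) = x;
  src_mul : forall h k : arr H,
    composable h k -> gpd_src (gpd_mul h k) = gpd_src k;
  tgt_mul : forall h k : arr H,
    composable h k -> gpd_tgt (gpd_mul h k) = gpd_tgt h;
  gpd_mulA : forall h k l : arr H, composable h k -> composable k l ->
    gpd_mul h (gpd_mul k l) = gpd_mul (gpd_mul h k) l;
  gpd_mul1 : forall h : arr H, gpd_mul (gpd_unit (gpd_tgt h)) h = h;
  gpd_mulr1 : forall h : arr H, gpd_mul h (gpd_unit (gpd_src h)) = h;
  src_inv : forall h : arr H, gpd_src (gpd_inv h) = gpd_tgt h;
  tgt_inv : forall h : arr H, gpd_tgt (gpd_inv h) = gpd_src h;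
  gpd_mulV : forall h : arr H,
    gpd_mul (gpd_inv h) h = gpd_unit (gpd_src h);
  gpd_mulrV : forall h : arr H,
    gpd_mul h (gpd_inv h) = gpd_unit (gpd_tgt h)
}.

Definition is_morphism_to_group H K (Phi : arr H -> K) : Prop :=
  is_smooth Phi /\
  forall h k, composable h k -> Phi (gpd_mul h k) = gmul (Phi h) (Phi k).

Record is_groupoid_morphism (H1 H2 : lie_groupoid_data R)
    (F : arr H1 -> arr H2) (f : obj H1 -> obj H2) : Prop :=
  IsGroupoidMorphism {
  morphism_smooth : is_smooth F;
  morphism_obj_smooth : is_smooth f;
  morphism_src : forall h, gpd_src (F h) = f (gpd_src h);
  morphism_tgt : forall h, gpd_tgt (F h) = f (gpd_tgt h);
  morphism_mul : forall h k, composable h k ->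
    F (gpd_mul h k) = gpd_mul (F h) (F k)
}.

Definition pair_groupoid M : lie_groupoid_data R := {|
  arr := M ** M;
  obj := M;
  gpd_src := snd;
  gpd_tgt := fst;
  gpd_unit := fun a => (a, a);
  gpd_inv := fun h => (h.2, h.1);
  gpd_mul := fun h k => (h.1, k.2);
  gpd_comp := M ** M ** M;
  comp_fst := fun c => (c.1.1, c.1.2);
  comp_snd := fun c => (c.1.2, c.2) |}.

Definition prod_groupoid_group H K : lie_groupoid_data R := {|
  arr := arr H ** K;
  obj := obj H;
  gpd_src := fun h => gpd_src h.1;
  gpd_tgt := fun h => gpd_tgt h.1;
  gpd_unit := fun x => (gpd_unit x, gone);
  gpd_inv := fun h => (gpd_inv h.1, ginv h.2);
  gpd_mul := fun h k => (gpd_mul h.1 k.1, gmul h.2 k.2);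
  gpd_comp := gpd_comp H ** (K ** K);
  comp_fst := fun c => (comp_fst c.1, c.2.1);
  comp_snd := fun c => (comp_snd c.1, c.2.2) |}.

Definition action_groupoid K N (act : K -> N -> N) : lie_groupoid_data R := {|
  arr := K ** N;
  obj := N;
  gpd_src := snd;
  gpd_tgt := fun h => act h.1 h.2;
  gpd_unit := fun x => (gone, x);
  gpd_inv := fun h => (ginv h.1, act h.1 h.2);
  gpd_mul := fun h k => (gmul h.1 k.1, k.2);
  gpd_comp := K ** (K ** N);
  comp_fst := fun c => (c.1, act c.2.1 c.2.2);
  comp_snd := fun c => c.2 |}.

End LieGroupoid.

Section MomentMap.
Context {R : realType}.
Local Notation tangent M := 'rV[R]_(mdim M).
Local Notation lie_algebra K := 'rV[R]_(mdim K).
Variables (S : shifted_data R) (g' : set (lie_algebra S)).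
Variables (H : lie_groupoid_data R) (Phi : arr H -> S) (sigma : form2 (arr H)).

Record is_moment_map : Prop := IsMomentMap {
  mm_group : is_shifted_symplectic S;
  mm_manin_pair : is_manin_pair g';
  mm_groupoid : is_lie_groupoid H;
  mm_morphism : is_morphism_to_group Phi;
  mm_form : is_form2 sigma;
  mm_unit : pullback2 (@gpd_unit R H) sigma = 0;
  mm_multiplicative :
    pullback2 (@comp_fst R H) sigma + pullback2 (@comp_snd R H) sigma
      - pullback2 (@comp_mul R H) sigma
    = @pullback2 R (gpd_comp H) (prod_manifold S S)
        (fun c => (Phi (comp_fst c), Phi (comp_snd c))) (sh_Omega S);
  mm_closed : ext_d2 sigma + pullback3 Phi (sh_Theta S) = 0;
  mm_dim : (mdim (arr H))%:Q - 2 * (mdim (obj H))%:Q = 2^-1 * (mdim S)%:Q;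
  mm_kernel : forall h Z, (forall W, sigma h Z W = 0) -> tmap Phi h Z = 0 ->
    Z = 0;
  mm_dirac : forall h, A_dirac g' (Phi h) =
    [set e | exists Z, exists beta : tangent S -> R, [/\ scalar beta,
      (forall W, sigma h Z W = beta (tmap Phi h W)) &
      e = (tmap Phi h Z, beta)]]
}.

Definition algebroid_fibre (x : obj H) : set (tangent (arr H)) :=
  [set a | tmap gpd_src (gpd_unit x) a = 0].

Definition anchor (x : obj H) (a : tangent (arr H)) : tangent (obj H) :=
  tmap gpd_tgt (gpd_unit x) a.

Definition lambda (x : obj H) (a : tangent (arr H)) : tangent (obj H) -> R :=
  fun w => sigma (gpd_unit x) a (tmap gpd_unit x w).

Definition lie_Phi (x : obj H) (a : tangent (arr H)) : lie_algebra S :=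
  tmap Phi (gpd_unit x) a.

Definition integrated_dirac (x : obj H) :
    set (tangent (obj H) * (tangent (obj H) -> R) * lie_algebra S) :=
  [set (anchor x a, lambda x a, lie_Phi x a) | a in algebroid_fibre x].

Definition ker_lambda (x : obj H) : set (tangent (arr H)) :=
  [set a | algebroid_fibre x a /\ lambda x a = 0].

Definition is_psi (psi : obj H -> lie_algebra S -> tangent (arr H)) : Prop :=
  forall x,
    (forall u, g' u -> ker_lambda x (psi x u) /\ lie_Phi x (psi x u) = u) /\
    (forall a, ker_lambda x a -> g' (lie_Phi x a) /\ psi x (lie_Phi x a) = a).

Variables (G' : lie_group_data R) (phi : G' -> S).

Record is_integration : Prop := IsIntegration {
  integration_group : is_lie_group G';
  integration_morphism : is_lie_group_morphism phi;
  integration_inj : injective (tmap phi gone);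
  integration_image : tmap phi gone @` setT = g';
  integration_pairing : forall (g : G') (u v : lie_algebra S),
    pairing (Ad (phi g) u) (Ad (phi g) v) = pairing u v;
  integration_Ad : forall (g : G') (u : lie_algebra G'),
    Ad (phi g) (tmap phi gone u) = tmap phi gone (Ad g u)
}.

Record is_global_with (psi : obj H -> lie_algebra S -> tangent (arr H))
    (act : G' -> obj H -> obj H) (Psi : G' * obj H -> arr H) : Prop :=
  IsGlobalWith {
  global_psi : is_psi psi;
  global_act : is_lie_group_action act;
  global_act_integrates : forall x (u : lie_algebra G'),
    tmap (act^~ x) gone u = anchor x (psi x (tmap phi gone u));
  global_Psi : @is_groupoid_morphism R (action_groupoid act) H Psi id;
  global_Psi_integrates : forall x (u : lie_algebra G'),
    @tmap R (prod_manifold G' (obj H)) (arr H) Psi (gone, x) (row_mx u 0)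
    = psi x (tmap phi gone u);
  global_Phi_Psi : forall g x, Phi (Psi (g, x)) = phi g;
  global_equivariant : forall (g1 g2 : G') (h : arr H),
    Phi (gpd_mul (gpd_mul (Psi (g1, gpd_tgt h)) h)
                 (gpd_inv (Psi (g2, gpd_src h))))
    = gmul (gmul (phi g1) (Phi h)) (ginv (phi g2));
  global_isotropic : forall g : G', pullback2 (fun x => Psi (g, x)) sigma = 0
}.

Definition is_global_moment_map : Prop :=
  [/\ is_moment_map, is_integration &
      exists psi act Psi, is_global_with psi act Psi].

End MomentMap.

Section QuasiPoisson.
Context {R : realType}.
Local Notation tangent M := 'rV[R]_(mdim M).
Local Notation lie_algebra K := 'rV[R]_(mdim K).
Variables (G : lie_group_data R).
Variables (B : lie_algebra G -> lie_algebra G -> R).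

Definition double_group : shifted_data R :=
  prod_shifted (canonical_shifted B) (opp_shifted (canonical_shifted B)).

Definition double_group2 : shifted_data R :=
  prod_shifted double_group double_group.

Definition diagonal2 : set (lie_algebra double_group2) :=
  [set row_mx (row_mx u1 u1) (row_mx u2 u2)
    | u1 in [set: lie_algebra G] & u2 in [set: lie_algebra G]].

Definition diagonal2_map (g : prod_lie_group G G) : double_group2 :=
  ((g.1, g.1), (g.2, g.2)).

Definition PG2 : lie_groupoid_data R :=
  prod_groupoid_group (pair_groupoid G) (prod_lie_group G G).

Definition Phi_PG2 (h : arr PG2) : double_group2 :=
  let: ((a1, a2), (g1, g2)) := h in
  ((gmul (gmul a1 g2) (ginv a2), g1), (gmul (gmul (ginv a1) g1) a2, g2)).

Definition sigma_PG2 : form2 (arr PG2) :=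
  let pull (f : G * G * (G * G) -> G * G) :=
    @pullback2 R (arr PG2) (prod_manifold G G) f
      (sh_Omega (canonical_shifted B)) in
  pull (fun '(a1, a2, (g1, g2)) => (a1, gmul (gmul (ginv a1) g1) a2))
  - pull (fun '(a1, a2, (g1, g2)) => (g1, a2))
  - pull (fun '(a1, a2, (g1, g2)) => (a1, g2))
  + pull (fun '(a1, a2, (g1, g2)) => (gmul (gmul a1 g2) (ginv a2), a2)).

Definition rho (a : G) (u1 u2 : lie_algebra G) : tangent G :=
  right_field u1 a - left_field u2 a.

(* The elements (rho(u), alpha, (u, - rho^* alpha)), where (u, v^\/) is        *)
(* identified with (u + v/2, u - v/2) in each of the two factors.              *)
Definition quasi_poisson_dirac (a : G) :
    set (tangent G * (tangent G -> R) * lie_algebra double_group2) :=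
  [set e | exists u1 u2 v1 v2 : lie_algebra G, exists alpha : tangent G -> R,
    [/\ scalar alpha,
        (forall w1 w2, B v1 w1 + B v2 w2 = - alpha (rho a w1 w2)) &
        e = (rho a u1 u2, alpha,
             row_mx (row_mx (u1 + 2^-1 *: v1) (u1 - 2^-1 *: v1))
                    (row_mx (u2 + 2^-1 *: v2) (u2 - 2^-1 *: v2)))]].

End QuasiPoisson.

Arguments double_group {R G} B.
Arguments double_group2 {R G} B.
Arguments diagonal2 {R G} B.
Arguments diagonal2_map {R G} B.
Arguments PG2 {R} G.
Arguments Phi_PG2 {R G} B.
Arguments sigma_PG2 {R G} B.
Arguments quasi_poisson_dirac {R G} B.

(* Main.v *)
(* Write Phi = ((b, g1), (c, g2)) with b = a1 g2 a2^-1 and c = a1^-1 g1 a2, so that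
   b a2 = a1 g2 and a1 c = g1 a2.  The form sigma is the signed sum of the pullbacks of
   Omega_G along (a1, c), (g1, a2), (a1, g2), (b, a2).  Its multiplicativity is a
   combination of six instances of the Polyakov-Wiegmann identity delta Omega_G = 0, and
   d sigma is read off from pr_1^* Theta_G + pr_2^* Theta_G - m^* Theta_G = - d Omega_G,
   the terms Theta_G(b a2) and Theta_G(a1 g2), respectively Theta_G(a1 c) and
   Theta_G(g1 a2), cancelling.  As Omega_G is invariant under (a, b) -> (x a, b y), the last
   identity reduces to the unit of G^2, where it is the Maurer-Cartan equation.

   In terms of the logarithmic derivatives f^* theta^r of the components, sigma becomes a
   polynomial in B and Ad.  The infinitesimal two-sided action of the diagonal lifts
   u^r - v^l from D^2 to vector fields Z on the groupoid, and i_Z sigma is the pullback of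
   the covector prescribed by A; this is one inclusion in the moment map condition, and
   the other one follows because A is maximal isotropic.

   The form sigma vanishes on every submanifold where Phi is constant, which gives both
   the normalization along the units and the isotropy of the global action. *)

Require Import Defs.
From HB Require Import structures.
From mathcomp Require Import all_boot all_order all_algebra.
From mathcomp Require Import all_classical all_reals all_analysis.
From mathcomp Require Import ring lra.

Set Implicit Arguments.
Unset Strict Implicit.
Unset Printing Implicit Defensive.
Import Order.TTheory GRing.Theory Num.Theory.
Import numFieldNormedType.Exports.

Local Open Scope classical_set_scope.
Local Open Scope ring_scope.

(** * Calculus in R^n *)

Section Calculus.
Context {R : realType}.
Implicit Types (m n : nat) (W : normedModType R).

(** A tangent vector at p is a row vector read in the chart centred at p, so its coordinates change
    meaning as the base point moves. For this reason the calculus is developed for representatives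
    in arbitrary charts, and [tmap] is the special case of the charts centred at the points. Besides
    the chain and product rules, the main analytic input is the symmetry of second derivatives. It
    gives the naturality of d and the compatibility of morphisms with brackets, and it expresses all
    first derivatives at the unit of invariant fields and Maurer-Cartan forms through one bilinear
    map, [mul2].

    That $\Theta_G$ is closed is a parity argument: inversion reverses the sign of $\Theta_G$ and
    acts by -1 on the tangent space at the unit, where a 4-form is even.

    Maximality of A is made explicit. In the right trivialization, a pair (u, v) gives the vector $u
    - \mathrm{Ad}_d v$ and the covector $\frac12(u + \mathrm{Ad}_d v)$, so u and v can be recovered
    from the vector and the covector; orthogonality to A then says exactly that both lie in the
    lagrangian subalgebra. *)

Lemma rV_sum_delta n (v : 'rV[R]_n) : v = \sum_j v 0 j *: delta_mx 0 j.
Proof. exact: row_sum_delta. Qed.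

(** Linearity mostly appears as a hypothesis on a bare function, such as a form evaluated at a
    moving point. Expansion in the standard basis turns such a function into a finite sum, to which
    the rules of calculus apply. *)
Lemma scalar_sum W n (phi : 'rV[R]_n -> W) (v : 'rV[R]_n) :
  linear phi -> phi v = \sum_j v 0 j *: phi (delta_mx 0 j).
Proof.
move=> lphi; pose L := HB.pack phi (GRing.isLinear.Build _ _ _ _ phi lphi) : {linear _ -> _}.
rewrite -[phi]/(L : _ -> _) {1}[v]rV_sum_delta linear_sum.
by apply: eq_bigr => j _; rewrite linearZ.
Qed.

(** Representatives in charts agree with explicit formulas only near a point, so differentiability
    has to depend on the germ alone. The differential of f serves as that of g. *)
Lemma differentiable_ext W m (f g : 'rV[R]_m -> W) x :
  (\forall y \near x, f y = g y) -> differentiable f x -> differentiable g x.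
Proof.
move=> fg df; have /diff_locallyP[cf Df] := df.
have gE : g \o shift x = cst (g x) + 'd f x +o_ (nbhs (0 : 'rV[R]_m)) id.
  apply/eqaddoP => e e0; have /eqaddoP/(_ _ e0) De := Df.
  have fg0 : \forall y \near (0 : 'rV[R]_m), f (y + x) = g (y + x).
    move: fg; rewrite (near_shift 0) /=; apply: filterS => y /=.
    by rewrite subr0.
  have fgx : f x = g x := nbhs_singleton fg.
  near=> y.
  have -> : (g \o shift x - (cst (g x) + 'd f x)) y = (f \o shift x - (cst (f x) + 'd f x)) y.
    rewrite -[LHS]/(g (y + x) - (g x + 'd f x y)) -fgx -(near fg0 y)//.
  by near: y.
have dgf : 'd g x = 'd f x :> (_ -> _) by apply: diff_unique.
by apply/diff_locallyP; rewrite dgf.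
Unshelve. all: by end_near. Qed.

Lemma differentiable_sum_scale W (V : normedModType R) n (a : 'I_n -> V -> R^o) (w : 'I_n -> W) (x : V) :
  (forall j, differentiable (a j) x) ->
  differentiable (fun y => \sum_j a j y *: w j) x.
Proof.
move=> da.
have -> : (fun y => \sum_j a j y *: w j) = \sum_j (fun y => a j y *: w j).
  by apply/funext => y; rewrite fct_sumE.
apply: differentiable_sum => j; exact: (@differentiableZl _ _ _ (a j) (w j) x).
Qed.

Lemma differentiable_rV (V : normedModType R) n (f : V -> 'rV[R]_n) (x : V) :
  (forall j, differentiable (fun y => f y 0 j : R^o) x) -> differentiable f x.
Proof.
move=> df.
have -> : f = (fun y => \sum_j f y 0 j *: delta_mx 0 j).
  by apply/funext => y; exact: rV_sum_delta.
exact: (@differentiable_sum_scale _ _ n (fun j y => f y 0 j)).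
Qed.

Lemma differentiable_fun_coord n (x : 'rV[R]_n) j :
  differentiable (fun y : 'rV[R]_n => y 0 j : R^o) x.
Proof. exact: (@differentiable_coord R 1 n x 0 j). Qed.

(** In finite dimension a linear map is a finite combination of coordinate functions, so continuity
    comes with linearity. *)
Lemma differentiable_lin W n (phi : 'rV[R]_n -> W) x :
  linear phi -> differentiable phi x.
Proof.
move=> lphi.
have -> : phi = (fun y => \sum_j y 0 j *: phi (delta_mx 0 j)).
  by apply/funext => y; exact: scalar_sum.
apply: (@differentiable_sum_scale W _ n (fun j (y : 'rV[R]_n) => y 0 j)) => j.
exact: differentiable_fun_coord.
Qed.

Lemma differentiable_coordE (V : normedModType R) n (f : V -> 'rV[R]_n) (x : V) j :
  differentiable f x -> differentiable (fun y => f y 0 j : R^o) x.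
Proof.
move=> df. apply: (@differentiable_comp _ _ _ _ f (fun M : 'rV[R]_n => M 0 j : R^o)) => //.
exact: differentiable_fun_coord.
Qed.

Lemma derive_coordE (V : normedModType R) n (f : V -> 'rV[R]_n) (x v : V) j :
  differentiable f x -> ('D_v f x) 0 j = 'D_v (fun y => f y 0 j : R^o) x.
Proof.
move=> df; rewrite derive_mx ?mxE//.
exact: diff_derivable.
Qed.

Lemma derive_linE (V : normedModType R) W (f : V -> W) x :
  differentiable f x -> linear (fun v => 'D_v f x).
Proof. by move=> df a u v; rewrite !deriveE// linearP. Qed.

Lemma derive_comp m n W (f : 'rV[R]_m -> 'rV[R]_n) (g : 'rV[R]_n -> W) x v :
  differentiable f x -> differentiable g (f x) ->
  'D_v (g \o f) x = 'D_('D_v f x) g (f x).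
Proof.
move=> df dg; rewrite !deriveE//; last exact: differentiable_comp.
by rewrite diff_comp.
Qed.

Lemma derive_lin W n (phi : 'rV[R]_n -> W) x v :
  linear phi -> 'D_v phi x = phi v.
Proof.
move=> lphi; rewrite deriveE; last exact: differentiable_lin.
pose L := HB.pack phi (GRing.isLinear.Build _ _ _ _ phi lphi) : {linear _ -> _}.
rewrite (_ : 'd phi x = phi :> (_ -> _))//.
apply: (@diff_lin _ _ _ L).
by move=> y; exact/differentiable_continuous/differentiable_lin.
Qed.

(** On an open set an equality holds near each point, hence passes to all directional derivatives;
    this is what the induction on k uses. *)
Lemma Ck_on_ext W m k (U : set 'rV[R]_m) (f g : 'rV[R]_m -> W) : open U ->
  (forall x, U x -> f x = g x) -> Ck_on k U f -> Ck_on k U g.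
Proof.
move=> oU; elim: k f g => [|k IH] f g fg /=.
  move=> cf x Ux; have fx := cf x Ux.
  have fgx : \forall y \near x, f y = g y.
    by apply: filterS (open_nbhs_nbhs (conj oU Ux)) => y /fg.
  change (g @ x --> g x); rewrite -(fg _ Ux).
  by move=> A /fx fA; apply: filterS2 fgx fA => y /= <-.
move=> [df cf]; have nfg x : U x -> \forall y \near x, f y = g y.
  by move=> Ux; apply: filterS (open_nbhs_nbhs (conj oU Ux)) => y /fg.
split=> [x Ux|v]; first exact: differentiable_ext (nfg _ Ux) (df _ Ux).
apply: IH (cf v) => x Ux; exact: near_eq_derive (nfg _ Ux).
Qed.

Lemma Ck_on_sub W m k (U V : set 'rV[R]_m) (f : 'rV[R]_m -> W) :
  V `<=` U -> Ck_on k U f -> Ck_on k V f.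
Proof.
move=> VU; elim: k f => [|k IH] f /=; first by move=> cf x /VU/cf.
by move=> [df cf]; split=> [x /VU/df|v]//; exact: IH.
Qed.

(** [Ck_on] constrains a function defined everywhere, and its derivatives, at each point of U
    separately; it can therefore be checked one point at a time. *)
Lemma Ck_on_local W m k (U : set 'rV[R]_m) (f : 'rV[R]_m -> W) :
  (forall x, U x -> exists V, V x /\ Ck_on k V f) -> Ck_on k U f.
Proof.
elim: k f => [|k IH] f /= H.
  by move=> x /H[V [Vx]]; exact.
split=> [x /H[V [Vx [df _]]]|v]; first exact: df.
by apply: IH => x /H[V [Vx [_ cf]]]; exists V.
Qed.

Lemma Ck_onW W m k (U : set 'rV[R]_m) (f : 'rV[R]_m -> W) :
  Ck_on k.+1 U f -> Ck_on k U f.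
Proof.
elim: k f => [|k IH] f /= [df cf].
  by move=> x Ux; apply/differentiable_continuous/df.
by split=> // v; apply: IH.
Qed.

Lemma Ck_on_cst W m k (U : set 'rV[R]_m) (c : W) : Ck_on k U (fun=> c).
Proof.
elim: k c => [|k IH] c /=; first by move=> x _; exact: cst_continuous.
split=> [x _|v]; first exact: differentiable_cst.
have -> : (fun x => 'D_v (fun=> c) x) = (fun=> 0) :> ('rV[R]_m -> W).
  by apply/funext => x; exact: derive_cst.
exact: IH.
Qed.

Lemma Ck_on_lin W m k (U : set 'rV[R]_m) (phi : 'rV[R]_m -> W) :
  linear phi -> Ck_on k U phi.
Proof.
move=> lphi; case: k => [|k] /=.
  by move=> x _; apply/differentiable_continuous/differentiable_lin.
split=> [x _|v]; first exact: differentiable_lin.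
have -> : (fun x => 'D_v phi x) = (fun=> phi v).
  by apply/funext => x; rewrite derive_lin.
exact: Ck_on_cst.
Qed.

Lemma Ck_onD W m k (U : set 'rV[R]_m) (f g : 'rV[R]_m -> W) : open U ->
  Ck_on k U f -> Ck_on k U g -> Ck_on k U (fun x => f x + g x).
Proof.
move=> oU; elim: k f g => [|k IH] f g /=.
  by move=> cf cg x Ux; apply: continuousD; [exact: cf|exact: cg].
move=> [df cf] [dg cg]; split=> [x Ux|v].
  by apply: differentiableD; [exact: df|exact: dg].
apply: Ck_on_ext (IH _ _ (cf v) (cg v)) => // x Ux.
by rewrite (@deriveD _ _ _ f g)//; apply: diff_derivable; [exact: df|exact: dg].
Qed.

(** The product rule involves f and g themselves besides their derivatives, so [Ck_onW] first lowers
    their order to that of the induction hypothesis. *)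
Lemma Ck_onM m k (U : set 'rV[R]_m) (f g : 'rV[R]_m -> R^o) : open U ->
  Ck_on k U f -> Ck_on k U g -> Ck_on k U (fun x => f x * g x : R^o).
Proof.
move=> oU; elim: k f g => [|k IH] f g.
  by move=> cf cg x Ux; apply: continuousM; [exact: cf|exact: cg].
move=> Cf Cg; have := Ck_onW Cf; have := Ck_onW Cg.
move: Cf Cg => /= [df cf] [dg cg] Cg Cf; split=> [x Ux|v].
  by apply: differentiableM; [exact: df|exact: dg].
apply: Ck_on_ext (Ck_onD oU (IH _ _ Cf (cg v)) (IH _ _ (cf v) Cg)) => // x Ux.
rewrite (@deriveM _ _ f g)//; [|apply: diff_derivable; exact: df|apply: diff_derivable; exact: dg].
by rewrite [_ *: 'D_v f x]mulrC.
Qed.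

Lemma Ck_on_sum W m k n (U : set 'rV[R]_m) (f : 'I_n -> 'rV[R]_m -> W) : open U ->
  (forall j, Ck_on k U (f j)) -> Ck_on k U (fun x => \sum_j f j x).
Proof.
move=> oU Cf; have -> : (fun x => \sum_j f j x) = \sum_j f j.
  by apply/funext => x; rewrite fct_sumE.
elim/big_ind: _ => //; first exact: Ck_on_cst.
by move=> g h Cg Ch; exact: Ck_onD.
Qed.

Lemma Ck_on_rV m n k (U : set 'rV[R]_m) (f : 'rV[R]_m -> 'rV[R]_n) : open U ->
  (forall j, Ck_on k U (fun x => f x 0 j : R^o)) -> Ck_on k U f.
Proof.
move=> oU; elim: k f => [|k IH] f /= Cf.
  move=> x Ux.
  have -> : f = (fun y => \sum_j f y 0 j *: delta_mx 0 j).
    by apply/funext => y; exact: rV_sum_delta.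
  have -> : (fun y => \sum_j f y 0 j *: delta_mx 0 j) =
      \sum_j (fun y => f y 0 j *: delta_mx 0 j) :> (_ -> 'rV[R]_n).
    by apply/funext => y; rewrite fct_sumE.
  elim/big_ind: _ => [|g h cg ch|j _]; first exact: cst_continuous.
    exact: continuousD.
  by apply: (@continuousZr_tmp _ _ _ (fun y => f y 0 j)); exact: Cf.
split=> [x Ux|v]; first by apply: differentiable_rV => j; case: (Cf j) => + _; apply.
apply: IH => j; apply: Ck_on_ext ((Cf j).2 v) => // x Ux.
rewrite derive_coordE//; apply: differentiable_rV => i.
by case: (Cf i) => + _; apply.
Qed.

Lemma Ck_on_coord m n k (U : set 'rV[R]_m) (f : 'rV[R]_m -> 'rV[R]_n) j : open U ->
  Ck_on k U f -> Ck_on k U (fun x => f x 0 j : R^o).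
Proof.
move=> oU; elim: k f => [|k IH] f /=.
  move=> Cf x Ux; apply: (@continuous_comp _ _ _ f (fun M : 'rV[R]_n => M 0 j)).
    exact: Cf.
  exact: coord_continuous.
move=> [df cf]; split=> [x Ux|v]; first exact: differentiable_coordE (df _ Ux).
by apply: Ck_on_ext (IH _ (cf v)) => // x Ux; rewrite derive_coordE//; exact: df.
Qed.

(** The chain rule is written as the sum over j of the j-th coordinate of $D_v f$ times $(\partial_j
    g) \circ f$, so that the induction hypothesis applies to each partial derivative of g. With a
    scalar target only products of scalar functions occur. *)
Lemma Ck_on_compR m n k (U : set 'rV[R]_m) (V : set 'rV[R]_n)
    (f : 'rV[R]_m -> 'rV[R]_n) (g : 'rV[R]_n -> R^o) : open U ->
  Ck_on k U f -> Ck_on k V g -> (forall x, U x -> V (f x)) ->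
  Ck_on k U (g \o f).
Proof.
move=> oU + + fUV; elim: k f fUV g => [|k IH] f fUV g.
  by move=> cf cg x Ux; apply: continuous_comp; [exact: cf|exact/cg/fUV].
move=> Cf Cg; have Cf' := Ck_onW Cf; have := Ck_onW Cg.
move: Cf Cg => /= [df cf] [dg cg] Cg'; split=> [x Ux|v].
  by apply: differentiable_comp; [exact: df|exact/dg/fUV].
apply: (@Ck_on_ext _ _ _ _
   (fun x => \sum_j ('D_v f x) 0 j * ('D_(delta_mx 0 j) g \o f) x)) => //.
  move=> x Ux; rewrite (derive_comp v (df _ Ux) (dg _ (fUV _ Ux))).
  rewrite [RHS](@scalar_sum _ _ (fun w => 'D_w g (f x)))//.
  exact/derive_linE/dg/fUV.
apply: Ck_on_sum => // j; apply: Ck_onM => //; first exact: Ck_on_coord (cf v).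
exact: IH.
Qed.

Lemma smooth_on_diff W m (U : set 'rV[R]_m) (f : 'rV[R]_m -> W) x :
  smooth_on U f -> U x -> differentiable f x.
Proof. by move=> /(_ 1)[df _]; exact: df. Qed.

Lemma smooth_on_derive W m (U : set 'rV[R]_m) (f : 'rV[R]_m -> W) v :
  smooth_on U f -> smooth_on U (fun x => 'D_v f x).
Proof. by move=> sf k; exact: (sf k.+1).2. Qed.

Lemma smooth_on_ext W m (U : set 'rV[R]_m) (f g : 'rV[R]_m -> W) : open U ->
  (forall x, U x -> f x = g x) -> smooth_on U f -> smooth_on U g.
Proof. by move=> oU fg sf k; exact: Ck_on_ext (sf k). Qed.

Lemma smooth_on_sub W m (U V : set 'rV[R]_m) (f : 'rV[R]_m -> W) :
  V `<=` U -> smooth_on U f -> smooth_on V f.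
Proof. by move=> VU sf k; exact: Ck_on_sub (sf k). Qed.

Lemma smooth_on_local W m (U : set 'rV[R]_m) (f : 'rV[R]_m -> W) :
  (forall x, U x -> exists V, V x /\ smooth_on V f) -> smooth_on U f.
Proof. by move=> H k; apply: Ck_on_local => x /H[V [Vx sf]]; exists V. Qed.

Lemma smooth_on_comp m n p (U : set 'rV[R]_m) (V : set 'rV[R]_n)
    (f : 'rV[R]_m -> 'rV[R]_n) (g : 'rV[R]_n -> 'rV[R]_p) : open U -> open V ->
  smooth_on U f -> smooth_on V g -> (forall x, U x -> V (f x)) ->
  smooth_on U (g \o f).
Proof.
move=> oU oV sf sg fUV k; apply: Ck_on_rV => // j.
apply: (@Ck_on_compR _ _ _ _ V _ (fun y => g y 0 j : R^o)) => //.
exact: Ck_on_coord.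
Qed.

Lemma smooth_on_compR m n (U : set 'rV[R]_m) (V : set 'rV[R]_n)
    (f : 'rV[R]_m -> 'rV[R]_n) (g : 'rV[R]_n -> R^o) : open U ->
  smooth_on U f -> smooth_on V g -> (forall x, U x -> V (f x)) ->
  smooth_on U (g \o f).
Proof. by move=> oU sf sg fUV k; exact: Ck_on_compR (sf k) (sg k) fUV. Qed.

(** A family of linear forms applied to a moving vector is, in the basis, a sum of products of
    smooth functions. Coefficients of pulled-back forms have this shape. *)
Lemma smooth_on_appR m n (U : set 'rV[R]_m) (phi : 'rV[R]_m -> 'rV[R]_n -> R^o)
    (a : 'rV[R]_m -> 'rV[R]_n) : open U ->
  (forall x, U x -> linear (phi x)) -> (forall u, smooth_on U (phi^~ u)) ->
  smooth_on U a -> smooth_on U (fun x => phi x (a x)).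
Proof.
move=> oU lphi sphi sa k.
apply: (@Ck_on_ext _ _ _ _ (fun x => \sum_j a x 0 j * phi x (delta_mx 0 j))) => //.
  by move=> x Ux; rewrite [RHS](scalar_sum _ (lphi _ Ux)).
apply: Ck_on_sum => // j; apply: Ck_onM => //; last exact: sphi.
exact: Ck_on_coord (sa k).
Qed.

Section AppRule.
Variables (m n : nat) (phi : 'rV[R]_m -> 'rV[R]_n -> R^o).
Variables (a : 'rV[R]_m -> 'rV[R]_n) (x : 'rV[R]_m).
Hypotheses (lphi : \forall y \near x, linear (phi y)).
Hypotheses (dphi : forall u, differentiable (phi^~ u) x) (da : differentiable a x).

Let F := fun y => \sum_j a y 0 j * phi y (delta_mx 0 j) : R^o.

Let FE : \forall y \near x, F y = phi y (a y).
Proof. by apply: filterS lphi => y ly; rewrite [RHS](scalar_sum _ ly). Qed.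

Let dterm j : differentiable (fun y => a y 0 j * phi y (delta_mx 0 j) : R^o) x.
Proof. by apply: differentiableM; [exact: differentiable_coordE|exact: dphi]. Qed.

Let Fsum : F = \sum_j (fun y => a y 0 j * phi y (delta_mx 0 j) : R^o).
Proof. by apply/funext => y; rewrite fct_sumE. Qed.

Lemma differentiable_appR : differentiable (fun y => phi y (a y)) x.
Proof.
apply: differentiable_ext FE _; rewrite Fsum; exact: differentiable_sum.
Qed.

(** Product rule for a linear form and its argument which both depend on the point. The expansion in
    the basis is differentiated termwise, and linearity reassembles the two groups of terms. *)
Lemma derive_appR v :
  'D_v (fun y => phi y (a y)) x = 'D_v (phi^~ (a x)) x + phi x ('D_v a x).
Proof.
have lx : linear (phi x) := nbhs_singleton lphi.
rewrite -(near_eq_derive _ FE) Fsum derive_sum; last first.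
  by move=> j; apply/diff_derivable/dterm.
have -> : 'D_v (phi^~ (a x)) x = \sum_j a x 0 j * 'D_v (phi^~ (delta_mx 0 j)) x.
  have E : \forall y \near x, (\sum_j (a x 0 j *: (phi^~ (delta_mx 0 j) : _ -> R^o))) y = phi y (a x).
    by apply: filterS lphi => y ly; rewrite [RHS](scalar_sum _ ly) fct_sumE.
  rewrite -(near_eq_derive _ E) derive_sum; last first.
    by move=> j; apply/derivableZ/diff_derivable/dphi.
  by apply: eq_bigr => j _; rewrite deriveZ//; apply/diff_derivable/dphi.
rewrite (scalar_sum _ lx) -big_split /=; apply: eq_bigr => j _.
rewrite (@deriveM _ _ (fun y => a y 0 j : R^o) (phi^~ (delta_mx 0 j))).
- by rewrite derive_coordE//; congr (_ + _); rewrite [LHS]mulrC.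
- exact/diff_derivable/differentiable_coordE.
- exact/diff_derivable/dphi.
Qed.

End AppRule.

End Calculus.

(** * Symmetry of mixed second derivatives *)

Section Schwarz.
Context {R : realType}.
Implicit Types (m n : nat).

(** Restriction to an affine line turns a directional derivative into an ordinary one, to which the
    mean value theorem applies. *)
Lemma is_derive_line m (f : 'rV[R]_m -> R^o) (x u : 'rV[R]_m) (s : R) :
  differentiable f (x + s *: u) ->
  is_derive s (1 : R) (fun t : R => f (x + t *: u)) ('D_u f (x + s *: u)).
Proof.
move=> df; have := @diff_derivable _ _ _ f _ u df.
have E : (fun h : R => h^-1 *: ((f \o shift (x + s *: u)) (h *: u) - f (x + s *: u))) =
   (fun h : R => h^-1 *: (((fun t : R => f (x + t *: u)) \o shift s) (h *: (1 : R)) - f (x + s *: u))).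
  apply/funext => h /=; do 3 f_equal.
  by rewrite scalerDl addrCA -[h *: 1]/(h * 1) mulr1.
rewrite /derivable E => D; apply: DeriveDef; first exact: D.
by rewrite /derive E.
Qed.

(* Two applications of the mean value theorem to the increment of
   [f (x + s u + h v) - f (x + s u)] over [s] in [0, h]. *)
Lemma second_difference m (f : 'rV[R]_m -> R^o) (x u v : 'rV[R]_m) (h : R) :
  0 < h ->
  (forall s t, 0 <= s <= h -> 0 <= t <= h ->
     differentiable f (x + s *: u + t *: v) /\
     differentiable (fun y => 'D_u f y) (x + s *: u + t *: v)) ->
  exists s t, [/\ 0 <= s <= h, 0 <= t <= h &
    f (x + h *: u + h *: v) - f (x + h *: u) - f (x + h *: v) + f x
    = h * (h * 'D_v (fun y => 'D_u f y) (x + s *: u + t *: v))].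
Proof.
move=> h0 df; pose phi (s : R) := f ((x + h *: v) + s *: u) - f (x + s *: u).
have hh : 0 <= h <= h by rewrite ltW/=.
have h00 : 0 <= (0 : R) <= h by rewrite lexx ltW.
have dphi (s : R) : 0 <= s <= h -> is_derive s (1 : R) phi
    ('D_u f ((x + h *: v) + s *: u) - 'D_u f (x + s *: u)).
  move=> sh; apply: is_deriveB; apply: is_derive_line.
    by rewrite addrAC; exact: (df s h sh hh).1.
  by have := (df s 0 sh h00).1; rewrite scale0r addr0.
have oo s : s \in `]0, h[%R -> 0 <= s <= h.
  by rewrite in_itv /= => /andP[/ltW-> /ltW->].
have cphi : {within `[0, h], continuous phi}.
  apply: derivable_within_continuous => s; rewrite in_itv /= => sh.
  by have [] := dphi s sh.
have [s sh Es] := MVT_segment (ltW h0) (fun s sh => dphi s (oo s sh)) cphi.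
have {}sh : 0 <= s <= h by move: sh; rewrite in_itv.
pose psi (t : R) := 'D_u f (x + s *: u + t *: v).
have dpsi (t : R) : 0 <= t <= h -> is_derive t (1 : R) psi
    ('D_v (fun y => 'D_u f y) (x + s *: u + t *: v)).
  by move=> th; apply: (@is_derive_line _ (fun y => 'D_u f y)); exact: (df s t sh th).2.
have cpsi : {within `[0, h], continuous psi}.
  apply: derivable_within_continuous => t; rewrite in_itv /= => th.
  by have [] := dpsi t th.
have [t th Et] := MVT_segment (ltW h0) (fun t th => dpsi t (oo t th)) cpsi.
exists s, t; split=> //.
move: Es Et; rewrite /phi /psi !scale0r !addr0 !subr0 [x + h *: v + s *: u]addrAC => Es Et.
rewrite [x + h *: u + _]addrAC [h * (h * _)]mulrC [h * 'D_v _ _]mulrC -Et -Es.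
by rewrite opprB addrA; exact: addrAC.
Qed.

Lemma norm_triangle_half (a b d e : R) :
  `|a - d| < e / 2 -> `|b - d| < e / 2 -> `|a - b| <= e.
Proof.
rewrite !ltr_norml => /andP[? ?] /andP[? ?].
by rewrite ler_norml; apply/andP; split; lra.
Qed.

(** The same second difference, divided by $h^2$, is a value of each of the two mixed derivatives at
    points of a small parallelogram at x. By continuity these values are within e/2 of those at x,
    for any e. *)
Lemma derive_sym_R m (f : 'rV[R]_m -> R^o) (U : set 'rV[R]_m) x u v :
  open U -> U x -> smooth_on U f ->
  'D_u (fun y => 'D_v f y) x = 'D_v (fun y => 'D_u f y) x.
Proof.
move=> oU Ux sf; apply/eqP; rewrite -subr_eq0 -normr_le0.
apply/ler_addgt0Pr => e e0; rewrite add0r.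
pose A w1 w2 y := 'D_w1 (fun y => 'D_w2 f y) y.
have cA w1 w2 : {for x, continuous (A w1 w2)}.
  exact: (smooth_on_derive w1 (smooth_on_derive w2 sf) 0 x Ux).
have e2 : 0 < e / 2 by rewrite divr_gt0.
have near_e w1 w2 : \forall y \near x, `|A w1 w2 x - A w1 w2 y| < e / 2.
  exact: ((cvgrPdist_lt _ _).1 (cA w1 w2) _ e2).
have : \forall y \near x, [/\ U y, `|A u v x - A u v y| < e / 2 &
    `|A v u x - A v u y| < e / 2].
  have nU := open_nbhs_nbhs (conj oU Ux); have nuv := near_e u v; have nvu := near_e v u.
  by apply: filterS3 nU nuv nvu => y *; split.
move=> /nbhs_ballP[r /= r0 Br].
(* Adding 1 keeps c positive when u = v = 0. With h = r / c, all points x + s u + t v with s, t in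
   [0, h] lie in the ball of radius r. *)
pose c := `|u| + `|v| + 1.
have c0 : 0 < c by rewrite ltr_wpDl// addr_ge0.
pose h := r / c.
have h0 : 0 < h by rewrite divr_gt0.
have Bst s t : 0 <= s <= h -> 0 <= t <= h -> ball x r (x + s *: u + t *: v).
  move=> /andP[s0 sh] /andP[t0 th]; rewrite -ball_normE /ball_ /=.
  rewrite -addrA opprD addrA subrr add0r normrN.
  apply: le_lt_trans (ler_normD _ _) _; rewrite !normrZ !ger0_norm//.
  have -> : r = h * c by rewrite /h divfK// gt_eqF.
  rewrite /c mulrDr mulr1 mulrDr.
  have := ler_wpM2r (normr_ge0 u) sh; have := ler_wpM2r (normr_ge0 v) th; lra.
have hh : 0 <= h <= h by rewrite ltW/=.
have Usmooth y : U y -> differentiable f y by exact: smooth_on_diff sf.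
have Usmooth' w y : U y -> differentiable (fun y => 'D_w f y) y.
  exact: smooth_on_diff (smooth_on_derive w sf).
have [|s [t [sh th E1]]] := @second_difference _ f x u v h h0.
  by move=> s t sh th; have [Uy _ _] := Br _ (Bst _ _ sh th); split; [exact: Usmooth|exact: Usmooth'].
have [|t' [s' [th' sh' E2]]] := @second_difference _ f x v u h h0.
  move=> t' s' th' sh'; rewrite addrAC; have [Uy _ _] := Br _ (Bst _ _ sh' th').
  by split; [exact: Usmooth|exact: Usmooth'].
(* Exchanging u and v does not change the second difference, so both applications of the mean value
   theorem evaluate one number. *)
have EA : A v u (x + s *: u + t *: v) = A u v (x + s' *: u + t' *: v).
  have hn0 : h != 0 by rewrite gt_eqF.
  have hI (a b : R) : h * (h * a) = h * (h * b) -> a = b by move=> /(mulfI hn0)/(mulfI hn0).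
  rewrite [x + s' *: u + _]addrAC; apply: hI; apply: (etrans (esym E1)).
  apply: etrans E2; rewrite [x + h *: v + _]addrAC.
  by congr (_ + _); exact: addrAC.
have [_ _ l1] := Br _ (Bst _ _ sh th).
have [_ l2 _] := Br _ (Bst _ _ sh' th').
have l3 := norm_triangle_half l2 (eq_ind _ (fun z => `|A v u x - z| < e / 2) l1 _ EA).
exact: l3.
Qed.

Lemma derive_sym m n (f : 'rV[R]_m -> 'rV[R]_n) (U : set 'rV[R]_m) x u v :
  open U -> U x -> smooth_on U f ->
  'D_u (fun y => 'D_v f y) x = 'D_v (fun y => 'D_u f y) x.
Proof.
move=> oU Ux sf; apply/rowP => j.
have sfj : smooth_on U (fun y => f y 0 j : R^o) by move=> k; exact: Ck_on_coord.
have E w1 w2 : ('D_w1 (fun y => 'D_w2 f y) x) 0 j =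
    'D_w1 (fun y => 'D_w2 (fun y => f y 0 j : R^o) y) x.
  rewrite derive_coordE; last exact: smooth_on_diff (smooth_on_derive w2 sf) Ux.
  apply: near_eq_derive; apply: filterS (open_nbhs_nbhs (conj oU Ux)) => y Uy.
  by rewrite derive_coordE//; exact: smooth_on_diff Uy.
exact: etrans (E u v) (etrans (derive_sym_R u v oU Ux sfj) (esym (E v u))).
Qed.

End Schwarz.

(** * Manifolds *)

Section Charts.
Context {R : realType}.
Local Notation tangent M := 'rV[R]_(mdim M).
Implicit Types M N K : manifold_data R.

Lemma chart_codP M (p m : M) : chart_dom p m -> chart_cod p (chart p m).
Proof. by move=> pm; exists m. Qed.

Lemma chart_inv_dom M (hM : is_manifold M) (p : M) x :
  chart_cod p x -> chart_dom p (chart_inv p x).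
Proof. by move=> [q pq <-]; rewrite chartK. Qed.

Lemma chart_invK M (hM : is_manifold M) (p : M) x :
  chart_cod p x -> chart p (chart_inv p x) = x.
Proof. by move=> [q pq <-]; rewrite chartK. Qed.

Lemma chart_continuous_at M (hM : is_manifold M) (p m : M) :
  chart_dom p m -> {for m, continuous (chart p)}.
Proof.
move=> pm; have := chart_continuous hM (p := p).
by rewrite continuous_open_subspace; [apply; rewrite inE|exact: chart_dom_open].
Qed.

Lemma chart_inv_continuous_at M (hM : is_manifold M) (p : M) x :
  chart_cod p x -> {for x, continuous (chart_inv p)}.
Proof.
move=> px; have := chart_inv_continuous hM (p := p).
by rewrite continuous_open_subspace; [apply; rewrite inE|exact: chart_cod_open].
Qed.

Lemma near_chart_inv M (hM : is_manifold M) (p m : M) (A : set M) :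
  chart_dom p m -> nbhs m A -> \forall x \near chart p m, A (chart_inv p x).
Proof.
move=> pm mA.
have := chart_inv_continuous_at hM (chart_codP pm).
by move=> /(_ A); rewrite chartK//; apply.
Qed.

Lemma near_chart_cod M (hM : is_manifold M) (p m : M) :
  chart_dom p m -> \forall x \near chart p m, chart_cod p x.
Proof.
by move=> pm; apply: open_nbhs_nbhs; split;
  [exact: chart_cod_open|exact: chart_codP].
Qed.

Lemma open_chart_preim M (hM : is_manifold M) (p : M) (A : set M) :
  open A -> open (chart_cod p `&` chart_inv p @^-1` A).
Proof.
move=> oA; rewrite openE => x [px Ax].
have [m pm mx] := px; rewrite -mx in px Ax *; rewrite /= chartK// in Ax.
have n1 := near_chart_cod hM pm.
have nA : nbhs m A by exact: open_nbhs_nbhs.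
have n2 := near_chart_inv hM pm nA.
by apply: filterS2 n1 n2 => y ? ?; split.
Qed.

(** Charts and their inverses are total functions; the representative [rep f p q] is meaningful only
    on this part of the chart at p. *)
Definition rep_dom M N (f : M -> N) (p : M) (q : N) : set (tangent M) :=
  chart_cod p `&` chart_inv p @^-1` (f @^-1` chart_dom q).

Definition rep M N (f : M -> N) (p : M) (q : N) : tangent M -> tangent N :=
  chart q \o f \o chart_inv p.

Lemma rep_dom_open M N (hM : is_manifold M) (hN : is_manifold N) (f : M -> N)
  p q : continuous f -> open (rep_dom f p q).
Proof.
move=> cf; apply: open_chart_preim => //; apply: open_comp.
  by move=> x _; exact: cf.
exact: chart_dom_open.
Qed.

Lemma rep_domP M N (hM : is_manifold M) (f : M -> N) p q m :
  chart_dom p m -> chart_dom q (f m) -> rep_dom f p q (chart p m).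
Proof. by move=> pm qm; split; [exact: chart_codP|rewrite /= chartK]. Qed.

Lemma rep_smooth M N (f : M -> N) p q : is_smooth f ->
  smooth_on (rep_dom f p q) (rep f p q).
Proof. by case=> _; exact. Qed.

Lemma rep_diff M N (hM : is_manifold M) (f : M -> N) p q m : is_smooth f ->
  chart_dom p m -> chart_dom q (f m) ->
  differentiable (rep f p q) (chart p m).
Proof.
by move=> sf pm qm; apply: smooth_on_diff (rep_smooth p q sf) _; exact: rep_domP.
Qed.

(* [tmap f m] is the case [p = m], [q = f m]. *)
Definition drep M N (f : M -> N) (p : M) (q : N) (m : M) (u : tangent M) :
    tangent N := 'D_u (rep f p q) (chart p m).

Lemma drep_linear M N (hM : is_manifold M) (f : M -> N) p q m : is_smooth f ->
  chart_dom p m -> chart_dom q (f m) -> linear (drep f p q m).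
Proof. by move=> sf pm qm; apply: derive_linE; exact: rep_diff. Qed.

(** The chain rule is needed for charts that are not centred at the points: coefficients of forms
    and fields are functions on one fixed chart, while [tmap] changes its chart with the base point.
    Near the point, the chart at q cancels against its inverse. *)
Lemma drep_comp M N K (hM : is_manifold M) (hN : is_manifold N)
    (f : M -> N) (g : N -> K) p q r m u :
  is_smooth f -> is_smooth g ->
  chart_dom p m -> chart_dom q (f m) -> chart_dom r (g (f m)) ->
  drep (g \o f) p r m u = drep g q r (f m) (drep f p q m u).
Proof.
move=> sf sg pm qm rm; rewrite /drep.
have fE : rep f p q (chart p m) = chart q (f m) by rewrite /rep /= chartK.
rewrite -fE -derive_comp; [|exact: rep_diff|by rewrite fE; exact: rep_diff].
apply: near_eq_derive.
have nfm : nbhs m (f @^-1` chart_dom q).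
  by apply: (sf.1 m); apply: open_nbhs_nbhs; split => //; exact: chart_dom_open.
apply: filterS (near_chart_inv hM pm nfm) => x /= qx.
by rewrite /rep /= chartK.
Qed.

Lemma drep_id M (hM : is_manifold M) (p m : M) u :
  chart_dom p m -> drep id p p m u = u.
Proof.
move=> pm; have lid : linear (@id (tangent M)) by move=> a w v.
apply: etrans (derive_lin (chart p m) u lid).
apply: near_eq_derive; apply: filterS (near_chart_cod hM pm) => x px.
by rewrite /rep /= chart_invK.
Qed.

Lemma is_smooth_id M (hM : is_manifold M) : is_smooth (@id M).
Proof. by split=> [x|p q]; [exact: id|exact: chart_transition_smooth]. Qed.

(** Smoothness quantifies over the charts of source and target, but the middle chart is free: near
    each point it is taken to be the one centred at the image of that point under f. *)
Lemma is_smooth_comp M N K (hM : is_manifold M) (hN : is_manifold N)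
  (hK : is_manifold K)
  (f : M -> N) (g : N -> K) : is_smooth f -> is_smooth g -> is_smooth (g \o f).
Proof.
move=> sf sg.
have cgf : continuous (g \o f).
  by move=> x; apply: continuous_comp; [exact: sf.1|exact: sg.1].
split=> // p r; apply: smooth_on_local => x gfx.
have [px rx] := gfx; pose q := f (chart_inv p x).
pose V := rep_dom f p q `&` rep_dom (g \o f) p r.
have oV : open V by apply: openI; apply: rep_dom_open => //; exact: sf.1.
exists V; split; first by split=> //; split=> //=; exact: chart_dom_center.
apply: (@smooth_on_ext _ _ _ _ (rep g q r \o rep f p q)) => //.
  by move=> y [[py qy] _]; rewrite /rep /= chartK.
apply: (@smooth_on_comp _ _ _ _ _ (rep_dom g q r)) => //.
- by apply: rep_dom_open => //; exact: sg.1.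
- by apply: smooth_on_sub (rep_smooth p q sf) => y [].
- exact: rep_smooth.
- move=> y [[py qy] [_ ry]]; split; first exact: chart_codP.
  by rewrite /rep /= chartK.
Qed.

Lemma is_smooth_cst M N (hN : is_manifold N) (c : N) : is_smooth (fun _ : M => c).
Proof.
split=> [x|p q]; first exact: cst_continuous.
by move=> k; exact: Ck_on_cst.
Qed.

Lemma tmap_comp M N K (hM : is_manifold M) (hN : is_manifold N)
    (hK : is_manifold K) (f : M -> N) (g : N -> K) p u :
  is_smooth f -> is_smooth g ->
  tmap (g \o f) p u = tmap g (f p) (tmap f p u).
Proof. by move=> sf sg; apply: drep_comp => //; exact: chart_dom_center. Qed.

Lemma tmap_id M (hM : is_manifold M) (p : M) u : tmap id p u = u.
Proof. by apply: drep_id => //; exact: chart_dom_center. Qed.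

Lemma tmap_cst M N (c : N) (p : M) u : tmap (fun _ => c) p u = 0.
Proof. exact: derive_cst. Qed.

Lemma tmap_linear M N (hM : is_manifold M) (hN : is_manifold N)
  (f : M -> N) p : is_smooth f -> linear (tmap f p).
Proof. by move=> sf; apply: drep_linear => //; exact: chart_dom_center. Qed.

End Charts.

(** * Products of manifolds *)

Section ProductManifold.
Context {R : realType}.
Local Notation tangent M := 'rV[R]_(mdim M).
Implicit Types M N K : manifold_data R.

Lemma lsubmx_linear (m n : nat) : linear (@lsubmx R 1 m n).
Proof. by move=> a u v; rewrite linearP. Qed.

Lemma rsubmx_linear (m n : nat) : linear (@rsubmx R 1 m n).
Proof. by move=> a u v; rewrite linearP. Qed.

Lemma smooth_on_lin (W : normedModType R) m (U : set 'rV[R]_m) (phi : 'rV[R]_m -> W) :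
  linear phi -> smooth_on U phi.
Proof. by move=> lphi k; exact: Ck_on_lin. Qed.

Lemma row_mx_sum_linear (m n : nat) (x : 'rV[R]_m) (y : 'rV[R]_n) :
  row_mx x y = row_mx x 0 + row_mx 0 y.
Proof. by rewrite add_row_mx addr0 add0r. Qed.

Lemma row_mx_linear1 (m n : nat) : linear (fun x : 'rV[R]_m => row_mx x (0 : 'rV[R]_n)).
Proof. by move=> a u v; rewrite scale_row_mx add_row_mx scaler0 addr0. Qed.

Lemma row_mx_linear2 (m n : nat) : linear (fun y : 'rV[R]_n => row_mx (0 : 'rV[R]_m) y).
Proof. by move=> a u v; rewrite scale_row_mx add_row_mx scaler0 addr0. Qed.

Lemma smooth_on_row_mx k m n (U : set 'rV[R]_k) (f : 'rV[R]_k -> 'rV[R]_m)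
    (g : 'rV[R]_k -> 'rV[R]_n) : open U -> smooth_on U f -> smooth_on U g ->
  smooth_on U (fun x => row_mx (f x) (g x)).
Proof.
move=> oU sf sg.
have s1 : smooth_on U (fun x => row_mx (f x) (0 : 'rV[R]_n)).
  apply: (@smooth_on_comp _ _ _ _ _ setT f (fun x => row_mx x 0)) => //.
    exact: openT.
  apply: smooth_on_lin; exact: row_mx_linear1.
have s2 : smooth_on U (fun x => row_mx (0 : 'rV[R]_m) (g x)).
  apply: (@smooth_on_comp _ _ _ _ _ setT g (fun x => row_mx 0 x)) => //.
    exact: openT.
  apply: smooth_on_lin; exact: row_mx_linear2.
move=> j; apply: Ck_on_ext (Ck_onD oU (s1 j) (s2 j)) => // x _.
by rewrite -row_mx_sum_linear.
Qed.

Lemma derive_row_mx k m n (f : 'rV[R]_k -> 'rV[R]_m)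
    (g : 'rV[R]_k -> 'rV[R]_n) x v : differentiable f x -> differentiable g x ->
  'D_v (fun x => row_mx (f x) (g x)) x = row_mx ('D_v f x) ('D_v g x).
Proof.
move=> df dg.
have d1 := @differentiable_lin _ _ _ _ (f x) (@row_mx_linear1 m n).
have d2 := @differentiable_lin _ _ _ _ (g x) (@row_mx_linear2 m n).
have -> : (fun x => row_mx (f x) (g x)) =
    ((fun x => row_mx x 0) \o f) + ((fun y => row_mx 0 y) \o g).
  by apply/funext => y; exact: row_mx_sum_linear.
have D1 := derive_comp v df d1; have D2 := derive_comp v dg d2.
rewrite (derive_lin _ _ (@row_mx_linear1 m n)) in D1.
rewrite (derive_lin _ _ (@row_mx_linear2 m n)) in D2.
rewrite deriveD ?D1 ?D2 -?row_mx_sum_linear//.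
- by apply: diff_derivable; apply: differentiable_comp.
- by apply: diff_derivable; apply: differentiable_comp.
Qed.

Lemma prod_hausdorff (S T : topologicalType) :
  hausdorff_space S -> hausdorff_space T -> hausdorff_space (S * T)%type.
Proof.
move=> hS hT [x1 x2] [y1 y2] cxy; congr pair.
- apply: hS => A B nA nB.
  have [[z1 z2] [/= [Az _] [Bz _]]] := cxy (A `*` setT) (B `*` setT)
    ltac:(by exists (A, setT) => //; split; [exact: nA|exact: filterT])
    ltac:(by exists (B, setT) => //; split; [exact: nB|exact: filterT]).
  by exists z1.
- apply: hT => A B nA nB.
  have [[z1 z2] [/= [_ Az] [_ Bz]]] := cxy (setT `*` A) (setT `*` B)
    ltac:(by exists (setT, A) => //; split; [exact: filterT|exact: nA])
    ltac:(by exists (setT, B) => //; split; [exact: filterT|exact: nB]).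
  by exists z2.
Qed.

Lemma open_setX (S T : topologicalType) (A : set S) (B : set T) :
  open A -> open B -> open (A `*` B).
Proof.
move=> oA oB; rewrite openE => -[x y] [/= Ax By].
by exists (A, B) => //; split; apply: open_nbhs_nbhs; split.
Qed.

Lemma prod_second_countable (S T : topologicalType) :
  @second_countable S -> @second_countable T -> @second_countable (S * T)%type.
Proof.
move=> [B1 c1 [B1o b1]] [B2 c2 [B2o b2]].
exists [set U.1 `*` U.2 | U in B1 `*` B2].
  apply: sub_countable (card_image_le _ _) _; exact: countableX.
split.
  by move=> W [UV [BU BV] <-]; apply: open_setX; [exact: B1o|exact: B2o].
move=> [x y] A [UV [nU nV] UVA]; case: UV nU nV UVA => U V /= nU nV UVA.
have [U' [BU' U'x] U'U] := b1 x U nU.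
have [V' [BV' V'y] V'V] := b2 y V nV.
exists (U' `*` V'); first by split=> //; exists (U', V').
by move=> [z1 z2] [/= /U'U ? /V'V ?]; apply: UVA.
Qed.

End ProductManifold.

Section ProductManifold.
Context {R : realType}.
Local Notation tangent M := 'rV[R]_(mdim M).
Local Notation "M ** N" := (prod_manifold M N) (at level 40).
Implicit Types M N K : manifold_data R.

Lemma continuous_row_mx (T : topologicalType) m n (f : T -> 'rV[R]_m)
    (g : T -> 'rV[R]_n) x : {for x, continuous f} -> {for x, continuous g} ->
  {for x, continuous (fun y => row_mx (f y) (g y))}.
Proof.
move=> cf cg.
have -> : (fun y => row_mx (f y) (g y)) =
    ((fun v => row_mx v (0 : 'rV[R]_n)) \o f) + ((fun w => row_mx (0 : 'rV[R]_m) w) \o g).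
  by apply/funext => y; exact: row_mx_sum_linear.
apply: continuousD; apply: continuous_comp => //.
  by apply/differentiable_continuous/differentiable_lin; exact: row_mx_linear1.
by apply/differentiable_continuous/differentiable_lin; exact: row_mx_linear2.
Qed.

Lemma lsubmx_continuous m n : continuous (@lsubmx R 1 m n).
Proof.
by move=> x; apply/differentiable_continuous/differentiable_lin; exact: lsubmx_linear.
Qed.

Lemma rsubmx_continuous m n : continuous (@rsubmx R 1 m n).
Proof.
by move=> x; apply/differentiable_continuous/differentiable_lin; exact: rsubmx_linear.
Qed.

Lemma prod_chart_cod M N (p : M ** N) (x : tangent (M ** N)) :
  chart_cod p x <-> chart_cod p.1 (lsubmx x) /\ chart_cod p.2 (rsubmx x).
Proof.
split=> [[q [q1 q2] <-]|[[q1 pq1 E1] [q2 pq2 E2]]].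
  by rewrite /= row_mxKl row_mxKr; split; [exists q.1|exists q.2].
by exists (q1, q2) => //=; rewrite E1 E2 hsubmxK.
Qed.

Section PairContinuity.
Variables S T U : topologicalType.

Lemma continuous_pair_at (f : S -> T) (g : S -> U) x :
  {for x, continuous f} -> {for x, continuous g} ->
  {for x, continuous (fun y => (f y, g y))}.
Proof. by move=> cf cg; apply: cvg_pair. Qed.

Lemma fst_continuous : continuous (@fst T U).
Proof. by move=> x; exact: cvg_fst. Qed.

Lemma snd_continuous : continuous (@snd T U).
Proof. by move=> x; exact: cvg_snd. Qed.

End PairContinuity.

Lemma open_prod_chart_cod M N (hM : is_manifold M) (hN : is_manifold N)
  (p : M ** N) : open (chart_cod p).
Proof.
have -> : chart_cod p = (lsubmx @^-1` chart_cod p.1) `&` (rsubmx @^-1` chart_cod p.2).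
  by apply/seteqP; split=> x /prod_chart_cod.
apply: openI; apply: open_comp; try exact: chart_cod_open.
  by move=> x _; exact: lsubmx_continuous.
by move=> x _; exact: rsubmx_continuous.
Qed.

(** Transition maps of the product are pairs of transition maps of the factors, precomposed with the
    linear projections onto the two blocks of a row. *)
Lemma prod_is_manifold M N (hM : is_manifold M) (hN : is_manifold N) :
  is_manifold (M ** N).
Proof.
have cinv (p : M ** N) (x : tangent (M ** N)) : chart_cod p x ->
    {for x, continuous (@chart_inv _ (M ** N) p)}.
  move=> /prod_chart_cod[x1 x2]; apply: continuous_pair_at.
    apply: continuous_comp; first exact: lsubmx_continuous.
    exact: chart_inv_continuous_at.
  apply: continuous_comp; first exact: rsubmx_continuous.
  exact: chart_inv_continuous_at.
have oc := open_prod_chart_cod hM hN.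
have od (p : M ** N) : open (@chart_dom _ (M ** N) p).
  by apply: open_setX; exact: chart_dom_open.
split.
- by apply: prod_hausdorff; exact: manifold_hausdorff.
- by apply: prod_second_countable; exact: manifold_second_countable.
- exact: od.
- by move=> p; split; exact: chart_dom_center.
- exact: oc.
- by move=> p q [q1 q2]; rewrite /= row_mxKl row_mxKr !chartK//; case: q {q1 q2}.
- move=> p; rewrite continuous_open_subspace// => q; rewrite inE => -[q1 q2].
  apply: (@continuous_row_mx (M * N)%type _ _ (chart p.1 \o fst) (chart p.2 \o snd)).
    by apply: continuous_comp; [exact: fst_continuous|exact: chart_continuous_at].
  by apply: continuous_comp; [exact: snd_continuous|exact: chart_continuous_at].
- by move=> p; rewrite continuous_open_subspace// => x; rewrite inE; exact: cinv.
- move=> p q; set U := (X in smooth_on X _).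
  have oU : open U.
    rewrite openE => x [px qx]; apply: filterI.
      by apply: open_nbhs_nbhs; split.
    apply: (cinv p x px); apply: open_nbhs_nbhs; split => //.
  apply: smooth_on_row_mx => //.
  + apply: (@smooth_on_comp _ _ _ _ _ (rep_dom id p.1 q.1) _ (rep id p.1 q.1)) => //.
    * by apply: rep_dom_open => //; move=> y; exact: id.
    * exact/smooth_on_lin/lsubmx_linear.
    * by apply: rep_smooth; exact: is_smooth_id.
    * by move=> x [/prod_chart_cod[? ?] [? ?]]; split.
  + apply: (@smooth_on_comp _ _ _ _ _ (rep_dom id p.2 q.2) _ (rep id p.2 q.2)) => //.
    * by apply: rep_dom_open => //; move=> y; exact: id.
    * exact/smooth_on_lin/rsubmx_linear.
    * by apply: rep_smooth; exact: is_smooth_id.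
    * by move=> x [/prod_chart_cod[? ?] [? ?]]; split.
Qed.

Lemma is_smooth_fst M N (hM : is_manifold M) (hN : is_manifold N) :
  @is_smooth R (M ** N) M fst.
Proof.
split=> [|p q]; first exact: fst_continuous.
have hP := prod_is_manifold hM hN.
apply: (@smooth_on_comp _ _ _ _ _ (rep_dom id p.1 q) _ (rep id p.1 q)) => //.
- by apply: (@rep_dom_open _ (M ** N) M hP hM fst); exact: fst_continuous.
- by apply: rep_dom_open => //; move=> y; exact: id.
- exact/smooth_on_lin/lsubmx_linear.
- by apply: rep_smooth; exact: is_smooth_id.
- by move=> x [/prod_chart_cod[? ?] ?]; split.
Qed.

Lemma is_smooth_snd M N (hM : is_manifold M) (hN : is_manifold N) :
  @is_smooth R (M ** N) N snd.
Proof.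
split=> [|p q]; first exact: snd_continuous.
have hP := prod_is_manifold hM hN.
apply: (@smooth_on_comp _ _ _ _ _ (rep_dom id p.2 q) _ (rep id p.2 q)) => //.
- by apply: (@rep_dom_open _ (M ** N) N hP hN snd); exact: snd_continuous.
- by apply: rep_dom_open => //; move=> y; exact: id.
- exact/smooth_on_lin/rsubmx_linear.
- by apply: rep_smooth; exact: is_smooth_id.
- by move=> x [/prod_chart_cod[? ?] ?]; split.
Qed.

Lemma is_smooth_pair K M N (hK : is_manifold K) (hM : is_manifold M)
    (hN : is_manifold N) (f : K -> M) (g : K -> N) :
  is_smooth f -> is_smooth g ->
  @is_smooth R K (M ** N) (fun x => (f x, g x)).
Proof.
move=> sf sg.
have cfg : continuous (fun x => (f x, g x)).
  by move=> x; apply: continuous_pair_at; [exact: sf.1|exact: sg.1].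
split=> // p q.
have oU := @rep_dom_open _ K (M ** N) hK (prod_is_manifold hM hN) _ p q cfg.
apply: smooth_on_row_mx => //.
  by apply: smooth_on_sub (rep_smooth p q.1 sf) => x [? []].
by apply: smooth_on_sub (rep_smooth p q.2 sg) => x [? []].
Qed.

(** In product charts the projection coincides near the base point with the linear map [lsubmx],
    which is its own derivative. *)
Lemma tmap_fst M N (hM : is_manifold M) (hN : is_manifold N) (p : M ** N) u :
  @tmap R (M ** N) M fst p u = lsubmx u.
Proof.
apply: etrans (derive_lin (@chart _ (M ** N) p p) u (@lsubmx_linear _ _ _)).
apply: near_eq_derive.
have pp : @chart_dom _ (M ** N) p p by apply: (chart_dom_center (prod_is_manifold hM hN)).
apply: filterS (near_chart_cod (prod_is_manifold hM hN) pp) => x /prod_chart_cod[px _].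
exact: chart_invK.
Qed.

Lemma tmap_snd M N (hM : is_manifold M) (hN : is_manifold N) (p : M ** N) u :
  @tmap R (M ** N) N snd p u = rsubmx u.
Proof.
apply: etrans (derive_lin (@chart _ (M ** N) p p) u (@rsubmx_linear _ _ _)).
apply: near_eq_derive.
have pp : @chart_dom _ (M ** N) p p by apply: (chart_dom_center (prod_is_manifold hM hN)).
apply: filterS (near_chart_cod (prod_is_manifold hM hN) pp) => x /prod_chart_cod[_ px].
exact: chart_invK.
Qed.

Lemma tmap_pair K M N (hK : is_manifold K) (hM : is_manifold M)
    (hN : is_manifold N) (f : K -> M) (g : K -> N) (p : K) u :
  is_smooth f -> is_smooth g ->
  @tmap R K (M ** N) (fun x => (f x, g x)) p u = row_mx (tmap f p u) (tmap g p u).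
Proof.
by move=> sf sg; apply: derive_row_mx; apply: rep_diff => //; exact: chart_dom_center.
Qed.

End ProductManifold.

(** * Differential forms *)

Section AppRules.
Context {R : realType}.

(** Reduces to the scalar rule coordinate by coordinate. It serves for a Maurer-Cartan form
    evaluated on an invariant field, and for the differential of a morphism evaluated on a
    right-invariant field. *)
Lemma derive_app m n k (phi : 'rV[R]_m -> 'rV[R]_n -> 'rV[R]_k)
    (a : 'rV[R]_m -> 'rV[R]_n) x v :
  (\forall y \near x, linear (phi y)) ->
  (forall u, differentiable (phi^~ u) x) -> differentiable a x ->
  'D_v (fun y => phi y (a y)) x = 'D_v (phi^~ (a x)) x + phi x ('D_v a x).
Proof.
move=> lphi dphi da; apply/rowP => j.
have lj : \forall y \near x, linear (fun u => phi y u 0 j : R^o).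
  by apply: filterS lphi => y ly c u w; rewrite ly !mxE.
have dj u : differentiable (fun y => phi y u 0 j : R^o) x.
  exact: differentiable_coordE (dphi u).
have df : differentiable (fun y => phi y (a y)) x.
  apply: differentiable_rV => i; apply: (differentiable_appR (phi := fun y u => phi y u 0 i : R^o)) => //.
    by apply: filterS lphi => y ly c u w; rewrite ly !mxE.
  by move=> u; exact: differentiable_coordE (dphi u).
apply: (etrans (derive_coordE v j df)).
apply: (etrans (derive_appR (phi := fun y u => phi y u 0 j : R^o) lj dj da v)).
by rewrite [RHS]mxE; congr (_ + _); exact/esym/(derive_coordE v j (dphi (a x))).
Qed.

(** The scalar rule is applied to the second slot, with the first already substituted, and then to
    the first slot with the second frozen at its value at x. *)
Lemma derive_appR2 m n1 n2 (phi : 'rV[R]_m -> 'rV[R]_n1 -> 'rV[R]_n2 -> R^o)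
    (a : 'rV[R]_m -> 'rV[R]_n1) (b : 'rV[R]_m -> 'rV[R]_n2) x :
  (\forall y \near x, forall u, linear (phi y u)) ->
  (\forall y \near x, forall u, linear (phi y ^~ u)) ->
  (forall u1 u2, differentiable (fun y => phi y u1 u2) x) ->
  differentiable a x -> differentiable b x ->
  differentiable (fun y => phi y (a y) (b y)) x /\
  (forall v, 'D_v (fun y => phi y (a y) (b y)) x =
     'D_v (fun y => phi y (a x) (b x)) x + phi x ('D_v a x) (b x)
     + phi x (a x) ('D_v b x)).
Proof.
move=> l2 l1 dphi da db.
have dp1 u2 : differentiable (fun y => phi y (a y) u2) x.
  apply: (differentiable_appR (phi := fun y u => phi y u u2)) => //.
  by apply: filterS l1.
have l2' : \forall y \near x, linear (phi y (a y)) by apply: filterS l2 => y.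
split; first exact: (differentiable_appR (phi := fun y u => phi y (a y) u)).
move=> v.
apply: (etrans (derive_appR (phi := fun y u => phi y (a y) u) l2' dp1 db v)).
congr (_ + _).
apply: (derive_appR (phi := fun y u => phi y u (b x))) => //.
by apply: filterS l1.
Qed.

Lemma derive_appR3 m n1 n2 n3
    (phi : 'rV[R]_m -> 'rV[R]_n1 -> 'rV[R]_n2 -> 'rV[R]_n3 -> R^o)
    (a : 'rV[R]_m -> 'rV[R]_n1) (b : 'rV[R]_m -> 'rV[R]_n2)
    (c : 'rV[R]_m -> 'rV[R]_n3) x :
  (\forall y \near x, forall u1 u2, linear (fun u => phi y u u1 u2)) ->
  (\forall y \near x, forall u1 u2, linear (fun u => phi y u1 u u2)) ->
  (\forall y \near x, forall u1 u2, linear (fun u => phi y u1 u2 u)) ->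
  (forall u1 u2 u3, differentiable (fun y => phi y u1 u2 u3) x) ->
  differentiable a x -> differentiable b x -> differentiable c x ->
  forall v, 'D_v (fun y => phi y (a y) (b y) (c y)) x =
     'D_v (fun y => phi y (a x) (b x) (c x)) x + phi x ('D_v a x) (b x) (c x)
     + phi x (a x) ('D_v b x) (c x) + phi x (a x) (b x) ('D_v c x).
Proof.
move=> l1 l2 l3 dphi da db dc v.
have H u3 := derive_appR2 (phi := fun y u1 u2 => phi y u1 u2 u3) (a := a) (b := b) (x := x).
have l3' : \forall y \near x, linear (phi y (a y) (b y)).
  by apply: filterS l3 => y.
have dp u3 : differentiable (fun y => phi y (a y) (b y) u3) x.
  by case: (H u3) => //; [apply: filterS l2|apply: filterS l1].
apply: (etrans (derive_appR (phi := fun y u => phi y (a y) (b y) u) l3' dp dc v)).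
congr (_ + _).
by case: (H (c x)) => //; [apply: filterS l2|apply: filterS l1].
Qed.

Lemma smooth_on_appR2 m n1 n2 (U : set 'rV[R]_m)
    (phi : 'rV[R]_m -> 'rV[R]_n1 -> 'rV[R]_n2 -> R^o)
    (a : 'rV[R]_m -> 'rV[R]_n1) (b : 'rV[R]_m -> 'rV[R]_n2) : open U ->
  (forall x u, U x -> linear (phi x u)) ->
  (forall x u, U x -> linear (phi x ^~ u)) ->
  (forall u1 u2, smooth_on U (fun y => phi y u1 u2)) ->
  smooth_on U a -> smooth_on U b -> smooth_on U (fun x => phi x (a x) (b x)).
Proof.
move=> oU l2 l1 sphi sa sb.
apply: (smooth_on_appR (phi := fun y u => phi y (a y) u)) => //.
  by move=> x /l2.
move=> u2; apply: (smooth_on_appR (phi := fun y u => phi y u u2)) => //.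
by move=> x Ux; exact: (l1 x u2 Ux).
Qed.

Lemma smooth_on_appR3 m n1 n2 n3 (U : set 'rV[R]_m)
    (phi : 'rV[R]_m -> 'rV[R]_n1 -> 'rV[R]_n2 -> 'rV[R]_n3 -> R^o)
    (a : 'rV[R]_m -> 'rV[R]_n1) (b : 'rV[R]_m -> 'rV[R]_n2)
    (c : 'rV[R]_m -> 'rV[R]_n3) : open U ->
  (forall x u1 u2, U x -> linear (fun u => phi x u u1 u2)) ->
  (forall x u1 u2, U x -> linear (fun u => phi x u1 u u2)) ->
  (forall x u1 u2, U x -> linear (fun u => phi x u1 u2 u)) ->
  (forall u1 u2 u3, smooth_on U (fun y => phi y u1 u2 u3)) ->
  smooth_on U a -> smooth_on U b -> smooth_on U c ->
  smooth_on U (fun x => phi x (a x) (b x) (c x)).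
Proof.
move=> oU l1 l2 l3 sphi sa sb sc.
apply: (smooth_on_appR (phi := fun y u => phi y (a y) (b y) u)) => //.
  by move=> x Ux; exact: (l3 x _ _ Ux).
move=> u3; apply: (smooth_on_appR2 (phi := fun y u1 u2 => phi y u1 u2 u3)) => //.
- by move=> x u Ux; exact: (l2 x _ _ Ux).
- by move=> x u Ux; exact: (l1 x _ _ Ux).
Qed.

End AppRules.

(** * Pullbacks of forms in coordinates *)

Section FormPullback.
Context {R : realType}.
Local Notation tangent M := 'rV[R]_(mdim M).
Local Notation "M ** N" := (prod_manifold M N) (at level 40).
Implicit Types M N K : manifold_data R.

(** Both sides arise from the chain rule through the charts at p and q, applied to f precomposed and
    postcomposed with the identity. Changes of coordinates are representatives of the identity. *)
Lemma tmap_from_chart M N (hM : is_manifold M) (hN : is_manifold N)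
    (f : M -> N) (p : M) (q : N) x u : is_smooth f -> rep_dom f p q x ->
  tmap f (chart_inv p x) (from_chart p (chart_inv p x) u)
  = from_chart q (f (chart_inv p x)) ('D_u (rep f p q) x).
Proof.
move=> sf [px qx]; set m := chart_inv p x.
have pm : chart_dom p m by exact: chart_inv_dom.
have mm := chart_dom_center hM m; have fmm := chart_dom_center hN (f m).
have -> : 'D_u (rep f p q) x = drep f p q m u by rewrite /drep /m chart_invK.
rewrite -[LHS]/(drep f m (f m) m (drep id p m m u)).
rewrite -[RHS]/(drep id q (f m) (f m) (drep f p q m u)).
have si := is_smooth_id hM; have si' := is_smooth_id hN.
by rewrite -(drep_comp hM hM u si sf pm mm fmm) -(drep_comp hM hN u sf si' pm qx fmm).
Qed.

Lemma from_chart_linear M (hM : is_manifold M) (p m : M) :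
  chart_dom p m -> linear (from_chart p m).
Proof.
move=> pm; apply: (drep_linear hM (is_smooth_id hM) pm).
exact: chart_dom_center.
Qed.

Lemma from_chart_id M (hM : is_manifold M) (p : M) u : from_chart p p u = u.
Proof. by apply: (drep_id hM u); exact: chart_dom_center. Qed.

Lemma rep_inv M N (hN : is_manifold N) (f : M -> N) p q x : rep_dom f p q x ->
  chart_inv q (rep f p q x) = f (chart_inv p x).
Proof. by move=> [_ qx]; rewrite /rep /= chartK. Qed.

Lemma rep_cod M N (f : M -> N) p q x : rep_dom f p q x ->
  chart_cod q (rep f p q x).
Proof. by move=> [_ qx]; exact: chart_codP. Qed.

(** Separates the two sources of variation: the coefficients of w are taken at the moved point, and
    the arguments are derivatives of the representative of f. In this form the product rule
    applies. *)
Lemma form2_in_chart_pullback M N (hM : is_manifold M) (hN : is_manifold N)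
    (f : M -> N) (w : form2 N) (p : M) (q : N) u1 u2 x :
  is_smooth f -> rep_dom f p q x ->
  form2_in_chart (pullback2 f w) p u1 u2 x =
  form2_in_chart w q ('D_u1 (rep f p q) x) ('D_u2 (rep f p q) x) (rep f p q x).
Proof.
move=> sf qx; rewrite /form2_in_chart /pullback2 (rep_inv hN qx).
by congr (w _ _ _); exact: tmap_from_chart.
Qed.

Lemma form3_in_chart_pullback M N (hM : is_manifold M) (hN : is_manifold N)
    (f : M -> N) (w : form3 N) (p : M) (q : N) u1 u2 u3 x :
  is_smooth f -> rep_dom f p q x ->
  form3_in_chart (pullback3 f w) p u1 u2 u3 x =
  form3_in_chart w q ('D_u1 (rep f p q) x) ('D_u2 (rep f p q) x)
    ('D_u3 (rep f p q) x) (rep f p q x).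
Proof.
move=> sf qx; rewrite /form3_in_chart /pullback3 (rep_inv hN qx).
by congr (w _ _ _ _); exact: tmap_from_chart.
Qed.

Section FormInChart.
Variables (M : manifold_data R) (hM : is_manifold M).

Lemma form2_in_chart_linear1 (w : form2 M) (hw : is_form2 w) (p : M) x u2 :
  chart_cod p x -> linear (fun u => form2_in_chart w p u u2 x).
Proof.
move=> px a u v; rewrite /form2_in_chart.
rewrite (from_chart_linear hM (chart_inv_dom hM px)).
exact: (form2_linear1 hw).
Qed.

Lemma form2_in_chart_linear2 (w : form2 M) (hw : is_form2 w) (p : M) x u1 :
  chart_cod p x -> linear (fun u => form2_in_chart w p u1 u x).
Proof.
move=> px a u v; rewrite /form2_in_chart.
rewrite (from_chart_linear hM (chart_inv_dom hM px)).
exact: (form2_linear2 hw).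
Qed.

Lemma form3_in_chart_linear1 (w : form3 M) (hw : is_form3 w) (p : M) x u2 u3 :
  chart_cod p x -> linear (fun u => form3_in_chart w p u u2 u3 x).
Proof.
move=> px a u v; rewrite /form3_in_chart.
rewrite (from_chart_linear hM (chart_inv_dom hM px)).
exact: (form3_linear1 hw).
Qed.

Lemma form3_in_chart_linear2 (w : form3 M) (hw : is_form3 w) (p : M) x u1 u3 :
  chart_cod p x -> linear (fun u => form3_in_chart w p u1 u u3 x).
Proof.
move=> px a u v; rewrite /form3_in_chart.
rewrite (from_chart_linear hM (chart_inv_dom hM px)).
exact: (form3_linear2 hw).
Qed.

Lemma form3_in_chart_linear3 (w : form3 M) (hw : is_form3 w) (p : M) x u1 u2 :
  chart_cod p x -> linear (fun u => form3_in_chart w p u1 u2 u x).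
Proof.
move=> px a u v; rewrite /form3_in_chart.
rewrite (from_chart_linear hM (chart_inv_dom hM px)).
exact: (form3_linear3 hw).
Qed.

Lemma form2_in_chart_diff (w : form2 M) (hw : is_form2 w) (p : M) u1 u2 x :
  chart_cod p x -> differentiable (form2_in_chart w p u1 u2) x.
Proof. exact: smooth_on_diff (form2_smooth hw p u1 u2). Qed.

Lemma form3_in_chart_diff (w : form3 M) (hw : is_form3 w) (p : M) u1 u2 u3 x :
  chart_cod p x -> differentiable (form3_in_chart w p u1 u2 u3) x.
Proof. exact: smooth_on_diff (form3_smooth hw p u1 u2 u3). Qed.

Lemma scalarD (n : nat) (phi : 'rV[R]_n -> R) u v :
  scalar phi -> phi (u + v) = phi u + phi v.
Proof. by move=> l; have := l 1 u v; rewrite scale1r mul1r. Qed.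

Lemma scalar0 (n : nat) (phi : 'rV[R]_n -> R) : scalar phi -> phi 0 = 0.
Proof.
move=> l; have := scalarD 0 0 l; rewrite addr0 => /eqP.
by rewrite -subr_eq0 opprD addrA subrr sub0r oppr_eq0 => /eqP.
Qed.

Lemma scalar_scale (n : nat) (phi : 'rV[R]_n -> R) a u :
  scalar phi -> phi (a *: u) = a * phi u.
Proof. by move=> l; have := l a u 0; rewrite (scalar0 l) !addr0. Qed.

Lemma scalarN (n : nat) (phi : 'rV[R]_n -> R) u :
  scalar phi -> phi (- u) = - phi u.
Proof. by move=> l; rewrite -scaleN1r scalar_scale// mulN1r. Qed.

Lemma alternating_antisym n (phi : 'rV[R]_n -> 'rV[R]_n -> R) u v :
  (forall w, scalar (phi^~ w)) -> (forall w, scalar (phi w)) ->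
  (forall w, phi w w = 0) -> phi u v = - phi v u.
Proof.
move=> l1 l2 alt; have := alt (u + v).
rewrite (scalarD _ _ (l2 _)) !(scalarD _ _ (l1 _)) !alt add0r addr0 => /eqP.
by rewrite addr_eq0 => /eqP ->; rewrite opprK.
Qed.

Lemma form2_antisym (w : form2 M) (hw : is_form2 w) p u v : w p u v = - w p v u.
Proof.
apply: alternating_antisym; [exact: form2_linear1|exact: form2_linear2|].
exact: form2_alternating.
Qed.

Lemma form3_antisym12 (w : form3 M) (hw : is_form3 w) p u v x :
  w p u v x = - w p v u x.
Proof.
apply: (alternating_antisym (phi := fun u v => w p u v x)) => z.
- exact: form3_linear1.
- exact: form3_linear2.
- exact: form3_alternating12.
Qed.

Lemma form3_antisym23 (w : form3 M) (hw : is_form3 w) p u v x :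
  w p u v x = - w p u x v.
Proof.
apply: (alternating_antisym (phi := fun v x => w p u v x)) => z.
- exact: form3_linear2.
- exact: form3_linear3.
- exact: form3_alternating23.
Qed.

End FormInChart.

(** Smoothness is checked near each point, with the target chart centred at its image; there the
    coefficients are those of w composed with a smooth map and evaluated on derivatives of that
    map. *)
Lemma pullback2_form M N (hM : is_manifold M) (hN : is_manifold N)
    (f : M -> N) (w : form2 N) : is_smooth f -> is_form2 w ->
  is_form2 (pullback2 f w).
Proof.
move=> sf hw; split.
- move=> p u2 a u v; rewrite /pullback2 (tmap_linear hM hN _ sf).
  exact: (form2_linear1 hw).
- move=> p u1 a u v; rewrite /pullback2 (tmap_linear hM hN _ sf).
  exact: (form2_linear2 hw).
- by move=> p u; exact: (form2_alternating hw).
- move=> p u1 u2; apply: smooth_on_local => x px.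
  pose q := f (chart_inv p x); pose V := rep_dom f p q.
  have oV : open V by apply: rep_dom_open => //; exact: sf.1.
  exists V; split; first by split=> //; exact: chart_dom_center.
  apply: (smooth_on_ext oV (fun y Vy => esym (form2_in_chart_pullback hM hN w u1 u2 sf Vy))).
  have sF := rep_smooth p q sf.
  apply: (smooth_on_appR2 (phi := fun x v1 v2 => form2_in_chart w q v1 v2 (rep f p q x))) => //.
  + by move=> y u Vy; exact: form2_in_chart_linear2 (rep_cod Vy).
  + by move=> y u Vy; exact: form2_in_chart_linear1 (rep_cod Vy).
  + move=> v1 v2; apply: (smooth_on_compR oV sF (form2_smooth hw q v1 v2)).
    by move=> y Vy; exact: rep_cod.
  + exact: smooth_on_derive.
  + exact: smooth_on_derive.
Qed.

Lemma pullback3_form M N (hM : is_manifold M) (hN : is_manifold N)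
    (f : M -> N) (w : form3 N) : is_smooth f -> is_form3 w ->
  is_form3 (pullback3 f w).
Proof.
move=> sf hw; split.
- move=> p u2 u3 a u v; rewrite /pullback3 (tmap_linear hM hN _ sf).
  exact: (form3_linear1 hw).
- move=> p u1 u3 a u v; rewrite /pullback3 (tmap_linear hM hN _ sf).
  exact: (form3_linear2 hw).
- move=> p u1 u2 a u v; rewrite /pullback3 (tmap_linear hM hN _ sf).
  exact: (form3_linear3 hw).
- by move=> p u v; exact: (form3_alternating12 hw).
- by move=> p u v; exact: (form3_alternating23 hw).
- move=> p u1 u2 u3; apply: smooth_on_local => x px.
  pose q := f (chart_inv p x); pose V := rep_dom f p q.
  have oV : open V by apply: rep_dom_open => //; exact: sf.1.
  exists V; split; first by split=> //; exact: chart_dom_center.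
  apply: (smooth_on_ext oV (fun y Vy => esym (form3_in_chart_pullback hM hN w u1 u2 u3 sf Vy))).
  have sF := rep_smooth p q sf.
  apply: (smooth_on_appR3 (phi := fun x v1 v2 v3 => form3_in_chart w q v1 v2 v3 (rep f p q x))) => //.
  + by move=> y u v Vy; exact: form3_in_chart_linear1 (rep_cod Vy).
  + by move=> y u v Vy; exact: form3_in_chart_linear2 (rep_cod Vy).
  + by move=> y u v Vy; exact: form3_in_chart_linear3 (rep_cod Vy).
  + move=> v1 v2 v3; apply: (smooth_on_compR oV sF (form3_smooth hw q v1 v2 v3)).
    by move=> y Vy; exact: rep_cod.
  + exact: smooth_on_derive.
  + exact: smooth_on_derive.
  + exact: smooth_on_derive.
Qed.

End FormPullback.

(** * Naturality and additivity of the exterior derivative *)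

Section ExteriorDerivative.
Context {R : realType}.
Local Notation tangent M := 'rV[R]_(mdim M).
Local Notation "M ** N" := (prod_manifold M N) (at level 40).
Implicit Types M N K : manifold_data R.

Definition pullback4 M N (f : M -> N) (w : form4 N) : form4 M :=
  fun p u1 u2 u3 u4 =>
    w (f p) (tmap f p u1) (tmap f p u2) (tmap f p u3) (tmap f p u4).

(** The $s_{ij}$ stand for second derivatives of the coordinate map, with $s_{ij}$ and $s_{ji}$
    already identified. They cancel in the alternating sum because w is antisymmetric, and only the
    derivatives $d_i$ of the coefficients of w remain. *)
Lemma alternating2_cancel (V : Type) (w : V -> V -> R) (a1 a2 a3 s12 s13 s23 : V)
    (d1 d2 d3 : R) : (forall u v, w u v = - w v u) ->
  (d1 + w s12 a3 + w a2 s13) - (d2 + w s12 a3 + w a1 s23)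
  + (d3 + w s13 a2 + w a1 s23) = d1 - d2 + d3.
Proof. by move=> anti; rewrite (anti s13 a2); ring. Qed.

Lemma alternating3_cancel (V : Type) (w : V -> V -> V -> R)
    (a1 a2 a3 a4 s12 s13 s14 s23 s24 s34 : V) (d1 d2 d3 d4 : R) :
  (forall u v x, w u v x = - w v u x) -> (forall u v x, w u v x = - w u x v) ->
  (d1 + w s12 a3 a4 + w a2 s13 a4 + w a2 a3 s14)
  - (d2 + w s12 a3 a4 + w a1 s23 a4 + w a1 a3 s24)
  + (d3 + w s13 a2 a4 + w a1 s23 a4 + w a1 a2 s34)
  - (d4 + w s14 a2 a3 + w a1 s24 a3 + w a1 a2 s34) = d1 - d2 + d3 - d4.
Proof.
move=> a12 a23; rewrite (a12 a2 s13) (a23 a2 a3 s14) (a12 a2 s14) (a23 a1 a3 s24).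
ring.
Qed.

Section Naturality.
Variables (M N : manifold_data R) (hM : is_manifold M) (hN : is_manifold N).
Variables (f : M -> N) (sf : is_smooth f) (p : M).
Let q := f p.
Let F := rep f p q.
Let c := chart p p.
Let S u v := 'D_u (fun x => 'D_v F x) c.

Let qc : rep_dom f p q c.
Proof. by apply: rep_domP => //; exact: chart_dom_center. Qed.

Let oV : open (rep_dom f p q).
Proof. by apply: rep_dom_open => //; exact: sf.1. Qed.

Let near_dom : \forall x \near c, rep_dom f p q x.
Proof. exact: open_nbhs_nbhs (conj oV qc). Qed.

Let sF : smooth_on (rep_dom f p q) F.
Proof. exact: rep_smooth. Qed.

Let S_sym u v : S u v = S v u.
Proof. exact: derive_sym oV qc sF. Qed.

Let dF : differentiable F c.
Proof. exact: smooth_on_diff sF qc. Qed.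

Let dDF v : differentiable (fun x => 'D_v F x) c.
Proof. exact: smooth_on_diff (smooth_on_derive v sF) qc. Qed.

Let Fc : F c = chart q q.
Proof. by rewrite /F /rep /c /= chartK//; exact: chart_dom_center. Qed.

Let codFc : chart_cod q (F c).
Proof. exact: rep_cod qc. Qed.

Let invFc : chart_inv q (F c) = q.
Proof. by rewrite Fc chartK//; exact: chart_dom_center. Qed.

Let in_chart2 (w : form2 N) a b : form2_in_chart w q a b (F c) = w q a b.
Proof. by rewrite /form2_in_chart invFc !from_chart_id. Qed.

Let in_chart3 (w : form3 N) a b d : form3_in_chart w q a b d (F c) = w q a b d.
Proof. by rewrite /form3_in_chart invFc !from_chart_id. Qed.

Let derive_compF (g : tangent N -> R^o) u : differentiable g (F c) ->
  'D_u (g \o F) c = 'D_(tmap f p u) g (chart q q).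
Proof. by move=> dg; rewrite -Fc; exact: derive_comp dF dg. Qed.

(** Three terms of the product rule: one from the motion of the base point, and one from each
    argument, where a second derivative [S] of the representative appears. *)
Lemma derive_form2_pullback (w : form2 N) (hw : is_form2 w) u1 u2 u3 :
  'D_u1 (form2_in_chart (pullback2 f w) p u2 u3) c =
  'D_(tmap f p u1) (form2_in_chart w q (tmap f p u2) (tmap f p u3)) (chart q q)
  + w q (S u1 u2) (tmap f p u3) + w q (tmap f p u2) (S u1 u3).
Proof.
have E : \forall x \near c, form2_in_chart (pullback2 f w) p u2 u3 x =
    form2_in_chart w q ('D_u2 F x) ('D_u3 F x) (F x).
  by apply: filterS near_dom => x; exact: form2_in_chart_pullback.
apply: (etrans (near_eq_derive u1 E)).
have [| | |//|//|_ D] := derive_appR2 (phi := fun x a b => form2_in_chart w q a b (F x))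
   (a := fun x => 'D_u2 F x) (b := fun x => 'D_u3 F x) (x := c).
- by apply: filterS near_dom => x qx u; exact: form2_in_chart_linear2 (rep_cod qx).
- by apply: filterS near_dom => x qx u; exact: form2_in_chart_linear1 (rep_cod qx).
- move=> v1 v2; apply: differentiable_comp dF _.
  exact: form2_in_chart_diff.
have X1 := derive_compF u1 (form2_in_chart_diff hw ('D_u2 F c) ('D_u3 F c) codFc).
have X2 := in_chart2 w (S u1 u2) ('D_u3 F c).
have X3 := in_chart2 w ('D_u2 F c) (S u1 u3).
exact: etrans (D u1) (congr2 +%R (congr2 +%R X1 X2) X3).
Qed.

(** [S_sym] brings the six second-derivative terms to three symmetric symbols, which then cancel in
    pairs. *)
Lemma ext_d2_pullback_at (w : form2 N) (hw : is_form2 w) u1 u2 u3 :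
  ext_d2 (pullback2 f w) p u1 u2 u3 = pullback3 f (ext_d2 w) p u1 u2 u3.
Proof.
have D1 := derive_form2_pullback hw u1 u2 u3.
have D2 := derive_form2_pullback hw u2 u1 u3.
have D3 := derive_form2_pullback hw u3 u1 u2.
rewrite (S_sym u2 u1) in D2; rewrite (S_sym u3 u1) (S_sym u3 u2) in D3.
apply: etrans (congr2 +%R (congr2 (fun x y : R => x - y) D1 D2) D3) _.
exact: alternating2_cancel (form2_antisym hw q).
Qed.

Lemma derive_form3_pullback (w : form3 N) (hw : is_form3 w) u1 u2 u3 u4 :
  'D_u1 (form3_in_chart (pullback3 f w) p u2 u3 u4) c =
  'D_(tmap f p u1) (form3_in_chart w q (tmap f p u2) (tmap f p u3) (tmap f p u4)) (chart q q)
  + w q (S u1 u2) (tmap f p u3) (tmap f p u4)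
  + w q (tmap f p u2) (S u1 u3) (tmap f p u4)
  + w q (tmap f p u2) (tmap f p u3) (S u1 u4).
Proof.
have E : \forall x \near c, form3_in_chart (pullback3 f w) p u2 u3 u4 x =
    form3_in_chart w q ('D_u2 F x) ('D_u3 F x) ('D_u4 F x) (F x).
  by apply: filterS near_dom => x; exact: form3_in_chart_pullback.
apply: (etrans (near_eq_derive u1 E)).
have D := derive_appR3 (phi := fun x a b d => form3_in_chart w q a b d (F x))
   (a := fun x => 'D_u2 F x) (b := fun x => 'D_u3 F x) (c := fun x => 'D_u4 F x) (x := c).
have h1 : \forall x \near c, forall u v, linear (fun a => form3_in_chart w q a u v (F x)).
  by apply: filterS near_dom => x qx u v; exact: form3_in_chart_linear1 (rep_cod qx).
have h2 : \forall x \near c, forall u v, linear (fun a => form3_in_chart w q u a v (F x)).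
  by apply: filterS near_dom => x qx u v; exact: form3_in_chart_linear2 (rep_cod qx).
have h3 : \forall x \near c, forall u v, linear (fun a => form3_in_chart w q u v a (F x)).
  by apply: filterS near_dom => x qx u v; exact: form3_in_chart_linear3 (rep_cod qx).
have h4 v1 v2 v3 : differentiable (form3_in_chart w q v1 v2 v3 \o F) c.
  by apply: differentiable_comp dF _; exact: form3_in_chart_diff.
have {}D := D h1 h2 h3 h4 (dDF u2) (dDF u3) (dDF u4) u1.
have X1 := derive_compF u1 (form3_in_chart_diff hw ('D_u2 F c) ('D_u3 F c) ('D_u4 F c) codFc).
have X2 := in_chart3 w (S u1 u2) ('D_u3 F c) ('D_u4 F c).
have X3 := in_chart3 w ('D_u2 F c) (S u1 u3) ('D_u4 F c).
have X4 := in_chart3 w ('D_u2 F c) ('D_u3 F c) (S u1 u4).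
exact: etrans D (congr2 +%R (congr2 +%R (congr2 +%R X1 X2) X3) X4).
Qed.

Lemma ext_d3_pullback_at (w : form3 N) (hw : is_form3 w) u1 u2 u3 u4 :
  ext_d3 (pullback3 f w) p u1 u2 u3 u4 = pullback4 f (ext_d3 w) p u1 u2 u3 u4.
Proof.
have D1 := derive_form3_pullback hw u1 u2 u3 u4.
have D2 := derive_form3_pullback hw u2 u1 u3 u4.
have D3 := derive_form3_pullback hw u3 u1 u2 u4.
have D4 := derive_form3_pullback hw u4 u1 u2 u3.
rewrite (S_sym u2 u1) in D2; rewrite (S_sym u3 u1) (S_sym u3 u2) in D3.
rewrite (S_sym u4 u1) (S_sym u4 u2) (S_sym u4 u3) in D4.
apply: etrans (congr2 (fun x y : R => x - y) (congr2 +%R (congr2 (fun x y : R => x - y) D1 D2) D3) D4) _.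
exact: alternating3_cancel (form3_antisym12 hw q) (form3_antisym23 hw q).
Qed.

End Naturality.

Lemma ext_d2_pullback M N (hM : is_manifold M) (hN : is_manifold N) (f : M -> N)
  (w : form2 N) : is_smooth f -> is_form2 w ->
  ext_d2 (pullback2 f w) = pullback3 f (ext_d2 w).
Proof.
move=> sf hw; apply/funext => p; apply/funext => u1; apply/funext => u2.
by apply/funext => u3; exact: ext_d2_pullback_at.
Qed.

Lemma ext_d3_pullback M N (hM : is_manifold M) (hN : is_manifold N) (f : M -> N)
  (w : form3 N) : is_smooth f -> is_form3 w ->
  ext_d3 (pullback3 f w) = pullback4 f (ext_d3 w).
Proof.
move=> sf hw; apply/funext => p; apply/funext => u1; apply/funext => u2.
by apply/funext => u3; apply/funext => u4; exact: ext_d3_pullback_at.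
Qed.

Section FormOps.
Variables (M : manifold_data R) (hM : is_manifold M).

Lemma smooth_onD (W : normedModType R) m (U : set 'rV[R]_m) (f g : 'rV[R]_m -> W) :
  open U -> smooth_on U f -> smooth_on U g -> smooth_on U (fun x => f x + g x).
Proof. by move=> oU sf sg k; exact: Ck_onD. Qed.

Lemma smooth_onM m (U : set 'rV[R]_m) (f g : 'rV[R]_m -> R^o) :
  open U -> smooth_on U f -> smooth_on U g -> smooth_on U (fun x => f x * g x : R^o).
Proof. by move=> oU sf sg k; exact: Ck_onM. Qed.

Lemma smooth_onZ m (U : set 'rV[R]_m) (a : R) (f : 'rV[R]_m -> R^o) :
  open U -> smooth_on U f -> smooth_on U (fun x => a * f x : R^o).
Proof. by move=> oU sf; apply: smooth_onM => // k; exact: Ck_on_cst. Qed.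

Lemma form2D (w1 w2 : form2 M) : is_form2 w1 -> is_form2 w2 ->
  is_form2 (w1 + w2 : form2 M).
Proof.
move=> h1 h2; split.
- by move=> p u a x y; rewrite [LHS](congr2 +%R (form2_linear1 h1 p u a x y) (form2_linear1 h2 p u a x y)) mulrDr addrACA.
- by move=> p u a x y; rewrite [LHS](congr2 +%R (form2_linear2 h1 p u a x y) (form2_linear2 h2 p u a x y)) mulrDr addrACA.
- by move=> p u; rewrite [LHS](congr2 +%R (form2_alternating h1 p u) (form2_alternating h2 p u)) addr0.
- move=> p u1 u2; apply: smooth_onD (form2_smooth h1 p u1 u2) (form2_smooth h2 p u1 u2).
  exact: chart_cod_open.
Qed.

Lemma form2N (w : form2 M) : is_form2 w -> is_form2 (- w : form2 M).
Proof.
move=> h; split.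
- by move=> p u a x y; rewrite [LHS](congr1 -%R (form2_linear1 h p u a x y)) opprD mulrN.
- by move=> p u a x y; rewrite [LHS](congr1 -%R (form2_linear2 h p u a x y)) opprD mulrN.
- by move=> p u; rewrite [LHS](congr1 -%R (form2_alternating h p u)) oppr0.
- move=> p u1 u2; have oU : open (chart_cod p) by exact: chart_cod_open.
  apply: (@smooth_on_ext _ _ _ _ (fun x => -1 * form2_in_chart w p u1 u2 x : R^o) _ oU).
    by move=> x _; exact: mulN1r.
  exact: smooth_onZ oU (form2_smooth h p u1 u2).
Qed.

Lemma form3D (w1 w2 : form3 M) : is_form3 w1 -> is_form3 w2 ->
  is_form3 (w1 + w2 : form3 M).
Proof.
move=> h1 h2; split.
- by move=> p u v a x y; rewrite [LHS](congr2 +%R (form3_linear1 h1 p u v a x y) (form3_linear1 h2 p u v a x y)) mulrDr addrACA.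
- by move=> p u v a x y; rewrite [LHS](congr2 +%R (form3_linear2 h1 p u v a x y) (form3_linear2 h2 p u v a x y)) mulrDr addrACA.
- by move=> p u v a x y; rewrite [LHS](congr2 +%R (form3_linear3 h1 p u v a x y) (form3_linear3 h2 p u v a x y)) mulrDr addrACA.
- by move=> p u v; rewrite [LHS](congr2 +%R (form3_alternating12 h1 p u v) (form3_alternating12 h2 p u v)) addr0.
- by move=> p u v; rewrite [LHS](congr2 +%R (form3_alternating23 h1 p u v) (form3_alternating23 h2 p u v)) addr0.
- move=> p u1 u2 u3; apply: smooth_onD (form3_smooth h1 p u1 u2 u3) (form3_smooth h2 p u1 u2 u3).
  exact: chart_cod_open.
Qed.

Lemma form3N (w : form3 M) : is_form3 w -> is_form3 (- w : form3 M).
Proof.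
move=> h; split.
- by move=> p u v a x y; rewrite [LHS](congr1 -%R (form3_linear1 h p u v a x y)) opprD mulrN.
- by move=> p u v a x y; rewrite [LHS](congr1 -%R (form3_linear2 h p u v a x y)) opprD mulrN.
- by move=> p u v a x y; rewrite [LHS](congr1 -%R (form3_linear3 h p u v a x y)) opprD mulrN.
- by move=> p u v; rewrite [LHS](congr1 -%R (form3_alternating12 h p u v)) oppr0.
- by move=> p u v; rewrite [LHS](congr1 -%R (form3_alternating23 h p u v)) oppr0.
- move=> p u1 u2 u3; have oU : open (chart_cod p) by exact: chart_cod_open.
  apply: (@smooth_on_ext _ _ _ _ (fun x => -1 * form3_in_chart w p u1 u2 u3 x : R^o) _ oU).
    by move=> x _; exact: mulN1r.
  exact: smooth_onZ oU (form3_smooth h p u1 u2 u3).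
Qed.

Lemma form2_in_chart_derivable (w : form2 M) (p : M) u v x : is_form2 w ->
  derivable (form2_in_chart w p u v) (chart p p) x.
Proof.
move=> h; apply/diff_derivable/form2_in_chart_diff => //.
exact/chart_codP/chart_dom_center.
Qed.

Lemma form3_in_chart_derivable (w : form3 M) (p : M) u1 u2 u3 x : is_form3 w ->
  derivable (form3_in_chart w p u1 u2 u3) (chart p p) x.
Proof.
move=> h; apply/diff_derivable/form3_in_chart_diff => //.
exact/chart_codP/chart_dom_center.
Qed.

Lemma alt2_sumD (a1 a2 a3 b1 b2 b3 : R) :
  (a1 + b1) - (a2 + b2) + (a3 + b3) = (a1 - a2 + a3) + (b1 - b2 + b3).
Proof. ring. Qed.

Lemma alt2_sumN (a1 a2 a3 : R) : - a1 - - a2 + - a3 = - (a1 - a2 + a3).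
Proof. ring. Qed.

Lemma alt3_sumD (a1 a2 a3 a4 b1 b2 b3 b4 : R) :
  (a1 + b1) - (a2 + b2) + (a3 + b3) - (a4 + b4) =
  (a1 - a2 + a3 - a4) + (b1 - b2 + b3 - b4).
Proof. ring. Qed.

Lemma alt3_sumN (a1 a2 a3 a4 : R) :
  - a1 - - a2 + - a3 - - a4 = - (a1 - a2 + a3 - a4).
Proof. ring. Qed.

Lemma ext_d2D (w1 w2 : form2 M) : is_form2 w1 -> is_form2 w2 ->
  ext_d2 (w1 + w2 : form2 M) = ext_d2 w1 + ext_d2 w2 :> form3 M.
Proof.
move=> h1 h2; apply/funext => p; apply/funext => u1; apply/funext => u2; apply/funext => u3.
have D x u v := @deriveD _ _ _ (form2_in_chart w1 p u v) (form2_in_chart w2 p u v) (chart p p) x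
  (form2_in_chart_derivable h1) (form2_in_chart_derivable h2).
apply: etrans (congr2 +%R (congr2 (fun x y : R => x - y) (D u1 u2 u3) (D u2 u1 u3)) (D u3 u1 u2)) _.
exact: alt2_sumD.
Qed.

Lemma ext_d2N (w : form2 M) : is_form2 w ->
  ext_d2 (- w : form2 M) = - ext_d2 w :> form3 M.
Proof.
move=> h; apply/funext => p; apply/funext => u1; apply/funext => u2; apply/funext => u3.
have D x u v := @deriveN _ _ _ (form2_in_chart w p u v) (chart p p) x
  (form2_in_chart_derivable h).
apply: etrans (congr2 +%R (congr2 (fun x y : R => x - y) (D u1 u2 u3) (D u2 u1 u3)) (D u3 u1 u2)) _.
exact: alt2_sumN.
Qed.

Lemma ext_d3D (w1 w2 : form3 M) : is_form3 w1 -> is_form3 w2 ->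
  ext_d3 (w1 + w2 : form3 M) = ext_d3 w1 + ext_d3 w2 :> form4 M.
Proof.
move=> h1 h2; apply/funext => p; apply/funext => u1; apply/funext => u2; apply/funext => u3; apply/funext => u4.
have D x u v z := @deriveD _ _ _ (form3_in_chart w1 p u v z) (form3_in_chart w2 p u v z) (chart p p) x
  (form3_in_chart_derivable h1) (form3_in_chart_derivable h2).
apply: etrans (congr2 (fun x y : R => x - y) (congr2 +%R (congr2 (fun x y : R => x - y)
  (D u1 u2 u3 u4) (D u2 u1 u3 u4)) (D u3 u1 u2 u4)) (D u4 u1 u2 u3)) _.
exact: alt3_sumD.
Qed.

Lemma ext_d3N (w : form3 M) : is_form3 w ->
  ext_d3 (- w : form3 M) = - ext_d3 w :> form4 M.
Proof.
move=> h; apply/funext => p; apply/funext => u1; apply/funext => u2; apply/funext => u3; apply/funext => u4.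
have D x u v z := @deriveN _ _ _ (form3_in_chart w p u v z) (chart p p) x
  (form3_in_chart_derivable h).
apply: etrans (congr2 (fun x y : R => x - y) (congr2 +%R (congr2 (fun x y : R => x - y)
  (D u1 u2 u3 u4) (D u2 u1 u3 u4)) (D u3 u1 u2 u4)) (D u4 u1 u2 u3)) _.
exact: alt3_sumN.
Qed.

End FormOps.

Lemma pullback2_comp M N K (hM : is_manifold M) (hN : is_manifold N)
    (hK : is_manifold K) (f : M -> N) (g : N -> K) (w : form2 K) :
  is_smooth f -> is_smooth g ->
  pullback2 f (pullback2 g w) = pullback2 (g \o f) w.
Proof.
move=> sf sg; apply/funext => p; apply/funext => u1; apply/funext => u2.
by rewrite /pullback2; congr (w _ _ _); apply/esym; exact: tmap_comp.
Qed.

Lemma pullback3_comp M N K (hM : is_manifold M) (hN : is_manifold N)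
    (hK : is_manifold K) (f : M -> N) (g : N -> K) (w : form3 K) :
  is_smooth f -> is_smooth g ->
  pullback3 f (pullback3 g w) = pullback3 (g \o f) w.
Proof.
move=> sf sg; apply/funext => p; apply/funext => u1; apply/funext => u2; apply/funext => u3.
by rewrite /pullback3; congr (w _ _ _ _); apply/esym; exact: tmap_comp.
Qed.

End ExteriorDerivative.

(** * Lie groups *)

Section TwoVariables.
Context {R : realType}.
Local Notation tangent M := 'rV[R]_(mdim M).
Local Notation "M ** N" := (prod_manifold M N) (at level 40).
Implicit Types M N K : manifold_data R.

Lemma is_smooth_inl M N (hM : is_manifold M) (hN : is_manifold N) (b : N) :
  @is_smooth R M (M ** N) (fun x => (x, b)).
Proof. by apply: is_smooth_pair => //; [exact: is_smooth_id|exact: is_smooth_cst]. Qed.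

Lemma is_smooth_inr M N (hM : is_manifold M) (hN : is_manifold N) (a : M) :
  @is_smooth R N (M ** N) (fun y => (a, y)).
Proof. by apply: is_smooth_pair => //; [exact: is_smooth_cst|exact: is_smooth_id]. Qed.

Lemma linearDE (V W : lmodType R) (f : V -> W) u v :
  linear f -> f (u + v) = f u + f v.
Proof. by move=> l; have := l 1 u v; rewrite !scale1r. Qed.

Lemma linear0E (V W : lmodType R) (f : V -> W) : linear f -> f 0 = 0.
Proof. by move=> l; apply: (@addrI _ (f 0)); rewrite -linearDE// !addr0. Qed.

Lemma linearZE (V W : lmodType R) (f : V -> W) a u :
  linear f -> f (a *: u) = a *: f u.
Proof. by move=> l; have := l a u 0; rewrite (linear0E l) !addr0. Qed.

Lemma linearNE (V W : lmodType R) (f : V -> W) u : linear f -> f (- u) = - f u.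
Proof. by move=> l; rewrite -scaleN1r linearZE// scaleN1r. Qed.

Lemma linearBE (V W : lmodType R) (f : V -> W) u v :
  linear f -> f (u - v) = f u - f v.
Proof. by move=> l; rewrite linearDE// linearNE. Qed.

Lemma tmap2 M N K (hM : is_manifold M) (hN : is_manifold N) (hK : is_manifold K)
    (F : M ** N -> K) a b u v : is_smooth F ->
  @tmap R (M ** N) K F (a, b) (row_mx u v) =
  tmap (fun x => F (x, b)) a u + tmap (fun y => F (a, y)) b v.
Proof.
move=> sF; have hP := prod_is_manifold hM hN.
rewrite row_mx_sum_linear (linearDE _ _ (tmap_linear hP hK _ sF)).
apply: (congr2 +%R).
- have := tmap_comp hM hP hK a u (is_smooth_inl hM hN b) sF.
  move=> /esym; rewrite (tmap_pair hM hM hN a u (is_smooth_id hM) (is_smooth_cst _ hN b)).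
  by rewrite (tmap_id hM) (tmap_cst b).
- have := tmap_comp hN hP hK b v (is_smooth_inr hM hN a) sF.
  move=> /esym; rewrite (tmap_pair hN hM hN b v (is_smooth_cst _ hM a) (is_smooth_id hN)).
  by rewrite (tmap_id hN) (tmap_cst a).
Qed.

Lemma drep_inl M N K (hM : is_manifold M) (hN : is_manifold N) (hK : is_manifold K)
    (F : M ** N -> K) p q r a b u : is_smooth F ->
  chart_dom p a -> chart_dom q b -> chart_dom r (F (a, b)) ->
  drep (fun x => F (x, b)) p r a u =
  @drep R (M ** N) K F (p, q) r (a, b) (row_mx u 0).
Proof.
move=> sF pa qb rF; have hP := prod_is_manifold hM hN.
have pq : @chart_dom _ (M ** N) (p, q) (a, b) by split.
apply: etrans (drep_comp hM hP u (is_smooth_inl hM hN b) sF pa pq rF) _.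
congr (drep _ _ _ _ _).
apply: etrans (derive_row_mx u (rep_diff hM (is_smooth_id hM) pa pa)
  (rep_diff hM (is_smooth_cst M hN b) pa qb)) _.
by congr row_mx; [exact: drep_id|exact: derive_cst].
Qed.

Lemma drep_inr M N K (hM : is_manifold M) (hN : is_manifold N) (hK : is_manifold K)
    (F : M ** N -> K) p q r a b v : is_smooth F ->
  chart_dom p a -> chart_dom q b -> chart_dom r (F (a, b)) ->
  drep (fun y => F (a, y)) q r b v =
  @drep R (M ** N) K F (p, q) r (a, b) (row_mx 0 v).
Proof.
move=> sF pa qb rF; have hP := prod_is_manifold hM hN.
have pq : @chart_dom _ (M ** N) (p, q) (a, b) by split.
apply: etrans (drep_comp hN hP v (is_smooth_inr hM hN a) sF qb pq rF) _.
congr (drep _ _ _ _ _).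
apply: etrans (derive_row_mx v (rep_diff hN (is_smooth_cst N hM a) qb pa)
  (rep_diff hN (is_smooth_id hN) qb qb)) _.
by congr row_mx; [exact: derive_cst|exact: drep_id].
Qed.

(** Source of the smoothness of the Maurer-Cartan forms: they are partial derivatives along the
    diagonal of $F(y, m) = y m^{-1}$ and of $F(y, m) = m^{-1} y$. Since F is constant there, the
    chart of the target stays centred at k while m moves. *)
Lemma smooth_partial_diag M K (hM : is_manifold M) (hK : is_manifold K)
    (F : M ** M -> K) (k : K) p u : is_smooth F -> (forall m, F (m, m) = k) ->
  smooth_on (chart_cod p) (fun x => let m := chart_inv p x in
    tmap (fun y => F (y, m)) m (from_chart p m u)).
Proof.
move=> sF Fk; have hP := prod_is_manifold hM hM.
have oU : open (chart_cod p) by exact: chart_cod_open.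
pose RF := @rep R (M ** M) K F (p, p) k.
have sRF : smooth_on (rep_dom F (p, p) k) RF := rep_smooth _ _ sF.
have oV : open (@rep_dom R (M ** M) K F (p, p) k).
  by apply: rep_dom_open => //; exact: sF.1.
pose V := @rep_dom R (M ** M) K F (p, p) k.
apply: (@smooth_on_ext _ _ _ _ ((fun z => 'D_(row_mx u 0) RF z) \o (fun x => row_mx x x)) _ oU).
  move=> x px /=; set m := chart_inv p x.
  have pm : chart_dom p m by exact: chart_inv_dom.
  have mm := chart_dom_center hM m.
  have xE : chart p m = x by rewrite chart_invK.
  have kF : chart_dom (F (m, m)) (F (m, m)) by exact: chart_dom_center.
  apply/esym.
  have E1 := drep_comp hM hM u (is_smooth_id hM)
    (is_smooth_comp hM hP hK (is_smooth_inl hM hM m) sF) pm mm kF.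
  apply: etrans (esym E1) _.
  apply: etrans (drep_inl hM hM hK u sF pm pm kF) _.
  by rewrite /drep /= xE Fk.
apply: (@smooth_on_comp _ _ _ _ _ V) => //.
- by apply: smooth_on_row_mx => //; apply: smooth_on_lin.
- exact: smooth_on_derive.
- move=> x px; split; first by apply/prod_chart_cod; rewrite row_mxKl row_mxKr.
  rewrite /= row_mxKl row_mxKr Fk; exact: chart_dom_center.
Qed.

End TwoVariables.

(** * Translations, the adjoint action and logarithmic derivatives *)

Section LieGroupCalculus.
Context {R : realType}.
Local Notation tangent M := 'rV[R]_(mdim M).
Local Notation lie_algebra K := 'rV[R]_(mdim K).
Local Notation "M ** N" := (prod_manifold M N) (at level 40).
Implicit Types M N : manifold_data R.
Variables (G : lie_group_data R) (hG : is_lie_group G).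
Let hM : is_manifold G := lie_group_manifold hG.
Implicit Types g h k : G.

Lemma gmulgV g : gmul g (ginv g) = gone.
Proof.
have V := gmulVg hG; have A := gmulA hG; have I := gmul1g hG.
by rewrite -[LHS]I -{1}(V (ginv g)) -A (A (ginv g)) V I V.
Qed.

Lemma gmulg1 g : gmul g gone = g.
Proof.
by rewrite -{1}(gmulVg hG g) (gmulA hG) gmulgV (gmul1g hG).
Qed.

Lemma gmulKg g h : gmul (ginv g) (gmul g h) = h.
Proof. by rewrite (gmulA hG) (gmulVg hG) (gmul1g hG). Qed.

Lemma gmulVKg g h : gmul g (gmul (ginv g) h) = h.
Proof. by rewrite (gmulA hG) gmulgV (gmul1g hG). Qed.

Lemma gmulgK g h : gmul (gmul h g) (ginv g) = h.
Proof. by rewrite -(gmulA hG) gmulgV gmulg1. Qed.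

Lemma gmulgVK g h : gmul (gmul h (ginv g)) g = h.
Proof. by rewrite -(gmulA hG) (gmulVg hG) gmulg1. Qed.

Lemma ginv_unique g h : gmul g h = gone -> ginv g = h.
Proof. by move=> E; rewrite -(gmulKg g h) E gmulg1. Qed.

Lemma ginvK g : ginv (ginv g) = g.
Proof. by apply: ginv_unique; exact: (gmulVg hG). Qed.

Lemma ginvM g h : ginv (gmul g h) = gmul (ginv h) (ginv g).
Proof. by apply: ginv_unique; rewrite (gmulA hG) gmulgK gmulgV. Qed.

Lemma ginv1 : ginv gone = gone :> G.
Proof. by apply: ginv_unique; rewrite gmulg1. Qed.

Section Maps.
Variables (M : manifold_data R) (hm : is_manifold M).
Implicit Types f : M -> G.

Lemma is_smooth_mul f1 f2 : is_smooth f1 -> is_smooth f2 ->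
  is_smooth (fun x => gmul (f1 x) (f2 x)).
Proof.
move=> s1 s2; have hP := prod_is_manifold hM hM.
exact: (is_smooth_comp hm hP hM (is_smooth_pair hm hM hM s1 s2) (gmul_smooth hG)).
Qed.

Lemma is_smooth_inv f : is_smooth f -> is_smooth (fun x => ginv (f x)).
Proof. by move=> s; exact: (is_smooth_comp hm hM hM s (ginv_smooth hG)). Qed.

End Maps.

Lemma is_smooth_mulr g : @is_smooth R G G (fun x => gmul x g).
Proof.
by apply: (is_smooth_mul hM); [exact: is_smooth_id|exact: is_smooth_cst].
Qed.

Lemma is_smooth_mull g : @is_smooth R G G (gmul g).
Proof.
by apply: (is_smooth_mul hM); [exact: is_smooth_cst|exact: is_smooth_id].
Qed.

Lemma is_smooth_conj g : @is_smooth R G G (fun x => gmul (gmul g x) (ginv g)).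
Proof.
by apply: (is_smooth_mul hM); [exact: is_smooth_mull|exact: is_smooth_cst].
Qed.

Lemma tmapGG_comp (f1 f2 : G -> G) p u : is_smooth f1 -> is_smooth f2 ->
  tmap f2 (f1 p) (tmap f1 p u) = tmap (fun x => f2 (f1 x)) p u.
Proof. by move=> s1 s2; apply/esym; exact: tmap_comp. Qed.

Lemma tmap_ext (f1 f2 : G -> G) p u : f1 =1 f2 -> tmap f1 p u = tmap f2 p u.
Proof. by move=> /funext->. Qed.

Lemma tmap_idG (f : G -> G) p u : (forall x, f x = x) -> tmap f p u = u.
Proof.
move=> E; have -> : f = id by apply/funext => x; exact: E.
exact: tmap_id.
Qed.

Lemma theta_r_right_field u g : theta_r g (right_field u g) = u.
Proof.
rewrite /theta_r /right_field -{2}(gmul1g hG g).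
rewrite (tmapGG_comp _ _ (is_smooth_mulr g) (is_smooth_mulr (ginv g))).
by apply: tmap_idG => x; exact: gmulgK.
Qed.

Lemma right_field_theta_r g (X : tangent G) : right_field (theta_r g X) g = X.
Proof.
rewrite /theta_r /right_field -(gmulgV g).
rewrite (tmapGG_comp _ _ (is_smooth_mulr (ginv g)) (is_smooth_mulr g)).
by apply: tmap_idG => x; exact: gmulgVK.
Qed.

Lemma theta_r1 u : @theta_r _ G gone u = u.
Proof. by apply: tmap_idG => x; rewrite ginv1 gmulg1. Qed.

Lemma theta_l1 u : @theta_l _ G gone u = u.
Proof. by apply: tmap_idG => x; rewrite ginv1 (gmul1g hG). Qed.

Lemma right_field1 u : @right_field _ G u gone = u.
Proof. by apply: tmap_idG => x; rewrite gmulg1. Qed.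

Lemma left_field1 u : @left_field _ G u gone = u.
Proof. by apply: tmap_idG => x; rewrite (gmul1g hG). Qed.

Lemma theta_r_linear g : linear (theta_r g).
Proof. exact: tmap_linear (is_smooth_mulr _). Qed.

Lemma theta_l_linear g : linear (theta_l g).
Proof. exact: tmap_linear (is_smooth_mull _). Qed.

Lemma Ad_linear g : linear (Ad g).
Proof. exact: tmap_linear (is_smooth_conj _). Qed.

Lemma right_field_linear g : linear (fun u => right_field u g).
Proof. exact: tmap_linear (is_smooth_mulr _). Qed.

Lemma conj1 g : gmul (gmul g gone) (ginv g) = gone.
Proof. by rewrite gmulg1 gmulgV. Qed.

Lemma AdM g h u : Ad (gmul g h) u = Ad g (Ad h u).
Proof.
rewrite /Ad -{2}(conj1 h) (tmapGG_comp _ _ (is_smooth_conj h) (is_smooth_conj g)).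
by apply: tmap_ext => x; rewrite ginvM !(gmulA hG).
Qed.

Lemma Ad1 u : Ad (gone : G) u = u.
Proof. by apply: tmap_idG => x; rewrite ginv1 gmulg1 (gmul1g hG). Qed.

Lemma AdVK g u : Ad g (Ad (ginv g) u) = u.
Proof. by rewrite -AdM gmulgV Ad1. Qed.

Lemma AdKV g u : Ad (ginv g) (Ad g u) = u.
Proof. by rewrite -AdM (gmulVg hG) Ad1. Qed.

(** A left translation is a conjugation followed by a right translation. With [theta_l_Ad] this
    moves everything to the right trivialization, where only [theta_r] and [Ad] occur. *)
Lemma left_field_Ad u g : left_field u g = right_field (Ad g u) g.
Proof.
rewrite /left_field /right_field /Ad -{2}(conj1 g).
rewrite (tmapGG_comp _ _ (is_smooth_conj g) (is_smooth_mulr g)).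
by apply: tmap_ext => x; rewrite gmulgVK.
Qed.

Lemma theta_l_Ad g (X : tangent G) : theta_l g X = Ad (ginv g) (theta_r g X).
Proof.
rewrite /theta_l /theta_r /Ad -(gmulgV g).
rewrite (tmapGG_comp _ _ (is_smooth_mulr (ginv g)) (is_smooth_conj (ginv g))).
by apply: tmap_ext => x; rewrite ginvK -!(gmulA hG) (gmulVg hG) gmulg1.
Qed.

Lemma theta_l_left_field u g : theta_l g (left_field u g) = u.
Proof. by rewrite theta_l_Ad left_field_Ad theta_r_right_field AdKV. Qed.

Section LogDerivative.
Variables (M : manifold_data R) (hm : is_manifold M).
Implicit Types f : M -> G.

(** The pullback $f^*\theta^r$, that is, the right logarithmic derivative of f. *)
Definition dlog f (p : M) (v : tangent M) : lie_algebra G :=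
  theta_r (f p) (tmap f p v).

Lemma tmap_mul f1 f2 p v : is_smooth f1 -> is_smooth f2 ->
  tmap (fun x => gmul (f1 x) (f2 x)) p v =
  tmap (fun a => gmul a (f2 p)) (f1 p) (tmap f1 p v) +
  tmap (gmul (f1 p)) (f2 p) (tmap f2 p v).
Proof.
move=> s1 s2; have hP := prod_is_manifold hM hM.
apply: etrans (tmap_comp hm hP hM p v (is_smooth_pair hm hM hM s1 s2) (gmul_smooth hG)) _.
rewrite (tmap_pair hm hM hM p v s1 s2).
exact: (tmap2 hM hM hM (f1 p) (f2 p) _ _ (gmul_smooth hG)).
Qed.

Lemma dlog_cst g p v : dlog (fun _ : M => g) p v = 0.
Proof. by rewrite /dlog tmap_cst; exact: linear0E (theta_r_linear g). Qed.

(** Each term of the product rule is translated back to the unit from the right. The one from f2 has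
    to pass the factor f1 p, which conjugates it. *)
Lemma dlog_mul f1 f2 p v : is_smooth f1 -> is_smooth f2 ->
  dlog (fun x => gmul (f1 x) (f2 x)) p v =
  dlog f1 p v + Ad (f1 p) (dlog f2 p v).
Proof.
move=> s1 s2; rewrite /dlog tmap_mul// (linearDE _ _ (theta_r_linear _)).
apply: (congr2 +%R).
  rewrite /theta_r (tmapGG_comp _ _ (is_smooth_mulr _) (is_smooth_mulr _)).
  by apply: tmap_ext => x; rewrite ginvM (gmulA hG) gmulgK.
rewrite /theta_r (tmapGG_comp _ _ (is_smooth_mull _) (is_smooth_mulr _)).
rewrite /Ad -(gmulgV (f2 p)).
rewrite (tmapGG_comp _ _ (is_smooth_mulr (ginv (f2 p))) (is_smooth_conj (f1 p))).
by apply: tmap_ext => x; rewrite ginvM !(gmulA hG).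
Qed.

(** Obtained by differentiating the constant map $f^{-1} f$. *)
Lemma dlog_inv f p v : is_smooth f ->
  dlog (fun x => ginv (f x)) p v = - Ad (ginv (f p)) (dlog f p v).
Proof.
move=> s; have si := is_smooth_inv hm s.
have := dlog_mul p v si s.
have -> : (fun x => gmul (ginv (f x)) (f x)) = (fun=> gone).
  by apply/funext => x; exact: (gmulVg hG).
by rewrite dlog_cst => /esym/eqP; rewrite addr_eq0 => /eqP.
Qed.

Lemma theta_l_dlog f p v : theta_l (f p) (tmap f p v) = Ad (ginv (f p)) (dlog f p v).
Proof. exact: theta_l_Ad. Qed.

Lemma dlog_eq0 f p v : dlog f p v = 0 <-> tmap f p v = 0.
Proof.
split=> [E|E]; last by rewrite /dlog E; exact: linear0E (theta_r_linear _).
by rewrite -(right_field_theta_r (f p) (tmap f p v)) -/(dlog f p v) E;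
  exact: (linear0E (right_field_linear _)).
Qed.

End LogDerivative.

End LieGroupCalculus.

(** * The bracket and the Maurer-Cartan forms through the second derivative of the multiplication *)

Section LieBracket.
Context {R : realType}.
Local Notation tangent M := 'rV[R]_(mdim M).
Local Notation lie_algebra K := 'rV[R]_(mdim K).
Local Notation "M ** N" := (prod_manifold M N) (at level 40).
Variables (G : lie_group_data R) (hG : is_lie_group G).
Let hM : is_manifold G := lie_group_manifold hG.
Let hP : is_manifold (G ** G) := prod_is_manifold hM hM.
Let e : G := gone.
Let c : tangent G := chart e e.
Let mulG : G ** G -> G := fun x => gmul x.1 x.2.
Let smul : @is_smooth R (G ** G) G mulG := gmul_smooth hG.
Let mu := @rep R (G ** G) G mulG (e, e) e.

Let ee : chart_dom e e. Proof. exact: chart_dom_center. Qed.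

Let mudom (a b : G) : chart_dom e a -> chart_dom e b -> chart_dom e (gmul a b) ->
  @rep_dom R (G ** G) G mulG (e, e) e (row_mx (chart e a) (chart e b)).
Proof.
move=> ea eb eab; split.
  by apply/prod_chart_cod; rewrite row_mxKl row_mxKr; split; exact: chart_codP.
by rewrite /= row_mxKl row_mxKr !chartK.
Qed.

Let mucc : @rep_dom R (G ** G) G mulG (e, e) e (row_mx c c).
Proof. by apply: mudom => //; rewrite (gmul1g hG). Qed.

Let omu : open (@rep_dom R (G ** G) G mulG (e, e) e).
Proof. by apply: rep_dom_open => //; exact: smul.1. Qed.

Let smu : smooth_on (@rep_dom R (G ** G) G mulG (e, e) e) mu.
Proof. exact: rep_smooth. Qed.

(** The value of the field at m is a partial derivative of the multiplication at (1, m). In the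
    chart at the unit the first argument is frozen at c and only the second moves with the point. *)
Lemma right_field_in_chart v y : chart_cod e y ->
  field_in_chart (right_field v) e y = 'D_(row_mx v 0) mu (row_mx c y).
Proof.
move=> ey; set m := chart_inv e y.
have em : chart_dom e m by exact: chart_inv_dom.
have mm : chart_dom m m by exact: chart_dom_center.
have yE : chart e m = y by exact: chart_invK.
pose f x := gmul x m.
have fe : f e = m by exact: (gmul1g hG).
have sf : is_smooth f by exact: is_smooth_mulr.
rewrite -[LHS]/(drep id m e m (right_field v m)).
have -> : right_field v m = drep f e m e v.
  by rewrite -[LHS]/(drep f e (f e) e v) fe.
have mfe : chart_dom m (f e) by rewrite fe.
have efe : chart_dom e (f e) by rewrite fe.
have E := drep_comp hM hM v sf (is_smooth_id hM) ee mfe efe.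
rewrite fe in E; apply: etrans (esym E) _.
apply: etrans (drep_inl hM hM hM v smul ee em efe) _.
by rewrite /drep /= yE.
Qed.

Lemma left_field_in_chart v y : chart_cod e y ->
  field_in_chart (left_field v) e y = 'D_(row_mx 0 v) mu (row_mx y c).
Proof.
move=> ey; set m := chart_inv e y.
have em : chart_dom e m by exact: chart_inv_dom.
have mm : chart_dom m m by exact: chart_dom_center.
have yE : chart e m = y by exact: chart_invK.
pose f x := gmul m x.
have fe : f e = m by exact: (gmulg1 hG).
have sf : is_smooth f by exact: is_smooth_mull.
rewrite -[LHS]/(drep id m e m (left_field v m)).
have -> : left_field v m = drep f e m e v.
  by rewrite -[LHS]/(drep f e (f e) e v) fe.
have mfe : chart_dom m (f e) by rewrite fe.
have efe : chart_dom e (f e) by rewrite fe.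
have E := drep_comp hM hM v sf (is_smooth_id hM) ee mfe efe.
rewrite fe in E; apply: etrans (esym E) _.
apply: etrans (drep_inr hM hM hM v smul em ee efe) _.
by rewrite /drep /= yE.
Qed.

(** The mixed second derivative of the multiplication at the unit, hence the bilinear term of its
    Taylor expansion there. It depends on the chart; its antisymmetric part gives the bracket. *)
Definition mul2 (u v : lie_algebra G) : lie_algebra G :=
  'D_(row_mx u 0) (fun z => 'D_(row_mx 0 v) mu z) (row_mx c c).

Let mul2_sym u v :
  'D_(row_mx 0 v) (fun z => 'D_(row_mx u 0) mu z) (row_mx c c) = mul2 u v.
Proof. exact: derive_sym omu mucc smu. Qed.

Let dDmu w : differentiable (fun z => 'D_w mu z) (row_mx c c).
Proof. exact: smooth_on_diff (smooth_on_derive w smu) mucc. Qed.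

Let near_cod : \forall y \near c, chart_cod e y.
Proof. exact: near_chart_cod. Qed.

Let drowl (a : tangent G) : differentiable (fun y : tangent G => row_mx a y) c.
Proof.
have -> : (fun y : tangent G => row_mx a y) = cst (row_mx a 0) + row_mx 0.
  by apply/funext => y; exact: row_mx_sum_linear.
apply: differentiableD; first exact: differentiable_cst.
exact/differentiable_lin/row_mx_linear2.
Qed.

Let drowr (a : tangent G) : differentiable (fun y : tangent G => row_mx y a) c.
Proof.
have -> : (fun y : tangent G => row_mx y a) = (fun y => row_mx y 0) + cst (row_mx 0 a).
  by apply/funext => y; exact: row_mx_sum_linear.
apply: differentiableD; last exact: differentiable_cst.
exact/differentiable_lin/row_mx_linear1.
Qed.

Let derive_rowl a u : 'D_u (fun y : tangent G => row_mx a y) c = row_mx (0 : tangent G) u.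
Proof.
have dc := @differentiable_cst R (tangent G) (tangent G) a c.
have di : differentiable (@id (tangent G)) c by exact: differentiable_lin.
apply: etrans (derive_row_mx u dc di) _.
by congr row_mx; [exact: derive_cst|exact: derive_id].
Qed.

Let derive_rowr a u : 'D_u (fun y : tangent G => row_mx y a) c = row_mx u (0 : tangent G).
Proof.
have dc := @differentiable_cst R (tangent G) (tangent G) a c.
have di : differentiable (@id (tangent G)) c by exact: differentiable_lin.
apply: etrans (derive_row_mx u di dc) _.
by congr row_mx; [exact: derive_id|exact: derive_cst].
Qed.

Let right_field_near v : \forall y \near c,
  ((fun z => 'D_(row_mx v 0) mu z) \o (fun y => row_mx c y)) y =
  field_in_chart (right_field v) e y.
Proof. by apply: filterS near_cod => y ey; rewrite right_field_in_chart. Qed.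

Let left_field_near v : \forall y \near c,
  ((fun z => 'D_(row_mx 0 v) mu z) \o (fun y => row_mx y c)) y =
  field_in_chart (left_field v) e y.
Proof. by apply: filterS near_cod => y ey; rewrite left_field_in_chart. Qed.

Lemma right_field_in_chart_diff v :
  differentiable (field_in_chart (right_field v) e) c.
Proof.
apply: differentiable_ext (right_field_near v) _.
exact: differentiable_comp (drowl c) (dDmu _).
Qed.

Lemma left_field_in_chart_diff v :
  differentiable (field_in_chart (left_field v) e) c.
Proof.
apply: differentiable_ext (left_field_near v) _.
exact: differentiable_comp (drowr c) (dDmu _).
Qed.

Lemma derive_right_field u v :
  'D_u (field_in_chart (right_field v) e) c = mul2 v u.
Proof.
apply: etrans (esym (near_eq_derive u (right_field_near v))) _.
apply: etrans (derive_comp u (drowl c) (dDmu _)) _.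
by rewrite derive_rowl mul2_sym.
Qed.

Lemma derive_left_field u v :
  'D_u (field_in_chart (left_field v) e) c = mul2 u v.
Proof.
apply: etrans (esym (near_eq_derive u (left_field_near v))) _.
apply: etrans (derive_comp u (drowr c) (dDmu _)) _.
by rewrite derive_rowr.
Qed.

(** The order of the arguments reflects the convention of right-invariant fields: $v^r$ varies with
    the second factor of the multiplication, so its derivative along u is [mul2 v u]. *)
Lemma lie_bracket_mul2 u v : lie_bracket u v = mul2 v u - mul2 u v :> lie_algebra G.
Proof.
have E x y : 'D_(@right_field _ G x gone) (field_in_chart (right_field y) gone)
    (@chart _ G gone gone) = mul2 y x.
  by rewrite (right_field1 hG); exact: derive_right_field.
exact (congr2 (fun x y : tangent G => x - y) (E u v) (E v u)).
Qed.

Lemma mul2_linear1 v : linear (mul2^~ v).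
Proof.
have l := derive_linE (dDmu (row_mx 0 v)).
by move=> a u w; rewrite /mul2 row_mx_linear1; exact: l.
Qed.

Lemma mul2_linear2 u : linear (mul2 u).
Proof.
have l := derive_linE (dDmu (row_mx u 0)).
by move=> a v w; rewrite -!mul2_sym row_mx_linear2; exact: l.
Qed.

Section Commutator.
Variables (n : nat) (b : 'rV[R]_n -> 'rV[R]_n -> 'rV[R]_n).
Hypotheses (b1 : forall v, linear (b^~ v)) (b2 : forall u, linear (b u)).

Lemma commutator_linear2 u : linear (fun v => b v u - b u v).
Proof. by move=> a v w; rewrite b1 b2 scalerBr opprD addrACA. Qed.

End Commutator.

Lemma lie_bracket_linear2 u : linear (fun v : lie_algebra G => lie_bracket u v).
Proof.
have -> : (fun v : lie_algebra G => lie_bracket u v) = (fun v => mul2 v u - mul2 u v).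
  by apply/funext => v; exact: lie_bracket_mul2.
exact (commutator_linear2 mul2_linear1 mul2_linear2 u).
Qed.

Lemma lie_bracketC u v : lie_bracket u v = - lie_bracket v u :> lie_algebra G.
Proof. exact (esym (opprB _ _)). Qed.

Lemma lie_bracket_self u : lie_bracket u u = 0 :> lie_algebra G.
Proof. exact (subrr _). Qed.

Definition theta_r_in_chart p u (y : tangent G) : lie_algebra G :=
  theta_r (chart_inv p y) (from_chart p (chart_inv p y) u).
Definition theta_l_in_chart p u (y : tangent G) : lie_algebra G :=
  theta_l (chart_inv p y) (from_chart p (chart_inv p y) u).

Lemma theta_r_in_chart_smooth p u : smooth_on (chart_cod p) (theta_r_in_chart p u).
Proof.
pose F : G ** G -> G := fun x => gmul x.1 (ginv x.2).
have sF : @is_smooth R (G ** G) G F.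
  apply: (is_smooth_mul hG hP); first exact: is_smooth_fst.
  apply: (is_smooth_inv hG hP); exact: is_smooth_snd.
exact: (smooth_partial_diag hM hM p u sF (gmulgV hG)).
Qed.

Lemma theta_l_in_chart_smooth p u : smooth_on (chart_cod p) (theta_l_in_chart p u).
Proof.
pose F : G ** G -> G := fun x => gmul (ginv x.2) x.1.
have sF : @is_smooth R (G ** G) G F.
  apply: (is_smooth_mul hG hP); last exact: is_smooth_fst.
  apply: (is_smooth_inv hG hP); exact: is_smooth_snd.
exact: (smooth_partial_diag hM hM p u sF (gmulVg hG)).
Qed.

Lemma theta_r_in_chart_linear p y : chart_cod p y ->
  linear (fun u => theta_r_in_chart p u y).
Proof.
move=> py a u v; rewrite /theta_r_in_chart.
by rewrite (from_chart_linear hM (chart_inv_dom hM py)); exact: theta_r_linear.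
Qed.

Lemma theta_l_in_chart_linear p y : chart_cod p y ->
  linear (fun u => theta_l_in_chart p u y).
Proof.
move=> py a u v; rewrite /theta_l_in_chart.
by rewrite (from_chart_linear hM (chart_inv_dom hM py)); exact: theta_l_linear.
Qed.

Lemma from_to_chart (p m : G) (u : tangent G) : chart_dom p m ->
  from_chart p m (to_chart p m u) = u.
Proof.
move=> pm; have mm : chart_dom m m by exact: chart_dom_center.
have si := is_smooth_id hM.
apply: etrans (esym (drep_comp hM hM u si si mm pm mm)) _.
exact: drep_id.
Qed.

Let inv_c : chart_inv e c = e. Proof. exact: chartK. Qed.

Let cod_c : chart_cod e c. Proof. exact: chart_codP. Qed.

Let theta_r_c u : theta_r_in_chart e u c = u.
Proof. by rewrite /theta_r_in_chart inv_c (from_chart_id hM) (theta_r1 hG). Qed.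

Let theta_l_c u : theta_l_in_chart e u c = u.
Proof. by rewrite /theta_l_in_chart inv_c (from_chart_id hM) (theta_l1 hG). Qed.

Let to_chart_id u : to_chart e e u = u.
Proof. exact: drep_id. Qed.

Let right_field_c v : field_in_chart (right_field v) e c = v.
Proof. by rewrite /field_in_chart inv_c (right_field1 hG) to_chart_id. Qed.

Let left_field_c v : field_in_chart (left_field v) e c = v.
Proof. by rewrite /field_in_chart inv_c (left_field1 hG) to_chart_id. Qed.

(* The Maurer-Cartan equation, before antisymmetrization, at the unit. *)
Lemma derive_theta_r u v : 'D_u (theta_r_in_chart e v) c = - mul2 v u.
Proof.
have l : \forall y \near c, linear (fun w => theta_r_in_chart e w y).
  by apply: filterS near_cod => y ey; exact: theta_r_in_chart_linear.
have d w : differentiable (theta_r_in_chart e w) c.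
  exact: smooth_on_diff (theta_r_in_chart_smooth e w) cod_c.
have E : \forall y \near c,
    theta_r_in_chart e (field_in_chart (right_field v) e y) y = v.
  apply: filterS near_cod => y ey; rewrite /theta_r_in_chart /field_in_chart.
  rewrite from_to_chart ?(theta_r_right_field hG)//.
  exact: chart_inv_dom.
have := derive_app u l d (right_field_in_chart_diff v).
rewrite right_field_c theta_r_c derive_right_field => D.
apply/eqP; rewrite -addr_eq0 -D; apply/eqP.
by apply: etrans (near_eq_derive u E) _; exact: derive_cst.
Qed.

(** The form $\theta^l$ is constant on a left-invariant field; the product rule therefore makes its
    derivative on a fixed vector opposite to the derivative of the field. *)
Lemma derive_theta_l u v : 'D_u (theta_l_in_chart e v) c = - mul2 u v.
Proof.
have l : \forall y \near c, linear (fun w => theta_l_in_chart e w y).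
  by apply: filterS near_cod => y ey; exact: theta_l_in_chart_linear.
have d w : differentiable (theta_l_in_chart e w) c.
  exact: smooth_on_diff (theta_l_in_chart_smooth e w) cod_c.
have E : \forall y \near c,
    theta_l_in_chart e (field_in_chart (left_field v) e y) y = v.
  apply: filterS near_cod => y ey; rewrite /theta_l_in_chart /field_in_chart.
  rewrite from_to_chart ?(theta_l_left_field hG)//.
  exact: chart_inv_dom.
have := derive_app u l d (left_field_in_chart_diff v).
rewrite left_field_c theta_l_c derive_left_field => D.
apply/eqP; rewrite -addr_eq0 -D; apply/eqP.
by apply: etrans (near_eq_derive u E) _; exact: derive_cst.
Qed.

End LieBracket.

(** * Morphisms of Lie groups, product groups and brackets *)

Section Morphisms.
Context {R : realType}.
Local Notation tangent M := 'rV[R]_(mdim M).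
Local Notation lie_algebra K := 'rV[R]_(mdim K).
Local Notation "M ** N" := (prod_manifold M N) (at level 40).

Lemma lie_bracketE (G : lie_group_data R) (hG : is_lie_group G) (u v : lie_algebra G) :
  lie_bracket u v = 'D_u (field_in_chart (right_field v) gone) (@chart _ G gone gone)
    - 'D_v (field_in_chart (right_field u) gone) (@chart _ G gone gone).
Proof.
have H x y := congr1 (fun w => 'D_w (field_in_chart (right_field y) gone)
  (@chart _ G gone gone)) (right_field1 hG x).
exact (congr2 (fun x y : tangent G => x - y) (H u v) (H v u)).
Qed.

Section BracketMorphism.
Variables (K L : lie_group_data R) (hK : is_lie_group K) (hL : is_lie_group L).
Let mK : is_manifold K := lie_group_manifold hK.
Let mL : is_manifold L := lie_group_manifold hL.
Variables (f : K -> L) (hf : is_lie_group_morphism f).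
Let sf : is_smooth f := hf.1.

Lemma morphism1 : f gone = gone.
Proof.
have := hf.2 gone gone; rewrite (gmul1g hK) => E.
by rewrite -[LHS](gmulKg hL (f gone)) -E (gmulVg hL).
Qed.

Lemma morphismV x : f (ginv x) = ginv (f x).
Proof.
by apply/esym/(ginv_unique hL); rewrite -hf.2 (gmulgV hK) morphism1.
Qed.

(** Differentiates $f \circ R_m = R_{f(m)} \circ f$ at the unit: the right-invariant fields of v and
    of its image are f-related. *)
Lemma tmap_right_field v m :
  tmap f m (right_field v m) = right_field (tmap f gone v) (f m).
Proof.
have E1 := tmap_comp mK mK mL gone v (is_smooth_mulr hK m) sf.
have E2 := tmap_comp mK mL mL gone v sf (is_smooth_mulr hL (f m)).
have Ef : f \o (fun x => gmul x m) = (fun y => gmul y (f m)) \o f.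
  by apply/funext => x; exact: hf.2.
rewrite Ef /= (gmul1g hK) in E1; rewrite morphism1 in E2.
exact (etrans (esym E1) E2).
Qed.

Let c : tangent K := chart gone gone.
Let F := rep f (gone : K) (gone : L).
Let ee : @chart_dom _ K gone gone. Proof. exact: chart_dom_center. Qed.
Let ee' : @chart_dom _ L gone gone. Proof. exact: chart_dom_center. Qed.
Let fe : chart_dom (gone : L) (f gone). Proof. by rewrite morphism1. Qed.
Let cdom : rep_dom f (gone : K) (gone : L) c.
Proof. exact: rep_domP. Qed.
Let odom : open (rep_dom f (gone : K) (gone : L)).
Proof. by apply: rep_dom_open => //; exact: sf.1. Qed.
Let sF : smooth_on (rep_dom f (gone : K) (gone : L)) F.
Proof. exact: rep_smooth. Qed.
Let near_dom : \forall y \near c, rep_dom f (gone : K) (gone : L) y.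
Proof. exact: open_nbhs_nbhs (conj odom cdom). Qed.
Let Fc : F c = @chart _ L gone gone.
Proof. by rewrite /F /rep /c /= chartK// morphism1. Qed.
Let dF : differentiable F c. Proof. exact: smooth_on_diff sF cdom. Qed.
Let tmapE1 u : 'D_u F c = tmap f gone u.
Proof. by rewrite /tmap morphism1. Qed.
Let S u v := 'D_u (fun y => 'D_v F y) c.

Let in_chart v : \forall y \near c,
  'D_(field_in_chart (right_field v) gone y) F y =
  (field_in_chart (right_field (tmap f gone v)) gone \o F) y.
Proof.
apply: filterS near_dom => y hy; have [ey fy] := hy.
set m := chart_inv (gone : K) y.
have em : chart_dom (gone : K) m by exact: chart_inv_dom.
have mm : chart_dom m m by exact: chart_dom_center.
have mm' : chart_dom (f m) (f m) by exact: chart_dom_center.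
have yE : chart (gone : K) m = y by exact: chart_invK.
have E1 := drep_comp mK mK (right_field v m) (is_smooth_id mK) sf mm em fy.
have E2 := drep_comp mK mL (right_field v m) sf (is_smooth_id mL) mm mm' fy.
have A W : drep f gone gone m W = 'D_W F y by rewrite /drep yE.
have Fy : chart_inv gone (F y) = f m by exact (rep_inv mL hy).
have Bf X : field_in_chart X gone (F y) = drep id (f m) gone (f m) (X (f m)).
  by rewrite -Fy.
have T := tmap_right_field v m.
exact (etrans (esym (A _)) (etrans (esym E1) (etrans E2
  (etrans (congr1 (drep id (f m) gone (f m)) T) (esym (Bf _)))))).
Qed.

(** Differentiating along u the relation between the two fields, written in charts at the units,
    produces a second derivative of f besides the two wanted terms. *)
Let derived u v :
  S u v + tmap f gone ('D_u (field_in_chart (right_field v) gone) c) =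
  'D_(tmap f gone u) (field_in_chart (right_field (tmap f gone v)) gone)
    (@chart _ L gone gone).
Proof.
have l : \forall y \near c, linear (fun a => 'D_a F y).
  apply: filterS near_dom => y hy; apply: derive_linE; exact: smooth_on_diff sF hy.
have d w : differentiable (fun y => 'D_w F y) c.
  exact: smooth_on_diff (smooth_on_derive w sF) cdom.
have D1 := derive_app u l d (right_field_in_chart_diff hK v).
have D2 := near_eq_derive u (in_chart v).
have dR := right_field_in_chart_diff hL (tmap f gone v).
rewrite -Fc in dR; have D3 := derive_comp u dF dR.
have E : field_in_chart (right_field v) gone c = v.
  rewrite /field_in_chart /c (chartK mK ee) (right_field1 hK).
  exact: drep_id.
rewrite E tmapE1 in D1; rewrite tmapE1 Fc in D3.
exact (etrans (esym D1) (etrans D2 D3)).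
Qed.

(** The second derivative [S] of f is symmetric, so it disappears from the difference of the two
    relations [derived]. *)
Lemma morphism_bracket u v :
  tmap f gone (lie_bracket u v) = lie_bracket (tmap f gone u) (tmap f gone v).
Proof.
have E1 := derived u v; have E2 := derived v u.
have S12 : S u v = S v u by exact (derive_sym u v odom cdom sF).
have H1 := lie_bracketE hK u v.
have H2 := lie_bracketE hL (tmap f gone u) (tmap f gone v).
have H3 := congr2 (fun x y : tangent L => x - y) E1 E2.
have H4 := congr1 (tmap f gone) H1.
have H5 := linearBE ('D_u (field_in_chart (right_field v) gone) c)
  ('D_v (field_in_chart (right_field u) gone) c) (tmap_linear mK mL gone sf).
have H6 (a b s t : tangent L) : s = t -> (s + a) - (t + b) = a - b.
  by move=> ->; rewrite opprD addrACA subrr add0r.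
exact (etrans H4 (etrans H5 (etrans (esym (H6 _ _ _ _ S12)) (etrans H3 (esym H2))))).
Qed.

End BracketMorphism.

Lemma prod_is_lie_group (K L : lie_group_data R) :
  is_lie_group K -> is_lie_group L -> is_lie_group (prod_lie_group K L).
Proof.
move=> hK hL; have mK := lie_group_manifold hK; have mL := lie_group_manifold hL.
have mP := prod_is_manifold mK mL; have mPP := prod_is_manifold mP mP.
have s1 : @is_smooth R ((K ** L) ** (K ** L)) (K ** L) fst by exact: is_smooth_fst.
have s2 : @is_smooth R ((K ** L) ** (K ** L)) (K ** L) snd by exact: is_smooth_snd.
have sf : @is_smooth R (K ** L) K fst by exact: is_smooth_fst.
have ss : @is_smooth R (K ** L) L snd by exact: is_smooth_snd.
split.
- exact: mP.
- by move=> [a1 a2] [b1 b2] [c1 c2]; rewrite /= (gmulA hK) (gmulA hL).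
- by move=> [a1 a2]; rewrite /= (gmul1g hK) (gmul1g hL).
- by move=> [a1 a2]; rewrite /= (gmulVg hK) (gmulVg hL).
- apply: (is_smooth_pair mPP mK mL).
  + apply: (is_smooth_mul hK mPP).
      exact: (is_smooth_comp mPP mP mK s1 sf).
    exact: (is_smooth_comp mPP mP mK s2 sf).
  + apply: (is_smooth_mul hL mPP).
      exact: (is_smooth_comp mPP mP mL s1 ss).
    exact: (is_smooth_comp mPP mP mL s2 ss).
- apply: (is_smooth_pair mP mK mL); first exact: (is_smooth_inv hK mP).
  exact: (is_smooth_inv hL mP).
Qed.

Section ProductBracket.
Variables (K L : lie_group_data R) (hK : is_lie_group K) (hL : is_lie_group L).
Let mK : is_manifold K := lie_group_manifold hK.
Let mL : is_manifold L := lie_group_manifold hL.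
Let P := prod_lie_group K L.
Let hP : is_lie_group P := prod_is_lie_group hK hL.

Lemma fst_morphism : @is_lie_group_morphism R P K fst.
Proof. by split=> //; exact: (is_smooth_fst mK mL). Qed.

Lemma snd_morphism : @is_lie_group_morphism R P L snd.
Proof. by split=> //; exact: (is_smooth_snd mK mL). Qed.

(** Read off from the images under the two projections, which are morphisms and whose differentials
    are the two blocks. *)
Lemma lie_bracket_prod (u v : lie_algebra P) :
  lie_bracket u v = row_mx (@lie_bracket R K (lsubmx u) (lsubmx v))
                           (@lie_bracket R L (rsubmx u) (rsubmx v)).
Proof.
rewrite -[LHS]hsubmxK; congr row_mx.
  have := morphism_bracket hP hK fst_morphism u v.
  by rewrite !(tmap_fst mK mL).
have := morphism_bracket hP hL snd_morphism u v.
by rewrite !(tmap_snd mK mL).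
Qed.

End ProductBracket.

Section AdMorphism.
Variables (G : lie_group_data R) (hG : is_lie_group G).
Let hM : is_manifold G := lie_group_manifold hG.

Lemma conj_morphism (g : G) :
  is_lie_group_morphism (fun x : G => gmul (gmul g x) (ginv g)).
Proof.
split; first exact: is_smooth_conj.
by move=> x y; rewrite !(gmulA hG) (gmulgVK hG).
Qed.

Lemma Ad_bracket (g : G) (u v : lie_algebra G) :
  Ad g (lie_bracket u v) = lie_bracket (Ad g u) (Ad g v).
Proof. exact: (morphism_bracket hG hG (conj_morphism g) u v). Qed.

End AdMorphism.

End Morphisms.

(** * The canonical 2-shifted symplectic form *)

(* Unification would otherwise unfold these down to limits of difference quotients. *)
Local Opaque derive tmap theta_l theta_r Ad lie_bracket right_field left_field.

Section Algebra.
Context {R : realType}.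

Section Trilinear.
Variables (n : nat) (T : 'rV[R]_n -> 'rV[R]_n -> 'rV[R]_n -> R).
Hypotheses (T3 : forall x y, scalar (T x y)) (Tcyc : forall x y z, T x y z = T y z x).

Lemma cyclic_linear1 y z : scalar (fun x => T x y z).
Proof. by move=> a x w; rewrite !(Tcyc _ y z); exact: T3. Qed.

Lemma cyclic_linear2 x z : scalar (fun y => T x y z).
Proof. by move=> a y w; rewrite !(Tcyc x) !(Tcyc _ z x); exact: T3. Qed.

(** The six mixed terms are arranged as in the value of $d\Omega_G$ at the unit, with the $a_i$
    coming from the first factor of $G \times G$ and the $b_i$ from the second. *)
Lemma cyclic_trilinear_add a1 a2 a3 b1 b2 b3 :
  T (a1 + b1) (a2 + b2) (a3 + b3) =
  T a1 a2 a3 + T b1 b2 b3 +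
  (T b3 a1 a2 + T b1 a2 a3 + T b2 a3 a1 + T a1 b2 b3 + T a2 b3 b1 + T a3 b1 b2).
Proof.
rewrite !(scalarD _ _ (cyclic_linear1 _ _)) !(scalarD _ _ (cyclic_linear2 _ _)).
rewrite !(scalarD _ _ (T3 _ _)) (Tcyc b3 a1) (Tcyc b2 a3) (Tcyc a3 a1).
rewrite (Tcyc a2 b3) (Tcyc b3 b1) (Tcyc a3 b1).
ring.
Qed.

End Trilinear.

(** Here f and g stand for Ad of the first two factors, [fi] and [gi] for their inverses and [gfi]
    for the inverse of Ad of their product. The vectors X, Y, Z are the logarithmic derivatives of
    the three factors along one tangent vector, and the primed ones along another. *)
Lemma cocycle_algebra n (B : 'rV[R]_n -> 'rV[R]_n -> R) (f fi g gi gfi : 'rV[R]_n -> 'rV[R]_n)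
    h X X' Y Y' Z Z' :
  (forall u, scalar (B u)) -> (forall v, scalar (B^~ v)) ->
  (forall u v, fi (u + v) = fi u + fi v) -> (forall u v, gi (u + v) = gi u + gi v) ->
  (forall u, fi (f u) = u) -> (forall u v, B (gi u) v = B u (g v)) ->
  (forall u, gfi u = gi (fi u)) ->
  h * (B (gi Y) Z' - B (gi Y') Z)
  - h * (B (gfi (X + f Y)) Z' - B (gfi (X' + f Y')) Z)
  + h * (B (fi X) (Y' + g Z') - B (fi X') (Y + g Z))
  - h * (B (fi X) Y' - B (fi X') Y) = 0.
Proof.
move=> B2 B1 fiD giD fK gB gf.
rewrite !gf !fiD !fK !giD !(scalarD _ _ (B1 _)) !(scalarD _ _ (B2 _)) !gB; ring.
Qed.

End Algebra.

Section Canonical.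
Context {R : realType}.
Local Notation tangent M := 'rV[R]_(mdim M).
Local Notation lie_algebra K := 'rV[R]_(mdim K).
Local Notation "M ** N" := (prod_manifold M N) (at level 40).
Variables (G : lie_group_data R) (hG : is_lie_group G).
Variables (B : lie_algebra G -> lie_algebra G -> R).
Hypotheses (hB : is_quadratic B) (hAd : is_Ad_invariant B).
Let hM : is_manifold G := lie_group_manifold hG.
Let hP : is_manifold (G ** G) := prod_is_manifold hM hM.
Let S := canonical_shifted B.
Let Om : form2 (G ** G) := sh_Omega S.
Let Th : form3 G := sh_Theta S.

Lemma B_linear2 u : scalar (B u). Proof. exact: quadratic_linear. Qed.

Lemma B_linear1 v : scalar (B^~ v).
Proof. by move=> a u w; rewrite !(quadratic_sym hB _ v); exact: B_linear2. Qed.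

Lemma BDl u v w : B (u + v) w = B u w + B v w.
Proof. exact: (scalarD _ _ (B_linear1 w)). Qed.
Lemma BNl u v : B (- u) v = - B u v.
Proof. exact: (scalarN _ (B_linear1 v)). Qed.
Lemma BNr u v : B u (- v) = - B u v.
Proof. exact: (scalarN _ (B_linear2 u)). Qed.
Lemma BBl u v w : B (u - v) w = B u w - B v w.
Proof. by rewrite BDl BNl. Qed.
Lemma B0l u : B 0 u = 0. Proof. exact: (scalar0 (B_linear1 u)). Qed.
Lemma B0r u : B u 0 = 0. Proof. exact: (scalar0 (B_linear2 u)). Qed.
Lemma BZr a u v : B u (a *: v) = a * B u v.
Proof. by have := scalar_scale a v (B_linear2 u). Qed.

Lemma B_Ad (g : G) u v : B (Ad g u) v = B u (Ad (ginv g) v).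
Proof. by rewrite -(hAd g u (Ad (ginv g) v)) (AdVK hG). Qed.

Lemma B_AdV (g : G) u v : B (Ad (ginv g) u) v = B u (Ad g v).
Proof. by rewrite B_Ad (ginvK hG). Qed.

(** The Cartan 3-form of the quadratic Lie algebra. *)
Definition cartan3 (x y z : lie_algebra G) : R := B x (lie_bracket y z).

(** Infinitesimal invariance of B combined with antisymmetry of the bracket. *)
Lemma cartan3_cyc x y z : cartan3 x y z = cartan3 y z x.
Proof.
rewrite /cartan3.
have Q := quadratic_inv hB z x y.
have -> : lie_bracket y z = - lie_bracket z y :> lie_algebra G by exact (lie_bracketC y z).
by rewrite BNr; apply/eqP; rewrite eq_sym -addr_eq0 quadratic_sym// Q.
Qed.

Lemma cartan3_linear3 x y : scalar (cartan3 x y).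
Proof.
move=> a z w; rewrite /cartan3 (lie_bracket_linear2 hG y a z w); exact: B_linear2.
Qed.

Lemma cartan3_linear2 x z : scalar (fun y => cartan3 x y z).
Proof. exact (cyclic_linear2 cartan3_linear3 cartan3_cyc x z). Qed.

Lemma cartan3_linear1 y z : scalar (fun x => cartan3 x y z).
Proof. exact (cyclic_linear1 cartan3_linear3 cartan3_cyc y z). Qed.

Lemma cartan3_alt23 x y : cartan3 x y y = 0.
Proof.
by rewrite /cartan3 -[RHS](B0r x); congr (B x _); exact (lie_bracket_self y).
Qed.

Lemma cartan3_alt12 x y : cartan3 x x y = 0.
Proof. by rewrite 2!cartan3_cyc; exact: cartan3_alt23. Qed.

Lemma cartan3_Ad (g : G) x y z : cartan3 (Ad g x) (Ad g y) (Ad g z) = cartan3 x y z.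
Proof.
rewrite /cartan3 -[RHS](hAd g); congr (B _ _).
exact (esym (Ad_bracket hG g y z)).
Qed.

Lemma cartan3N x y z : cartan3 (- x) (- y) (- z) = - cartan3 x y z.
Proof.
rewrite (scalarN _ (cartan3_linear1 _ _)) (scalarN _ (cartan3_linear2 _ _)).
by rewrite (scalarN _ (cartan3_linear3 _ _)) opprK.
Qed.

(** The three cyclic terms of the wedge product coincide and each carries the factor 2 of
    $[\theta, \theta]$; hence $-\frac1{12} \cdot 2 \cdot 3 = -\frac12$. *)
Lemma ThetaE (g : G) X Y Z :
  Th g X Y Z = - 2^-1 * cartan3 (theta_l g X) (theta_l g Y) (theta_l g Z).
Proof.
have key x y z : - 12^-1 * (B x (2 *: lie_bracket y z) + B y (2 *: lie_bracket z x)
    + B z (2 *: lie_bracket x y)) = - 2^-1 * cartan3 x y z.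
  rewrite !BZr -[B y _]/(cartan3 y z x) -[B z _]/(cartan3 z x y) -[B x _]/(cartan3 x y z).
  have -> : cartan3 z x y = cartan3 x y z by exact (cartan3_cyc z x y).
  have -> : cartan3 y z x = cartan3 x y z by exact (esym (cartan3_cyc x y z)).
  move: (cartan3 x y z) => t; lra.
exact (key _ _ _).
Qed.

Lemma OmegaE (p : G ** G) (X Y : tangent (G ** G)) :
  Om p X Y = - 2^-1 * (B (theta_l p.1 (lsubmx X)) (theta_r p.2 (rsubmx Y))
                      - B (theta_l p.1 (lsubmx Y)) (theta_r p.2 (rsubmx X))).
Proof. by rewrite -!(tmap_fst hM hM p) -!(tmap_snd hM hM p). Qed.

Lemma Omega_row (a b : G) (x x' y y' : lie_algebra G) :
  Om (a, b) (row_mx x y) (row_mx x' y') =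
  - 2^-1 * (B (theta_l a x) (theta_r b y') - B (theta_l a x') (theta_r b y)).
Proof. by rewrite OmegaE !row_mxKl !row_mxKr. Qed.

Section Pullback.
Variables (M : manifold_data R) (hm : is_manifold M).

Definition Omega_pull (f g : M -> G) : form2 M :=
  @pullback2 R M (G ** G) (fun x => (f x, g x)) Om.

Lemma Omega_pullE (f g : M -> G) p u v : is_smooth f -> is_smooth g ->
  Omega_pull f g p u v =
  - 2^-1 * (B (Ad (ginv (f p)) (dlog f p u)) (dlog g p v)
            - B (Ad (ginv (f p)) (dlog f p v)) (dlog g p u)).
Proof.
move=> sf sg.
have E x : @tmap R M (G ** G) (fun x => (f x, g x)) p x = row_mx (tmap f p x) (tmap g p x).
  exact (tmap_pair hm hM hM p x sf sg).
apply: (etrans (congr2 (Om (f p, g p)) (E u) (E v))).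
apply: (etrans (Omega_row _ _ _ _ _ _)).
have E' x := theta_l_dlog hG f p x.
exact (congr1 (fun z => - 2^-1 * z) (congr2 (fun x y => B x _ - B y _) (E' u) (E' v))).
Qed.

(** Passing from $\theta^l$ to $\theta^r$ applies one and the same Ad to all three arguments, and
    the Cartan form is Ad-invariant. *)
Lemma Theta_pullE (f : M -> G) p u v w : is_smooth f ->
  pullback3 f Th p u v w =
  - 2^-1 * cartan3 (dlog f p u) (dlog f p v) (dlog f p w).
Proof.
move=> sf; have E x := theta_l_dlog hG f p x.
have H := etrans (congr2 (fun a b => cartan3 a b _) (E u) (E v)) (congr1 _ (E w)).
have H' := etrans H (cartan3_Ad (ginv (f p)) _ _ _).
exact (etrans (ThetaE (f p) (tmap f p u) (tmap f p v) (tmap f p w))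
  (congr1 (fun z => - 2^-1 * z) H')).
Qed.

(* The Polyakov-Wiegmann identity. *)
Lemma Omega_cocycle (f g h : M -> G) p u v :
  is_smooth f -> is_smooth g -> is_smooth h ->
  Omega_pull g h p u v - Omega_pull (fun x => gmul (f x) (g x)) h p u v
  + Omega_pull f (fun x => gmul (g x) (h x)) p u v - Omega_pull f g p u v = 0.
Proof.
move=> sf sg sh; have sfg := is_smooth_mul hG hm sf sg.
have sgh := is_smooth_mul hG hm sg sh.
rewrite !Omega_pullE// !(dlog_mul hG hm)//.
rewrite !(ginvM hG).
exact (cocycle_algebra (- 2^-1) _ _ _ _ _ _ B_linear2 B_linear1
  (fun u v => linearDE u v (Ad_linear hG _)) (fun u v => linearDE u v (Ad_linear hG _))
  (AdKV hG (f p)) (B_AdV (g p)) (AdM hG (ginv (g p)) (ginv (f p)))).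
Qed.

End Pullback.

End Canonical.

Local Transparent derive tmap theta_l theta_r Ad lie_bracket right_field left_field.

Section WedgeLinear.
Context {R : realType}.

Lemma smooth_onB m (U : set 'rV[R]_m) (f g : 'rV[R]_m -> R^o) : open U ->
  smooth_on U f -> smooth_on U g -> smooth_on U (fun x => f x - g x : R^o).
Proof.
move=> oU sf sg; have sg' := smooth_onZ (-1) oU sg.
apply: (smooth_on_ext oU _ (smooth_onD oU sf sg')) => x _.
by rewrite mulN1r.
Qed.

Lemma scalar_ext n (f g : 'rV[R]_n -> R) : f =1 g -> scalar g -> scalar f.
Proof. by move=> /funext->. Qed.

Variables (m n : nat) (B : 'rV[R]_n -> 'rV[R]_n -> R) (a b : 'rV[R]_m -> 'rV[R]_n).
Variables (h : R) (y z : 'rV[R]_n).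
Hypotheses (B1 : forall v, scalar (B^~ v)) (B2 : forall u, scalar (B u)).
Hypotheses (la : linear a) (lb : linear b).

Lemma wedge_scalar1 : scalar (fun u => h * (B (a u) y - B z (b u))).
Proof. by move=> c u v; rewrite la lb B1 B2; ring. Qed.

Lemma wedge_scalar2 : scalar (fun u => h * (B z (b u) - B (a u) y)).
Proof. by move=> c u v; rewrite la lb B1 B2; ring. Qed.

End WedgeLinear.

(** * Bilinearity, alternation and smoothness of the canonical forms *)

Section CanonicalForms.
Context {R : realType}.
Local Notation tangent M := 'rV[R]_(mdim M).
Local Notation lie_algebra K := 'rV[R]_(mdim K).
Local Notation "M ** N" := (prod_manifold M N) (at level 40).
Variables (G : lie_group_data R) (hG : is_lie_group G).
Variables (B : lie_algebra G -> lie_algebra G -> R).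
Hypotheses (hB : is_quadratic B) (hAd : is_Ad_invariant B).
Let hM : is_manifold G := lie_group_manifold hG.
Let hP : is_manifold (G ** G) := prod_is_manifold hM hM.
Let S := canonical_shifted B.
Let Om : form2 (G ** G) := sh_Omega S.
Let Th : form3 G := sh_Theta S.

Let OmE p X Y : Om p X Y = - 2^-1 * (B (theta_l p.1 (lsubmx X)) (theta_r p.2 (rsubmx Y))
                      - B (theta_l p.1 (lsubmx Y)) (theta_r p.2 (rsubmx X))).
Proof. exact: OmegaE. Qed.

Let ThE g X Y Z : Th g X Y Z =
  - 2^-1 * cartan3 B (theta_l g X) (theta_l g Y) (theta_l g Z).
Proof. exact: ThetaE. Qed.

Let linB2 u : linear (B u : _ -> R^o). Proof. exact: B_linear2. Qed.
Let linB1 v : linear (B^~ v : _ -> R^o). Proof. exact: B_linear1. Qed.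

Lemma smooth_on_B m (U : set 'rV[R]_m) (a b : 'rV[R]_m -> lie_algebra G) :
  open U -> smooth_on U a -> smooth_on U b ->
  smooth_on U (fun x => B (a x) (b x) : R^o).
Proof.
move=> oU sa sb; apply: (smooth_on_appR2 (phi := fun _ u v => B u v : R^o)) => //.
by move=> u v k; exact: Ck_on_cst.
Qed.

Lemma derive_B m (a b : 'rV[R]_m -> lie_algebra G) x v :
  differentiable a x -> differentiable b x ->
  differentiable (fun x => B (a x) (b x) : R^o) x /\
  'D_v (fun x => B (a x) (b x) : R^o) x = B ('D_v a x) (b x) + B (a x) ('D_v b x).
Proof.
move=> da db.
have l2 : \forall y \near x, forall u, linear (B u : _ -> R^o) by apply: filterE => y; exact: linB2.
have l1 : \forall y \near x, forall v, linear (B^~ v : _ -> R^o) by apply: filterE => y; exact: linB1.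
have dB u1 u2 : differentiable (fun y : 'rV[R]_m => B u1 u2 : R^o) x.
  exact: differentiable_cst.
have [d E] := derive_appR2 (phi := fun _ u v => B u v : R^o) l2 l1 dB da db.
split; first exact: d.
have E' := derive_cst (B (a x) (b x) : R^o) x v.
have {}E := etrans (E v) (congr1 (fun z => z + _ + _) E').
by rewrite E add0r.
Qed.

Let rep_fst p (x : tangent (G ** G)) u : @chart_cod _ (G ** G) p x ->
  'D_u (@rep R (G ** G) G fst p p.1) x = lsubmx u.
Proof.
move=> px; apply: etrans (derive_lin x u (@lsubmx_linear R _ _)).
have oU : open (@chart_cod _ (G ** G) p) by exact: chart_cod_open.
apply: near_eq_derive; apply: filterS (open_nbhs_nbhs (conj oU px)).
by move=> y /prod_chart_cod[? ?]; exact: chart_invK.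
Qed.

Let rep_snd p (x : tangent (G ** G)) u : @chart_cod _ (G ** G) p x ->
  'D_u (@rep R (G ** G) G snd p p.2) x = rsubmx u.
Proof.
move=> px; apply: etrans (derive_lin x u (@rsubmx_linear R _ _)).
have oU : open (@chart_cod _ (G ** G) p) by exact: chart_cod_open.
apply: near_eq_derive; apply: filterS (open_nbhs_nbhs (conj oU px)).
by move=> y /prod_chart_cod[? ?]; exact: chart_invK.
Qed.

Let from_chart_fst (p : G ** G) x u : chart_cod p x ->
  lsubmx (from_chart p (chart_inv p x) u) =
  from_chart p.1 (chart_inv p.1 (lsubmx x)) (lsubmx u).
Proof.
move=> px; have [p1 p2] := (prod_chart_cod p x).1 px.
have d1 : @rep_dom R (G ** G) G fst p p.1 x by split=> //; exact: chart_inv_dom.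
have H := tmap_from_chart hP hM u (is_smooth_fst hM hM) d1.
rewrite (tmap_fst hM hM) in H; apply: etrans H _.
by rewrite rep_fst.
Qed.

Let from_chart_snd (p : G ** G) x u : chart_cod p x ->
  rsubmx (from_chart p (chart_inv p x) u) =
  from_chart p.2 (chart_inv p.2 (rsubmx x)) (rsubmx u).
Proof.
move=> px; have [p1 p2] := (prod_chart_cod p x).1 px.
have d1 : @rep_dom R (G ** G) G snd p p.2 x by split=> //; exact: chart_inv_dom.
have H := tmap_from_chart hP hM u (is_smooth_snd hM hM) d1.
rewrite (tmap_snd hM hM) in H; apply: etrans H _.
by rewrite rep_snd.
Qed.

(** In product charts the coordinates split, so the coefficients of $\Omega_G$ become pairings of
    those of $\theta^l$ and $\theta^r$. Both the smoothness of $\Omega_G$ and its derivatives at the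
    unit are read off from this formula. *)
Lemma Omega_in_chart (p : G ** G) u v x : chart_cod p x ->
  form2_in_chart Om p u v x =
  - 2^-1 * (B (theta_l_in_chart p.1 (lsubmx u) (lsubmx x))
              (theta_r_in_chart p.2 (rsubmx v) (rsubmx x))
            - B (theta_l_in_chart p.1 (lsubmx v) (lsubmx x))
              (theta_r_in_chart p.2 (rsubmx u) (rsubmx x))).
Proof.
move=> px; apply: etrans (OmegaE hG B _ _ _) _.
have El w := from_chart_fst w px; have Er w := from_chart_snd w px.
have E w z := congr2 (fun a b => B (theta_l (chart_inv p.1 (lsubmx x)) a)
  (theta_r (chart_inv p.2 (rsubmx x)) b)) (El w) (Er z).
exact (congr1 (fun z => - 2^-1 * z) (congr2 (fun a b : R => a - b) (E u v) (E v u))).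
Qed.

Lemma Omega_is_form2 : is_form2 Om.
Proof.
have tl (p : G ** G) : linear (fun X : tangent (G ** G) => theta_l p.1 (lsubmx X)).
  by move=> a x y; rewrite lsubmx_linear (theta_l_linear hG).
have tr (p : G ** G) : linear (fun X : tangent (G ** G) => theta_r p.2 (rsubmx X)).
  by move=> a x y; rewrite rsubmx_linear (theta_r_linear hG).
split.
- move=> p v; exact (scalar_ext (fun u => OmE p u v)
    (wedge_scalar1 _ _ _ (B_linear1 hB) (B_linear2 hB) (tl p) (tr p))).
- move=> p v; exact (scalar_ext (fun u => OmE p v u)
    (wedge_scalar2 _ _ _ (B_linear1 hB) (B_linear2 hB) (tl p) (tr p))).
- by move=> p u; rewrite OmE subrr mulr0.
- move=> p u1 u2; have oU : open (chart_cod p) by exact: (chart_cod_open hP).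
  apply: (smooth_on_ext oU (fun x px => esym (Omega_in_chart u1 u2 px))).
  apply: smooth_onZ => //.
  have sl u : smooth_on (chart_cod p) (fun x => theta_l_in_chart p.1 u (lsubmx x)).
    apply: (@smooth_on_comp _ _ _ _ _ (chart_cod p.1) (@lsubmx R 1 _ _) (theta_l_in_chart p.1 u)) => //.
    + exact: chart_cod_open.
    + exact/smooth_on_lin/lsubmx_linear.
    + exact: theta_l_in_chart_smooth.
    + by move=> x /prod_chart_cod[].
  have sr u : smooth_on (chart_cod p) (fun x => theta_r_in_chart p.2 u (rsubmx x)).
    apply: (@smooth_on_comp _ _ _ _ _ (chart_cod p.2) (@rsubmx R 1 _ _) (theta_r_in_chart p.2 u)) => //.
    + exact: chart_cod_open.
    + exact/smooth_on_lin/rsubmx_linear.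
    + exact: theta_r_in_chart_smooth.
    + by move=> x /prod_chart_cod[].
  have s1 := smooth_on_B oU (sl (lsubmx u1)) (sr (rsubmx u2)).
  have s2 := smooth_on_B oU (sl (lsubmx u2)) (sr (rsubmx u1)).
  exact (smooth_onB oU s1 s2).
Qed.

Lemma Theta_in_chart (p : G) u v w x :
  form3_in_chart Th p u v w x =
  - 2^-1 * cartan3 B (theta_l_in_chart p u x) (theta_l_in_chart p v x)
    (theta_l_in_chart p w x).
Proof. exact: ThE. Qed.

Lemma Theta_is_form3 : is_form3 Th.
Proof.
have c1 := cartan3_linear1 hG hB; have c2 := cartan3_linear2 hG hB.
have c3 := cartan3_linear3 hG hB.
have sc (f : lie_algebra G -> R) g : scalar f ->
    scalar (fun X : tangent G => - 2^-1 * f (theta_l g X)).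
  by move=> lf a x y; rewrite (theta_l_linear hG) lf mulrDr mulrCA.
split.
- move=> p u v; exact (scalar_ext (fun x => ThE p x u v) (sc _ p (c1 _ _))).
- move=> p u v; exact (scalar_ext (fun x => ThE p u x v) (sc _ p (c2 _ _))).
- move=> p u v; exact (scalar_ext (fun x => ThE p u v x) (sc _ p (c3 _ _))).
- move=> p u v; rewrite ThE; have -> := cartan3_alt12 hB (theta_l p u) (theta_l p v).
  exact: mulr0.
- move=> p u v; rewrite ThE; have -> := cartan3_alt23 hB (theta_l p u) (theta_l p v).
  exact: mulr0.
- move=> p u1 u2 u3; have oU : open (chart_cod p) by exact: chart_cod_open.
  apply: (smooth_on_ext oU (fun x px => esym (Theta_in_chart p u1 u2 u3 x))).
  apply: smooth_onZ => //.
  have st u := theta_l_in_chart_smooth hG p u.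
  exact (smooth_on_appR3 (phi := fun _ a b c => cartan3 B a b c : R^o) oU
    (fun x u v _ => c1 u v) (fun x u v _ => c2 u v) (fun x u v _ => c3 u v)
    (fun a b c k => Ck_on_cst k _ _) (st u1) (st u2) (st u3)).
Qed.

End CanonicalForms.

Local Opaque derive tmap theta_l theta_r Ad lie_bracket right_field left_field mul2.

(** * The exterior derivative of $\Omega_G$ at the unit *)

Section DOmegaAlgebra.
Context {R : realType}.
Variables (n : nat) (B : 'rV[R]_n -> 'rV[R]_n -> R) (m br : 'rV[R]_n -> 'rV[R]_n -> 'rV[R]_n).
Hypotheses (B1 : forall v, scalar (B^~ v)) (B2 : forall u, scalar (B u)).
Hypotheses (Bs : forall u v, B u v = B v u) (brE : forall u v, br u v = m v u - m u v).

(** The local D is the derivative at the unit of a coefficient of $\Omega_G$, with m in the role of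
    [mul2]. In the alternating sum each value of m meets its transpose with the opposite sign, which
    makes six brackets out of twelve terms. *)
Lemma dOmega_algebra a1 a2 a3 b1 b2 b3 :
  let D a a' b a'' b'' b0 := - 2^-1 * ((- B (m a a') b'' - B a' (m b'' b)) -
      (- B (m a a'') b0 - B a'' (m b0 b))) in
  D a1 a2 b1 a3 b3 b2 - D a2 a1 b2 a3 b3 b1 + D a3 a1 b3 a2 b2 b1 =
  - 2^-1 * (B b3 (br a1 a2) + B b1 (br a2 a3) + B b2 (br a3 a1)
   + B a1 (br b2 b3) + B a2 (br b3 b1) + B a3 (br b1 b2)).
Proof.
move=> D; rewrite /D !brE !(scalarD _ _ (B2 _)) !(scalarN _ (B2 _)).
rewrite !(Bs (m _ _) _); ring.
Qed.

End DOmegaAlgebra.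

Section CanonicalShifted.
Context {R : realType}.
Local Notation tangent M := 'rV[R]_(mdim M).
Local Notation lie_algebra K := 'rV[R]_(mdim K).
Local Notation "M ** N" := (prod_manifold M N) (at level 40).
Variables (G : lie_group_data R) (hG : is_lie_group G).
Variables (B : lie_algebra G -> lie_algebra G -> R).
Hypotheses (hB : is_quadratic B) (hAd : is_Ad_invariant B).
Let hM : is_manifold G := lie_group_manifold hG.
Let hP : is_manifold (G ** G) := prod_is_manifold hM hM.
Let S := canonical_shifted B.
Let Om : form2 (G ** G) := sh_Omega S.
Let Th : form3 G := sh_Theta S.
Let e : G := gone.
Let c : tangent G := chart e e.
Let cc : tangent (G ** G) := row_mx c c.

Let ee : chart_dom e e. Proof. exact: chart_dom_center. Qed.
Let cod_c : chart_cod e c. Proof. exact: chart_codP. Qed.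
Let inv_c : chart_inv e c = e. Proof. exact: chartK. Qed.

Let theta_r_c u : theta_r_in_chart e u c = u.
Proof. by rewrite /theta_r_in_chart inv_c (from_chart_id hM) (theta_r1 hG). Qed.

Let theta_l_c u : theta_l_in_chart e u c = u.
Proof. by rewrite /theta_l_in_chart inv_c (from_chart_id hM) (theta_l1 hG). Qed.

Let Pf a b (z : tangent (G ** G)) : R^o :=
  B (theta_l_in_chart e a (lsubmx z)) (theta_r_in_chart e b (rsubmx z)).

Let dl (z : tangent (G ** G)) : differentiable (@lsubmx R 1 (mdim G) (mdim G)) z.
Proof. exact: differentiable_lin (@lsubmx_linear R _ _). Qed.

Let dr (z : tangent (G ** G)) : differentiable (@rsubmx R 1 (mdim G) (mdim G)) z.
Proof. exact: differentiable_lin (@rsubmx_linear R _ _). Qed.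

Let ccl : lsubmx cc = c. Proof. exact: row_mxKl. Qed.
Let ccr : rsubmx cc = c. Proof. exact: row_mxKr. Qed.

Let dtl a : differentiable (theta_l_in_chart e a) (lsubmx cc).
Proof. by rewrite ccl; exact: smooth_on_diff (theta_l_in_chart_smooth hG e a) cod_c. Qed.

Let dtr a : differentiable (theta_r_in_chart e a) (rsubmx cc).
Proof. by rewrite ccr; exact: smooth_on_diff (theta_r_in_chart_smooth hG e a) cod_c. Qed.

Let Dtl a W : 'D_W (theta_l_in_chart e a \o (@lsubmx R 1 (mdim G) (mdim G))) cc =
  - mul2 (lsubmx W) a.
Proof.
apply: etrans (derive_comp W (dl cc) (dtl a)) _.
have E := derive_lin cc W (@lsubmx_linear R (mdim G) (mdim G)).
apply: etrans (congr1 (fun w => 'D_w (theta_l_in_chart e a) (lsubmx cc)) E) _.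
apply: etrans (congr1 (fun w => 'D_(lsubmx W) (theta_l_in_chart e a) w) ccl) _.
exact (derive_theta_l hG (lsubmx W) a).
Qed.

Let Dtr a W : 'D_W (theta_r_in_chart e a \o (@rsubmx R 1 (mdim G) (mdim G))) cc =
  - mul2 a (rsubmx W).
Proof.
apply: etrans (derive_comp W (dr cc) (dtr a)) _.
have E := derive_lin cc W (@rsubmx_linear R (mdim G) (mdim G)).
apply: etrans (congr1 (fun w => 'D_w (theta_r_in_chart e a) (rsubmx cc)) E) _.
apply: etrans (congr1 (fun w => 'D_(rsubmx W) (theta_r_in_chart e a) w) ccr) _.
exact (derive_theta_r hG (rsubmx W) a).
Qed.

Let DPf a b W : differentiable (Pf a b) cc /\
  'D_W (Pf a b) cc = - B (mul2 (lsubmx W) a) b - B a (mul2 b (rsubmx W)).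
Proof.
have [d E] := derive_B hB W (differentiable_comp (dl cc) (dtl a))
  (differentiable_comp (dr cc) (dtr b)).
split; first exact: d.
apply: etrans E _.
have E1 : (theta_r_in_chart e b \o (@rsubmx R 1 (mdim G) (mdim G))) cc = b.
  exact (etrans (congr1 (theta_r_in_chart e b) ccr) (theta_r_c b)).
have E2 : (theta_l_in_chart e a \o (@lsubmx R 1 (mdim G) (mdim G))) cc = a.
  exact (etrans (congr1 (theta_l_in_chart e a) ccl) (theta_l_c a)).
apply: etrans (congr2 +%R (congr2 B (Dtl a W) E1) (congr2 B E2 (Dtr b W))) _.
exact (congr2 +%R (BNl hB _ _) (BNr hB _ _)).
Qed.

Let DOm (U V W : tangent (G ** G)) :
  'D_W (form2_in_chart Om ((e, e) : G ** G) U V) (@chart _ (G ** G) (e, e) (e, e)) =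
  - 2^-1 * ((- B (mul2 (lsubmx W) (lsubmx U)) (rsubmx V)
             - B (lsubmx U) (mul2 (rsubmx V) (rsubmx W)))
          - (- B (mul2 (lsubmx W) (lsubmx V)) (rsubmx U)
             - B (lsubmx V) (mul2 (rsubmx U) (rsubmx W)))).
Proof.
have eee : @chart_dom _ (G ** G) (e, e) (e, e) by split.
have E : \forall z \near cc,
   ((- 2^-1) *: (Pf (lsubmx U) (rsubmx V) - Pf (lsubmx V) (rsubmx U))) z =
   form2_in_chart Om ((e, e) : G ** G) U V z.
  apply: filterS (near_chart_cod hP eee) => z hz.
  exact (esym (Omega_in_chart hG B U V hz)).
apply: etrans (esym (near_eq_derive W E)) _.
have [d1 E1] := DPf (lsubmx U) (rsubmx V) W.
have [d2 E2] := DPf (lsubmx V) (rsubmx U) W.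
have D1 := @diff_derivable _ _ _ _ _ W d1; have D2 := @diff_derivable _ _ _ _ _ W d2.
apply: etrans (deriveZ _ (derivableB D1 D2)) _.
apply: etrans (congr1 (fun z => (- 2^-1) *: z) (deriveB D1 D2)) _.
exact (congr1 (fun z : R => (- 2^-1) * z) (congr2 (fun x y : R => x - y) E1 E2)).
Qed.

(** The coefficients of $\theta^l$ and $\theta^r$ have derivatives given by [mul2] at the unit.
    After antisymmetrization each Cartan term takes two arguments from one factor of $G \times G$
    and one from the other. *)
Lemma ext_d2_Omega_unit (U1 U2 U3 : tangent (G ** G)) :
  let a1 := lsubmx U1 in let a2 := lsubmx U2 in let a3 := lsubmx U3 in
  let b1 := rsubmx U1 in let b2 := rsubmx U2 in let b3 := rsubmx U3 in
  ext_d2 Om ((e, e) : G ** G) U1 U2 U3 = - 2^-1 *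
  (cartan3 B b3 a1 a2 + cartan3 B b1 a2 a3 + cartan3 B b2 a3 a1
   + cartan3 B a1 b2 b3 + cartan3 B a2 b3 b1 + cartan3 B a3 b1 b2).
Proof.
move=> a1 a2 a3 b1 b2 b3.
apply: etrans (congr2 +%R (congr2 (fun x y : R => x - y) (DOm U2 U3 U1) (DOm U1 U3 U2))
  (DOm U1 U2 U3)) _.
exact (dOmega_algebra (B_linear2 hB) (quadratic_sym hB) (lie_bracket_mul2 hG) a1 a2 a3 b1 b2 b3).
Qed.

End CanonicalShifted.

Local Opaque cartan3.

(** * Invariance of the canonical forms and the relation between $d\Omega_G$ and $\Theta_G$ *)

Section Invariance.
Context {R : realType}.
Local Notation tangent M := 'rV[R]_(mdim M).
Local Notation lie_algebra K := 'rV[R]_(mdim K).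
Local Notation "M ** N" := (prod_manifold M N) (at level 40).
Variables (G : lie_group_data R) (hG : is_lie_group G).
Variables (B : lie_algebra G -> lie_algebra G -> R).
Hypotheses (hB : is_quadratic B) (hAd : is_Ad_invariant B).
Let hM : is_manifold G := lie_group_manifold hG.
Let hP : is_manifold (G ** G) := prod_is_manifold hM hM.
Let Om : form2 (G ** G) := sh_Omega (canonical_shifted B).
Let Th : form3 G := sh_Theta (canonical_shifted B).
Let e : G := gone.

Section Maps.
Variables (M : manifold_data R) (hm : is_manifold M).

Lemma dlog_mull (g : G) (f : M -> G) p v : is_smooth f ->
  dlog (fun x => gmul g (f x)) p v = Ad g (dlog f p v).
Proof.
move=> sf; apply: etrans (dlog_mul hG hm p v (is_smooth_cst M hM g) sf) _.
by rewrite (dlog_cst hG) add0r.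
Qed.

Lemma dlog_mulr (g : G) (f : M -> G) p v : is_smooth f ->
  dlog (fun x => gmul (f x) g) p v = dlog f p v.
Proof.
move=> sf; apply: etrans (dlog_mul hG hm p v sf (is_smooth_cst M hM g)) _.
by rewrite (dlog_cst hG) (linear0E (Ad_linear hG _)) addr0.
Qed.

Lemma is_smooth_fmull (g : G) (f : M -> G) : is_smooth f -> is_smooth (fun x => gmul g (f x)).
Proof. by move=> sf; apply: (is_smooth_mul hG hm) => //; exact: is_smooth_cst. Qed.

Lemma is_smooth_fmulr (g : G) (f : M -> G) : is_smooth f -> is_smooth (fun x => gmul (f x) g).
Proof. by move=> sf; apply: (is_smooth_mul hG hm) => //; exact: is_smooth_cst. Qed.

(** $\Omega_G$ pairs $\theta^l$ of the first factor, unchanged by left translations, with $\theta^r$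
    of the second, unchanged by right translations. *)
Lemma Omega_pull_invariant (x y : G) (f g : M -> G) p u v : is_smooth f -> is_smooth g ->
  Omega_pull B (fun a => gmul x (f a)) (fun a => gmul (g a) y) p u v = Omega_pull B f g p u v.
Proof.
move=> sf sg.
have sf' := is_smooth_fmull x sf; have sg' := is_smooth_fmulr y sg.
have E w : Ad (ginv (gmul x (f p))) (dlog (fun a => gmul x (f a)) p w) =
    Ad (ginv (f p)) (dlog f p w).
  rewrite (dlog_mull x p w sf) (ginvM hG).
  by rewrite -(AdM hG) (gmulgVK hG).
have E' w := dlog_mulr y p w sg.
apply: etrans (Omega_pullE hG B hm p u v sf' sg') _.
apply: etrans _ (esym (Omega_pullE hG B hm p u v sf sg)).
have EE w z := congr2 B (E w) (E' z).
exact (congr1 (fun z => - 2^-1 * z) (congr2 (fun a b : R => a - b) (EE u v) (EE v u))).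
Qed.

(** Common form of left and right invariance: the logarithmic derivative changes by Ad of a fixed
    element in one case and not at all in the other. *)
Lemma Theta_pull_eq (f f' : M -> G) (A : lie_algebra G -> lie_algebra G) p u v w :
  is_smooth f -> is_smooth f' -> (forall z, dlog f' p z = A (dlog f p z)) ->
  (forall a b c, cartan3 B (A a) (A b) (A c) = cartan3 B a b c) ->
  pullback3 f' Th p u v w = pullback3 f Th p u v w.
Proof.
move=> sf sf' E EA.
apply: etrans (Theta_pullE hG hB hAd p u v w sf') _.
apply: etrans _ (esym (Theta_pullE hG hB hAd p u v w sf)).
by rewrite !E EA.
Qed.

Lemma Theta_pull_mull (g : G) (f : M -> G) p u v w : is_smooth f ->
  pullback3 (fun x => gmul g (f x)) Th p u v w = pullback3 f Th p u v w.
Proof.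
move=> sf.
exact (Theta_pull_eq u v w sf (is_smooth_fmull g sf) (fun z => dlog_mull g p z sf)
  (cartan3_Ad hG hAd g)).
Qed.

Lemma Theta_pull_mulr (g : G) (f : M -> G) p u v w : is_smooth f ->
  pullback3 (fun x => gmul (f x) g) Th p u v w = pullback3 f Th p u v w.
Proof.
move=> sf.
exact (Theta_pull_eq (A := id) u v w sf (is_smooth_fmulr g sf)
  (fun z => dlog_mulr g p z sf) (fun _ _ _ => erefl)).
Qed.

(** Inversion sends the logarithmic derivative to minus its image under Ad; Ad leaves the Cartan
    form unchanged, and the sign is taken three times. *)
Lemma Theta_pull_inv (f : M -> G) p u v w : is_smooth f ->
  pullback3 (fun x => ginv (f x)) Th p u v w = - pullback3 f Th p u v w.
Proof.
move=> sf; have sf' := is_smooth_inv hG hm sf.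
apply: etrans (Theta_pullE hG hB hAd p u v w sf') _.
apply: etrans _ (congr1 -%R (esym (Theta_pullE hG hB hAd p u v w sf))).
rewrite !(dlog_inv hG hm p _ sf) (cartan3N hG hB) (cartan3_Ad hG hAd).
by rewrite mulrN.
Qed.

End Maps.

Let s1 : @is_smooth R (G ** G) G fst. Proof. exact: is_smooth_fst. Qed.
Let s2 : @is_smooth R (G ** G) G snd. Proof. exact: is_smooth_snd. Qed.

Lemma Omega_pull_id p u v : Om p u v = @Omega_pull R G B (G ** G) fst snd p u v.
Proof.
case: p => a b.
have E w : @tmap R (G ** G) (G ** G) (fun x => (x.1, x.2)) (a, b) w = w.
  apply: etrans (tmap_pair hP hM hM ((a, b) : G ** G) w s1 s2) _.
  rewrite (tmap_fst hM hM) (tmap_snd hM hM); exact: hsubmxK.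
exact (esym (congr2 (Om (a, b)) (E u) (E v))).
Qed.

Lemma cross_terms_algebra (ta tb tab x : R) : tab = ta + tb + x ->
  - 2^-1 * ta + - 2^-1 * tb - - 2^-1 * tab = - (- 2^-1 * x).
Proof. by move=> ->; ring. Qed.

Lemma canonical_Theta_Omega (q : G ** G) U1 U2 U3 :
  @pullback3 R (G ** G) G fst Th q U1 U2 U3 + @pullback3 R (G ** G) G snd Th q U1 U2 U3
  - @pullback3 R (G ** G) G (fun k => gmul k.1 k.2) Th q U1 U2 U3
  = - ext_d2 Om q U1 U2 U3.
Proof.
case: q U1 U2 U3 => x y U1 U2 U3.
pose f1 : G ** G -> G := fun a => gmul (ginv x) a.1.
pose f2 : G ** G -> G := fun a => gmul a.2 (ginv y).
pose q : G ** G := (x, y).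
have sf1 : is_smooth f1 by exact: (is_smooth_fmull hP).
have sf2 : is_smooth f2 by exact: (is_smooth_fmulr hP).
(* A symmetry of $\Omega_G$ that takes the given point (x, y) to the unit. *)
pose F : G ** G -> G ** G := fun a => (f1 a, f2 a).
have sF : is_smooth F by exact: (is_smooth_pair hP hM hM).
have F1 : f1 q = e by exact: (gmulVg hG).
have F2 : f2 q = e by exact: (gmulgV hG).
have Fq : F q = (e, e) by rewrite /F F1 F2.
have OmF : pullback2 F Om = Om.
  apply/funext => p; apply/funext => u; apply/funext => v.
  apply: etrans (Omega_pull_invariant hP (ginv x) (ginv y) p u v s1 s2) _.
  exact (esym (Omega_pull_id p u v)).
have hOm : is_form2 Om := Omega_is_form2 hG hB.
have D1 := ext_d2_pullback hP hP sF hOm; rewrite OmF in D1.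
have {}D1 : ext_d2 Om q U1 U2 U3 =
    ext_d2 Om ((e, e) : G ** G) (tmap F q U1) (tmap F q U2) (tmap F q U3).
  by rewrite -Fq [LHS](congr1 (fun w : form3 (G ** G) => w q U1 U2 U3) D1).
have TF U : tmap F q U = row_mx (tmap f1 q U) (tmap f2 q U).
  exact: (tmap_pair hP hM hM q U sf1 sf2).
have dl1 U : dlog f1 q U = lsubmx (tmap F q U).
  by rewrite TF row_mxKl /dlog F1; exact: theta_r1.
have dl2 U : dlog f2 q U = rsubmx (tmap F q U).
  by rewrite TF row_mxKr /dlog F2; exact: theta_r1.
pose f3 : G ** G -> G := fun a => gmul (f1 a) (f2 a).
have sf3 : is_smooth f3 by exact: (is_smooth_mul hG hP).
(* At the unit Ad is trivial, so the logarithmic derivative of the product is a sum. The left-hand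
   side of the claim thus becomes the mixed part of the Cartan form of a sum. *)
have dl3 U : dlog f3 q U = lsubmx (tmap F q U) + rsubmx (tmap F q U).
  apply: etrans (dlog_mul hG hP q U sf1 sf2) _.
  by rewrite F1 (Ad1 hG) dl1 dl2.
have P1 : @pullback3 R (G ** G) G fst Th q U1 U2 U3 = pullback3 f1 Th q U1 U2 U3.
  exact (esym (Theta_pull_mull hP (ginv x) q U1 U2 U3 s1)).
have P2 : @pullback3 R (G ** G) G snd Th q U1 U2 U3 = pullback3 f2 Th q U1 U2 U3.
  exact (esym (Theta_pull_mulr hP (ginv y) q U1 U2 U3 s2)).
have sm : @is_smooth R (G ** G) G (fun k => gmul k.1 k.2) by exact: (gmul_smooth hG).
(* Translations do not affect the pullback of $\Theta_G$, so the product of a and b may be replaced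
   by $x^{-1} a b y^{-1}$, the product of the two components of [F]. *)
have P3 : @pullback3 R (G ** G) G (fun k => gmul k.1 k.2) Th q U1 U2 U3 =
    pullback3 f3 Th q U1 U2 U3.
  have sm' := is_smooth_fmull hP (ginv x) sm.
  apply: etrans (esym (Theta_pull_mull hP (ginv x) q U1 U2 U3 sm)) _.
  apply: etrans (esym (Theta_pull_mulr hP (ginv y) q U1 U2 U3 sm')) _.
  have Ef : (fun k : G ** G => gmul (gmul (ginv x) (gmul k.1 k.2)) (ginv y)) = f3.
    by apply/funext => k; rewrite /f3 /f1 /f2 !(gmulA hG).
  exact (congr1 (fun f => @pullback3 R (G ** G) G f Th q U1 U2 U3) Ef).
have T1 := etrans P1 (Theta_pullE hG hB hAd q U1 U2 U3 sf1).
have T2 := etrans P2 (Theta_pullE hG hB hAd q U1 U2 U3 sf2).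
have T3 := etrans P3 (Theta_pullE hG hB hAd q U1 U2 U3 sf3).
rewrite !dl1 in T1; rewrite !dl2 in T2; rewrite !dl3 in T3.
have D2 := etrans D1 (ext_d2_Omega_unit hG hB _ _ _).
apply: etrans (congr2 (fun a b : R => a - b) (congr2 +%R T1 T2) T3) _.
apply: etrans _ (congr1 -%R (esym D2)).
apply: cross_terms_algebra.
exact (cyclic_trilinear_add (cartan3_linear3 hG hB) (cartan3_cyc hB) _ _ _ _ _ _).
Qed.

End Invariance.

Lemma half_sum (R : realType) (t : R) : - (- 2^-1 * t) + 2^-1 * t = t.
Proof. lra. Qed.

(** * Closedness of $\Theta_G$ and the axioms of a shifted symplectic group *)

Section FormLemmas.
Context {R : realType}.
Local Notation tangent M := 'rV[R]_(mdim M).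
Local Notation "M ** N" := (prod_manifold M N) (at level 40).
Implicit Types M N : manifold_data R.

Lemma pullback3_id M (hM : is_manifold M) (w : form3 M) : pullback3 id w = w.
Proof.
apply/funext => p; apply/funext => u; apply/funext => v; apply/funext => x.
have E y := tmap_id hM p y.
exact (etrans (congr2 (fun a b => w p a b _) (E u) (E v)) (congr1 (w p u v) (E x))).
Qed.

(** Four signs cancel in every term: three from the arguments of the coefficient and one from the
    direction of differentiation. *)
Lemma ext_d3_opp_args M (hM : is_manifold M) (w : form3 M) p u1 u2 u3 u4 :
  is_form3 w -> ext_d3 w p (- u1) (- u2) (- u3) (- u4) = ext_d3 w p u1 u2 u3 u4.
Proof.
move=> hw.
have pp : chart_dom p p by exact: chart_dom_center.
have D a b c d : 'D_(- a) (form3_in_chart w p (- b) (- c) (- d)) (chart p p) =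
    'D_a (form3_in_chart w p b c d) (chart p p).
  have df := form3_in_chart_diff hw b c d (chart_codP pp).
  have E : \forall x \near chart p p,
      (- form3_in_chart w p b c d) x = form3_in_chart w p (- b) (- c) (- d) x.
    apply: filterS (near_chart_cod hM pp) => x px.
    have l1 := form3_in_chart_linear1 hM hw (- c) (- d) px.
    have l2 := form3_in_chart_linear2 hM hw b (- d) px.
    have l3 := form3_in_chart_linear3 hM hw b c px.
    apply/esym; apply: etrans (linearNE b l1) _; congr (- _).
    apply: etrans (linearNE c l2) _; rewrite -[RHS]opprK; congr (- _).
    exact (linearNE d l3).
  apply: etrans (esym (near_eq_derive (- a) E)) _.
  have dfN := differentiableN df.
  apply: etrans (linearNE a (derive_linE dfN)) _.
  apply: etrans (congr1 -%R (deriveN (@diff_derivable _ _ _ _ _ a df))) _.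
  exact: opprK.
exact (congr2 (fun x y : R => x - y) (congr2 +%R (congr2 (fun x y : R => x - y)
  (D u1 u2 u3 u4) (D u2 u1 u3 u4)) (D u3 u1 u2 u4)) (D u4 u1 u2 u3)).
Qed.

End FormLemmas.

Section CanonicalShifted.
Context {R : realType}.
Local Notation tangent M := 'rV[R]_(mdim M).
Local Notation lie_algebra K := 'rV[R]_(mdim K).
Local Notation "M ** N" := (prod_manifold M N) (at level 40).
Variables (G : lie_group_data R) (hG : is_lie_group G).
Variables (B : lie_algebra G -> lie_algebra G -> R).
Hypotheses (hB : is_quadratic B) (hAd : is_Ad_invariant B).
Let hM : is_manifold G := lie_group_manifold hG.
Let hP : is_manifold (G ** G) := prod_is_manifold hM hM.
Let hPP : is_manifold (G ** G ** G) := prod_is_manifold hP hM.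
Let Om : form2 (G ** G) := sh_Omega (canonical_shifted B).
Let Th : form3 G := sh_Theta (canonical_shifted B).
Let e : G := gone.
Let sid : is_smooth (@id G) := is_smooth_id hM.
Let hTh : is_form3 Th := Theta_is_form3 hG hB.

(** Pulling back by inversion turns $\Theta_G$ into its opposite, while its differential at the unit
    is -1 and $d\Theta_G$ is even in four arguments. By naturality the value of $d\Theta_G$ at the
    unit equals its own opposite. *)
Let dTheta_unit u1 u2 u3 u4 : ext_d3 Th e u1 u2 u3 u4 = 0.
Proof.
pose I : G -> G := ginv.
have sI : is_smooth I by exact: ginv_smooth.
have I1 : I e = e by exact: ginv1.
have pI : pullback3 I Th = - Th :> form3 G.
  apply/funext => p; apply/funext => u; apply/funext => v; apply/funext => w.
  apply: etrans (Theta_pull_inv hG hB hAd hM p u v w sid) _.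
  exact (congr1 (fun w' : form3 G => - w' p u v w) (pullback3_id hM Th)).
have D1 := ext_d3_pullback hM hM sI hTh; rewrite pI (ext_d3N hM hTh) in D1.
have TI u : tmap I e u = - u.
  have E := dlog_inv hG hM e u sid.
  rewrite -(theta_r1 hG (tmap I e u)) -[X in theta_r X]I1; apply: etrans E _.
  congr (- _); rewrite /= (ginv1 hG) (Ad1 hG) /dlog (tmap_id hM).
  exact: theta_r1.
have {}D1 := congr1 (fun w : form4 G => w e u1 u2 u3 u4) D1.
have D2 : - ext_d3 Th e u1 u2 u3 u4 = ext_d3 Th e u1 u2 u3 u4.
  apply: etrans D1 _.
  rewrite /pullback4 I1 !TI; exact: ext_d3_opp_args.
by move: D2; move: (ext_d3 Th e u1 u2 u3 u4) => x; lra.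
Qed.

(** Left translation by the inverse of g preserves the form and moves g to the unit. *)
Lemma canonical_Theta_closed : ext_d3 Th = 0.
Proof.
apply/funext => g; apply/funext => u1; apply/funext => u2; apply/funext => u3; apply/funext => u4.
pose L : G -> G := gmul (ginv g).
have sL : is_smooth L by exact: is_smooth_mull.
have pL : pullback3 L Th = Th.
  apply/funext => p; apply/funext => u; apply/funext => v; apply/funext => w.
  apply: etrans (Theta_pull_mull hG hB hAd hM (ginv g) p u v w sid) _.
  exact (congr1 (fun w' : form3 G => w' p u v w) (pullback3_id hM Th)).
have D1 := ext_d3_pullback hM hM sL hTh; rewrite pL in D1.
apply: etrans (congr1 (fun w : form4 G => w g u1 u2 u3 u4) D1) _.
rewrite /pullback4 [L g](gmulVg hG); exact: dTheta_unit.
Qed.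

Lemma canonical_pairing u v : pairing (S := canonical_shifted B) u v = B u v.
Proof.
have E1 : Om (e, e) (row_mx u 0) (row_mx 0 v) = - 2^-1 * B u v.
  apply: etrans (Omega_row hG B e e u 0 0 v) _.
  by rewrite !(theta_r1 hG) !(theta_l1 hG) (B0l hB) subr0.
have E2 : Om (e, e) (row_mx 0 u) (row_mx v 0) = 2^-1 * B u v.
  apply: etrans (Omega_row hG B e e 0 v u 0) _.
  by rewrite !(theta_r1 hG) !(theta_l1 hG) (B0l hB) sub0r (quadratic_sym hB v u) mulrNN.
exact (etrans (congr2 (fun a b : R => - a + b) E1 E2) (half_sum _)).
Qed.

Section Constant.
Variables (M : manifold_data R) (hm : is_manifold M).

(** Serves twice: for the normalization of $\Omega_G$, and for the vanishing of sigma along maps on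
    which Phi is constant. *)
Lemma Omega_pull_cstl (g : G) (f : M -> G) p u v : is_smooth f ->
  Omega_pull B (fun _ => g) f p u v = 0.
Proof.
move=> sf.
have E w z : B (Ad (ginv g) (dlog (fun _ : M => g) p w)) z = 0.
  by rewrite (dlog_cst hG) (linear0E (Ad_linear hG _)) (B0l hB).
apply: etrans (Omega_pullE hG B hm p u v (is_smooth_cst M hM g) sf) _.
apply: etrans (congr1 (fun z => - 2^-1 * z) (congr2 (fun a b : R => a - b) (E u _) (E v _))) _.
by rewrite subrr mulr0.
Qed.

Lemma Omega_pull_cstr (g : G) (f : M -> G) p u v : is_smooth f ->
  Omega_pull B f (fun _ => g) p u v = 0.
Proof.
move=> sf.
have E w z : B z (dlog (fun _ : M => g) p w) = 0.
  by rewrite (dlog_cst hG) (B0r hB).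
apply: etrans (Omega_pullE hG B hm p u v sf (is_smooth_cst M hM g)) _.
apply: etrans (congr1 (fun z => - 2^-1 * z) (congr2 (fun a b : R => a - b) (E v _) (E u _))) _.
by rewrite subrr mulr0.
Qed.

End Constant.

Lemma canonical_is_shifted : is_shifted_symplectic (canonical_shifted B).
Proof.
have s11 : @is_smooth R (G ** G ** G) G (fun k => k.1.1).
  exact: (is_smooth_comp hPP hP hM (is_smooth_fst hP hM) (is_smooth_fst hM hM)).
have s12 : @is_smooth R (G ** G ** G) G (fun k => k.1.2).
  exact: (is_smooth_comp hPP hP hM (is_smooth_fst hP hM) (is_smooth_snd hM hM)).
have s2 : @is_smooth R (G ** G ** G) G (fun k => k.2) by exact: (is_smooth_snd hP hM).
split.
- exact: hG.
- exact: Omega_is_form2.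
- exact: hTh.
- apply/funext => p; apply/funext => u; apply/funext => v.
  exact (Omega_pull_cstl hM gone p u v sid).
- apply/funext => p; apply/funext => u; apply/funext => v.
  exact (Omega_pull_cstr hM gone p u v sid).
- apply/funext => p; apply/funext => u; apply/funext => v.
  have EE : @Omega_pull R G B (G ** G ** G) (fun k => k.1.1) (fun k => k.1.2) =
      @pullback2 R (G ** G ** G) (G ** G) (fun k => k.1) Om.
    have -> // : (fun k : G * G * G => k.1) = (fun k => (k.1.1, k.1.2)).
    by apply/funext => -[[]].
  apply: etrans _ (Omega_cocycle hG hB hAd hPP p u v s11 s12 s2).
  exact (congr1 (fun w : form2 (G ** G ** G) => _ - w p u v) (esym EE)).
- apply/funext => q; apply/funext => u; apply/funext => v; apply/funext => w.
  exact (canonical_Theta_Omega hG hB hAd q u v w).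
- exact: canonical_Theta_closed.
- move=> u H; apply: (quadratic_nondeg hB) => v.
  by rewrite -canonical_pairing.
Qed.

End CanonicalShifted.

(** * Products and sign changes of shifted symplectic groups *)

Section OppProd.
Context {R : realType}.
Local Notation tangent M := 'rV[R]_(mdim M).
Local Notation lie_algebra K := 'rV[R]_(mdim K).
Local Notation "M ** N" := (prod_manifold M N) (at level 40).

Lemma oppr0R : - (0 : R) = 0. Proof. exact: oppr0. Qed.

Lemma alt4N (a b c d : R) : - a - - b + - c - - d = - (a - b + c - d).
Proof. ring. Qed.

Lemma alt3N (a b c : R) : - a + - b - - c = - (a + b - c).
Proof. ring. Qed.

Lemma pairing_sum (a b c d : R) : - (a + b) + (c + d) = - a + c + (- b + d).
Proof. ring. Qed.

Lemma opp_pairing (S : shifted_data R) (u v : lie_algebra S) :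
  pairing (S := opp_shifted S) u v = - pairing u v.
Proof. by rewrite [RHS]opprD. Qed.

Lemma opp_is_shifted (S : shifted_data R) :
  is_shifted_symplectic S -> is_shifted_symplectic (opp_shifted S).
Proof.
move=> hS; have hG := shifted_lie_group hS; have hM := lie_group_manifold hG.
have hP := prod_is_manifold hM hM.
split.
- exact: hG.
- exact: (form2N hP (Omega_form hS)).
- exact: (form3N hM (Theta_form hS)).
- apply/funext => p; apply/funext => u; apply/funext => v.
  exact (etrans (congr1 (fun w : form2 S => - w p u v) (Omega_normalized_l hS)) oppr0R).
- apply/funext => p; apply/funext => u; apply/funext => v.
  exact (etrans (congr1 (fun w : form2 S => - w p u v) (Omega_normalized_r hS)) oppr0R).
- apply/funext => p; apply/funext => u; apply/funext => v.
  apply: etrans (alt4N _ _ _ _) _.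
  exact (etrans (congr1 (fun w : form2 (S ** S ** S) => - w p u v) (Omega_closed hS)) oppr0R).
- apply/funext => p; apply/funext => u; apply/funext => v; apply/funext => w.
  apply: etrans (alt3N _ _ _) _.
  apply: etrans (congr1 (fun x : form3 (S ** S) => - x p u v w) (Theta_Omega hS)) _.
  exact (esym (congr1 (fun x : form3 (S ** S) => - x p u v w) (ext_d2N hP (Omega_form hS)))).
- apply: etrans (ext_d3N hM (Theta_form hS)) _.
  apply/funext => p; apply/funext => u; apply/funext => v; apply/funext => w; apply/funext => x.
  exact (etrans (congr1 (fun y : form4 S => - y p u v w x) (Theta_closed hS)) oppr0R).
- move=> u H; apply: (pairing_nondeg hS) => v.
  by apply/eqP; rewrite -oppr_eq0 -opp_pairing H.
Qed.

Lemma alt2_sumD' (a1 a2 a3 b1 b2 b3 : R) :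
  (a1 + b1) + (a2 + b2) - (a3 + b3) = (a1 + a2 - a3) + (b1 + b2 - b3).
Proof. ring. Qed.

Lemma opprD' (a b : R) : - (a + b) = - a + - b.
Proof. exact: opprD. Qed.

(** The forms of a product group are sums of pullbacks along projections. A commuting square moves
    an identity known on a factor, pulled back by the projection, to the product. *)
Lemma pullback2_swap (A M1 M2 C : manifold_data R) (hA : is_manifold A)
    (h1 : is_manifold M1) (h2 : is_manifold M2) (hC : is_manifold C)
    (f : A -> M1) (g : M1 -> C) (f' : A -> M2) (g' : M2 -> C) (w : form2 C) p u v :
  is_smooth f -> is_smooth g -> is_smooth f' -> is_smooth g' ->
  g \o f = g' \o f' ->
  pullback2 f (pullback2 g w) p u v = pullback2 f' (pullback2 g' w) p u v.
Proof.
move=> sf sg sf' sg' E.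
have E1 := pullback2_comp hA h1 hC w sf sg; have E2 := pullback2_comp hA h2 hC w sf' sg'.
rewrite E in E1; exact (congr1 (fun x : form2 A => x p u v) (etrans E1 (esym E2))).
Qed.

Lemma pullback3_swap (A M1 M2 C : manifold_data R) (hA : is_manifold A)
    (h1 : is_manifold M1) (h2 : is_manifold M2) (hC : is_manifold C)
    (f : A -> M1) (g : M1 -> C) (f' : A -> M2) (g' : M2 -> C) (w : form3 C) p u v x :
  is_smooth f -> is_smooth g -> is_smooth f' -> is_smooth g' ->
  g \o f = g' \o f' ->
  pullback3 f (pullback3 g w) p u v x = pullback3 f' (pullback3 g' w) p u v x.
Proof.
move=> sf sg sf' sg' E.
have E1 := pullback3_comp hA h1 hC w sf sg; have E2 := pullback3_comp hA h2 hC w sf' sg'.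
rewrite E in E1; exact (congr1 (fun y : form3 A => y p u v x) (etrans E1 (esym E2))).
Qed.

Lemma cocycle_maps_smooth (K : lie_group_data R) (hK : is_lie_group K) :
  [/\ @is_smooth R (K ** K ** K) (K ** K) (fun k => (k.1.2, k.2)),
      @is_smooth R (K ** K ** K) (K ** K) (fun k => (gmul k.1.1 k.1.2, k.2)),
      @is_smooth R (K ** K ** K) (K ** K) (fun k => (k.1.1, gmul k.1.2 k.2)) &
      @is_smooth R (K ** K ** K) (K ** K) (fun k => k.1)].
Proof.
have mK := lie_group_manifold hK; have mKK := prod_is_manifold mK mK.
have m3 := prod_is_manifold mKK mK.
have s11 : @is_smooth R (K ** K ** K) K (fun k => k.1.1).
  exact: (is_smooth_comp m3 mKK mK (is_smooth_fst mKK mK) (is_smooth_fst mK mK)).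
have s12 : @is_smooth R (K ** K ** K) K (fun k => k.1.2).
  exact: (is_smooth_comp m3 mKK mK (is_smooth_fst mKK mK) (is_smooth_snd mK mK)).
have s2 : @is_smooth R (K ** K ** K) K (fun k => k.2) by exact: (is_smooth_snd mKK mK).
split.
- exact: (is_smooth_pair m3 mK mK s12 s2).
- exact: (is_smooth_pair m3 mK mK (is_smooth_mul hK m3 s11 s12) s2).
- exact: (is_smooth_pair m3 mK mK s11 (is_smooth_mul hK m3 s12 s2)).
- exact: (is_smooth_fst mKK mK).
Qed.

Lemma pairing0r (S : shifted_data R) (hS : is_shifted_symplectic S) (u : lie_algebra S) :
  pairing u 0 = 0.
Proof.
have l1 := form2_linear1 (Omega_form hS); have l2 := form2_linear2 (Omega_form hS).
have r0 : row_mx (0 : lie_algebra S) (0 : lie_algebra S) = 0 by exact: row_mx0.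
have E1 := scalar0 (l2 (gone, gone) (row_mx u 0)).
have E2 := scalar0 (l2 (gone, gone) (row_mx 0 u)).
rewrite -r0 in E1 E2.
exact (etrans (congr2 (fun a b : R => - a + b) E1 E2) (addNr 0)).
Qed.

Section Product.
Variables (S T : shifted_data R).
Hypotheses (hS : is_shifted_symplectic S) (hT : is_shifted_symplectic T).
Let gS := shifted_lie_group hS.
Let gT := shifted_lie_group hT.
Let mS : is_manifold S := lie_group_manifold gS.
Let mT : is_manifold T := lie_group_manifold gT.
Let P := prod_shifted S T.
Let mP : is_manifold P := prod_is_manifold mS mT.
Let mPP : is_manifold (P ** P) := prod_is_manifold mP mP.
Let mP3 : is_manifold (P ** P ** P) := prod_is_manifold mPP mP.
Let mSS : is_manifold (S ** S) := prod_is_manifold mS mS.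
Let mTT : is_manifold (T ** T) := prod_is_manifold mT mT.
Let mS3 : is_manifold (S ** S ** S) := prod_is_manifold mSS mS.
Let mT3 : is_manifold (T ** T ** T) := prod_is_manifold mTT mT.
Let piS : P ** P -> S ** S := fun p => (p.1.1, p.2.1).
Let piT : P ** P -> T ** T := fun p => (p.1.2, p.2.2).
Let fS : P -> S := fst.
Let fT : P -> T := snd.

Let sfS : is_smooth fS. Proof. exact: is_smooth_fst. Qed.
Let sfT : is_smooth fT. Proof. exact: is_smooth_snd. Qed.
Let s1 : @is_smooth R (P ** P) P fst. Proof. exact: is_smooth_fst. Qed.
Let s2 : @is_smooth R (P ** P) P snd. Proof. exact: is_smooth_snd. Qed.

Let spS : is_smooth piS.
Proof.
exact: (is_smooth_pair mPP mS mS (is_smooth_comp mPP mP mS s1 sfS)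
  (is_smooth_comp mPP mP mS s2 sfS)).
Qed.

Let spT : is_smooth piT.
Proof.
exact: (is_smooth_pair mPP mT mT (is_smooth_comp mPP mP mT s1 sfT)
  (is_smooth_comp mPP mP mT s2 sfT)).
Qed.

Let gP : is_lie_group P := prod_is_lie_group gS gT.
Let rhoS : P ** P ** P -> S ** S ** S := fun k => ((k.1.1.1, k.1.2.1), k.2.1).
Let rhoT : P ** P ** P -> T ** T ** T := fun k => ((k.1.1.2, k.1.2.2), k.2.2).
Let OS := sh_Omega S.
Let OT := sh_Omega T.
Let hOS : is_form2 OS := Omega_form hS.
Let hOT : is_form2 OT := Omega_form hT.

Lemma tmap_prod_fst q (x y : tangent P) :
  tmap piS q (row_mx x y) = row_mx (lsubmx x) (lsubmx y).
Proof.
apply: etrans (tmap_pair mPP mS mS _ _ (is_smooth_comp mPP mP mS s1 sfS)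
  (is_smooth_comp mPP mP mS s2 sfS)) _.
have E1 := tmap_comp mPP mP mS q (row_mx x y) s1 sfS.
have E2 := tmap_comp mPP mP mS q (row_mx x y) s2 sfS.
rewrite (tmap_fst mP mP) (tmap_fst mS mT) row_mxKl in E1.
rewrite (tmap_snd mP mP) (tmap_fst mS mT) row_mxKr in E2.
exact (congr2 (fun a b : tangent S => row_mx a b) E1 E2).
Qed.

Lemma tmap_prod_snd q (x y : tangent P) :
  tmap piT q (row_mx x y) = row_mx (rsubmx x) (rsubmx y).
Proof.
apply: etrans (tmap_pair mPP mT mT _ _ (is_smooth_comp mPP mP mT s1 sfT)
  (is_smooth_comp mPP mP mT s2 sfT)) _.
have E1 := tmap_comp mPP mP mT q (row_mx x y) s1 sfT.
have E2 := tmap_comp mPP mP mT q (row_mx x y) s2 sfT.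
rewrite (tmap_fst mP mP) (tmap_snd mS mT) row_mxKl in E1.
rewrite (tmap_snd mP mP) (tmap_snd mS mT) row_mxKr in E2.
exact (congr2 (fun a b : tangent T => row_mx a b) E1 E2).
Qed.

Lemma prod_pairing (u v : lie_algebra P) :
  pairing u v = @pairing R S (lsubmx u) (lsubmx v) + @pairing R T (rsubmx u) (rsubmx v).
Proof.
have ES := tmap_prod_fst (gone, gone); have ET := tmap_prod_snd (gone, gone).
have l0 : lsubmx (0 : lie_algebra P) = 0 :> lie_algebra S by exact: linear0E (@lsubmx_linear R _ _).
have r0 : rsubmx (0 : lie_algebra P) = 0 :> lie_algebra T by exact: linear0E (@rsubmx_linear R _ _).
have ES1 := ES u 0; have ES2 := ES 0 u; have ES3 := ES v 0; have ES4 := ES 0 v.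
have ET1 := ET u 0; have ET2 := ET 0 u; have ET3 := ET v 0; have ET4 := ET 0 v.
rewrite l0 in ES1 ES2 ES3 ES4; rewrite r0 in ET1 ET2 ET3 ET4.
have A1 := congr2 +%R (congr2 (OS (gone, gone)) ES1 ES4) (congr2 (OT (gone, gone)) ET1 ET4).
have A2 := congr2 +%R (congr2 (OS (gone, gone)) ES2 ES3) (congr2 (OT (gone, gone)) ET2 ET3).
apply: etrans (congr2 (fun a b : R => - a + b) A1 A2) _.
exact (pairing_sum _ _ _ _).
Qed.

(** Every identity for the product is the sum of the identities for the factors, pulled back along
    the projections. The squares in question commute by computation, whence the [erefl] arguments.
    For nondegeneracy the test vectors are taken in one factor at a time. *)
Lemma prod_is_shifted : is_shifted_symplectic P.
Proof.
have fOS := pullback2_form mPP mSS spS hOS; have fOT := pullback2_form mPP mTT spT hOT.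
have fTS := pullback3_form mP mS sfS (Theta_form hS).
have fTT := pullback3_form mP mT sfT (Theta_form hT).
have s11 := is_smooth_comp mP3 mPP mP (is_smooth_fst mPP mP) s1.
have s12 := is_smooth_comp mP3 mPP mP (is_smooth_fst mPP mP) s2.
have s3 := is_smooth_snd mPP mP.
split.
- exact: prod_is_lie_group.
- exact: (form2D mPP fOS fOT).
- exact: (form3D mP fTS fTT).
- apply/funext => p; apply/funext => u; apply/funext => v.
  have sc : @is_smooth R P (P ** P) (fun k => (gone, k)) by exact: is_smooth_inr.
  have E1 := pullback2_swap mP mPP mS mSS OS p u v sc spS sfS (is_smooth_inr mS mS gone) erefl.
  have E2 := pullback2_swap mP mPP mT mTT OT p u v sc spT sfT (is_smooth_inr mT mT gone) erefl.
  have E1' := etrans E1 (congr1 (fun w : form2 S => w p.1 (tmap fS p u) (tmap fS p v)) (Omega_normalized_l hS)).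
  have E2' := etrans E2 (congr1 (fun w : form2 T => w p.2 (tmap fT p u) (tmap fT p v)) (Omega_normalized_l hT)).
  exact (etrans (congr2 +%R E1' E2') (addr0 _)).
- apply/funext => p; apply/funext => u; apply/funext => v.
  have sc : @is_smooth R P (P ** P) (fun k => (k, gone)) by exact: is_smooth_inl.
  have E1 := pullback2_swap mP mPP mS mSS OS p u v sc spS sfS (is_smooth_inl mS mS gone) erefl.
  have E2 := pullback2_swap mP mPP mT mTT OT p u v sc spT sfT (is_smooth_inl mT mT gone) erefl.
  have E1' := etrans E1 (congr1 (fun w : form2 S => w p.1 (tmap fS p u) (tmap fS p v)) (Omega_normalized_r hS)).
  have E2' := etrans E2 (congr1 (fun w : form2 T => w p.2 (tmap fT p u) (tmap fT p v)) (Omega_normalized_r hT)).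
  exact (etrans (congr2 +%R E1' E2') (addr0 _)).
- apply/funext => p; apply/funext => u; apply/funext => v.
  have srS : is_smooth rhoS.
    apply: (is_smooth_pair mP3 mSS mS).
      apply: (is_smooth_pair mP3 mS mS); first exact: (is_smooth_comp mP3 mP mS s11 sfS).
      exact: (is_smooth_comp mP3 mP mS s12 sfS).
    exact: (is_smooth_comp mP3 mP mS s3 sfS).
  have srT : is_smooth rhoT.
    apply: (is_smooth_pair mP3 mTT mT).
      apply: (is_smooth_pair mP3 mT mT); first exact: (is_smooth_comp mP3 mP mT s11 sfT).
      exact: (is_smooth_comp mP3 mP mT s12 sfT).
    exact: (is_smooth_comp mP3 mP mT s3 sfT).
  have [a1 a2 a3 a4] := cocycle_maps_smooth gP.
  have [b1 b2 b3 b4] := cocycle_maps_smooth gS.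
  have [c1 c2 c3 c4] := cocycle_maps_smooth gT.
  have E1 := pullback2_swap mP3 mPP mS3 mSS OS p u v a1 spS srS b1 erefl.
  have E2 := pullback2_swap mP3 mPP mS3 mSS OS p u v a2 spS srS b2 erefl.
  have E3 := pullback2_swap mP3 mPP mS3 mSS OS p u v a3 spS srS b3 erefl.
  have E4 := pullback2_swap mP3 mPP mS3 mSS OS p u v a4 spS srS b4 erefl.
  have F1 := pullback2_swap mP3 mPP mT3 mTT OT p u v a1 spT srT c1 erefl.
  have F2 := pullback2_swap mP3 mPP mT3 mTT OT p u v a2 spT srT c2 erefl.
  have F3 := pullback2_swap mP3 mPP mT3 mTT OT p u v a3 spT srT c3 erefl.
  have F4 := pullback2_swap mP3 mPP mT3 mTT OT p u v a4 spT srT c4 erefl.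
  have H1 := congr1 (fun w : form2 (S ** S ** S) => w (rhoS p) (tmap rhoS p u) (tmap rhoS p v)) (Omega_closed hS).
  have H2 := congr1 (fun w : form2 (T ** T ** T) => w (rhoT p) (tmap rhoT p u) (tmap rhoT p v)) (Omega_closed hT).
  have X1 := etrans (congr2 (fun a b : R => a - b) (congr2 +%R (congr2 (fun a b : R => a - b) E1 E2) E3) E4) H1.
  have X2 := etrans (congr2 (fun a b : R => a - b) (congr2 +%R (congr2 (fun a b : R => a - b) F1 F2) F3) F4) H2.
  apply: etrans (alt3_sumD _ _ _ _ _ _ _ _) _.
  exact (etrans (congr2 +%R X1 X2) (addr0 _)).
- apply/funext => p; apply/funext => u; apply/funext => v; apply/funext => w.
  have sm := gmul_smooth gP; have smS := gmul_smooth gS; have smT := gmul_smooth gT.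
  have q1 := is_smooth_fst mS mS; have q2 := is_smooth_snd mS mS.
  have r1 := is_smooth_fst mT mT; have r2 := is_smooth_snd mT mT.
  have E1 := pullback3_swap mPP mP mSS mS (sh_Theta S) p u v w s1 sfS spS q1 erefl.
  have E2 := pullback3_swap mPP mP mSS mS (sh_Theta S) p u v w s2 sfS spS q2 erefl.
  have E3 := pullback3_swap mPP mP mSS mS (sh_Theta S) p u v w sm sfS spS smS erefl.
  have F1 := pullback3_swap mPP mP mTT mT (sh_Theta T) p u v w s1 sfT spT r1 erefl.
  have F2 := pullback3_swap mPP mP mTT mT (sh_Theta T) p u v w s2 sfT spT r2 erefl.
  have F3 := pullback3_swap mPP mP mTT mT (sh_Theta T) p u v w sm sfT spT smT erefl.
  have H1 := congr1 (fun x : form3 (S ** S) => x (piS p) (tmap piS p u) (tmap piS p v) (tmap piS p w)) (Theta_Omega hS).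
  have H2 := congr1 (fun x : form3 (T ** T) => x (piT p) (tmap piT p u) (tmap piT p v) (tmap piT p w)) (Theta_Omega hT).
  have X1 := etrans (congr2 (fun a b : R => a - b) (congr2 +%R E1 E2) E3) H1.
  have X2 := etrans (congr2 (fun a b : R => a - b) (congr2 +%R F1 F2) F3) H2.
  apply: etrans (alt2_sumD' _ _ _ _ _ _) _.
  apply: etrans (congr2 +%R X1 X2) _.
  have D := ext_d2D mPP fOS fOT.
  have DS := ext_d2_pullback mPP mSS spS hOS; have DT := ext_d2_pullback mPP mTT spT hOT.
  apply: etrans (esym (opprD' _ _)) _.
  apply: (congr1 -%R).
  have {}D := congr1 (fun x : form3 (P ** P) => x p u v w) D.
  have {}DS := congr1 (fun x : form3 (P ** P) => x p u v w) DS.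
  have {}DT := congr1 (fun x : form3 (P ** P) => x p u v w) DT.
  exact (esym (etrans D (congr2 +%R DS DT))).
- apply: etrans (ext_d3D mP fTS fTT) _.
  apply/funext => p; apply/funext => u; apply/funext => v; apply/funext => w; apply/funext => x.
  have DS := ext_d3_pullback mP mS sfS (Theta_form hS).
  have DT := ext_d3_pullback mP mT sfT (Theta_form hT).
  have {}DS := congr1 (fun y : form4 P => y p u v w x) DS.
  have {}DT := congr1 (fun y : form4 P => y p u v w x) DT.
  have ZS := congr1 (fun y : form4 S => y (fS p) (tmap fS p u) (tmap fS p v) (tmap fS p w) (tmap fS p x)) (Theta_closed hS).
  have ZT := congr1 (fun y : form4 T => y (fT p) (tmap fT p u) (tmap fT p v) (tmap fT p w) (tmap fT p x)) (Theta_closed hT).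
  exact (etrans (congr2 +%R (etrans DS ZS) (etrans DT ZT)) (addr0 _)).
- move=> u H.
  have u1 : lsubmx u = 0 :> lie_algebra S.
    apply: (pairing_nondeg hS) => v; have := H (row_mx v 0).
    rewrite prod_pairing row_mxKl row_mxKr => E; apply: etrans E.
    by rewrite (pairing0r hT) addr0.
  have u2 : rsubmx u = 0 :> lie_algebra T.
    apply: (pairing_nondeg hT) => v; have := H (row_mx 0 v).
    rewrite prod_pairing row_mxKl row_mxKr => E; apply: etrans E.
    by rewrite (pairing0r hS) add0r.
  by rewrite -[u](@hsubmxK R 1 (mdim S) (mdim T)) u1 u2 row_mx0.
Qed.

End Product.

End OppProd.

(** * Componentwise formulas on product groups *)

Section GroupMorphisms.
Context {R : realType}.
Local Notation tangent M := 'rV[R]_(mdim M).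
Local Notation lie_algebra K := 'rV[R]_(mdim K).
Local Notation "M ** N" := (prod_manifold M N) (at level 40).

Section Morphism.
Variables (K L : lie_group_data R) (hK : is_lie_group K) (hL : is_lie_group L).
Let mK : is_manifold K := lie_group_manifold hK.
Let mL : is_manifold L := lie_group_manifold hL.
Variables (f : K -> L) (hf : is_lie_group_morphism f).
Let sf : is_smooth f := hf.1.
Let f1 : f gone = gone := morphism1 hK hL hf.

(** A morphism intertwines right translations, left translations and conjugations of the two groups.
    Specializing a and b gives its compatibility with [theta_r], [theta_l] and [Ad]; for the
    projections these are the componentwise formulas. *)
Lemma tmap_morphism (a : K -> K) (b : L -> L) m v : is_smooth a -> is_smooth b ->
  (forall x, f (a x) = b (f x)) ->
  tmap f (a m) (tmap a m v) = tmap b (f m) (tmap f m v).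
Proof.
move=> sa sb E.
have E1 := tmap_comp mK mK mL m v sa sf; have E2 := tmap_comp mK mL mL m v sf sb.
have Ef : f \o a = b \o f by apply/funext => x; exact: E.
rewrite Ef in E1; exact (etrans (esym E1) E2).
Qed.

Lemma tmap_theta_r m X : tmap f gone (theta_r m X) = theta_r (f m) (tmap f m X).
Proof.
have H x : f (gmul x (ginv m)) = gmul (f x) (ginv (f m)).
  by rewrite hf.2 (morphismV hK hL hf).
have E := tmap_morphism m X (is_smooth_mulr hK (ginv m)) (is_smooth_mulr hL (ginv (f m))) H.
by rewrite (gmulgV hK) in E.
Qed.

Lemma tmap_theta_l m X : tmap f gone (theta_l m X) = theta_l (f m) (tmap f m X).
Proof.
have H x : f (gmul (ginv m) x) = gmul (ginv (f m)) (f x).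
  by rewrite hf.2 (morphismV hK hL hf).
have E := tmap_morphism m X (is_smooth_mull hK (ginv m)) (is_smooth_mull hL (ginv (f m))) H.
by rewrite (gmulVg hK) in E.
Qed.

Lemma tmap_Ad m v : tmap f gone (Ad m v) = Ad (f m) (tmap f gone v).
Proof.
have H x : f (gmul (gmul m x) (ginv m)) = gmul (gmul (f m) (f x)) (ginv (f m)).
  by rewrite !hf.2 (morphismV hK hL hf).
have E := tmap_morphism gone v (is_smooth_conj hK m) (is_smooth_conj hL (f m)) H.
by rewrite (conj1 hK) f1 in E.
Qed.

End Morphism.

Section Product.
Variables (K L : lie_group_data R) (hK : is_lie_group K) (hL : is_lie_group L).
Let mK : is_manifold K := lie_group_manifold hK.
Let mL : is_manifold L := lie_group_manifold hL.
Let P := prod_lie_group K L.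
Let hP : is_lie_group P := prod_is_lie_group hK hL.
Let mf := fst_morphism hK hL.
Let ms := snd_morphism hK hL.

Let Tf m u : @tmap R P K fst m u = lsubmx u. Proof. exact (tmap_fst mK mL m u). Qed.
Let Ts m u : @tmap R P L snd m u = rsubmx u. Proof. exact (tmap_snd mK mL m u). Qed.

Lemma row_mx_eq m n (x : 'rV[R]_(m + n)) a b : lsubmx x = a -> rsubmx x = b -> x = row_mx a b.
Proof. by move=> <- <-; rewrite hsubmxK. Qed.

Lemma right_field_prod (m : P) (u : lie_algebra P) : right_field u m =
  row_mx (@right_field R K (lsubmx u) m.1) (@right_field R L (rsubmx u) m.2).
Proof.
have E1 := tmap_right_field hP hK mf u m; have E2 := tmap_right_field hP hL ms u m.
by rewrite !Tf in E1; rewrite !Ts in E2; exact: row_mx_eq.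
Qed.

Lemma theta_r_prod (m : P) (u : tangent P) : theta_r m u =
  row_mx (@theta_r R K m.1 (lsubmx u)) (@theta_r R L m.2 (rsubmx u)).
Proof.
have E1 := tmap_theta_r hP hK mf m u; have E2 := tmap_theta_r hP hL ms m u.
by rewrite !Tf in E1; rewrite !Ts in E2; exact: row_mx_eq.
Qed.

Lemma theta_l_prod (m : P) (u : tangent P) : theta_l m u =
  row_mx (@theta_l R K m.1 (lsubmx u)) (@theta_l R L m.2 (rsubmx u)).
Proof.
have E1 := tmap_theta_l hP hK mf m u; have E2 := tmap_theta_l hP hL ms m u.
by rewrite !Tf in E1; rewrite !Ts in E2; exact: row_mx_eq.
Qed.

Lemma Ad_prod (m : P) (u : lie_algebra P) : Ad m u =
  row_mx (@Ad R K m.1 (lsubmx u)) (@Ad R L m.2 (rsubmx u)).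
Proof.
have E1 := tmap_Ad hP hK mf m u; have E2 := tmap_Ad hP hL ms m u.
by rewrite !Tf in E1; rewrite !Ts in E2; exact: row_mx_eq.
Qed.

End Product.
End GroupMorphisms.

(** * Shifted groups with Cartan-Dirac covectors, and maximality of A *)

Section Standard.
Context {R : realType}.

Lemma covector_algebra (a b : R) : - 2^-1 * - a - - 2^-1 * b = 2^-1 * (a + b).
Proof. ring. Qed.

Lemma opp_sub (a b : R) : - a - - b = - (a - b).
Proof. ring. Qed.

Lemma opp_half (a b : R) : - (2^-1 * (a + b)) = 2^-1 * (- a + - b).
Proof. ring. Qed.

Local Notation tangent M := 'rV[R]_(mdim M).
Local Notation lie_algebra K := 'rV[R]_(mdim K).

(* The covectors of [A_dirac] are then those of the Cartan-Dirac structure; this is stable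
   under products and change of sign, and need not hold for a general shifted form. *)
Record is_cartan (S : shifted_data R) : Prop := IsCartan {
  cartan_shifted : is_shifted_symplectic S;
  cartan_quadratic : is_quadratic (@pairing R S);
  cartan_Ad : @is_Ad_invariant R S (@pairing R S);
  cartan_covector : forall (d : S) (u v : lie_algebra S) (w : tangent S),
    sh_Omega S (gone, d) (row_mx 0 w) (row_mx u 0)
      - sh_Omega S (d, gone) (row_mx w 0) (row_mx 0 v)
    = 2^-1 * (pairing u (theta_r d w) + pairing v (theta_l d w))
}.

(** On each of the two pairs of vectors in the covector, a single term of the antisymmetrized
    pairing survives and contributes one half. *)
Lemma canonical_is_cartan (G : lie_group_data R)
    (B : lie_algebra G -> lie_algebra G -> R) : is_lie_group G -> is_quadratic B ->
  is_Ad_invariant B -> is_cartan (canonical_shifted B).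
Proof.
move=> hG hB hAd.
have pE : @pairing R (canonical_shifted B) = B.
  apply/funext => u; apply/funext => v; exact: canonical_pairing.
split; rewrite ?pE//; first exact: canonical_is_shifted.
move=> d u v w.
have E1 := Omega_row hG B gone d 0 u w 0.
have E2 := Omega_row hG B d gone w 0 0 v.
rewrite (theta_l1 hG) !(B0l hB) sub0r in E1.
rewrite (theta_r1 hG) (linear0E (theta_l_linear hG d)) (B0l hB) subr0 in E2.
rewrite (theta_l1 hG) in E1.
apply: etrans (congr2 (fun a b : R => a - b) E1 E2) _.
rewrite (quadratic_sym hB v).
exact: covector_algebra.
Qed.

Lemma opp_is_cartan (S : shifted_data R) : is_cartan S -> is_cartan (opp_shifted S).
Proof.
case=> hS [q1 q2 q3 q4] hA hc.
have pE u v : @pairing R (opp_shifted S) u v = - @pairing R S u v := @opp_pairing R S u v.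
split.
- exact: opp_is_shifted.
- split.
  + by move=> u a x y; rewrite !pE q1 opprD mulrN.
  + by move=> u v; rewrite !pE q2.
  + by move=> u H; apply: q3 => v; apply/eqP; rewrite -oppr_eq0 -pE H.
  + move=> u v w; rewrite !pE.
    apply: etrans (esym (opprD' _ _)) _.
    exact (etrans (congr1 -%R (q4 u v w)) (oppr0R)).
- by move=> g u v; rewrite !pE (hA g u v).
- move=> d u v w; rewrite !pE.
  apply: etrans (opp_sub _ _) _.
  apply: etrans (congr1 -%R (hc d u v w)) _.
  exact: opp_half.
Qed.

End Standard.

Local Opaque pairing.

Section ProdCartan.
Context {R : realType}.
Local Notation tangent M := 'rV[R]_(mdim M).
Local Notation lie_algebra K := 'rV[R]_(mdim K).
Local Notation "M ** N" := (prod_manifold M N) (at level 40).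

Lemma sum_half (a b c d : R) :
  2^-1 * (a + b) + 2^-1 * (c + d) = 2^-1 * ((a + c) + (b + d)).
Proof. ring. Qed.

Lemma sum_scale (a x y z t : R) : (a * x + y) + (a * z + t) = a * (x + z) + (y + t).
Proof. ring. Qed.

Lemma half_total (a b : R) : 2^-1 * ((a + b) + (a - b)) = a.
Proof. lra. Qed.

Lemma half_difference n (b x : 'rV[R]_n) : (b + 2^-1 *: x) - (b - 2^-1 *: x) = x.
Proof. by apply/rowP => i; rewrite !mxE; lra. Qed.

Lemma half_scale (a x y z t : R) :
  2^-1 * ((a * x + y) + (a * z + t)) = a * (2^-1 * (x + z)) + 2^-1 * (y + t).
Proof. ring. Qed.

Lemma lagrangian_algebra (a1 a2 a3 a4 : R) :
  2^-1 * (a1 + a2) + (a3 - a4) = 0 -> (a3 + 2^-1 * a1) - (a4 - 2^-1 * a2) = 0.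
Proof. by move=> E; rewrite -[RHS]E; ring. Qed.

Lemma addrACA_real (a b c d : R) : (a + b) + (c + d) = (a + c) + (b + d).
Proof. exact: addrACA. Qed.

Lemma sum_sub (a b c d : R) : (a + b) - (c + d) = (a - c) + (b - d).
Proof. ring. Qed.

Lemma prod_is_cartan (S T : shifted_data R) :
  is_cartan S -> is_cartan T -> is_cartan (prod_shifted S T).
Proof.
case=> hS [qS1 qS2 qS3 qS4] AS cS; case=> hT [qT1 qT2 qT3 qT4] AT cT.
have hP := prod_is_shifted hS hT; have pE := prod_pairing hS hT.
have gS := shifted_lie_group hS; have gT := shifted_lie_group hT.
have mS := lie_group_manifold gS; have mT := lie_group_manifold gT.
split.
- exact: hP.
- split.
  + move=> u a x y; rewrite !pE.
    have l1 : lsubmx (a *: x + y) = a *: lsubmx x + lsubmx y :> lie_algebra S by exact: lsubmx_linear.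
    have l2 : rsubmx (a *: x + y) = a *: rsubmx x + rsubmx y :> lie_algebra T by exact: rsubmx_linear.
    rewrite l1 l2 qS1 qT1; exact: sum_scale.
  + by move=> u v; rewrite !pE; exact (congr2 (fun a b : R => a + b) (qS2 (lsubmx u) (lsubmx v)) (qT2 (rsubmx u) (rsubmx v))).
  + exact: (pairing_nondeg hP).
  + move=> u v w.
    have L x y := etrans (congr1 lsubmx (lie_bracket_prod gS gT x y)) (row_mxKl _ _).
    have L' x y := etrans (congr1 rsubmx (lie_bracket_prod gS gT x y)) (row_mxKr _ _).
    have E1 := etrans (pE (lie_bracket u v) w) (congr2 +%R
      (congr1 (fun x => @pairing R S x (lsubmx w)) (L u v))
      (congr1 (fun x => @pairing R T x (rsubmx w)) (L' u v))).
    have E2 := etrans (pE v (lie_bracket u w)) (congr2 +%R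
      (congr1 (@pairing R S (lsubmx v)) (L u w)) (congr1 (@pairing R T (rsubmx v)) (L' u w))).
    apply: etrans (congr2 +%R E1 E2) _; apply: etrans (addrACA_real _ _ _ _) _.
    exact (etrans (congr2 +%R (qS4 _ _ _) (qT4 _ _ _)) (addr0 0)).
- move=> g u v.
  have L x := etrans (congr1 lsubmx (Ad_prod gS gT g x)) (row_mxKl _ _).
  have L' x := etrans (congr1 rsubmx (Ad_prod gS gT g x)) (row_mxKr _ _).
  have E1 := etrans (congr2 (@pairing R S) (L u) (L v)) (AS g.1 _ _).
  have E2 := etrans (congr2 (@pairing R T) (L' u) (L' v)) (AT g.2 _ _).
  exact (etrans (pE _ _) (etrans (congr2 +%R E1 E2) (esym (pE _ _)))).
- move=> d u v w.
  have l0 : lsubmx (0 : lie_algebra (prod_shifted S T)) = 0 :> lie_algebra S.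
    exact: linear0E (@lsubmx_linear R _ _).
  have r0 : rsubmx (0 : lie_algebra (prod_shifted S T)) = 0 :> lie_algebra T.
    exact: linear0E (@rsubmx_linear R _ _).
  have ES := tmap_prod_fst hS hT; have ET := tmap_prod_snd hS hT.
  have ES1 := ES (gone, d) 0 w; have ES2 := ES (gone, d) u 0.
  have ES3 := ES (d, gone) w 0; have ES4 := ES (d, gone) 0 v.
  have ET1 := ET (gone, d) 0 w; have ET2 := ET (gone, d) u 0.
  have ET3 := ET (d, gone) w 0; have ET4 := ET (d, gone) 0 v.
  rewrite l0 in ES1 ES2 ES3 ES4; rewrite r0 in ET1 ET2 ET3 ET4.
  have A1 := congr2 +%R (congr2 (sh_Omega S (gone, d.1)) ES1 ES2) (congr2 (sh_Omega T (gone, d.2)) ET1 ET2).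
  have A2 := congr2 +%R (congr2 (sh_Omega S (d.1, gone)) ES3 ES4) (congr2 (sh_Omega T (d.2, gone)) ET3 ET4).
  apply: etrans (congr2 (fun a b : R => a - b) A1 A2) _.
  apply: etrans (sum_sub _ _ _ _) _.
  apply: etrans (congr2 +%R (cS d.1 _ _ _) (cT d.2 _ _ _)) _.
  have L := etrans (congr1 lsubmx (theta_r_prod gS gT d w)) (row_mxKl _ _).
  have L' := etrans (congr1 rsubmx (theta_r_prod gS gT d w)) (row_mxKr _ _).
  have M := etrans (congr1 lsubmx (theta_l_prod gS gT d w)) (row_mxKl _ _).
  have M' := etrans (congr1 rsubmx (theta_l_prod gS gT d w)) (row_mxKr _ _).
  have P1 := etrans (pE u (theta_r d w)) (congr2 +%R
    (congr1 (@pairing R S (lsubmx u)) L) (congr1 (@pairing R T (rsubmx u)) L')).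
  have P2 := etrans (pE v (theta_l d w)) (congr2 +%R
    (congr1 (@pairing R S (lsubmx v)) M) (congr1 (@pairing R T (rsubmx v)) M')).
  apply: etrans _ (esym (congr1 (fun z => 2^-1 * z) (congr2 +%R P1 P2))).
  exact: sum_half.
Qed.

Lemma double_group2_is_cartan (G : lie_group_data R)
    (B : lie_algebra G -> lie_algebra G -> R) : is_lie_group G -> is_quadratic B ->
  is_Ad_invariant B -> is_cartan (double_group2 B).
Proof.
move=> hG hB hAd; have hC := canonical_is_cartan hG hB hAd.
by do 2?apply: prod_is_cartan; try exact: hC; exact: opp_is_cartan.
Qed.

(** The Gram matrix M of B is invertible because a row vector killed by M is orthogonal to the whole
    basis. The representing vector solves a linear system with matrix M. *)
Lemma scalar_representation n (B : 'rV[R]_n -> 'rV[R]_n -> R) (phi : 'rV[R]_n -> R) :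
  (forall u, scalar (B u)) -> (forall v, scalar (B^~ v)) ->
  (forall u, (forall v, B u v = 0) -> u = 0) -> scalar phi ->
  exists b, forall v, phi v = B b v.
Proof.
move=> B2 B1 nd lphi.
pose M := \matrix_(i, j) B (delta_mx 0 i) (delta_mx 0 j) : 'M[R]_n.
have BE u j : B u (delta_mx 0 j) = (u *m M) 0 j.
  rewrite mxE [LHS](scalar_sum u (B1 (delta_mx 0 j))).
  by apply: eq_bigr => i _; rewrite mxE.
have M_unit : M \in unitmx.
  rewrite -row_free_unit; apply/row_freeP.
  suff : row_free M by move=> /row_freeP.
  rewrite -kermx_eq0; apply/eqP/row_matrixP => i; rewrite row0.
  apply: nd => v; rewrite (scalar_sum v (B2 _)); apply: big1 => j _.
  rewrite BE; have -> : row i (kermx M) *m M = 0.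
    by rewrite -row_mul mulmx_ker row0.
  by rewrite mxE; exact: mulr0.
pose w : 'rV[R]_n := \row_j phi (delta_mx 0 j).
exists (w *m invmx M) => v.
rewrite (scalar_sum v lphi) (scalar_sum v (B2 _)); apply: eq_bigr => j _.
by rewrite BE mulmxKV// mxE.
Qed.

Section Maximal.
Variables (S : shifted_data R) (hS : is_cartan S) (g' : set (lie_algebra S)).
Hypothesis (hg : is_manin_pair g').
Let gS := shifted_lie_group (cartan_shifted hS).
Let mS : is_manifold S := lie_group_manifold gS.
Let p2 : forall u, scalar (@pairing R S u) := quadratic_linear (cartan_quadratic hS).
Let psym := quadratic_sym (cartan_quadratic hS).
Let p1 v : scalar (fun u => @pairing R S u v).
Proof. by move=> a x y; rewrite !(psym _ v) p2. Qed.

Definition covector (d : S) (u v : lie_algebra S) : tangent S -> R :=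
  fun w => sh_Omega S (gone, d) (row_mx 0 w) (row_mx u 0)
           - sh_Omega S (d, gone) (row_mx w 0) (row_mx 0 v).

Lemma covectorE d u v w :
  covector d u v w = 2^-1 * (pairing u (theta_r d w) + pairing v (theta_l d w)).
Proof. exact: cartan_covector. Qed.

Lemma covector_scalar d u v : scalar (covector d u v).
Proof.
move=> a x y; rewrite !covectorE (theta_r_linear gS) (theta_l_linear gS) !p2.
exact: half_scale.
Qed.

(* [(X, beta)] is orthogonal to [A_dirac g' d], which is lagrangian. *)
Lemma A_dirac_maximal (d : S) (X : tangent S) (beta : tangent S -> R) :
  scalar beta ->
  (forall u v, g' u -> g' v ->
     covector d u v X + beta (right_field u d - left_field v d) = 0) ->
  A_dirac g' d (X, beta).
Proof.
move=> lb H; pose xi := theta_r d X.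
have lphi : scalar (fun eta => beta (right_field eta d)).
  by move=> a x y; rewrite (right_field_linear gS) lb.
have [b bE] := scalar_representation p2 p1 (quadratic_nondeg (cartan_quadratic hS)) lphi.
(* The element b represents beta and xi represents X in the right trivialization. The conditions $u
   - \mathrm{Ad}_d v = \xi$ and $\frac12(u + \mathrm{Ad}_d v) = b$ determine u and v. *)
pose u0 := b + 2^-1 *: xi; pose v0 := Ad (ginv d) (b - 2^-1 *: xi).
have Ai x v : pairing (Ad (ginv d) x) v = pairing x (Ad d v).
  exact (etrans (congr1 (pairing (Ad (ginv d) x)) (esym (AdKV gS d v)))
    (cartan_Ad hS (ginv d) x (Ad d v))).
have pBZ x y : pairing (b - 2^-1 *: x) y = pairing b y - 2^-1 * pairing x y.
  by rewrite (scalarD _ _ (p1 y)) (scalarN _ (p1 y)) (scalar_scale _ _ (p1 y)).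
have pDZ x y : pairing (b + 2^-1 *: x) y = pairing b y + 2^-1 * pairing x y.
  by rewrite (scalarD _ _ (p1 y)) (scalar_scale _ _ (p1 y)).
(* Orthogonality to A, rewritten for u0 and v0. Putting v = 0 or u = 0 shows that each of them is
   orthogonal to g', hence lies in it since g' is lagrangian. *)
have lag : forall u v, g' u -> g' v -> pairing u0 u - pairing v0 v = 0.
  move=> u v gu gv.
  have E := H u v gu gv.
  rewrite covectorE (scalarD _ _ lb) (scalarN _ lb) bE (left_field_Ad gS) bE in E.
  rewrite (theta_l_Ad gS) in E.
  have A1 : pairing u0 u = pairing b u + 2^-1 * pairing u xi.
    exact (etrans (pDZ xi u) (congr1 (fun z => pairing b u + 2^-1 * z) (psym _ _))).
  have A2 : pairing v0 v = pairing b (Ad d v) - 2^-1 * pairing v (Ad (ginv d) xi).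
    apply: etrans (Ai _ _) _; apply: etrans (pBZ _ _) _.
    exact (congr1 (fun z => pairing b (Ad d v) - 2^-1 * z)
      (etrans (esym (Ai xi v)) (psym _ _))).
  rewrite A1 A2; exact (lagrangian_algebra E).
have z1 (u : lie_algebra S) : pairing u 0 = 0 by exact: scalar0 (p2 u).
have gu0 : g' u0.
  apply/(manin_lagrangian hg) => u gu; have := lag u 0 gu (manin_0 hg).
  by rewrite z1 subr0.
have gv0 : g' v0.
  apply/(manin_lagrangian hg) => v gv; have := lag 0 v (manin_0 hg) gv.
  by rewrite z1 sub0r => /eqP; rewrite oppr_eq0 => /eqP.
have XE : X = right_field u0 d - left_field v0 d.
  have E1 : left_field v0 d = right_field (b - 2^-1 *: xi) d.
    by rewrite (left_field_Ad gS) /v0 (AdVK gS).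
  rewrite E1; apply: etrans _ (linearBE _ _ (right_field_linear gS d)).
  by rewrite /u0 half_difference (right_field_theta_r gS).
exists u0, v0; split=> //.
have bw : beta = covector d u0 v0.
  apply/funext => w; rewrite covectorE.
  have E1 : pairing v0 (theta_l d w) = pairing b (theta_r d w) - 2^-1 * pairing xi (theta_r d w).
    rewrite (theta_l_Ad gS); apply: etrans (cartan_Ad hS _ _ _) _; exact: pBZ.
  rewrite E1 [pairing u0 _]pDZ.
  apply: etrans (esym (half_total _ _)).
  by rewrite -bE (right_field_theta_r gS).
by rewrite -XE bw.
Qed.

End Maximal.

End ProdCartan.

(** * The group $D^2$ and its diagonal *)

Section Double.
Context {R : realType}.
Local Notation tangent M := 'rV[R]_(mdim M).
Local Notation lie_algebra K := 'rV[R]_(mdim K).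
Local Notation "M ** N" := (prod_manifold M N) (at level 40).
Variables (G : lie_group_data R) (hG : is_lie_group G).
Variables (B : lie_algebra G -> lie_algebra G -> R).
Hypotheses (hB : is_quadratic B) (hAd : is_Ad_invariant B).
Let hM : is_manifold G := lie_group_manifold hG.
Let hGG : is_lie_group (prod_lie_group G G) := prod_is_lie_group hG hG.
Let mGG : is_manifold (G ** G) := prod_is_manifold hM hM.
Let hG4 : is_lie_group (prod_lie_group (prod_lie_group G G) (prod_lie_group G G)) :=
  prod_is_lie_group hGG hGG.
Let S := double_group2 B.
Let hC := canonical_is_cartan hG hB hAd.
Let hD := prod_is_cartan hC (opp_is_cartan hC).
Let hS : is_cartan S := double_group2_is_cartan hG hB hAd.

Definition row4 (n : nat) (x1 x2 x3 x4 : 'rV[R]_n) : 'rV[R]_(n + n + (n + n)) :=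
  row_mx (row_mx x1 x2) (row_mx x3 x4).

Lemma row4_eta n (x : 'rV[R]_(n + n + (n + n))) :
  x = row4 (lsubmx (lsubmx x)) (rsubmx (lsubmx x)) (lsubmx (rsubmx x)) (rsubmx (rsubmx x)).
Proof. by rewrite /row4 !hsubmxK. Qed.

Lemma row4_inj n (x1 x2 x3 x4 y1 y2 y3 y4 : 'rV[R]_n) :
  row4 x1 x2 x3 x4 = row4 y1 y2 y3 y4 -> [/\ x1 = y1, x2 = y2, x3 = y3 & x4 = y4].
Proof. by move=> /eq_row_mx[/eq_row_mx[-> ->] /eq_row_mx[-> ->]]. Qed.

Lemma row4_linear n a (x1 x2 x3 x4 y1 y2 y3 y4 : 'rV[R]_n) :
  a *: row4 x1 x2 x3 x4 + row4 y1 y2 y3 y4 =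
  row4 (a *: x1 + y1) (a *: x2 + y2) (a *: x3 + y3) (a *: x4 + y4).
Proof. by rewrite /row4 !scale_row_mx !add_row_mx. Qed.

Lemma row4_sub n (x1 x2 x3 x4 y1 y2 y3 y4 : 'rV[R]_n) :
  row4 x1 x2 x3 x4 - row4 y1 y2 y3 y4 = row4 (x1 - y1) (x2 - y2) (x3 - y3) (x4 - y4).
Proof. by rewrite /row4 !opp_row_mx !add_row_mx. Qed.

Lemma pairing_row4 x1 x2 x3 x4 y1 y2 y3 y4 :
  @pairing R S (row4 x1 x2 x3 x4) (row4 y1 y2 y3 y4) =
  B x1 y1 - B x2 y2 + (B x3 y3 - B x4 y4).
Proof.
have cp := canonical_pairing hG hB.
have op x y : @pairing R (opp_shifted (canonical_shifted B)) x y = - B x y.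
  exact (etrans (@opp_pairing R (canonical_shifted B) x y) (congr1 -%R (cp x y))).
have dp a1 a2 b1 b2 : @pairing R (double_group B) (row_mx a1 a2) (row_mx b1 b2) = B a1 b1 - B a2 b2.
  have E := prod_pairing (cartan_shifted hC) (cartan_shifted (opp_is_cartan hC))
    (row_mx a1 a2) (row_mx b1 b2).
  by rewrite !row_mxKl !row_mxKr in E; exact (etrans E (congr2 +%R (cp _ _) (op _ _))).
have E := prod_pairing (cartan_shifted hD) (cartan_shifted hD) (row4 x1 x2 x3 x4) (row4 y1 y2 y3 y4).
rewrite /row4 !row_mxKl !row_mxKr in E.
exact (etrans E (congr2 +%R (dp _ _ _ _) (dp _ _ _ _))).
Qed.

Lemma lie_bracket_row4 x1 x2 x3 x4 y1 y2 y3 y4 :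
  @lie_bracket R S (row4 x1 x2 x3 x4) (row4 y1 y2 y3 y4) =
  row4 (@lie_bracket R G x1 y1) (@lie_bracket R G x2 y2)
       (@lie_bracket R G x3 y3) (@lie_bracket R G x4 y4).
Proof.
have E := lie_bracket_prod hGG hGG (row4 x1 x2 x3 x4) (row4 y1 y2 y3 y4).
rewrite /row4 !row_mxKl !row_mxKr in E.
have E2 a1 a2 b1 b2 := lie_bracket_prod hG hG (row_mx a1 a2) (row_mx b1 b2).
have {}E2 a1 a2 b1 b2 : @lie_bracket R (prod_lie_group G G) (row_mx a1 a2) (row_mx b1 b2) =
    row_mx (@lie_bracket R G a1 b1) (@lie_bracket R G a2 b2).
  by have := E2 a1 a2 b1 b2; rewrite !row_mxKl !row_mxKr.
exact (etrans E (congr2 (fun a b : 'rV[R]_(mdim G + mdim G) => row_mx a b)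
  (E2 x1 x2 y1 y2) (E2 x3 x4 y3 y4))).
Qed.

Lemma theta_r_row4 (d : S) x1 x2 x3 x4 :
  theta_r d (row4 x1 x2 x3 x4) =
  row4 (@theta_r R G d.1.1 x1) (@theta_r R G d.1.2 x2)
       (@theta_r R G d.2.1 x3) (@theta_r R G d.2.2 x4).
Proof.
have E := theta_r_prod hGG hGG d (row4 x1 x2 x3 x4).
rewrite /row4 !row_mxKl !row_mxKr in E.
have E2 (m : prod_lie_group G G) a1 a2 : theta_r m (row_mx a1 a2) =
    row_mx (@theta_r R G m.1 a1) (@theta_r R G m.2 a2).
  by have := theta_r_prod hG hG m (row_mx a1 a2); rewrite !row_mxKl !row_mxKr.
exact (etrans E (congr2 (fun a b : 'rV[R]_(mdim G + mdim G) => row_mx a b)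
  (E2 d.1 x1 x2) (E2 d.2 x3 x4))).
Qed.

Lemma right_field_row4 (d : S) x1 x2 x3 x4 :
  @right_field R S (row4 x1 x2 x3 x4) d =
  row4 (@right_field R G x1 d.1.1) (@right_field R G x2 d.1.2)
       (@right_field R G x3 d.2.1) (@right_field R G x4 d.2.2).
Proof.
have E := right_field_prod hGG hGG d (row4 x1 x2 x3 x4).
rewrite /row4 !row_mxKl !row_mxKr in E.
have E2 (m : prod_lie_group G G) a1 a2 : @right_field R (prod_lie_group G G) (row_mx a1 a2) m =
    row_mx (@right_field R G a1 m.1) (@right_field R G a2 m.2).
  by have := right_field_prod hG hG m (row_mx a1 a2); rewrite !row_mxKl !row_mxKr.
exact (etrans E (congr2 (fun a b : 'rV[R]_(mdim G + mdim G) => row_mx a b)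
  (E2 d.1 x1 x2) (E2 d.2 x3 x4))).
Qed.

Lemma Ad_row4 (d : S) x1 x2 x3 x4 :
  @Ad R S d (row4 x1 x2 x3 x4) =
  row4 (@Ad R G d.1.1 x1) (@Ad R G d.1.2 x2) (@Ad R G d.2.1 x3) (@Ad R G d.2.2 x4).
Proof.
have E := Ad_prod hGG hGG d (row4 x1 x2 x3 x4).
rewrite /row4 !row_mxKl !row_mxKr in E.
have E2 (m : prod_lie_group G G) a1 a2 : Ad m (row_mx a1 a2) =
    row_mx (@Ad R G m.1 a1) (@Ad R G m.2 a2).
  by have := Ad_prod hG hG m (row_mx a1 a2); rewrite !row_mxKl !row_mxKr.
exact (etrans E (congr2 (fun a b : 'rV[R]_(mdim G + mdim G) => row_mx a b)
  (E2 d.1 x1 x2) (E2 d.2 x3 x4))).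
Qed.

Lemma diagonal2P (u : lie_algebra S) :
  diagonal2 B u <-> exists u1 u2, u = row4 u1 u1 u2 u2.
Proof.
split=> [[u1 _ [u2 _ <-]]|[u1 [u2 ->]]]; first by exists u1, u2.
by exists u1 => //; exists u2.
Qed.

Lemma diagonal2_is_manin_pair : is_manin_pair (S := S) (diagonal2 B).
Proof.
have z0 : row4 0 0 0 0 = 0 :> lie_algebra S by rewrite /row4 !row_mx0.
split.
- exact: cartan_quadratic hS.
- by apply/diagonal2P; exists 0, 0; rewrite z0.
- move=> c u v /diagonal2P[u1 [u2 ->]] /diagonal2P[v1 [v2 ->]].
  by apply/diagonal2P; exists (c *: u1 + v1), (c *: u2 + v2); exact: row4_linear.
- move=> u v /diagonal2P[u1 [u2 ->]] /diagonal2P[v1 [v2 ->]].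
  apply/diagonal2P; exists (@lie_bracket R G u1 v1), (@lie_bracket R G u2 v2).
  exact: lie_bracket_row4.
- move=> u; split=> [/diagonal2P[u1 [u2 ->]] v /diagonal2P[v1 [v2 ->]]|H].
    by rewrite pairing_row4 !subrr addr0.
  move: H; rewrite (row4_eta u).
  set u11 := lsubmx (lsubmx u); set u12 := rsubmx (lsubmx u).
  set u21 := lsubmx (rsubmx u); set u22 := rsubmx (rsubmx u) => H.
  (* The test vector (w, w, 0, 0) isolates the difference of the first two components, because the
     second copy of the Lie algebra carries the opposite pairing. *)
  have H1 : u11 - u12 = 0.
    apply: (quadratic_nondeg hB) => w; rewrite (BBl hB).
    have := H (row4 w w 0 0) ((diagonal2P _).2 (ex_intro _ w (ex_intro _ 0 erefl))).
    by rewrite pairing_row4 !(B0r hB) subrr addr0.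
  have H2 : u21 - u22 = 0.
    apply: (quadratic_nondeg hB) => w; rewrite (BBl hB).
    have := H (row4 0 0 w w) ((diagonal2P _).2 (ex_intro _ 0 (ex_intro _ w erefl))).
    by rewrite pairing_row4 !(B0r hB) subrr add0r.
  apply/diagonal2P; exists u11, u21.
  by rewrite -(subr0_eq H1) -(subr0_eq H2).
Qed.

Let phi : prod_lie_group G G -> S := diagonal2_map B.

Lemma diagonal2_map_morphism : is_lie_group_morphism phi.
Proof.
have s1 := is_smooth_fst hM hM; have s2 := is_smooth_snd hM hM.
split; last by [].
apply: (is_smooth_pair mGG mGG mGG); exact: (is_smooth_pair mGG hM hM).
Qed.

Lemma tmap_diagonal2_map g u : tmap phi g u = row4 (lsubmx u) (lsubmx u) (rsubmx u) (rsubmx u).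
Proof.
have s1 := is_smooth_fst hM hM; have s2 := is_smooth_snd hM hM.
have s11 := is_smooth_pair mGG hM hM s1 s1; have s22 := is_smooth_pair mGG hM hM s2 s2.
have T1 := tmap_fst hM hM g u; have T2 := tmap_snd hM hM g u.
have E := tmap_pair mGG mGG mGG g u s11 s22.
have E1 := tmap_pair mGG hM hM g u s1 s1; have E2 := tmap_pair mGG hM hM g u s2 s2.
rewrite T1 in E1; rewrite T2 in E2.
exact (etrans E (congr2 (fun a b : 'rV[R]_(mdim G + mdim G) => row_mx a b) E1 E2)).
Qed.

Lemma diagonal2_is_integration : is_integration (diagonal2 B) phi.
Proof.
split.
- exact: hGG.
- exact: diagonal2_map_morphism.
- move=> u v; rewrite !tmap_diagonal2_map => /row4_inj[E1 _ E2 _].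
  by rewrite -[u](@hsubmxK R 1 (mdim G) (mdim G)) -[v](@hsubmxK R 1 (mdim G) (mdim G)) E1 E2.
- apply/seteqP; split=> u /=.
    move=> [w _ <-]; rewrite tmap_diagonal2_map; apply/diagonal2P.
    by exists (lsubmx w), (rsubmx w).
  move=> /diagonal2P[u1 [u2 ->]]; exists (row_mx u1 u2) => //.
  by rewrite tmap_diagonal2_map row_mxKl row_mxKr.
- by move=> g u v; exact: cartan_Ad hS _ _ _.
- move=> g u; exact (esym (tmap_Ad hGG hG4 diagonal2_map_morphism g u)).
Qed.

End Double.

(** * The groupoid P(G) x G^2 *)

Local Transparent derive tmap theta_l theta_r Ad lie_bracket right_field left_field mul2 cartan3 pairing.

Section Groupoid.
Context {R : realType}.
Local Notation tangent M := 'rV[R]_(mdim M).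
Local Notation lie_algebra K := 'rV[R]_(mdim K).
Local Notation "M ** N" := (prod_manifold M N) (at level 40).

(** A smooth section through each p gives, by the chain rule, a preimage of any tangent vector at f
    p. *)
Lemma submersion_of_sections (M N : manifold_data R) (hM : is_manifold M) (hN : is_manifold N)
    (f : M -> N) : is_smooth f ->
  (forall p, exists s : N -> M, [/\ is_smooth s, s (f p) = p & cancel s f]) ->
  is_submersion f.
Proof.
move=> sf H; split=> // p w; have [s [ss sp sK]] := H p.
exists (tmap s (f p) w).
have E := tmap_comp hN hM hN (f p) w ss sf.
have fs : f \o s = id by apply/funext => y; exact: sK.
rewrite fs (tmap_id hN) sp in E; exact (esym E).
Qed.

(** A smooth left inverse provides injectivity of the map and of its differentials, and its
    preimages of open sets show that the topology is induced. *)
Lemma embedding_of_retraction (M N : manifold_data R) (hM : is_manifold M) (hN : is_manifold N)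
    (f : M -> N) (r : N -> M) : is_smooth f -> is_smooth r -> cancel f r ->
  is_embedding f.
Proof.
move=> sf sr K.
have rf : r \o f = id by apply/funext => y; exact: K.
split=> //.
- exact: can_inj K.
- move=> p; apply: (can_inj (g := tmap r (f p))) => v.
  by have := tmap_comp hM hN hM p v sf sr; rewrite rf (tmap_id hM).
- move=> U oU; exists (r @^-1` U); first by apply: open_comp => // x _; exact: sr.1.
  by rewrite -comp_preimage rf.
Qed.

Section PG2.
Variables (G : lie_group_data R) (hG : is_lie_group G).
Let hM : is_manifold G := lie_group_manifold hG.
Let m2 : is_manifold (G ** G) := prod_is_manifold hM hM.
Let m3 : is_manifold (G ** G ** G) := prod_is_manifold m2 hM.
Let m4 : is_manifold (G ** G ** (G ** G)) := prod_is_manifold m2 m2.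
Let mK : is_manifold (G ** G ** (G ** G)) := m4.
Let mc : is_manifold ((G ** G ** G) ** (G ** G ** (G ** G))) := prod_is_manifold m3 mK.
Let H := PG2 G.

Lemma arr_PG2_manifold : is_manifold (arr H).
Proof. exact: m4. Qed.

Let s1 : @is_smooth R (arr H) (G ** G) fst. Proof. exact: is_smooth_fst. Qed.
Let s2 : @is_smooth R (arr H) (G ** G) snd. Proof. exact: is_smooth_snd. Qed.

Lemma smooth_a1 : @is_smooth R (arr H) G (fun h => h.1.1).
Proof. exact: (is_smooth_comp m4 m2 hM s1 (is_smooth_fst hM hM)). Qed.
Lemma smooth_a2 : @is_smooth R (arr H) G (fun h => h.1.2).
Proof. exact: (is_smooth_comp m4 m2 hM s1 (is_smooth_snd hM hM)). Qed.
Lemma smooth_g1 : @is_smooth R (arr H) G (fun h => h.2.1).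
Proof. exact: (is_smooth_comp m4 m2 hM s2 (is_smooth_fst hM hM)). Qed.
Lemma smooth_g2 : @is_smooth R (arr H) G (fun h => h.2.2).
Proof. exact: (is_smooth_comp m4 m2 hM s2 (is_smooth_snd hM hM)). Qed.

Lemma is_smooth_row4 (M : manifold_data R) (hm : is_manifold M) (f1 f2 f3 f4 : M -> G) :
  is_smooth f1 -> is_smooth f2 -> is_smooth f3 -> is_smooth f4 ->
  @is_smooth R M (G ** G ** (G ** G)) (fun x => ((f1 x, f2 x), (f3 x, f4 x))).
Proof.
move=> t1 t2 t3 t4; apply: (is_smooth_pair hm m2 m2); exact: (is_smooth_pair hm hM hM).
Qed.

Let cmp := gpd_comp H.
Let c1 : @is_smooth R cmp (G ** G ** G) fst. Proof. exact: is_smooth_fst. Qed.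
Let c2 : @is_smooth R cmp (G ** G ** (G ** G)) snd. Proof. exact: is_smooth_snd. Qed.
Let c11 : @is_smooth R cmp (G ** G) (fun c => c.1.1).
Proof. exact: (is_smooth_comp mc m3 m2 c1 (is_smooth_fst m2 hM)). Qed.
Let ca1 : @is_smooth R cmp G (fun c => c.1.1.1).
Proof. exact: (is_smooth_comp mc m2 hM c11 (is_smooth_fst hM hM)). Qed.
Let ca2 : @is_smooth R cmp G (fun c => c.1.1.2).
Proof. exact: (is_smooth_comp mc m2 hM c11 (is_smooth_snd hM hM)). Qed.
Let ca3 : @is_smooth R cmp G (fun c => c.1.2).
Proof. exact: (is_smooth_comp mc m3 hM c1 (is_smooth_snd m2 hM)). Qed.
Let cg : @is_smooth R cmp (G ** G) (fun c => c.2.1).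
Proof. exact: (is_smooth_comp mc m4 m2 c2 (is_smooth_fst m2 m2)). Qed.
Let ch : @is_smooth R cmp (G ** G) (fun c => c.2.2).
Proof. exact: (is_smooth_comp mc m4 m2 c2 (is_smooth_snd m2 m2)). Qed.

Lemma comp_fst_smooth : is_smooth (@comp_fst R H).
Proof. exact: (is_smooth_pair mc m2 m2 (is_smooth_pair mc hM hM ca1 ca2) cg). Qed.

Lemma comp_snd_smooth : is_smooth (@comp_snd R H).
Proof. exact: (is_smooth_pair mc m2 m2 (is_smooth_pair mc hM hM ca2 ca3) ch). Qed.

Lemma gpd_comp_manifold : is_manifold (gpd_comp H).
Proof. exact: mc. Qed.

Lemma comp_mul_smooth : is_smooth (@comp_mul R H).
Proof.
have hGG := prod_is_lie_group hG hG.
exact: (is_smooth_pair mc m2 m2 (is_smooth_pair mc hM hM ca1 ca3)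
  (is_smooth_mul hGG mc cg ch)).
Qed.

Let src_smooth : @is_smooth R (arr H) (obj H) (@gpd_src R H).
Proof. exact: smooth_a2. Qed.

Let tgt_smooth : @is_smooth R (arr H) (obj H) (@gpd_tgt R H).
Proof. exact: smooth_a1. Qed.

Lemma gpd_unit_smooth : @is_smooth R (obj H) (arr H) (@gpd_unit R H).
Proof.
apply: (is_smooth_pair hM m2 m2); last exact: (is_smooth_cst _ m2).
apply: (is_smooth_pair hM hM hM); exact: is_smooth_id.
Qed.

(** Must be defined on all pairs of arrows. On a pair that is not composable, the source of the
    first arrow is taken as the middle object; on the embedded manifold of composable pairs this
    inverts the embedding. *)
Let retract : arr H * arr H -> gpd_comp H :=
  fun hk => (((hk.1.1.1, hk.1.1.2), hk.2.1.2), (hk.1.2, hk.2.2)).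

Let retract_smooth : @is_smooth R (arr H ** arr H) (gpd_comp H) retract.
Proof.
have mAA := prod_is_manifold m4 m4.
have p1 : @is_smooth R (arr H ** arr H) (arr H) fst by exact: (is_smooth_fst m4 m4).
have p2 : @is_smooth R (arr H ** arr H) (arr H) snd by exact: (is_smooth_snd m4 m4).
have q1 := is_smooth_comp mAA m4 hM p1 smooth_a1.
have q2 := is_smooth_comp mAA m4 hM p1 smooth_a2.
have q3 := is_smooth_comp mAA m4 hM p2 smooth_a2.
have r1 := is_smooth_comp mAA m4 m2 p1 s2.
have r2 := is_smooth_comp mAA m4 m2 p2 s2.
exact: (is_smooth_pair mAA m3 m4 (is_smooth_pair mAA m2 hM (is_smooth_pair mAA hM hM q1 q2) q3)
  (is_smooth_pair mAA m2 m2 r1 r2)).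
Qed.

Lemma PG2_is_lie_groupoid : is_lie_groupoid H.
Proof.
have id_s := is_smooth_id hM.
split.
- exact: m4.
- exact: hM.
- exact: mc.
- apply: (submersion_of_sections m4 hM src_smooth) => p.
  exists (fun y : G => ((p.1.1, y), p.2)); split=> //; last by case: p => [[]].
  apply: (is_smooth_pair hM m2 m2); last exact: (is_smooth_cst _ m2).
  by apply: (is_smooth_pair hM hM hM) => //; exact: is_smooth_cst.
- apply: (submersion_of_sections m4 hM tgt_smooth) => p.
  exists (fun y : G => ((y, p.1.2), p.2)); split=> //; last by case: p => [[]].
  apply: (is_smooth_pair hM m2 m2); last exact: (is_smooth_cst _ m2).
  by apply: (is_smooth_pair hM hM hM) => //; exact: is_smooth_cst.
- exact: gpd_unit_smooth.
- apply: (is_smooth_pair m4 m2 m2).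
    exact: (is_smooth_pair m4 hM hM smooth_a2 smooth_a1).
  apply: (is_smooth_pair m4 hM hM); apply: (is_smooth_inv hG m4).
    exact: smooth_g1.
  exact: smooth_g2.
- apply: (embedding_of_retraction mc (prod_is_manifold m4 m4) _ retract_smooth).
    exact: (is_smooth_pair mc m4 m4 comp_fst_smooth comp_snd_smooth).
  by move=> [[[? ?] ?] [? ?]].
- move=> [[a1 a2] g] [[b1 b2] h]; split.
    rewrite /composable /= => E; exists (((a1, a2), b2), (g, h)).
    by rewrite E.
  by move=> [[[[x y] z] [g' h']] [[-> -> ->] [-> -> ->]]].
- exact: comp_mul_smooth.
- by [].
- by [].
- by [].
- by [].
- move=> [[? ?] [? ?]] [[? ?] [? ?]] [[? ?] [? ?]] _ _ /=.
  by rewrite !(gmulA hG).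
- by move=> [[? ?] [? ?]] /=; rewrite !(gmul1g hG).
- by move=> [[? ?] [? ?]] /=; rewrite !(gmulg1 hG).
- by [].
- by [].
- by move=> [[? ?] [? ?]] /=; rewrite !(gmulVg hG).
- by move=> [[? ?] [? ?]] /=; rewrite !(gmulgV hG).
Qed.

End PG2.
End Groupoid.

Local Opaque derive tmap theta_l theta_r Ad lie_bracket right_field left_field mul2 cartan3 pairing.

Lemma boundary_solve (R : realType) (a b c d a' b' c' : R) :
  a + b - c = - d -> a = a' -> b = b' -> c = c' -> d = c' - a' - b'.
Proof. by move=> H <- <- <-; lra. Qed.

(** * Pullbacks of the structure forms along maps into G and into product groups *)

Section OmegaPull.
Context {R : realType}.
Local Notation lie_algebra K := 'rV[R]_(mdim K).
Local Notation "M ** N" := (prod_manifold M N) (at level 40).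
Variables (G : lie_group_data R) (hG : is_lie_group G).
Variables (B : lie_algebra G -> lie_algebra G -> R).
Hypotheses (hB : is_quadratic B) (hAd : is_Ad_invariant B).
Let hM : is_manifold G := lie_group_manifold hG.
Variables (M : manifold_data R) (hm : is_manifold M).
Local Notation OP f g := (Omega_pull B (M := M) f g).

Lemma Omega_pull_form2 (f g : M -> G) : is_smooth f -> is_smooth g -> is_form2 (OP f g).
Proof.
move=> sf sg; have mGG := prod_is_manifold hM hM.
exact (pullback2_form hm mGG (is_smooth_pair hm hM hM sf sg) (Omega_is_form2 hG hB)).
Qed.

Lemma Omega_pull_comp (N : manifold_data R) (hn : is_manifold N) (q : N -> M) (f g : M -> G) p u v :
  is_smooth q -> is_smooth f -> is_smooth g ->
  OP f g (q p) (tmap q p u) (tmap q p v) =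
  Omega_pull B (M := N) (fun x => f (q x)) (fun x => g (q x)) p u v.
Proof.
move=> sq sf sg; have mGG := prod_is_manifold hM hM.
have E := pullback2_comp hn hm mGG (sh_Omega (canonical_shifted B)) sq (is_smooth_pair hm hM hM sf sg).
exact (congr1 (fun w : form2 N => w p u v) E).
Qed.

(** The products fg and gh are given only up to pointwise equality. This lets one map be factored in
    different ways in different instances, so that the terms containing it can be matched. *)
Lemma Omega_cocycle_eq (f g h fg gh : M -> G) p u v :
  is_smooth f -> is_smooth g -> is_smooth h ->
  (forall x, gmul (f x) (g x) = fg x) -> (forall x, gmul (g x) (h x) = gh x) ->
  OP g h p u v - OP fg h p u v + OP f gh p u v - OP f g p u v = 0.
Proof.
move=> sf sg sh /funext Efg /funext Egh.
have E := Omega_cocycle hG hB hAd hm p u v sf sg sh.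
rewrite Efg Egh in E; exact E.
Qed.

(** Naturality of d transports the relation $\mathrm{pr}_1^*\Theta_G + \mathrm{pr}_2^*\Theta_G -
    \mathtt{m}^*\Theta_G = -d\Omega_G$ along the map (f, g). *)
Lemma ext_d2_Omega_pull (f g : M -> G) p u v w : is_smooth f -> is_smooth g ->
  let Th k := @pullback3 R M G k (sh_Theta (canonical_shifted B)) p u v w in
  ext_d2 (OP f g) p u v w = Th (fun x => gmul (f x) (g x)) - Th f - Th g.
Proof.
move=> sf sg Th; have mGG := prod_is_manifold hM hM.
have sfg := is_smooth_pair hm hM hM sf sg.
have E := ext_d2_pullback hm mGG sfg (Omega_is_form2 hG hB).
have E1 := congr1 (fun w' : form3 M => w' p u v w) E.
have C := canonical_Theta_Omega hG hB hAd (f p, g p)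
  (tmap (fun x => (f x, g x) : G ** G) p u) (tmap (fun x => (f x, g x) : G ** G) p v)
  (tmap (fun x => (f x, g x) : G ** G) p w).
have P k (sk : @is_smooth R (G ** G) G k) := congr1 (fun w' : form3 M => w' p u v w)
   (pullback3_comp hm mGG hM (sh_Theta (canonical_shifted B)) sfg sk).
have P1 := P _ (is_smooth_fst hM hM); have P2 := P _ (is_smooth_snd hM hM).
have P3 := P _ (gmul_smooth hG).
exact (etrans E1 (boundary_solve C P1 P2 P3)).
Qed.

End OmegaPull.

Section ProdPull.
Context {R : realType}.
Local Notation "M ** N" := (prod_manifold M N) (at level 40).
Variables (S T : shifted_data R) (hS : is_manifold S) (hT : is_manifold T).
Variables (M : manifold_data R) (hm : is_manifold M).
Let hST : is_manifold (S ** T) := prod_is_manifold hS hT.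

Lemma prod_Theta_pull (f : M -> prod_shifted S T) p u v w : is_smooth f ->
  pullback3 f (sh_Theta (prod_shifted S T)) p u v w =
  @pullback3 R M S (fun x => (f x).1) (sh_Theta S) p u v w +
  @pullback3 R M T (fun x => (f x).2) (sh_Theta T) p u v w.
Proof.
move=> sf.
have E1 := pullback3_comp hm hST hS (sh_Theta S) sf (is_smooth_fst hS hT).
have E2 := pullback3_comp hm hST hT (sh_Theta T) sf (is_smooth_snd hS hT).
exact (congr2 (fun a b : form3 M => a p u v w + b p u v w) E1 E2).
Qed.

Lemma prod_Omega_pull (f g : M -> prod_shifted S T) p u v : is_smooth f -> is_smooth g ->
  @pullback2 R M (prod_manifold (prod_shifted S T) (prod_shifted S T))
     (fun x => (f x, g x)) (sh_Omega (prod_shifted S T)) p u v =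
  @pullback2 R M (S ** S) (fun x => ((f x).1, (g x).1)) (sh_Omega S) p u v +
  @pullback2 R M (T ** T) (fun x => ((f x).2, (g x).2)) (sh_Omega T) p u v.
Proof.
move=> sf sg; have m2 := prod_is_manifold hST hST.
have sfg := is_smooth_pair hm hST hST sf sg.
have F1 := is_smooth_fst hST hST; have F2 := is_smooth_snd hST hST.
have G1 := is_smooth_fst hS hT; have G2 := is_smooth_snd hS hT.
have q1 := is_smooth_pair m2 hS hS (is_smooth_comp m2 hST hS F1 G1) (is_smooth_comp m2 hST hS F2 G1).
have q2 := is_smooth_pair m2 hT hT (is_smooth_comp m2 hST hT F1 G2) (is_smooth_comp m2 hST hT F2 G2).
have E1 := pullback2_comp hm m2 (prod_is_manifold hS hS) (sh_Omega S) sfg q1.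
have E2 := pullback2_comp hm m2 (prod_is_manifold hT hT) (sh_Omega T) sfg q2.
exact (congr2 (fun a b : form2 M => a p u v + b p u v) E1 E2).
Qed.

End ProdPull.

(** * The linear algebra of sigma in the right trivialization *)

Section SigmaAlgebra.
Context {R : realType}.
Variables (n : nat) (B : 'rV[R]_n -> 'rV[R]_n -> R).
Hypotheses (B2 : forall u, scalar (B u)) (Bsym : forall u v, B u v = B v u).

Let B1 v : scalar (B^~ v).
Proof. by move=> a u w; rewrite !(Bsym _ v); exact: B2. Qed.

Let BD2 u v w : B u (v + w) = B u v + B u w. Proof. exact: (scalarD _ _ (B2 u)). Qed.
Let BD1 u v w : B (u + v) w = B u w + B v w. Proof. exact: (scalarD _ _ (B1 w)). Qed.
Let BN2 u v : B u (- v) = - B u v. Proof. exact: (scalarN _ (B2 u)). Qed.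
Let BN1 u v : B (- u) v = - B u v. Proof. exact: (scalarN _ (B1 v)). Qed.

(* [A], [P], [Q], [C] stand for Ad of a1, g1, g2, a2 and the primes for the inverses; [x1], [x2],
   [w1], [w2] are the right-trivialized components of a tangent vector along a1, a2, g1, g2. *)
Variables (A A' P P' Q Q' C C' : 'rV[R]_n -> 'rV[R]_n).

Hypotheses (AK : cancel A A') (A'K : cancel A' A) (PK : cancel P P')
  (QK : cancel Q Q') (CK : cancel C C') (C'K : cancel C' C).
Hypotheses (BA : forall u v, B (A u) v = B u (A' v)) (BA' : forall u v, B (A' u) v = B u (A v))
  (BP : forall u v, B (P u) v = B u (P' v)) (BP' : forall u v, B (P' u) v = B u (P v))
  (BQ : forall u v, B (Q u) v = B u (Q' v)) (BQ' : forall u v, B (Q' u) v = B u (Q v))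
  (BC : forall u v, B (C u) v = B u (C' v)) (BC' : forall u v, B (C' u) v = B u (C v)).
Hypotheses (AD : forall u v, A (u + v) = A u + A v) (AN : forall u, A (- u) = - A u)
  (A'D : forall u v, A' (u + v) = A' u + A' v) (A'N : forall u, A' (- u) = - A' u)
  (PD : forall u v, P (u + v) = P u + P v) (PN : forall u, P (- u) = - P u)
  (P'D : forall u v, P' (u + v) = P' u + P' v) (P'N : forall u, P' (- u) = - P' u)
  (QD : forall u v, Q (u + v) = Q u + Q v) (QN : forall u, Q (- u) = - Q u)
  (Q'D : forall u v, Q' (u + v) = Q' u + Q' v) (Q'N : forall u, Q' (- u) = - Q' u)
  (CD : forall u v, C (u + v) = C u + C v) (CN : forall u, C (- u) = - C u)
  (C'D : forall u v, C' (u + v) = C' u + C' v) (C'N : forall u, C' (- u) = - C' u).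

(** The logarithmic derivatives of $b = a_1 g_2 a_2^{-1}$ and, next, of $c = a_1^{-1} g_1 a_2$; each
    depends on three of the four components. *)
Definition logb x1 x2 w2 := x1 + A w2 - A (Q (C' x2)).
Definition logc x1 x2 w1 := A' (w1 + P x2 - x1).

(** One line for each of the four terms of sigma, in their order. In the last one the inverse of Ad
    of b is expanded as [C], [Q'], [A']. *)
Definition sigma_alg x1 x2 w1 w2 y1 y2 s1 s2 : R :=
  - 2^-1 * (B (A' x1) (logc y1 y2 s1) - B (A' y1) (logc x1 x2 w1))
  - - 2^-1 * (B (P' w1) y2 - B (P' s1) x2)
  - - 2^-1 * (B (A' x1) s2 - B (A' y1) w2)
  + - 2^-1 * (B (C (Q' (A' (logb x1 x2 w2)))) y2 - B (C (Q' (A' (logb y1 y2 s2)))) x2).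

(** The covector of A at Phi(h) for the diagonal elements (u1, u1, u2, u2) and (v1, v1, v2, v2),
    evaluated on the image of a tangent vector of the arrows. The minus signs come from the opposite
    pairing on the second entry of each pair. *)
Definition covector_alg u1 u2 v1 v2 y1 y2 s1 s2 : R :=
  2^-1 * ((B u1 (logb y1 y2 s2) - B u1 s1 + (B u2 (logc y1 y2 s1) - B u2 s2))
    + (B v1 (C (Q' (A' (logb y1 y2 s2)))) - B v1 (P' s1)
       + (B v2 (C' (P' (A (logc y1 y2 s1)))) - B v2 (Q' s2)))).

(** The first four arguments are the components of the generator of the infinitesimal two-sided
    action. Adjointness of each Ad to its inverse moves all operators to one side of B, after which
    the identity is linear in the remaining values. *)
Lemma sigma_covector_alg u1 u2 v1 v2 y1 y2 s1 s2 :
  sigma_alg (u1 - A u2) (v1 - C v2) (u1 - P v1) (u2 - Q v2) y1 y2 s1 s2 =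
  covector_alg u1 u2 v1 v2 y1 y2 s1 s2.
Proof.
(* Symmetry is applied to selected terms by hand, since as a rewriting rule it would loop. It puts
   the components of the generator in the first slot of these pairings. *)
rewrite /sigma_alg /covector_alg (Bsym (A' y1) (logc _ _ _)) (Bsym (P' s1)).
rewrite (Bsym (A' y1) (u2 - _)) (Bsym (C (Q' (A' (logb y1 _ _)))) (v1 - _)).
rewrite /logb /logc.
rewrite !(AD, AN, A'D, A'N, PD, PN, P'D, P'N, QD, QN, Q'D, Q'N, CD, CN, C'D, C'N,
  AK, A'K, PK, QK, CK, C'K, BD1, BD2, BN1, BN2, BA, BA', BP, BP', BQ, BQ', BC, BC', opprK).
lra.
Qed.

(** Infinitesimal form of the transformation of b into $k_1 b k_2^{-1}$ under the two-sided action;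
    the contributions of u2 and v2 cancel. *)
Lemma logb_lift u1 u2 v1 v2 :
  logb (u1 - A u2) (v1 - C v2) (u2 - Q v2) = u1 - A (Q (C' v1)).
Proof.
rewrite /logb !(AD, AN, QD, QN, C'D, C'N, CK).
by move: (A u2) (A _) (A _) => p q r; apply/rowP => i; rewrite !mxE; ring.
Qed.

Lemma logc_lift u1 u2 v1 v2 :
  logc (u1 - A u2) (v1 - C v2) (u1 - P v1) = u2 - A' (P (C v2)).
Proof.
rewrite /logc !(A'D, A'N, PD, PN, AK).
by move: (A' _) (A' _) (A' _) => p q r; apply/rowP => i; rewrite !mxE; ring.
Qed.

(** On the kernel of the differential of Phi the components along g1 and g2 vanish, and the equation
    for c gives $\mathrm{Ad}_{g_1} x_2 = x_1$. Testing against a vector with only a g1-component s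
    leaves two equal halves of $-B(x_1, s)$. *)
Lemma sigma_kernel_alg x1 x2 s : logb x1 x2 0 = 0 -> logc x1 x2 0 = 0 ->
  sigma_alg x1 x2 0 0 0 0 s 0 = - B x1 s.
Proof.
move=> b0 c0.
have f0 (f : 'rV[R]_n -> 'rV[R]_n) : (forall u v, f (u + v) = f u + f v) -> f 0 = 0.
  by move=> fD; have := fD 0 0; rewrite addr0 => /eqP; rewrite -subr_eq subrr => /eqP <-.
have [A0 A'0 P0 Q0 C'0] := And5 (f0 _ AD) (f0 _ A'D) (f0 _ PD) (f0 _ QD) (f0 _ C'D).
have z1 v : B 0 v = 0 by exact: scalar0 (B1 v).
have z2 v : B v 0 = 0 by exact: scalar0 (B2 v).
have E : P x2 = x1 by apply/eqP; rewrite -subr_eq0 -[P x2]add0r -[_ - _]A'K; rewrite -/(logc x1 x2 0) c0 A0.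
rewrite /sigma_alg b0 c0 /logb /logc !(A'0, C'0, Q0, A0, P0, addr0, subr0, z1, z2).
rewrite BA' A'K BP' E BC BQ' !z1 (Bsym s); lra.
Qed.

(** The situation at a unit arrow, where g1 = g2 = 1 and a1 = a2. The first vector lies in the fibre
    of the algebroid, so its a2-component is 0; the second is tangent to the units. The value is the
    one of $\lambda_\sigma$. *)
Lemma sigma_unit_alg x w1 w2 y :
  (forall u, P u = u) -> (forall u, P' u = u) -> (forall u, Q u = u) -> (forall u, Q' u = u) ->
  (forall u, C u = A u) -> (forall u, C' u = A' u) ->
  sigma_alg x 0 w1 w2 y y 0 0 = B (w1 - x - A w2) y.
Proof.
move=> P1 P'1 Q1 Q'1 C1 C'1.
have f0 (f : 'rV[R]_n -> 'rV[R]_n) : (forall u v, f (u + v) = f u + f v) -> f 0 = 0.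
  by move=> fD; have := fD 0 0; rewrite addr0 => /eqP; rewrite -subr_eq subrr => /eqP <-.
have A'0 := f0 _ A'D; have A0 := f0 _ AD.
have z1 v : B 0 v = 0 by exact: scalar0 (B1 v).
have z2 v : B v 0 = 0 by exact: scalar0 (B2 v).
rewrite /sigma_alg /logb /logc !(P1, P'1, Q1, Q'1, C1, C'1) !(A'0, A0, add0r, addr0, subr0).
rewrite !(subrr, A'K, AK, A'0, A0, z1, z2).
rewrite (Bsym (A' y)) (Bsym (A' y)) !(BD1, BN1, BA, BA', A'K, AK).
lra.
Qed.

End SigmaAlgebra.

Section ScalarIdentities.
Variable R : realType.

(** Most variables are named after the pair along which $\Omega_G$ is pulled back; b2, c2, h1, h2,
    a3 belong to the second arrow, and doubled letters in pairs such as a1cc denote products. The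
    terms x1, x2, y1, y2, for the pairs (b1, a2 h2), (a1 g2, h2), (g1 a2, c2), (g1, h1 a3), each
    occur in two of the hypotheses and are eliminated. *)
Lemma multiplicative_algebra
  (a1c1 g1a2 a1g2 b1a2 a2c2 h1a3 a2h2 b2a3 a1cc gha3 a1gh bba3 bb gh1 cc gh2 x1 x2 y1 y2 : R) :
  b2a3 - bba3 + x1 - bb = 0 -> a2h2 - x2 + x1 - b1a2 = 0 -> gh2 - x2 + a1gh - a1g2 = 0 ->
  cc - y1 + a1cc - a1c1 = 0 -> a2c2 - y1 + y2 - g1a2 = 0 -> h1a3 - gha3 + y2 - gh1 = 0 ->
  (a1c1 - g1a2 - a1g2 + b1a2) + (a2c2 - h1a3 - a2h2 + b2a3) - (a1cc - gha3 - a1gh + bba3) =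
  (bb - gh1) + (cc - gh2).
Proof. by lra. Qed.

(** The variables are values of $\Theta_G$ pulled back along the maps they name; x1 belongs to a1 c
    = g1 a2 and x2 to b a2 = a1 g2. *)
Lemma closed_algebra (x1 x2 a1 a2 b c g1 g2 : R) :
  (x1 - a1 - c) - (x1 - g1 - a2) - (x2 - a1 - g2) + (x2 - b - a2) + (b - g1 + (c - g2)) = 0.
Proof. by lra. Qed.

End ScalarIdentities.

Lemma addr_swap (V : zmodType) (a b c : V) : - a + b + c = b + c - a.
Proof. by rewrite -addrA addrC. Qed.

(** * The linear algebra of the quasi-Poisson Dirac structure *)

Section QuasiPoissonAlgebra.
Context {R : realType}.
Variables (n : nat) (B : 'rV[R]_n -> 'rV[R]_n -> R) (A A' : 'rV[R]_n -> 'rV[R]_n).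
Hypotheses (B2 : forall u, scalar (B u)) (Bsym : forall u v, B u v = B v u)
  (Bnd : forall u, (forall v, B u v = 0) -> u = 0).
Hypotheses (AK : cancel A A') (A'K : cancel A' A)
  (BA : forall u v, B (A u) v = B u (A' v)) (BA' : forall u v, B (A' u) v = B u (A v)).
Hypotheses (AD : forall u v, A (u + v) = A u + A v) (AN : forall u, A (- u) = - A u)
  (A'D : forall u v, A' (u + v) = A' u + A' v) (A'N : forall u, A' (- u) = - A' u)
  (AZ : forall c u, A (c *: u) = c *: A u) (A'Z : forall c u, A' (c *: u) = c *: A' u).

Let B1 v : scalar (B^~ v).
Proof. by move=> a u w; rewrite !(Bsym _ v); exact: B2. Qed.

Let BD2 u v w : B u (v + w) = B u v + B u w. Proof. exact: (scalarD _ _ (B2 u)). Qed.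
Let BD1 u v w : B (u + v) w = B u w + B v w. Proof. exact: (scalarD _ _ (B1 w)). Qed.
Let BN2 u v : B u (- v) = - B u v. Proof. exact: (scalarN _ (B2 u)). Qed.
Let BN1 u v : B (- u) v = - B u v. Proof. exact: (scalarN _ (B1 v)). Qed.

(** Here t, w1, w2 are the components along a1, g1, g2 of an element of the algebroid, and A is Ad
    of the base point. *)
Lemma dirac_to_qp t w1 w2 : exists u1 u2 v1 v2,
  [/\ forall y1 y2, B v1 y1 + B v2 y2 = - B (w1 - t - A w2) (y1 - A y2),
      t = u1 - A u2, t + A w2 = u1 + 2^-1 *: v1, w1 = u1 - 2^-1 *: v1 &
      A' (w1 - t) = u2 + 2^-1 *: v2 /\ w2 = u2 - 2^-1 *: v2].
Proof.
(* Under the identification of (u, v) with (u + v/2, u - v/2), u is the half-sum and v the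
   difference of the two entries, here for each of the two pairs. *)
exists (2^-1 *: (t + A w2 + w1)), (2^-1 *: (A' (w1 - t) + w2)), (t + A w2 - w1), (A' (w1 - t) - w2).
have E1 : 2^-1 *: (t + A w2 + w1) - A (2^-1 *: (A' (w1 - t) + w2)) = t.
  by rewrite AZ AD A'K; move: (A w2) => p; apply/rowP => i; rewrite !mxE; field.
split.
- by move=> y1 y2; rewrite !(A'D, A'N, BD1, BD2, BN1, BN2, BA', BA, AK); lra.
- by rewrite E1.
- by move: (A _) => p; apply/rowP => i; rewrite !mxE; field.
- by move: (A _) => p; apply/rowP => i; rewrite !mxE; field.
- by split; move: (A' _) => p; apply/rowP => i; rewrite !mxE; field.
Qed.

Lemma qp_to_dirac u1 u2 v1 v2 (alpha : 'rV[R]_n -> R) : scalar alpha ->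
  (forall y1 y2, B v1 y1 + B v2 y2 = - alpha (y1 - A y2)) ->
  let t := u1 - A u2 in let w1 := u1 - 2^-1 *: v1 in let w2 := u2 - 2^-1 *: v2 in
  [/\ forall y, alpha y = B (w1 - t - A w2) y, t + A w2 = u1 + 2^-1 *: v1 &
      A' (w1 - t) = u2 + 2^-1 *: v2].
Proof.
move=> sa H t w1 w2.
(* The pair (A y, y) generates no motion of the base point, so alpha vanishes on it; this ties v2 to
   v1. *)
have v2E : v2 = - A' v1.
  apply/eqP; rewrite -addr_eq0; apply/eqP; apply: Bnd => y.
  by have := H (A y) y; rewrite subrr (scalar0 sa) oppr0 BD1 BA' addrC.
have kE : w1 - t - A w2 = - v1.
  rewrite /w1 /t /w2 v2E !(AD, AN, AZ, A'K).
  by move: (A u2) => p; apply/rowP => i; rewrite !mxE; field.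
split.
- move=> y; rewrite kE BN1; have := H y 0.
  have A0 : A 0 = 0 by have := AD 0 0; rewrite addr0 => /eqP; rewrite -subr_eq subrr => /eqP <-.
  by rewrite A0 subr0 (scalar0 (B2 v2)) addr0 => ->; rewrite opprK.
- rewrite /t /w2 v2E !(AD, AN, AZ, A'K).
  by move: (A u2) => p; apply/rowP => i; rewrite !mxE; field.
- rewrite /w1 /t v2E !(A'D, A'N, A'Z, AK).
  by move: (A' u1) (A' v1) => p q; apply/rowP => i; rewrite !mxE; field.
Qed.

End QuasiPoissonAlgebra.

(** * The moment map *)

Section PairGroupoid.
Context {R : realType}.
Local Notation tangent M := 'rV[R]_(mdim M).
Local Notation lie_algebra K := 'rV[R]_(mdim K).
Local Notation "M ** N" := (prod_manifold M N) (at level 40).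
Variables (G : lie_group_data R) (hG : is_lie_group G).
Variables (B : lie_algebra G -> lie_algebra G -> R).
Hypotheses (hB : is_quadratic B) (hAd : is_Ad_invariant B).
Let hM : is_manifold G := lie_group_manifold hG.
Let mGG : is_manifold (G ** G) := prod_is_manifold hM hM.
Let hGG : is_lie_group (prod_lie_group G G) := prod_is_lie_group hG hG.
Let S := double_group2 B.
Let H := PG2 G.
Let mH : is_manifold (arr H) := arr_PG2_manifold hG.
Let mC : is_manifold (gpd_comp H) := gpd_comp_manifold hG.
Let mD : is_manifold (double_group B) := mGG.
Let hS : is_cartan S := double_group2_is_cartan hG hB hAd.
Let hG4 : is_lie_group S := shifted_lie_group (cartan_shifted hS).
Let phi : prod_lie_group G G -> S := diagonal2_map B.
Let Bsym := quadratic_sym hB.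
Let Bnd := quadratic_nondeg hB.
Let B2 := B_linear2 hB.
Let rfD (x : G) : linear (fun u => right_field u x) := right_field_linear hG x.

Let AdD (g : G) u v : Ad g (u + v) = Ad g u + Ad g v.
Proof. exact (linearDE u v (Ad_linear hG g)). Qed.
Let AdN (g : G) u : Ad g (- u) = - Ad g u.
Proof. exact (linearNE u (Ad_linear hG g)). Qed.
Let Ad0 (g : G) : Ad g 0 = 0.
Proof. exact (linear0E (Ad_linear hG g)). Qed.
Let AdZ (g : G) c u : Ad g (c *: u) = c *: Ad g u.
Proof. exact (linearZE c u (Ad_linear hG g)). Qed.
Let Ad1g u : Ad gone u = u :> lie_algebra G. Proof. exact (Ad1 hG u). Qed.

Definition arr_b (h : arr H) : G := gmul (gmul h.1.1 h.2.2) (ginv h.1.2).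
Definition arr_c (h : arr H) : G := gmul (gmul (ginv h.1.1) h.2.1) h.1.2.

Lemma smooth_b : @is_smooth R (arr H) G arr_b.
Proof.
exact: (is_smooth_mul hG mH (is_smooth_mul hG mH (smooth_a1 hG) (smooth_g2 hG))
  (is_smooth_inv hG mH (smooth_a2 hG))).
Qed.

Lemma smooth_c : @is_smooth R (arr H) G arr_c.
Proof.
exact: (is_smooth_mul hG mH (is_smooth_mul hG mH (is_smooth_inv hG mH (smooth_a1 hG))
  (smooth_g1 hG)) (smooth_a2 hG)).
Qed.

Lemma Phi_PG2E : Phi_PG2 B = fun h : arr H => ((arr_b h, h.2.1), (arr_c h, h.2.2)).
Proof. by apply/funext => -[[? ?] [? ?]]. Qed.

Local Notation OP := (Omega_pull B (M := arr H)).

Lemma sigma_PG2E : sigma_PG2 B =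
  OP (fun h => h.1.1) arr_c - OP (fun h => h.2.1) (fun h => h.1.2)
  - OP (fun h => h.1.1) (fun h => h.2.2) + OP arr_b (fun h => h.1.2).
Proof.
pose pull (f : G * G * (G * G) -> G * G) : form2 (arr H) :=
  @pullback2 R (arr H) (G ** G) f (sh_Omega (canonical_shifted B)).
have E1 : (fun '(a1, a2, (g1, g2)) => (a1, gmul (gmul (ginv a1) g1) a2)) =
  (fun h : arr H => (h.1.1, arr_c h)) by apply/funext => -[[? ?] [? ?]].
have E2 : (fun '(a1, a2, (g1, g2)) => (g1, a2)) =
  (fun h : arr H => (h.2.1, h.1.2)) by apply/funext => -[[? ?] [? ?]].
have E3 : (fun '(a1, a2, (g1, g2)) => (a1, g2)) =
  (fun h : arr H => (h.1.1, h.2.2)) by apply/funext => -[[? ?] [? ?]].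
have E4 : (fun '(a1, a2, (g1, g2)) => (gmul (gmul a1 g2) (ginv a2), a2)) =
  (fun h : arr H => (arr_b h, h.1.2)) by apply/funext => -[[? ?] [? ?]].
exact (congr2 (fun a b : form2 (arr H) => a + b) (congr2 (fun a b : form2 (arr H) => a - b)
  (congr2 (fun a b : form2 (arr H) => a - b) (congr1 pull E1) (congr1 pull E2))
  (congr1 pull E3)) (congr1 pull E4)).
Qed.

Lemma Phi_PG2_smooth : is_smooth (Phi_PG2 B).
Proof.
rewrite Phi_PG2E.
exact: (is_smooth_row4 hG mH smooth_b (smooth_g1 hG) smooth_c (smooth_g2 hG)).
Qed.

Lemma Phi_PG2_morphism : @is_morphism_to_group R H S (Phi_PG2 B).
Proof.
split; first exact: Phi_PG2_smooth.
move=> [[a1 a2] [g1 g2]] [[b1 b2] [h1 h2]]; rewrite /composable /= => <-.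
congr ((_, _), (_, _)); rewrite !(gmulA hG); last by rewrite (gmulgK hG).
by rewrite (gmulgVK hG).
Qed.

Lemma sigma_PG2_form : is_form2 (sigma_PG2 B).
Proof.
have F f g sf sg := @Omega_pull_form2 R G hG B hB (arr H) mH f g sf sg.
have F1 := F _ _ (smooth_a1 hG) smooth_c.
have F2 := F _ _ (smooth_g1 hG) (smooth_a2 hG).
have F3 := F _ _ (smooth_a1 hG) (smooth_g2 hG).
have F4 := F _ _ smooth_b (smooth_a2 hG).
have E := form2D mH (form2D mH (form2D mH F1 (form2N mH F2)) (form2N mH F3)) F4.
by rewrite sigma_PG2E; exact E.
Qed.

(** Reduces sigma along any map q to pullbacks of $\Omega_G$ along components of q. It is applied to
    the two projections and the multiplication of composable pairs, and to maps on which Phi is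
    constant. *)
Lemma sigma_PG2_pull (M : manifold_data R) (hm : is_manifold M) (q : M -> arr H) p u v :
  is_smooth q ->
  sigma_PG2 B (q p) (tmap q p u) (tmap q p v) =
  Omega_pull B (M := M) (fun x => (q x).1.1) (fun x => arr_c (q x)) p u v
  - Omega_pull B (M := M) (fun x => (q x).2.1) (fun x => (q x).1.2) p u v
  - Omega_pull B (M := M) (fun x => (q x).1.1) (fun x => (q x).2.2) p u v
  + Omega_pull B (M := M) (fun x => arr_b (q x)) (fun x => (q x).1.2) p u v.
Proof.
move=> sq.
have F f g sf sg := @Omega_pull_comp R G hG B (arr H) mH M hm q f g p u v sq sf sg.
have F1 := F _ _ (smooth_a1 hG) smooth_c.
have F2 := F _ _ (smooth_g1 hG) (smooth_a2 hG).
have F3 := F _ _ (smooth_a1 hG) (smooth_g2 hG).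
have F4 := F _ _ smooth_b (smooth_a2 hG).
have E := congr1 (fun w : form2 (arr H) => w (q p) (tmap q p u) (tmap q p v)) sigma_PG2E.
apply: (etrans E).
exact (congr2 (fun a b : R => a + b) (congr2 (fun a b : R => a - b)
  (congr2 (fun a b : R => a - b) F1 F2) F3) F4).
Qed.

(** Every term of sigma pairs a1 or a2 with one of the components b, g1, c, g2 of Phi, and
    $\Omega_G$ vanishes along a map with a constant component. *)
Lemma sigma_PG2_isotropic (M : manifold_data R) (hm : is_manifold M) (q : M -> arr H) (d : S) :
  is_smooth q -> (forall x, Phi_PG2 B (q x) = d) -> pullback2 q (sigma_PG2 B) = 0.
Proof.
move=> sq qd.
have /funext Eb : forall x, arr_b (q x) = d.1.1 by move=> x; rewrite -(qd x) Phi_PG2E.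
have /funext Eg1 : forall x, (q x).2.1 = d.1.2 by move=> x; rewrite -(qd x) Phi_PG2E.
have /funext Ec : forall x, arr_c (q x) = d.2.1 by move=> x; rewrite -(qd x) Phi_PG2E.
have /funext Eg2 : forall x, (q x).2.2 = d.2.2 by move=> x; rewrite -(qd x) Phi_PG2E.
have s1 := is_smooth_comp hm mH hM sq (smooth_a1 hG).
have s2 := is_smooth_comp hm mH hM sq (smooth_a2 hG).
apply/funext => p; apply/funext => u; apply/funext => v.
have E := sigma_PG2_pull hm p u v sq.
rewrite Eb Eg1 Ec Eg2 in E; apply: (etrans E).
have C1 := Omega_pull_cstr hG hB hm d.2.1 p u v s1.
have C2 := Omega_pull_cstl hG hB hm d.1.2 p u v s2.
have C3 := Omega_pull_cstr hG hB hm d.2.2 p u v s1.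
have C4 := Omega_pull_cstl hG hB hm d.1.1 p u v s2.
apply: (etrans (congr2 (fun a b : R => a + b) (congr2 (fun a b : R => a - b)
  (congr2 (fun a b : R => a - b) C1 C2) C3) C4)).
by rewrite !subr0 addr0.
Qed.

Lemma double_Omega_pull (M : manifold_data R) (hm : is_manifold M)
    (f1 f2 f3 f4 g1 g2 g3 g4 : M -> G) p u v :
  is_smooth f1 -> is_smooth f2 -> is_smooth f3 -> is_smooth f4 ->
  is_smooth g1 -> is_smooth g2 -> is_smooth g3 -> is_smooth g4 ->
  @pullback2 R M (S ** S)
    (fun x => (((f1 x, f2 x), (f3 x, f4 x)), ((g1 x, g2 x), (g3 x, g4 x)))) (sh_Omega S) p u v =
  (Omega_pull B f1 g1 p u v - Omega_pull B f2 g2 p u v)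
  + (Omega_pull B f3 g3 p u v - Omega_pull B f4 g4 p u v).
Proof.
move=> s1 s2 s3 s4 t1 t2 t3 t4.
have P k1 k2 (sk1 : is_smooth k1) (sk2 : is_smooth k2) := is_smooth_pair hm hM hM sk1 sk2.
have E := @prod_Omega_pull R (double_group B) (double_group B) mD mD M hm _ _ p u v
  (is_smooth_row4 hG hm s1 s2 s3 s4) (is_smooth_row4 hG hm t1 t2 t3 t4).
have E1 := @prod_Omega_pull R (canonical_shifted B) (opp_shifted (canonical_shifted B))
  hM hM M hm _ _ p u v (P _ _ s1 s2) (P _ _ t1 t2).
have E2 := @prod_Omega_pull R (canonical_shifted B) (opp_shifted (canonical_shifted B))
  hM hM M hm _ _ p u v (P _ _ s3 s4) (P _ _ t3 t4).
exact (etrans E (congr2 (fun a b : R => a + b) E1 E2)).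
Qed.

Lemma double_Theta_pull (M : manifold_data R) (hm : is_manifold M)
    (f1 f2 f3 f4 : M -> G) p u v w :
  is_smooth f1 -> is_smooth f2 -> is_smooth f3 -> is_smooth f4 ->
  let Th f := @pullback3 R M G f (sh_Theta (canonical_shifted B)) p u v w in
  @pullback3 R M S (fun x => ((f1 x, f2 x), (f3 x, f4 x))) (sh_Theta S) p u v w =
  (Th f1 - Th f2) + (Th f3 - Th f4).
Proof.
move=> s1 s2 s3 s4 Th.
have P k1 k2 (sk1 : is_smooth k1) (sk2 : is_smooth k2) := is_smooth_pair hm hM hM sk1 sk2.
have E := @prod_Theta_pull R (double_group B) (double_group B) mD mD M hm _ p u v w
  (is_smooth_row4 hG hm s1 s2 s3 s4).
have E1 := @prod_Theta_pull R (canonical_shifted B) (opp_shifted (canonical_shifted B))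
  hM hM M hm _ p u v w (P _ _ s1 s2).
have E2 := @prod_Theta_pull R (canonical_shifted B) (opp_shifted (canonical_shifted B))
  hM hM M hm _ p u v w (P _ _ s3 s4).
exact (etrans E (congr2 (fun a b : R => a + b) E1 E2)).
Qed.

Lemma arr_bK (h : arr H) : gmul (arr_b h) h.1.2 = gmul h.1.1 h.2.2.
Proof. by rewrite /arr_b (gmulgVK hG). Qed.

Lemma arr_cK (h : arr H) : gmul h.1.1 (arr_c h) = gmul h.2.1 h.1.2.
Proof. by rewrite /arr_c -!(gmulA hG) (gmulVKg hG). Qed.

Lemma arr_b_comp (c : gpd_comp H) :
  gmul (arr_b (comp_fst c)) (arr_b (comp_snd c)) = arr_b (comp_mul c).
Proof.
by case: c => [[[a1 a2] a3] [[g1 g2] [h1 h2]]]; rewrite /arr_b /= !(gmulA hG) (gmulgVK hG).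
Qed.

Lemma arr_c_comp (c : gpd_comp H) :
  gmul (arr_c (comp_fst c)) (arr_c (comp_snd c)) = arr_c (comp_mul c).
Proof.
by case: c => [[[a1 a2] a3] [[g1 g2] [h1 h2]]]; rewrite /arr_c /= !(gmulA hG) (gmulgK hG).
Qed.

Lemma sigma_PG2_multiplicative :
  pullback2 (@comp_fst R H) (sigma_PG2 B) + pullback2 (@comp_snd R H) (sigma_PG2 B)
      - pullback2 (@comp_mul R H) (sigma_PG2 B)
    = @pullback2 R (gpd_comp H) (S ** S)
        (fun c => (Phi_PG2 B (comp_fst c), Phi_PG2 B (comp_snd c))) (sh_Omega S).
Proof.
apply/funext => p; apply/funext => u; apply/funext => v.
have sF := comp_fst_smooth hG; have sS := comp_snd_smooth hG; have sM := comp_mul_smooth hG.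
have EF := sigma_PG2_pull mC p u v sF.
have ES := sigma_PG2_pull mC p u v sS.
have EM := sigma_PG2_pull mC p u v sM.
have cF k (sk : @is_smooth R (arr H) G k) := is_smooth_comp mC mH hM sF sk.
have cS k (sk : @is_smooth R (arr H) G k) := is_smooth_comp mC mH hM sS sk.
have sa1 := cF _ (smooth_a1 hG); have sa2 := cF _ (smooth_a2 hG).
have sa3 := cS _ (smooth_a2 hG).
have sg1 := cF _ (smooth_g1 hG); have sg2 := cF _ (smooth_g2 hG).
have sh1 := cS _ (smooth_g1 hG); have sh2 := cS _ (smooth_g2 hG).
have sb1 := cF _ smooth_b; have sb2 := cS _ smooth_b.
have sc1 := cF _ smooth_c; have sc2 := cS _ smooth_c.
have Co f g h fg gh sf sg sh E1 E2 := @Omega_cocycle_eq R G hG B hB hAd (gpd_comp H) mC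
  f g h fg gh p u v sf sg sh E1 E2.
have D := double_Omega_pull mC p u v sb1 sg1 sc1 sg2 sb2 sh1 sc2 sh2.
have Eb1 (c : gpd_comp H) : gmul (arr_b (comp_fst c)) c.1.1.2 = gmul c.1.1.1 c.2.1.2 := arr_bK (comp_fst c).
have Eb2 (c : gpd_comp H) : gmul (arr_b (comp_snd c)) c.1.2 = gmul c.1.1.2 c.2.2.2 := arr_bK (comp_snd c).
have Ec1 (c : gpd_comp H) : gmul c.1.1.1 (arr_c (comp_fst c)) = gmul c.2.1.1 c.1.1.2 := arr_cK (comp_fst c).
have Ec2 (c : gpd_comp H) : gmul c.1.1.2 (arr_c (comp_snd c)) = gmul c.2.2.1 c.1.2 := arr_cK (comp_snd c).
(* The first three instances follow the factorizations b1 b2 a3 = b1 a2 h2 = a1 g2 h2 of one map,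
   the last three a1 c1 c2 = g1 a2 c2 = g1 h1 a3. Consecutive instances share a regrouped term. *)
have C1 := Co _ _ _ _ _ sb1 sb2 sa3 arr_b_comp Eb2.
have C2 := Co _ _ _ _ _ sb1 sa2 sh2 Eb1 (fun=> erefl).
have C3 := Co _ _ _ _ _ sa1 sg2 sh2 (fun=> erefl) (fun=> erefl).
have C4 := Co _ _ _ _ _ sa1 sc1 sc2 Ec1 arr_c_comp.
have C5 := Co _ _ _ _ _ sg1 sa2 sc2 (fun=> erefl) Ec2.
have C6 := Co _ _ _ _ _ sg1 sh1 sa3 (fun=> erefl) (fun=> erefl).
rewrite Phi_PG2E.
apply: (etrans (congr2 (fun a b : R => a - b) (congr2 (fun a b : R => a + b) EF ES) EM)).
apply: (etrans _ (esym D)).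
exact (multiplicative_algebra C1 C2 C3 C4 C5 C6).
Qed.

Lemma sigma_PG2_closed : ext_d2 (sigma_PG2 B) + pullback3 (Phi_PG2 B) (sh_Theta S) = 0.
Proof.
apply/funext => p; apply/funext => u; apply/funext => v; apply/funext => w.
have F f g sf sg := @Omega_pull_form2 R G hG B hB (arr H) mH f g sf sg.
have F1 := F _ _ (smooth_a1 hG) smooth_c.
have F2 := F _ _ (smooth_g1 hG) (smooth_a2 hG).
have F3 := F _ _ (smooth_a1 hG) (smooth_g2 hG).
have F4 := F _ _ smooth_b (smooth_a2 hG).
have F12 := form2D mH F1 (form2N mH F2).
have F123 := form2D mH F12 (form2N mH F3).
have D k1 k2 s1 s2 := @ext_d2_Omega_pull R G hG B hB hAd (arr H) mH k1 k2 p u v w s1 s2.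
have D1 := D _ _ (smooth_a1 hG) smooth_c.
have D2 := D _ _ (smooth_g1 hG) (smooth_a2 hG).
have D3 := D _ _ (smooth_a1 hG) (smooth_g2 hG).
have D4 := D _ _ smooth_b (smooth_a2 hG).
have X1 := funext arr_cK; have X2 := funext arr_bK.
rewrite X1 in D1; rewrite X2 in D4.
have T := double_Theta_pull mH p u v w smooth_b (smooth_g1 hG) smooth_c (smooth_g2 hG).
rewrite -Phi_PG2E in T.
have A (w1 w2 : form2 (arr H)) (h1 : is_form2 w1) (h2 : is_form2 w2) :=
  congr1 (fun k : form3 (arr H) => k p u v w) (ext_d2D mH h1 h2).
have N (w1 : form2 (arr H)) (h1 : is_form2 w1) :=
  congr1 (fun k : form3 (arr H) => k p u v w) (ext_d2N mH h1).
have E : ext_d2 (sigma_PG2 B) p u v w = _ :=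
  congr1 (fun k : form2 (arr H) => ext_d2 k p u v w) sigma_PG2E.
have E1 := etrans E (A _ _ F123 F4).
have E2 := A _ _ F12 (form2N mH F3).
have E3 := A _ _ F1 (form2N mH F2).
have {}E3 := etrans E3 (congr2 (fun a b : R => a + b) D1
   (etrans (N _ F2) (congr1 (fun a : R => - a) D2))).
have {}E2 := etrans E2 (congr2 (fun a b : R => a + b) E3
   (etrans (N _ F3) (congr1 (fun a : R => - a) D3))).
have {}E1 := etrans E1 (congr2 (fun a b : R => a + b) E2 D4).
exact (etrans (congr2 (fun a b : R => a + b) E1 T) (closed_algebra _ _ _ _ _ _ _ _)).
Qed.

(** * Phi and sigma in the right trivialization of the arrows *)

Lemma tmap_a1 (h : arr H) Z : @tmap R (arr H) G (fun k => k.1.1) h Z = lsubmx (lsubmx Z).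
Proof.
have E := tmap_comp mH mGG hM h Z (is_smooth_fst mGG mGG) (is_smooth_fst hM hM).
apply: (etrans E); apply: (etrans (tmap_fst hM hM _ _)).
exact (congr1 lsubmx (tmap_fst mGG mGG _ _)).
Qed.

Lemma tmap_a2 (h : arr H) Z : @tmap R (arr H) G (fun k => k.1.2) h Z = rsubmx (lsubmx Z).
Proof.
have E := tmap_comp mH mGG hM h Z (is_smooth_fst mGG mGG) (is_smooth_snd hM hM).
apply: (etrans E); apply: (etrans (tmap_snd hM hM _ _)).
exact (congr1 rsubmx (tmap_fst mGG mGG _ _)).
Qed.

Lemma tmap_g1 (h : arr H) Z : @tmap R (arr H) G (fun k => k.2.1) h Z = lsubmx (rsubmx Z).
Proof.
have E := tmap_comp mH mGG hM h Z (is_smooth_snd mGG mGG) (is_smooth_fst hM hM).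
apply: (etrans E); apply: (etrans (tmap_fst hM hM _ _)).
exact (congr1 lsubmx (tmap_snd mGG mGG _ _)).
Qed.

Lemma tmap_g2 (h : arr H) Z : @tmap R (arr H) G (fun k => k.2.2) h Z = rsubmx (rsubmx Z).
Proof.
have E := tmap_comp mH mGG hM h Z (is_smooth_snd mGG mGG) (is_smooth_snd hM hM).
apply: (etrans E); apply: (etrans (tmap_snd hM hM _ _)).
exact (congr1 rsubmx (tmap_snd mGG mGG _ _)).
Qed.

Local Notation X1 h Z := (@dlog R G (arr H) (fun k => k.1.1) h Z).
Local Notation X2 h Z := (@dlog R G (arr H) (fun k => k.1.2) h Z).
Local Notation W1 h Z := (@dlog R G (arr H) (fun k => k.2.1) h Z).
Local Notation W2 h Z := (@dlog R G (arr H) (fun k => k.2.2) h Z).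

(** Rebuilds a tangent vector from its right-trivialized components along a1, a2, g1, g2. *)
Definition frame (h : arr H) (x1 x2 w1 w2 : lie_algebra G) : tangent (arr H) :=
  row4 (@right_field R G x1 h.1.1) (@right_field R G x2 h.1.2)
       (@right_field R G w1 h.2.1) (@right_field R G w2 h.2.2).

Lemma X1_frame h x1 x2 w1 w2 : X1 h (frame h x1 x2 w1 w2) = x1.
Proof.
apply: (etrans (congr1 (theta_r _) (tmap_a1 h _))).
by rewrite /frame /row4 !row_mxKl; exact (theta_r_right_field hG _ _).
Qed.

Lemma X2_frame h x1 x2 w1 w2 : X2 h (frame h x1 x2 w1 w2) = x2.
Proof.
apply: (etrans (congr1 (theta_r _) (tmap_a2 h _))).
by rewrite /frame /row4 row_mxKl row_mxKr; exact (theta_r_right_field hG _ _).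
Qed.

Lemma W1_frame h x1 x2 w1 w2 : W1 h (frame h x1 x2 w1 w2) = w1.
Proof.
apply: (etrans (congr1 (theta_r _) (tmap_g1 h _))).
by rewrite /frame /row4 row_mxKr row_mxKl; exact (theta_r_right_field hG _ _).
Qed.

Lemma W2_frame h x1 x2 w1 w2 : W2 h (frame h x1 x2 w1 w2) = w2.
Proof.
apply: (etrans (congr1 (theta_r _) (tmap_g2 h _))).
by rewrite /frame /row4 !row_mxKr; exact (theta_r_right_field hG _ _).
Qed.

Lemma frame_eta h Z : Z = frame h (X1 h Z) (X2 h Z) (W1 h Z) (W2 h Z).
Proof.
have K k (f : arr H -> G) : right_field (dlog f k Z) (f k) = tmap f k Z.
  exact (right_field_theta_r hG _ _).
have E1 := etrans (K h _) (tmap_a1 h Z); have E2 := etrans (K h _) (tmap_a2 h Z).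
have E3 := etrans (K h _) (tmap_g1 h Z); have E4 := etrans (K h _) (tmap_g2 h Z).
apply: (etrans (row4_eta Z)).
exact (esym (congr2 (fun a b : 'rV[R]_(mdim G + mdim G) => row_mx a b)
  (congr2 (fun a b : 'rV[R]_(mdim G) => row_mx a b) E1 E2)
  (congr2 (fun a b : 'rV[R]_(mdim G) => row_mx a b) E3 E4))).
Qed.

Lemma dlog_b h Z : dlog arr_b h Z =
  logb (Ad h.1.1) (Ad h.2.2) (Ad (ginv h.1.2)) (X1 h Z) (X2 h Z) (W2 h Z).
Proof.
have s12 := is_smooth_mul hG mH (smooth_a1 hG) (smooth_g2 hG).
have E := dlog_mul hG mH h Z s12 (is_smooth_inv hG mH (smooth_a2 hG)).
have E1 := dlog_mul hG mH h Z (smooth_a1 hG) (smooth_g2 hG).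
have E2 := dlog_inv hG mH h Z (smooth_a2 hG).
apply: (etrans E); apply: (congr2 (fun a b : lie_algebra G => a + b) E1).
apply: (etrans (congr1 _ E2)); apply: (etrans (linearNE _ (Ad_linear hG _))).
exact (congr1 (fun a => - a) (AdM hG _ _ _)).
Qed.

Lemma dlog_c h Z : dlog arr_c h Z =
  logc (Ad (ginv h.1.1)) (Ad h.2.1) (X1 h Z) (X2 h Z) (W1 h Z).
Proof.
have s1 := is_smooth_inv hG mH (smooth_a1 hG).
have s12 := is_smooth_mul hG mH s1 (smooth_g1 hG).
have E := dlog_mul hG mH h Z s12 (smooth_a2 hG).
have E1 := dlog_mul hG mH h Z s1 (smooth_g1 hG).
have E2 := dlog_inv hG mH h Z (smooth_a1 hG).
have A := Ad_linear hG (ginv h.1.1).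
rewrite E2 in E1; rewrite E1 (AdM hG) in E; apply: (etrans E).
have F := etrans (linearBE _ _ A) (congr1 (fun a => a - _)
   (linearDE (W1 h Z) (Ad h.2.1 (X2 h Z)) A)).
apply: (etrans _ (esym (F (X1 h Z)))).
exact (addr_swap _ _ _).
Qed.

Lemma Ad_arr_b (h : arr H) x :
  Ad (arr_b h) x = Ad h.1.1 (Ad h.2.2 (Ad (ginv h.1.2) x)).
Proof. by rewrite /arr_b !(AdM hG). Qed.

Lemma Ad_arr_c (h : arr H) x :
  Ad (arr_c h) x = Ad (ginv h.1.1) (Ad h.2.1 (Ad h.1.2 x)).
Proof. by rewrite /arr_c !(AdM hG). Qed.

Lemma Ad_ginv_b (h : arr H) x :
  Ad (ginv (arr_b h)) x = Ad h.1.2 (Ad (ginv h.2.2) (Ad (ginv h.1.1) x)).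
Proof. by rewrite /arr_b !(ginvM hG) (ginvK hG) !(AdM hG). Qed.

Lemma Ad_ginv_c (h : arr H) x :
  Ad (ginv (arr_c h)) x = Ad (ginv h.1.2) (Ad (ginv h.2.1) (Ad h.1.1 x)).
Proof. by rewrite /arr_c !(ginvM hG) (ginvK hG) !(AdM hG). Qed.

Local Notation sig h := (sigma_alg B (Ad h.1.1) (Ad (ginv h.1.1)) (Ad h.2.1) (Ad (ginv h.2.1))
  (Ad h.2.2) (Ad (ginv h.2.2)) (Ad h.1.2) (Ad (ginv h.1.2))).

Lemma sigma_PG2_log h Z W : sigma_PG2 B h Z W =
  sig h (X1 h Z) (X2 h Z) (W1 h Z) (W2 h Z) (X1 h W) (X2 h W) (W1 h W) (W2 h W).
Proof.
have E := congr1 (fun w : form2 (arr H) => w h Z W) sigma_PG2E.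
apply: (etrans E).
have F1 := Omega_pullE hG B mH h Z W (smooth_a1 hG) smooth_c.
have F2 := Omega_pullE hG B mH h Z W (smooth_g1 hG) (smooth_a2 hG).
have F3 := Omega_pullE hG B mH h Z W (smooth_a1 hG) (smooth_g2 hG).
have F4 := Omega_pullE hG B mH h Z W smooth_b (smooth_a2 hG).
have Eb V := etrans (Ad_ginv_b h (dlog arr_b h V)) (congr1 (fun t : lie_algebra G =>
  Ad h.1.2 (Ad (ginv h.2.2) (Ad (ginv h.1.1) t))) (dlog_b h V)).
have {}F1 := etrans F1 (congr2 (fun x y : lie_algebra G =>
  - 2^-1 * (B (Ad (ginv h.1.1) (X1 h Z)) x - B (Ad (ginv h.1.1) (X1 h W)) y))
  (dlog_c h W) (dlog_c h Z)).
have {}F4 := etrans F4 (congr2 (fun x y : lie_algebra G =>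
  - 2^-1 * (B x (X2 h W) - B y (X2 h Z))) (Eb Z) (Eb W)).
exact (congr2 (fun a b : R => a + b) (congr2 (fun a b : R => a - b)
  (congr2 (fun a b : R => a - b) F1 F2) F3) F4).
Qed.

Lemma tmap_Phi_PG2 (h : arr H) Z :
  @tmap R (arr H) S (Phi_PG2 B) h Z =
  row4 (@tmap R (arr H) G arr_b h Z) (@tmap R (arr H) G (fun k => k.2.1) h Z)
       (@tmap R (arr H) G arr_c h Z) (@tmap R (arr H) G (fun k => k.2.2) h Z).
Proof.
rewrite Phi_PG2E.
have P1 := is_smooth_pair mH hM hM smooth_b (smooth_g1 hG).
have P2 := is_smooth_pair mH hM hM smooth_c (smooth_g2 hG).
have E := tmap_pair mH mGG mGG h Z P1 P2.
exact (etrans E (congr2 (fun a b : 'rV[R]_(mdim G + mdim G) => row_mx a b)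
  (tmap_pair mH hM hM h Z smooth_b (smooth_g1 hG))
  (tmap_pair mH hM hM h Z smooth_c (smooth_g2 hG)))).
Qed.

Lemma PG2_dim : (mdim (arr H))%:Q - 2 * (mdim (obj H))%:Q = 2^-1 * (mdim S)%:Q.
Proof.
have key (n : nat) : (n + n + (n + n))%N%:Q - 2 * n%:Q = 2^-1 * (n + n + (n + n))%N%:Q.
  rewrite !PoszD !intrD; lra.
exact (key (mdim G)).
Qed.

Lemma tmap_Phi_PG2_eq0 h Z : tmap (Phi_PG2 B) h Z = 0 ->
  [/\ dlog arr_b h Z = 0, W1 h Z = 0, dlog arr_c h Z = 0 & W2 h Z = 0].
Proof.
move=> E.
have E0 : row4 0 0 0 0 = 0 :> 'rV[R]_(mdim G + mdim G + (mdim G + mdim G)).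
  by rewrite /row4 !row_mx0.
have [E1 E2 E3 E4] := row4_inj (etrans (esym (tmap_Phi_PG2 h Z)) (etrans E (esym E0))).
have D f := (@dlog_eq0 R G hG (arr H) f h Z).2.
exact (And4 (D _ E1) (D _ E2) (D _ E3) (D _ E4)).
Qed.

Lemma Phi_PG2_kernel (h : arr H) Z : (forall W, sigma_PG2 B h Z W = 0) ->
  tmap (Phi_PG2 B) h Z = 0 -> Z = 0.
Proof.
move=> sZ /tmap_Phi_PG2_eq0[b0 w1 c0 w2].
have Eb := etrans (esym (dlog_b h Z)) b0; have Ec := etrans (esym (dlog_c h Z)) c0.
rewrite w2 in Eb; rewrite w1 in Ec.
have x1 : X1 h Z = 0.
  apply: (quadratic_nondeg hB) => s.
  have E := sZ (frame h 0 0 s 0); rewrite sigma_PG2_log in E.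
  rewrite X1_frame X2_frame W1_frame W2_frame w1 w2 in E.
  have K := sigma_kernel_alg B2 Bsym (A' := Ad (ginv h.1.1)) (P' := Ad (ginv h.2.1))
    (Q' := Ad (ginv h.2.2)) (C := Ad h.1.2) (AdVK hG h.1.1) (B_AdV hG hAd _)
    (B_AdV hG hAd _) (B_AdV hG hAd _) (B_Ad hG hAd _) (AdD _) (AdD _) (AdD _) (AdD _) (AdD _) s Eb Ec.
  by apply/eqP; rewrite -oppr_eq0; apply/eqP; exact (etrans (esym K) E).
(* Once x1 = 0, the vanishing of the c-component says that invertible operators take x2 to 0. *)
have x2 : X2 h Z = 0.
  rewrite -[X2 h Z](AdKV hG h.2.1); rewrite x1 /logc subr0 add0r in Ec.
  have E := congr1 (Ad h.1.1) Ec; rewrite (AdVK hG) Ad0 in E.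
  by rewrite E Ad0.
rewrite (frame_eta h Z) x1 x2 w1 w2 /frame.
have r0 (g : G) : right_field 0 g = 0 := linear0E (right_field_linear hG g).
by rewrite !r0 /row4 !row_mx0.
Qed.

(* The infinitesimal generator of the two-sided action of G^2 x G^2 on the arrows. *)
Definition diagonal_lift (h : arr H) u1 u2 v1 v2 : tangent (arr H) :=
  frame h (u1 - Ad h.1.1 u2) (v1 - Ad h.1.2 v2) (u1 - Ad h.2.1 v1) (u2 - Ad h.2.2 v2).

(** Infinitesimal equivariance of Phi. Each of its four components has a logarithmic derivative of
    the form u - Ad v, the right-trivialized value of a difference $u^r - v^l$. *)
Lemma tmap_Phi_diagonal_lift (h : arr H) u1 u2 v1 v2 :
  tmap (Phi_PG2 B) h (diagonal_lift h u1 u2 v1 v2) =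
  @right_field R S (row4 u1 u1 u2 u2) (Phi_PG2 B h) - @left_field R S (row4 v1 v1 v2 v2) (Phi_PG2 B h).
Proof.
set Z := diagonal_lift _ _ _ _ _.
have fx1 : X1 h Z = u1 - Ad h.1.1 u2 by exact: X1_frame.
have fx2 : X2 h Z = v1 - Ad h.1.2 v2 by exact: X2_frame.
have fw1 : W1 h Z = u1 - Ad h.2.1 v1 by exact: W1_frame.
have fw2 : W2 h Z = u2 - Ad h.2.2 v2 by exact: W2_frame.
have Eb : dlog arr_b h Z = u1 - Ad (arr_b h) v1.
  have L := logb_lift (AdKV hG h.1.2) (AdD h.1.1) (AdN h.1.1) (AdD h.2.2) (AdN h.2.2)
    (AdD (ginv h.1.2)) (AdN (ginv h.1.2)) u1 u2 v1 v2.
  have L' := f_equal3 (logb (Ad h.1.1) (Ad h.2.2) (Ad (ginv h.1.2))) fx1 fx2 fw2.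
  have E := esym (Ad_arr_b h v1).
  exact (etrans (dlog_b h Z) (etrans (etrans L' L) (congr1 (fun t => u1 - t) E))).
have Ec : dlog arr_c h Z = u2 - Ad (arr_c h) v2.
  have L := logc_lift (Ad h.1.2) (AdKV hG h.1.1) (AdD (ginv h.1.1)) (AdN (ginv h.1.1))
    (AdD h.2.1) (AdN h.2.1) u1 u2 v1 v2.
  have L' := f_equal3 (logc (Ad (ginv h.1.1)) (Ad h.2.1)) fx1 fx2 fw1.
  have E := esym (Ad_arr_c h v2).
  exact (etrans (dlog_c h Z) (etrans (etrans L' L) (congr1 (fun t => u2 - t) E))).
have K (f : arr H -> G) x : dlog f h Z = x -> tmap f h Z = right_field x (f h).
  by move=> <-; exact (esym (right_field_theta_r hG _ _)).
have T := tmap_Phi_PG2 h Z.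
rewrite (K _ _ Eb) (K _ _ Ec) (K _ _ fw1) (K _ _ fw2) in T.
pose d : S := ((arr_b h, h.2.1), (arr_c h, h.2.2)).
have Ed : Phi_PG2 B h = d by rewrite Phi_PG2E.
have A := @Ad_row4 R G hG B d v1 v1 v2 v2.
have U := row4_sub u1 u1 u2 u2 (Ad (arr_b h) v1) (Ad h.2.1 v1) (Ad (arr_c h) v2) (Ad h.2.2 v2).
have F := @right_field_row4 R G hG B d (u1 - Ad (arr_b h) v1) (u1 - Ad h.2.1 v1)
  (u2 - Ad (arr_c h) v2) (u2 - Ad h.2.2 v2).
have L := left_field_Ad hG4 (row4 v1 v1 v2 v2) d.
have V := linearBE (row4 u1 u1 u2 u2) (row4 (Ad (arr_b h) v1) (Ad h.2.1 v1) (Ad (arr_c h) v2)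
  (Ad h.2.2 v2)) (right_field_linear hG4 d).
have LA := etrans L (congr1 (fun x : lie_algebra S => right_field x d) A).
have RU := congr1 (fun x : lie_algebra S => right_field x d) U.
have E := congr1 (fun x : tangent S => @right_field R S (row4 u1 u1 u2 u2) d - x) LA.
rewrite Ed.
exact (etrans (etrans (etrans T (esym F)) (esym RU)) (etrans V (esym E))).
Qed.

Lemma sigma_diagonal_lift (h : arr H) u1 u2 v1 v2 W :
  sigma_PG2 B h (diagonal_lift h u1 u2 v1 v2) W =
  covector (S := S) (Phi_PG2 B h) (row4 u1 u1 u2 u2) (row4 v1 v1 v2 v2) (tmap (Phi_PG2 B) h W).
Proof.
set Z := diagonal_lift _ _ _ _ _.
have fx1 : X1 h Z = u1 - Ad h.1.1 u2 by exact: X1_frame.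
have fx2 : X2 h Z = v1 - Ad h.1.2 v2 by exact: X2_frame.
have fw1 : W1 h Z = u1 - Ad h.2.1 v1 by exact: W1_frame.
have fw2 : W2 h Z = u2 - Ad h.2.2 v2 by exact: W2_frame.
have E := sigma_PG2_log h Z W.
have E2 := congr2 (fun x1 x2 => sigma_alg B (Ad h.1.1) (Ad (ginv h.1.1)) (Ad h.2.1)
  (Ad (ginv h.2.1)) (Ad h.2.2) (Ad (ginv h.2.2)) (Ad h.1.2) (Ad (ginv h.1.2)) x1 x2
  (W1 h Z) (W2 h Z) (X1 h W) (X2 h W) (W1 h W) (W2 h W)) fx1 fx2.
have E3 := congr2 (fun w1 w2 => sigma_alg B (Ad h.1.1) (Ad (ginv h.1.1)) (Ad h.2.1)
  (Ad (ginv h.2.1)) (Ad h.2.2) (Ad (ginv h.2.2)) (Ad h.1.2) (Ad (ginv h.1.2))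
  (u1 - Ad h.1.1 u2) (v1 - Ad h.1.2 v2) w1 w2 (X1 h W) (X2 h W) (W1 h W) (W2 h W)) fw1 fw2.
have BA (g : G) := B_Ad hG hAd g; have BA' (g : G) := B_AdV hG hAd g.
have K := sigma_covector_alg B2 Bsym (AdKV hG h.1.1) (AdVK hG h.1.1) (AdKV hG h.2.1)
  (AdKV hG h.2.2) (AdKV hG h.1.2) (AdVK hG h.1.2) (BA h.1.1) (BA' h.1.1) (BA h.2.1) (BA' h.2.1)
  (BA h.2.2) (BA' h.2.2) (BA h.1.2) (BA' h.1.2)
  (AdD (ginv h.1.1)) (AdN (ginv h.1.1)) (AdD (ginv h.2.1)) (AdN (ginv h.2.1))
  (AdD (ginv h.2.2)) (AdN (ginv h.2.2)) (AdD h.1.2) (AdN h.1.2) (AdD (ginv h.1.2)) (AdN (ginv h.1.2))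
  u1 u2 v1 v2 (X1 h W) (X2 h W) (W1 h W) (W2 h W).
apply: (etrans E); apply: (etrans E2); apply: (etrans E3); apply: (etrans K).
pose d : S := ((arr_b h, h.2.1), (arr_c h, h.2.2)).
have Ed : Phi_PG2 B h = d by rewrite Phi_PG2E.
pose Y : tangent S := row4 (@tmap R (arr H) G arr_b h W) (@tmap R (arr H) G (fun k => k.2.1) h W)
       (@tmap R (arr H) G arr_c h W) (@tmap R (arr H) G (fun k => k.2.2) h W).
have EY : @tmap R (arr H) S (Phi_PG2 B) h W = Y by exact (tmap_Phi_PG2 h W).
rewrite Ed; apply: (etrans _ (esym (congr1 (@covector R S d (row4 u1 u1 u2 u2) (row4 v1 v1 v2 v2)) EY))).
apply: (etrans _ (esym (covectorE hS d _ _ _))).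
have TR : theta_r d Y = row4 (dlog arr_b h W) (W1 h W) (dlog arr_c h W) (W2 h W).
  exact (@theta_r_row4 R G hG B d _ _ _ _).
have TL : theta_l d Y = row4 (Ad (ginv (arr_b h)) (dlog arr_b h W)) (Ad (ginv h.2.1) (W1 h W))
    (Ad (ginv (arr_c h)) (dlog arr_c h W)) (Ad (ginv h.2.2) (W2 h W)).
  exact (etrans (theta_l_Ad hG4 d Y) (etrans (congr1 (Ad (ginv d)) TR)
    (@Ad_row4 R G hG B (ginv d) _ _ _ _))).
have PR := etrans (congr1 (@pairing R S (row4 u1 u1 u2 u2)) TR)
  (pairing_row4 hG hB hAd _ _ _ _ _ _ _ _).
have PL := etrans (congr1 (@pairing R S (row4 v1 v1 v2 v2)) TL)
  (pairing_row4 hG hB hAd _ _ _ _ _ _ _ _).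
have Eb := dlog_b h W; have Ec := dlog_c h W.
have Eb' := etrans (Ad_ginv_b h (dlog arr_b h W)) (congr1 (fun t : lie_algebra G =>
  Ad h.1.2 (Ad (ginv h.2.2) (Ad (ginv h.1.1) t))) Eb).
have Ec' := etrans (Ad_ginv_c h (dlog arr_c h W)) (congr1 (fun t : lie_algebra G =>
  Ad (ginv h.1.2) (Ad (ginv h.2.1) (Ad h.1.1 t))) Ec).
have PR' := etrans PR (congr2 (fun x y => B u1 x - B u1 (W1 h W) + (B u2 y - B u2 (W2 h W))) Eb Ec).
have PL' := etrans PL (congr2 (fun x y => B v1 x - B v1 (Ad (ginv h.2.1) (W1 h W))
  + (B v2 y - B v2 (Ad (ginv h.2.2) (W2 h W)))) Eb' Ec').
exact (esym (congr2 (fun x y : R => 2^-1 * (x + y)) PR' PL')).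
Qed.

Lemma Phi_PG2_dirac (h : arr H) : A_dirac (S := S) (diagonal2 B) (Phi_PG2 B h) =
  [set e | exists Z, exists beta : tangent S -> R, [/\ scalar beta,
      (forall W, sigma_PG2 B h Z W = beta (tmap (Phi_PG2 B) h W)) &
      e = (tmap (Phi_PG2 B) h Z, beta)]].
Proof.
apply/seteqP; split=> [e [u [v [/diagonal2P[u1 [u2 ->]] /diagonal2P[v1 [v2 ->]] ->]]]|].
  exists (diagonal_lift h u1 u2 v1 v2).
  exists (covector (S := S) (Phi_PG2 B h) (row4 u1 u1 u2 u2) (row4 v1 v1 v2 v2)); split.
  - exact: covector_scalar hS _ _ _.
  - move=> W; exact (sigma_diagonal_lift h u1 u2 v1 v2 W).
  - exact (congr1 (fun x => (x, _)) (esym (tmap_Phi_diagonal_lift h u1 u2 v1 v2))).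
move=> e [Z [beta [sb sZ ->]]].
apply: (A_dirac_maximal hS (diagonal2_is_manin_pair hG hB hAd) sb).
move=> u v /diagonal2P[u1 [u2 ->]] /diagonal2P[v1 [v2 ->]].
(* Both Z and the lift Z' satisfy $i\sigma = \Phi^*\beta$, each with its own covector. The two mixed
   evaluations are therefore sigma(Z', Z) and sigma(Z, Z'), whose sum is 0. *)
pose Z' := diagonal_lift h u1 u2 v1 v2.
have E1 := congr1 beta (tmap_Phi_diagonal_lift h u1 u2 v1 v2).
have E2 := etrans (sZ Z') E1.
have E3 := sigma_diagonal_lift h u1 u2 v1 v2 Z.
have E4 := form2_antisym sigma_PG2_form h Z' Z.
have E5 := congr2 (fun a b : R => a + b) (etrans (esym E3) E4) (esym E2).
exact (etrans E5 (addNr _)).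
Qed.

Theorem PG2_is_moment_map : @is_moment_map R S (diagonal2 B) H (Phi_PG2 B) (sigma_PG2 B).
Proof.
split.
- exact: cartan_shifted hS.
- exact: (diagonal2_is_manin_pair hG hB hAd).
- exact: (PG2_is_lie_groupoid hG).
- exact: Phi_PG2_morphism.
- exact: sigma_PG2_form.
- apply: (sigma_PG2_isotropic hM (d := gone) (gpd_unit_smooth hG)) => x.
  by rewrite Phi_PG2E /arr_b /arr_c /= !(gmulg1 hG) (gmulgV hG) (gmulVg hG).
- exact: sigma_PG2_multiplicative.
- exact: sigma_PG2_closed.
- exact: PG2_dim.
- exact: Phi_PG2_kernel.
- exact: Phi_PG2_dirac.
Qed.

(** * The Lie algebroid and the integrated Dirac structure *)

Local Notation e x := (@gpd_unit R H x).

(** The source of an arrow is a2, so the fibre consists of the vectors without a2-component. *)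
Lemma fibreP (x : G) a : @algebroid_fibre R H x a <->
  exists t w1 w2, a = frame (e x) t 0 w1 w2.
Proof.
split=> [F|[t [w1 [w2 ->]]]].
  exists (X1 (e x) a), (W1 (e x) a), (W2 (e x) a).
  have E := (@dlog_eq0 R G hG (arr H) (fun k => k.1.2) (e x) a).2 F.
  apply: (etrans (frame_eta (e x) a)).
  exact (congr1 (fun t => frame (e x) _ t _ _) E).
apply: (@dlog_eq0 R G hG (arr H) (fun k => k.1.2) (e x) _).1.
exact: X2_frame.
Qed.

Lemma anchor_frame (x : G) t w1 w2 :
  @anchor R H x (frame (e x) t 0 w1 w2) = @right_field R G t x.
Proof.
apply: (etrans (tmap_a1 (e x) _)).
by rewrite /frame /row4 !row_mxKl.
Qed.

Lemma dlog_gone (M : manifold_data R) (f : M -> G) p v : f p = gone -> dlog f p v = tmap f p v.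
Proof. by move=> E; rewrite /dlog E; exact (theta_r1 hG _). Qed.

Lemma lie_Phi_frame (x : G) t w1 w2 :
  @lie_Phi R S H (Phi_PG2 B) x (frame (e x) t 0 w1 w2) =
  row4 (t + Ad x w2) w1 (Ad (ginv x) (w1 - t)) w2.
Proof.
set Z := frame _ _ _ _ _.
have fx1 : X1 (e x) Z = t by exact: X1_frame.
have fx2 : X2 (e x) Z = 0 by exact: X2_frame.
have fw1 : W1 (e x) Z = w1 by exact: W1_frame.
have fw2 : W2 (e x) Z = w2 by exact: W2_frame.
have eb : arr_b (e x) = gone by rewrite /arr_b /= (gmulg1 hG) (gmulgV hG).
have ec : arr_c (e x) = gone by rewrite /arr_c /= (gmulg1 hG) (gmulVg hG).
have Lb : dlog arr_b (e x) Z = t + Ad x w2.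
  have E := f_equal3 (logb (Ad x) (Ad gone) (Ad (ginv x))) fx1 fx2 fw2.
  apply: (etrans (dlog_b (e x) Z)); apply: (etrans E).
  by rewrite /logb !Ad0 subr0.
have Lc : dlog arr_c (e x) Z = Ad (ginv x) (w1 - t).
  have E := f_equal3 (logc (Ad (ginv x)) (Ad gone)) fx1 fx2 fw1.
  have F := congr1 (fun z => Ad (ginv x) (w1 + z - t)) (Ad0 gone).
  have F' := congr1 (fun z => Ad (ginv x) (z - t)) (addr0 w1).
  exact (etrans (dlog_c (e x) Z) (etrans E (etrans F F'))).
have Tb := etrans (esym (dlog_gone Z eb)) Lb; have Tc := etrans (esym (dlog_gone Z ec)) Lc.
have T1 := etrans (esym (@dlog_gone (arr H) (fun k => k.2.1) (e x) Z erefl)) fw1.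
have T2 := etrans (esym (@dlog_gone (arr H) (fun k => k.2.2) (e x) Z erefl)) fw2.
apply: (etrans (tmap_Phi_PG2 (e x) Z)).
exact (congr2 (fun a b : 'rV[R]_(mdim G + mdim G) => row_mx a b)
  (congr2 (fun a b : 'rV[R]_(mdim G) => row_mx a b) Tb T1)
  (congr2 (fun a b : 'rV[R]_(mdim G) => row_mx a b) Tc T2)).
Qed.

Lemma lambda_frame (x : G) t w1 w2 w :
  @lambda R H (sigma_PG2 B) x (frame (e x) t 0 w1 w2) w =
  B (w1 - t - Ad x w2) (theta_r x w).
Proof.
set Z := frame _ _ _ _ _.
have fx1 : X1 (e x) Z = t by exact: X1_frame.
have fx2 : X2 (e x) Z = 0 by exact: X2_frame.
have fw1 : W1 (e x) Z = w1 by exact: W1_frame.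
have fw2 : W2 (e x) Z = w2 by exact: W2_frame.
pose V : tangent (arr H) := @tmap R G (arr H) (@gpd_unit R H) x w.
have su := gpd_unit_smooth hG.
have C f (sf : @is_smooth R (arr H) G f) := tmap_comp hM mH hM x w su sf.
have y1 : X1 (e x) V = theta_r x w.
  exact (congr1 (theta_r x) (etrans (esym (C _ (smooth_a1 hG))) (tmap_id hM x w))).
have y2 : X2 (e x) V = theta_r x w.
  exact (congr1 (theta_r x) (etrans (esym (C _ (smooth_a2 hG))) (tmap_id hM x w))).
have s1 : W1 (e x) V = 0.
  apply: (dlog_eq0 hG _ _ _).2.
  exact (etrans (esym (C _ (smooth_g1 hG))) (tmap_cst (gone : G) x w)).
have s2 : W2 (e x) V = 0.
  apply: (dlog_eq0 hG _ _ _).2.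
  exact (etrans (esym (C _ (smooth_g2 hG))) (tmap_cst (gone : G) x w)).
have E := sigma_PG2_log (e x) Z V.
pose sg := sigma_alg B (Ad x) (Ad (ginv x)) (Ad gone) (Ad (ginv gone)) (Ad gone) (Ad (ginv gone))
  (Ad x) (Ad (ginv x)).
have E1 := congr2 (fun a b => sg a b (W1 (e x) Z) (W2 (e x) Z)
  (X1 (e x) V) (X2 (e x) V) (W1 (e x) V) (W2 (e x) V)) fx1 fx2.
have E2 := congr2 (fun a b => sg t 0 a b
  (X1 (e x) V) (X2 (e x) V) (W1 (e x) V) (W2 (e x) V)) fw1 fw2.
have E3 := congr2 (fun a b => sg t 0 w1 w2 a b (W1 (e x) V) (W2 (e x) V)) y1 y2.
have E4 := congr2 (fun a b => sg t 0 w1 w2 (theta_r x w) (theta_r x w) a b) s1 s2.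
have I1 u : Ad (ginv gone) u = u :> lie_algebra G by rewrite (ginv1 hG).
have K : sg t 0 w1 w2 (theta_r x w) (theta_r x w) 0 0 = _ :=
  sigma_unit_alg B2 Bsym (AdVK hG x) (B_Ad hG hAd x) (B_AdV hG hAd x) (AdD x) (AdD (ginv x))
  t w1 w2 (theta_r x w) Ad1g I1 Ad1g I1 (fun=> erefl) (fun=> erefl).
exact (etrans E (etrans E1 (etrans E2 (etrans E3 (etrans E4 K))))).
Qed.

Lemma rho_Ad (x : G) u1 u2 : rho x u1 u2 = right_field (u1 - Ad x u2) x.
Proof.
apply: (etrans _ (esym (linearBE _ _ (rfD x)))).
exact (congr1 (fun t => right_field u1 x - t) (left_field_Ad hG u2 x)).
Qed.

Lemma lambdaE (x : G) t w1 w2 :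
  @lambda R H (sigma_PG2 B) x (frame (e x) t 0 w1 w2) =
  fun w => B (w1 - t - Ad x w2) (theta_r x w).
Proof. by apply/funext => w; exact (lambda_frame x t w1 w2 w). Qed.

Lemma integrated_diracE (x : G) :
  @integrated_dirac R S H (Phi_PG2 B) (sigma_PG2 B) x =
  [set d | exists t w1 w2, d = (@right_field R G t x, fun w => B (w1 - t - Ad x w2) (theta_r x w),
     row4 (t + Ad x w2) w1 (Ad (ginv x) (w1 - t)) w2)].
Proof.
have E (t w1 w2 : lie_algebra G) : (@anchor R H x (frame (e x) t 0 w1 w2),
    @lambda R H (sigma_PG2 B) x (frame (e x) t 0 w1 w2),
    @lie_Phi R S H (Phi_PG2 B) x (frame (e x) t 0 w1 w2)) =
  (@right_field R G t x, fun w => B (w1 - t - Ad x w2) (theta_r x w),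
     row4 (t + Ad x w2) w1 (Ad (ginv x) (w1 - t)) w2).
  exact (congr2 (fun (a : tangent G * (tangent G -> R)) (b : lie_algebra S) => (a, b))
   (congr2 (fun (a : tangent G) (b : tangent G -> R) => (a, b)) (anchor_frame x t w1 w2)
      (lambdaE x t w1 w2)) (lie_Phi_frame x t w1 w2)).
apply/seteqP; split=> d.
  move=> [a /fibreP[t [w1 [w2 ->]]] <-]; exists t, w1, w2; exact (E _ _ _).
move=> [t [w1 [w2 ->]]]; exists (frame (e x) t 0 w1 w2).
  by apply/fibreP; exists t, w1, w2.
exact (E _ _ _).
Qed.

(** Both structures are parametrized: one by the components t, w1, w2 of an algebroid element, the
    other by u1, u2, v1, v2 and alpha. The parameters are matched by half-sums and differences of
    the pairs $(t + \mathrm{Ad}_x w_2, w_1)$ and $(\mathrm{Ad}_x^{-1}(w_1 - t), w_2)$. *)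
Lemma PG2_integrates_quasi_poisson (x : G) :
  @integrated_dirac R S H (Phi_PG2 B) (sigma_PG2 B) x = quasi_poisson_dirac B x.
Proof.
apply: (etrans (integrated_diracE x)); apply/seteqP; split=> d.
  move=> [t [w1 [w2 ->]]]; set k := w1 - t - Ad x w2.
  have [u1 [u2 [v1 [v2 [D1 D2 D3 D4 [D5 D6]]]]]] := dirac_to_qp B2 Bsym (AdKV hG x) (AdVK hG x)
    (B_Ad hG hAd x) (B_AdV hG hAd x) (AdD x) (AdZ x) t w1 w2.
  exists u1, u2, v1, v2, (fun w => B k (theta_r x w)); split.
  - move=> c u v; exact (etrans (congr1 (B k) (theta_r_linear hG x c u v)) (B2 k c _ _)).
  - move=> y1 y2.
    have E := etrans (congr1 (theta_r x) (rho_Ad x y1 y2)) (theta_r_right_field hG _ x).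
    exact (etrans (D1 y1 y2) (congr1 (fun z => - B k z) (esym E))).
  - have E1 := etrans (congr1 (fun u => right_field u x) D2) (esym (rho_Ad x u1 u2)).
    have E2 := congr2 (fun a b : 'rV[R]_(mdim G + mdim G) => row_mx a b)
      (congr2 (fun a b : 'rV[R]_(mdim G) => row_mx a b) D3 D4)
      (congr2 (fun a b : 'rV[R]_(mdim G) => row_mx a b) D5 D6).
    exact (congr2 (fun (a : tangent G) (b : lie_algebra S) => (a, fun w => B k (theta_r x w), b)) E1 E2).
move=> [u1 [u2 [v1 [v2 [alpha [sa D ->]]]]]].
pose alpha' (y : lie_algebra G) : R := alpha (right_field y x).
have sa' : scalar alpha'.
  move=> c u v; exact (etrans (congr1 alpha (right_field_linear hG x c u v)) (sa c _ _)).
have D' y1 y2 : B v1 y1 + B v2 y2 = - alpha' (y1 - Ad x y2).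
  exact (etrans (D y1 y2) (congr1 (fun z => - alpha z) (rho_Ad x y1 y2))).
have [Q1 Q2 Q3] := qp_to_dirac B2 Bsym Bnd (AdKV hG x) (AdVK hG x)
    (B_AdV hG hAd x) (AdD x) (AdN x) (AdD (ginv x)) (AdN (ginv x)) (AdZ x) (AdZ (ginv x)) u1 u2 sa' D'.
exists (u1 - Ad x u2), (u1 - 2^-1 *: v1), (u2 - 2^-1 *: v2).
have E1 := rho_Ad x u1 u2.
have E2 : alpha = fun w => B (u1 - 2^-1 *: v1 - (u1 - Ad x u2) - Ad x (u2 - 2^-1 *: v2)) (theta_r x w).
  apply/funext => w.
  exact (etrans (congr1 alpha (esym (right_field_theta_r hG x w))) (Q1 (theta_r x w))).
have E3 := congr2 (fun a b : 'rV[R]_(mdim G) => row4 a (u1 - 2^-1 *: v1) b (u2 - 2^-1 *: v2))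
   (esym Q2) (esym Q3).
exact (congr2 (fun (a : tangent G * (tangent G -> R)) (b : lie_algebra S) => (a, b))
  (congr2 (fun (a : tangent G) (b : tangent G -> R) => (a, b)) E1 E2) E3).
Qed.

(** * The global action and its lift to the arrows *)

Definition two_sided (g : prod_lie_group G G) (x : G) : G := gmul (gmul g.1 x) (ginv g.2).

(** Extended to all of $\mathfrak{d}^2$ by reading the first entry of each pair; on the diagonal
    this is the inverse of Lie(Phi). *)
Definition two_sided_psi (x : G) (u : lie_algebra S) : tangent (arr H) :=
  frame (e x) (lsubmx (lsubmx u) - Ad x (lsubmx (rsubmx u))) 0
    (lsubmx (lsubmx u)) (lsubmx (rsubmx u)).

Definition two_sided_Psi (p : G * G * G) : arr H := ((two_sided p.1 p.2, p.2), p.1).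

Lemma two_sided_psi_row4 x u1 u2 u3 u4 :
  two_sided_psi x (row4 u1 u2 u3 u4) = frame (e x) (u1 - Ad x u3) 0 u1 u3.
Proof. by rewrite /two_sided_psi /row4 row_mxKl row_mxKr !row_mxKl. Qed.

(** By nondegeneracy of B, the kernel of $\lambda_\sigma$ is the locus $w_1 = t + \mathrm{Ad}_x
    w_2$. On it the two entries of each pair in Lie(Phi) agree, so w1 and w2 parametrize the
    kernel. *)
Lemma two_sided_is_psi : @is_psi R S (diagonal2 B) H (Phi_PG2 B) (sigma_PG2 B) two_sided_psi.
Proof.
move=> x; split.
  move=> u /diagonal2P[u1 [u2 ->]].
  have P := two_sided_psi_row4 x u1 u1 u2 u2.
  have k0 : u1 - (u1 - Ad x u2) - Ad x u2 = 0 by rewrite subKr subrr.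
  have L : @lie_Phi R S H (Phi_PG2 B) x (two_sided_psi x (row4 u1 u1 u2 u2)) = row4 u1 u1 u2 u2.
    have E := etrans (congr1 (@lie_Phi R S H (Phi_PG2 B) x) P) (lie_Phi_frame x _ _ _).
    have E1 : u1 - Ad x u2 + Ad x u2 = u1 := subrK _ _.
    have E2 : u1 - (u1 - Ad x u2) = Ad x u2 by exact: subKr.
    have E3 := etrans (congr1 (Ad (ginv x)) E2) (AdKV hG x u2).
    exact (etrans E (congr2 (fun a b => row4 a u1 b u2) E1 E3)).
  split; last exact L.
  split.
    apply/fibreP; exists (u1 - Ad x u2), u1, u2; exact P.
  apply/funext => w.
  have E := etrans (congr1 (fun a => @lambda R H (sigma_PG2 B) x a w) P)
    (lambda_frame x _ _ _ w).
  exact (etrans E (etrans (congr1 (fun k => B k (theta_r x w)) k0) (B0l hB _))).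
move=> a [/fibreP[t [w1 [w2 ->]]] l0].
have k0 : w1 - t - Ad x w2 = 0.
  apply: (quadratic_nondeg hB) => y.
  have E := congr1 (fun f : tangent G -> R => f (right_field y x)) l0.
  have F := lambda_frame x t w1 w2 (right_field y x).
  have T := congr1 (B (w1 - t - Ad x w2)) (theta_r_right_field hG y x).
  exact (etrans (esym T) (etrans (esym F) E)).
have w1E : t + Ad x w2 = w1 by apply/eqP; rewrite eq_sym -subr_eq0 opprD addrA k0.
have tE : w1 - Ad x w2 = t by rewrite -w1E addrK.
have w2E : Ad (ginv x) (w1 - t) = w2.
  have E : w1 - t = Ad x w2 by rewrite -w1E addrC addKr.
  exact (etrans (congr1 (Ad (ginv x)) E) (AdKV hG x w2)).
have L := etrans (lie_Phi_frame x t w1 w2) (congr2 (fun a b => row4 a w1 b w2) w1E w2E).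
split; first by apply/diagonal2P; exists w1, w2; exact L.
apply: (etrans (congr1 (two_sided_psi x) L)); apply: (etrans (two_sided_psi_row4 x w1 w1 w2 w2)).
exact (congr1 (fun t => frame (e x) t 0 w1 w2) tE).
Qed.

Let p1 : @is_smooth R (G ** G ** G) (G ** G) fst. Proof. exact: is_smooth_fst. Qed.
Let p2 : @is_smooth R (G ** G ** G) G snd. Proof. exact: is_smooth_snd. Qed.
Let m3 : is_manifold (G ** G ** G) := prod_is_manifold mGG hM.
Let sG1 : @is_smooth R (G ** G) G fst := is_smooth_fst hM hM.
Let sG2 : @is_smooth R (G ** G) G snd := is_smooth_snd hM hM.

Lemma two_sided_smooth : @is_smooth R (G ** G ** G) G (fun p => two_sided p.1 p.2).
Proof.
have q1 := is_smooth_comp m3 mGG hM p1 sG1; have q2 := is_smooth_comp m3 mGG hM p1 sG2.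
exact: (is_smooth_mul hG m3 (is_smooth_mul hG m3 q1 p2) (is_smooth_inv hG m3 q2)).
Qed.

Lemma two_sided1 x : two_sided gone x = x :> G.
Proof. by rewrite /two_sided /= (gmul1g hG) (ginv1 hG) (gmulg1 hG). Qed.

Lemma two_sidedM g h x : two_sided (@gmul R (prod_lie_group G G) g h) x = two_sided g (two_sided h x).
Proof. by rewrite /two_sided /= (ginvM hG) !(gmulA hG). Qed.

Lemma two_sided_is_action : @is_lie_group_action R (prod_lie_group G G) G two_sided.
Proof. split; [exact: two_sided1|exact: two_sidedM|exact: two_sided_smooth]. Qed.

Lemma tmap_two_sided x (u : lie_algebra (prod_lie_group G G)) :
  @tmap R (prod_lie_group G G) G (fun g => two_sided g x) gone u = rho x (lsubmx u) (rsubmx u).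
Proof.
pose f (g : prod_lie_group G G) := two_sided g x.
pose o : prod_lie_group G G := gone.
have s1 := is_smooth_fmulr hG mGG x sG1.
have D := dlog_mul hG mGG o u s1 (is_smooth_inv hG mGG sG2).
have D1 := dlog_mulr hG mGG x o u sG1.
have D2 := dlog_inv hG mGG o u sG2.
have E1 : @dlog R G (G ** G) fst o u = lsubmx u.
  exact (etrans (dlog_gone (p := o) u erefl) (tmap_fst hM hM o u)).
have E2 : @dlog R G (G ** G) snd o u = rsubmx u.
  exact (etrans (dlog_gone (p := o) u erefl) (tmap_snd hM hM o u)).
have E : dlog f o u = lsubmx u - Ad x (rsubmx u).
  apply: (etrans D); apply: (congr2 (fun a b : lie_algebra G => a + b) (etrans D1 E1)).
  have F1 : gmul (gone : G) x = x by exact: gmul1g hG x.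
  have F2 : ginv (gone : G) = gone by exact: ginv1 hG.
  apply: (etrans (congr2 (fun g v => Ad g v) F1 D2)).
  apply: (etrans (congr2 (fun g v => Ad x (- Ad g v)) F2 E2)).
  exact (etrans (congr1 (fun v => Ad x (- v)) (Ad1g (rsubmx u))) (AdN x (rsubmx u))).
have K : tmap f o u = right_field (dlog f o u) x.
  have T : right_field (dlog f o u) (f o) = tmap f o u by exact (right_field_theta_r hG _ _).
  exact (etrans (esym T) (congr1 (right_field (dlog f o u)) (two_sided1 x))).
exact (etrans K (etrans (congr1 (fun v => right_field v x) E) (esym (rho_Ad x _ _)))).
Qed.

Let A := action_groupoid two_sided.

Lemma two_sided_Psi_smooth : @is_smooth R (G ** G ** G) (arr H) two_sided_Psi.
Proof.
have t := two_sided_smooth.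
have q1 : @is_smooth R (G ** G ** G) (G ** G) fst by exact: is_smooth_fst mGG hM.
have q2 : @is_smooth R (G ** G ** G) G snd by exact: is_smooth_snd mGG hM.
exact: (is_smooth_pair m3 mGG mGG (is_smooth_pair m3 hM hM t q2) q1).
Qed.

Lemma two_sided_Psi_morphism : @is_groupoid_morphism R A H two_sided_Psi id.
Proof.
split.
- exact: two_sided_Psi_smooth.
- exact: is_smooth_id hM.
- by [].
- by [].
- move=> [g x] [k y]; rewrite /composable /= => ->.
  by rewrite /two_sided_Psi /= two_sidedM.
Qed.

Lemma tmap_two_sided_Psi x (u : lie_algebra (prod_lie_group G G)) :
  @tmap R (prod_lie_group G G ** G) (arr H) two_sided_Psi (gone, x) (row_mx u 0) =
  two_sided_psi x (tmap phi gone u).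
Proof.
pose o : prod_lie_group G G := gone.
pose inl (g : G * G) : G * G * G := (g, x).
have si := is_smooth_id mGG; have sx := is_smooth_cst (G ** G) hM x.
have sinl : @is_smooth R (G ** G) (G ** G ** G) inl by exact (is_smooth_pair mGG mGG hM si sx).
have Ti : @tmap R (G ** G) (G ** G ** G) inl o u = row_mx u 0.
  have E := tmap_pair mGG mGG hM o u si sx.
  exact (etrans E (congr2 (fun (a : 'rV[R]_(mdim G + mdim G)) (b : 'rV[R]_(mdim G)) => row_mx a b)
    (tmap_id mGG o u) (tmap_cst (M := G ** G) x o u))).
have C := tmap_comp mGG m3 mH o u sinl two_sided_Psi_smooth.
have Ci := congr1 (@tmap R (G ** G ** G) (arr H) two_sided_Psi (o, x)) Ti.
have t1 : @is_smooth R (G ** G) G (fun g => two_sided g x).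
  exact (is_smooth_comp mGG m3 hM sinl two_sided_smooth).
have T1 := tmap_pair mGG hM hM o u t1 sx.
have T := tmap_pair mGG mGG mGG o u (is_smooth_pair mGG hM hM t1 sx) si.
have E1 := etrans T1 (congr2 (fun a b : 'rV[R]_(mdim G) => row_mx a b)
  (tmap_two_sided x u) (tmap_cst (M := G ** G) x o u)).
have E := etrans T (congr2 (fun a b : 'rV[R]_(mdim G + mdim G) => row_mx a b) E1 (tmap_id mGG o u)).
have P := etrans (congr1 (two_sided_psi x) (tmap_diagonal2_map hG B o u))
  (two_sided_psi_row4 x _ _ _ _).
apply: (etrans (esym Ci)); apply: (etrans (esym C)); apply: (etrans E); apply: (etrans _ (esym P)).
have r0 (g : G) : right_field 0 g = 0 := linear0E (right_field_linear hG g).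
have r1 v : right_field v gone = v :> lie_algebra G := right_field1 hG v.
have Eu : u = row_mx (lsubmx u) (rsubmx u) := esym (@hsubmxK R 1 (mdim G) (mdim G) u).
have F1 := congr2 (fun a b : 'rV[R]_(mdim G) => row_mx a b)
  (rho_Ad x (lsubmx u) (rsubmx u)) (esym (r0 x)).
have F2 := etrans Eu (congr2 (fun a b : 'rV[R]_(mdim G) => row_mx a b)
  (esym (r1 (lsubmx u))) (esym (r1 (rsubmx u)))).
exact (congr2 (fun a b : 'rV[R]_(mdim G + mdim G) => row_mx a b) F1 F2).
Qed.

(** For $a_1 = g_1 x g_2^{-1}$ and $a_2 = x$ one has $b = a_1 g_2 x^{-1} = g_1$ and $c = a_1^{-1}
    g_1 x = g_2$. *)
Lemma Phi_two_sided_Psi g x : Phi_PG2 B (two_sided_Psi (g, x)) = phi g.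
Proof.
case: g => g1 g2; rewrite /two_sided_Psi /two_sided /phi /diagonal2_map /=.
congr ((_, _), (_, _)).
  by rewrite !(gmulgVK hG, gmulgK hG).
by rewrite !(ginvM hG, ginvK hG, gmulA hG) !(gmulgVK hG).
Qed.

Lemma Phi_PG2_equivariant (g1 g2 : prod_lie_group G G) (h : arr H) :
  Phi_PG2 B (gpd_mul (gpd_mul (two_sided_Psi (g1, gpd_tgt h)) h)
                 (gpd_inv (two_sided_Psi (g2, gpd_src h))))
  = gmul (gmul (phi g1) (Phi_PG2 B h)) (ginv (phi g2)).
Proof.
case: g1 g2 h => [g11 g12] [g21 g22] [[a1 a2] [k1 k2]].
rewrite /two_sided_Psi /two_sided /phi /diagonal2_map /=.
congr ((_, _), (_, _)) => //; rewrite !(ginvM hG, ginvK hG, gmulA hG);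
  by rewrite !(gmulgVK hG, gmulgK hG).
Qed.

Lemma PG2_is_global : @is_global_with R S (diagonal2 B) H (Phi_PG2 B) (sigma_PG2 B)
  (prod_lie_group G G) phi two_sided_psi two_sided two_sided_Psi.
Proof.
split.
- exact: two_sided_is_psi.
- exact: two_sided_is_action.
- move=> x u.
  have P := etrans (congr1 (two_sided_psi x) (tmap_diagonal2_map hG B gone u))
    (two_sided_psi_row4 x _ _ _ _).
  have E := etrans (congr1 (@anchor R H x) P) (anchor_frame x _ _ _).
  exact (etrans (tmap_two_sided x u) (etrans (rho_Ad x _ _) (esym E))).
- exact: two_sided_Psi_morphism.
- exact: tmap_two_sided_Psi.
- exact: Phi_two_sided_Psi.
- exact: Phi_PG2_equivariant.
- move=> g; apply: (sigma_PG2_isotropic hM (d := phi g)); last exact: Phi_two_sided_Psi.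
  have sp := is_smooth_pair hM mGG hM (is_smooth_cst G mGG g) (is_smooth_id hM).
  exact: (is_smooth_comp hM m3 mH sp two_sided_Psi_smooth).
Qed.

End PairGroupoid.

Theorem proposition5p23 (R : realType) (G : lie_group_data R)
    (B : 'rV[R]_(mdim G) -> 'rV[R]_(mdim G) -> R)
    (hG : is_lie_group G) (hB : is_quadratic B) (hAd : is_Ad_invariant B) :
  is_global_moment_map (diagonal2 B) (Phi_PG2 B) (sigma_PG2 B)
    (diagonal2_map B) /\
  (forall a : G,
     integrated_dirac (Phi_PG2 B) (sigma_PG2 B) a
     = quasi_poisson_dirac B a).
Proof.
split; last exact (PG2_integrates_quasi_poisson hG hB hAd).
split.
- exact (PG2_is_moment_map hG hB hAd).
- exact (diagonal2_is_integration hG hB hAd).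
- exact (ex_intro _ _ (ex_intro _ _ (ex_intro _ _ (PG2_is_global hG hB hAd)))).
Qed.
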